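(* Let $k$ be a field of odd characteristic $p \geq 3$ and let $G$ be a finite group of $p$-rank $r \geq 8$. Then there exist infinitely many mutually nonisomorphic finite dimensional complexes $\mathcal{D}_*$ of projective $kG$-modules such that \[ \sum_i \dim_k \operatorname{H}_i(\mathcal{D}_* ) < 2^r . \] Moreover, if $G$ is a $p$-group, then these complexes $\mathcal{D}_*$ can be taken to be complexes of free $kG$-modules.
   Context: The $p$-rank of a finite group $G$ is the largest $r$ such that $G$ contains an elementary abelian $p$-subgroup of order $p^r$. A finite dimensional complex means a bounded complex of finitely generated modules. $\operatorname{H}_i(\mathcal{D}_* )$ denotes the $i$-th homology group of the complex $\mathcal{D}_*$. *)

(* Defs.v *)
(* Finite-dimensional kG-modules are matrix representations
   (right action on row vectors: v |-> v *m rG g). *)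
From HB Require Import structures.
From mathcomp Require Import all_boot all_order all_algebra all_fingroup all_solvable.
From mathcomp Require Import mxrepresentation.
Set Implicit Arguments. Unset Strict Implicit. Unset Printing Implicit Defensive.
Import GRing.Theory Num.Theory.
Local Open Scope ring_scope.

Section KGComplexes.
Variables (k : fieldType) (gT : finGroupType) (G : {group gT}).

Definition kG_hom m n (rM : mx_representation k G m) (rN : mx_representation k G n)
  (f : 'M[k]_(m, n)) : Prop :=
  forall g, g \in G -> rM g *m f = f *m rN g.

Definition kG_basis n (rM : mx_representation k G n) m (E : 'M[k]_(m, n)) : Prop :=
  (forall v : 'rV[k]_n, exists c : 'I_m -> gT -> k,
      v = \sum_(j < m) \sum_(g in G) c j g *: (row j E *m rM g)) /\
  (forall c : 'I_m -> gT -> k,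
      \sum_(j < m) \sum_(g in G) c j g *: (row j E *m rM g) = 0 ->
      forall j g, g \in G -> c j g = 0).

Definition kG_free n (rM : mx_representation k G n) : Prop :=
  exists m (E : 'M[k]_(m, n)), kG_basis rM E.

Definition kG_projective n (rM : mx_representation k G n) : Prop :=
  exists n' (rF : mx_representation k G n'), kG_free rF /\
  exists (s : 'M[k]_(n, n')) (r : 'M[k]_(n', n)),
    kG_hom rM rF s /\ kG_hom rF rM r /\ s *m r = 1%:M.

Record kG_complex := KGComplex {
  cdim : int -> nat;
  crep : forall i, mx_representation k G (cdim i);
  cd : forall i, 'M[k]_(cdim i, cdim (i - 1));
  cd_hom : forall i, kG_hom (crep i) (crep (i - 1)) (cd i);
  cd_sq : forall i, cd i *m cd (i - 1) = 0;
  cbound : nat;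
  cdim_bounded : forall i : int, (cbound < `|i|)%N -> cdim i = 0%N
}.

Definition cx_projective (C : kG_complex) := forall i, kG_projective (crep C i).
Definition cx_free (C : kG_complex) := forall i, kG_free (crep C i).

Definition homology_dim (C : kG_complex) (i : int) : nat :=
  (\rank (kermx (cd C i)) - \rank (cd C (i + 1)))%N.

Definition total_homology_dim (C : kG_complex) : nat :=
  (\sum_(j < (cbound C).*2.+1) homology_dim C (j%:Z - (cbound C)%:Z))%N.

Definition chain_map (C D : kG_complex) (f : forall i, 'M[k]_(cdim C i, cdim D i)) :=
  (forall i, kG_hom (crep C i) (crep D i) (f i)) /\
  (forall i, cd C i *m f (i - 1) = f i *m cd D i).
Arguments chain_map : clear implicits.

Lemma dim_subK (D : kG_complex) (i : int) : cdim D (i - 1 + 1) = cdim D i.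
Proof. by rewrite subrK. Qed.

Lemma dim_addK (D : kG_complex) (i : int) : cdim D (i + 1 - 1) = cdim D i.
Proof. by rewrite addrK. Qed.

Definition chain_homotopic (C D : kG_complex)
  (f f' : forall i, 'M[k]_(cdim C i, cdim D i)) :=
  exists h : forall i, 'M[k]_(cdim C i, cdim D (i + 1)),
    (forall i, kG_hom (crep C i) (crep D (i + 1)) (h i)) /\
    (forall i, f i - f' i =
       castmx (erefl, dim_subK D i) (cd C i *m h (i - 1)) +
       castmx (erefl, dim_addK D i) (h i *m cd D (i + 1))).
Arguments chain_homotopic : clear implicits.

(* isomorphism in the homotopy category K^b(kG-mod); for bounded complexes of
   projectives this is the same as isomorphism in the derived category *)
Definition homotopy_equivalent (C D : kG_complex) : Prop :=
  exists (f : forall i, 'M[k]_(cdim C i, cdim D i))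
         (g : forall i, 'M[k]_(cdim D i, cdim C i)),
    chain_map C D f /\ chain_map D C g /\
    chain_homotopic C C (fun i => f i *m g i) (fun i => 1%:M) /\
    chain_homotopic D D (fun i => g i *m f i) (fun i => 1%:M).

End KGComplexes.

(* Main.v *)
(* For every s there is a class zeta_s of even degree d whose restriction to each elementary
   abelian subgroup E of rank s acts injectively on the cohomology of every module that is
   already projective over the proper subgroups of E: it is a sum of powers of the classes of
   the exact complexes of chains on joins of boundaries of simplices on the cosets of E.
   Twisting the truncated standard coresolution by zeta_s gives a complex C_s with one
   homology class in its bottom degree, one in its top degree, and modules whose cohomology
   is annihilated by zeta_s^2. Hence the modules of C_1 (x) ... (x) C_r have no cohomology over
   any elementary abelian p-subgroup, and by induction over the p-subgroups (Chouinard) they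
   are projective.

   The homology of this tensor product has dimension 2^r. Each C_s carries the degree lowering
   operator e_s that maps its top class to its bottom class. On the 2^8-dimensional homology of
   C_1 (x) ... (x) C_8 the operator w = e_1 e_2 + e_3 e_4 + e_5 e_6 + e_7 e_8 has a kernel of
   dimension at most 126, because 2 is invertible, so that the cone of w has homology of
   dimension at most 252 < 2^8. Tensoring with C_9, ..., C_r gives at most 252 * 2^(r - 8),
   and shifting the result gives infinitely many complexes. *)
Require Import Defs.
From HB Require Import structures.
From mathcomp Require Import all_boot all_order all_algebra all_fingroup all_solvable.
From mathcomp Require Import mxrepresentation.
From mathcomp Require Import boolp functions.
From mathcomp Require Import zify ring.
Set Implicit Arguments. Unset Strict Implicit. Unset Printing Implicit Defensive.
Import GRing.Theory.
Local Open Scope ring_scope.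

(** * Reflexive normalization in abelian groups *)

(** Cohomology is handled through explicit cochains. The class of an exact complex is an iterated
    connecting homomorphism, and the product with it is injective for coefficients in [M] once the
    chain modules tensored with [M] are acyclic. These are induced from the stabilizers of
    simplices. No simplex of the join contains a whole coset of [E], so its stabilizer in [E] is
    proper: this is where projectivity over proper subgroups enters and why the argument is an
    induction over subgroups. The classes of different [E] must not interfere after restriction and
    must share one even degree; powers take care of the degree and of the orientation character. The
    complexes carry no twist for subgroups that are not elementary abelian. There the product with a
    central subgroup of order [p] inside the Frattini subgroup carries two comparable classes, one
    of which dies on the first factor. The number eight comes from the kernel estimate: for 0, 1, 2,
    3, 4 pairs of factors the kernel is bounded by 1, 3, 10, 35, 126 and the homology of the cone by
    twice that; 70 exceeds 64, whereas 252 is below 256. *)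

Inductive zexp := ZVar of nat | ZZero | ZAdd of zexp & zexp | ZOpp of zexp.

Fixpoint zeval (M : zmodType) (env : seq M) (e : zexp) : M :=
  match e with
  | ZVar i => nth 0 env i
  | ZZero => 0
  | ZAdd a b => zeval env a + zeval env b
  | ZOpp a => - zeval env a
  end.

(** The components count positive and negative occurrences, so that comparing coefficients in
    [zeval_eq] is a computation with natural numbers. *)
Fixpoint zcoef (e : zexp) (i : nat) : nat * nat :=
  match e with
  | ZVar j => ((i == j) : nat, 0%N)
  | ZZero => (0%N, 0%N)
  | ZAdd a b => ((zcoef a i).1 + (zcoef b i).1, (zcoef a i).2 + (zcoef b i).2)%N
  | ZOpp a => ((zcoef a i).2, (zcoef a i).1)
  end.

Lemma zevalE (M : zmodType) (env : seq M) e :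
  zeval env e =
  \sum_(i < size env) (env`_i *+ (zcoef e i).1 - env`_i *+ (zcoef e i).2).
Proof.
elim: e => [j||a IHa b IHb|a IHa] /=.
- have [jn|jn] := ltnP j (size env); last first.
    rewrite nth_default // big1 // => i _; rewrite mulr0n subr0.
    by case: eqP (ltn_ord i) => [->|//]; rewrite ltnNge jn.
  rewrite (bigD1 (Ordinal jn)) //= eqxx mulr1n mulr0n subr0 big1 ?addr0 // => i ij.
  case: eqP => [e|_]; last by rewrite subrr.
  by case/eqP: ij; apply: val_inj.
- by rewrite big1 // => i _; rewrite subrr.
- rewrite IHa IHb -big_split; apply: eq_bigr => i _ /=.
  by rewrite !mulrnDr opprD addrACA.
- by rewrite IHa -sumrN; apply: eq_bigr => i _; rewrite opprB.
Qed.

Lemma zeval_eq (M : zmodType) (env : seq M) e1 e2 :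
  all (fun i => (zcoef e1 i).1 + (zcoef e2 i).2 == (zcoef e2 i).1 + (zcoef e1 i).2)%N
    (iota 0 (size env)) ->
  zeval env e1 = zeval env e2.
Proof.
move=> /allP e; rewrite !zevalE; apply: eq_bigr => i _.
have /eqP ei : ((zcoef e1 i).1 + (zcoef e2 i).2 == (zcoef e2 i).1 + (zcoef e1 i).2)%N.
  by apply: e; rewrite mem_iota ltn_ord.
apply/eqP; rewrite subr_eq addrAC eq_sym subr_eq eq_sym -!mulrnDr.
by rewrite ei.
Qed.

(** Atoms are identified up to conversion and not only up to syntax. *)
Ltac zsame x y :=
  match constr:(tt) with
  | _ => let _ := constr:(@erefl _ x : x = y) in constr:(true)
  | _ => constr:(false)
  end.
Ltac zindex x env :=
  lazymatch env with
  | x :: _ => constr:(0%N)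
  | ?y :: ?r => lazymatch zsame x y with
              | true => constr:(0%N)
              | false => let n := zindex x r in constr:(S n)
              end
  end.
Ltac zmem x env :=
  lazymatch env with
  | [::] => constr:(false)
  | x :: _ => constr:(true)
  | ?y :: ?r => lazymatch zsame x y with true => constr:(true) | false => zmem x r end
  end.
Ltac zatoms t env :=
  lazymatch t with
  | 0 => env
  | (?a + ?b)%R => let env' := zatoms a env in zatoms b env'
  | (- ?a)%R => zatoms a env
  | _ => lazymatch zmem t env with true => env | false => constr:(t :: env) end
  end.
Ltac zreify t env :=
  lazymatch t with
  | 0 => constr:(ZZero)
  | (?a + ?b)%R => let a' := zreify a env in let b' := zreify b env in
                 constr:(ZAdd a' b')
  | (- ?a)%R => let a' := zreify a env in constr:(ZOpp a')
  | _ => let n := zindex t env in constr:(ZVar n)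
  end.
Ltac abel :=
  match goal with |- @eq ?T ?l ?r =>
    let env0 := zatoms l (@nil T) in
    let env := zatoms r env0 in
    let l' := zreify l env in
    let r' := zreify r env in
    refine (@zeval_eq _ env l' r' _); vm_compute; reflexivity
  end.

Definition mklin (k : fieldType) (M N : lmodType k) (f : M -> N)
    (pf : linear f) : {linear M -> N} :=
  HB.pack f (GRing.isLinear.Build _ _ _ _ f pf).

(** * Homogeneous cochains *)

Section Coboundary.
Variables (k : fieldType) (Y : Type).
Implicit Types (M N : lmodType k).

(* A function on sequences of length [i.+1] is a homogeneous [i]-cochain. The cochains
   of a group have their vertices in the whole ambient group and are invariant under
   left translation, so that restriction to a subgroup leaves the function unchanged. *)
Fixpoint cobd M (f : seq Y -> M) (s : seq Y) : M :=
  if s is x :: s' then f s' - cobd (fun t => f (x :: t)) s' else 0.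

Lemma eq_cobd_size M (f g : seq Y -> M) s :
  (forall t, size t = (size s).-1 -> f t = g t) -> cobd f s = cobd g s.
Proof.
elim: s f g => [//|x s IH] f g /= efg; congr (_ - _); first exact: efg.
case: s IH efg => [//|y s] IH efg.
by apply: IH => t st; apply: efg; rewrite /= st.
Qed.

Lemma eq_cobd M (f g : seq Y -> M) s : f =1 g -> cobd f s = cobd g s.
Proof. by move=> e; apply: eq_cobd_size => t _. Qed.

Lemma cobdB M (f g : seq Y -> M) s :
  cobd (fun t => f t - g t) s = cobd f s - cobd g s.
Proof.
elim: s f g => [|x s IH] f g /=; first by rewrite subrr.
by rewrite IH; abel.
Qed.

Lemma cobd_lin M N (phi : {linear M -> N}) (f : seq Y -> M) s :
  cobd (fun t => phi (f t)) s = phi (cobd f s).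
Proof.
elim: s f => [|x s IH] f /=; first by rewrite raddf0.
by rewrite raddfB (IH (fun t => f (x :: t))).
Qed.

Lemma cobd0 M (s : seq Y) : cobd (fun _ => 0 : M) s = 0.
Proof. by elim: s => //= x s ->; rewrite subrr. Qed.

Lemma cobdD M (f g : seq Y -> M) s :
  cobd (fun t => f t + g t) s = cobd f s + cobd g s.
Proof.
rewrite -[g in RHS]/(fun t => g t).
have -> : cobd g s = - cobd (fun t => 0 - g t) s.
  by rewrite cobdB cobd0 sub0r opprK.
rewrite -cobdB; apply: eq_cobd => t; by rewrite sub0r opprK.
Qed.

Lemma cobdZ M c (f : seq Y -> M) s : cobd (fun t => c *: f t) s = c *: cobd f s.
Proof.
elim: s f => [|x s IH] f /=; first by rewrite scaler0.
by rewrite scalerBr (IH (fun t => f (x :: t))).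
Qed.

Lemma cobd_sum M (I : Type) (r : seq I) (P : pred I) (f : I -> seq Y -> M) s :
  cobd (fun t => \sum_(i <- r | P i) f i t) s = \sum_(i <- r | P i) cobd (f i) s.
Proof.
elim: r => [|i r IH].
  by rewrite big_nil -[RHS](cobd0 M s); apply: eq_cobd => t; rewrite big_nil.
rewrite big_cons -IH; case: ifP => Pi.
  by rewrite -cobdD; apply: eq_cobd => t; rewrite big_cons Pi.
by apply: eq_cobd => t; rewrite big_cons Pi.
Qed.

Lemma cobd_cobd M (f : seq Y -> M) s : cobd (cobd f) s = 0.
Proof.
elim: s f => [//|x s IH] f /=.
rewrite (cobdB f (cobd (fun t => f (x :: t)))) IH subr0.
by rewrite subrr.
Qed.

Lemma cobd_map M (p : Y -> Y) (f : seq Y -> M) s :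
  cobd f (map p s) = cobd (fun t => f (map p t)) s.
Proof. by elim: s f => //= x s IH f; rewrite IH. Qed.

Fixpoint prism M (p : Y -> Y) (f : seq Y -> M) (s : seq Y) : M :=
  if s is x :: s' then f (x :: map p s) - prism p (fun t => f (x :: t)) s' else 0.

Lemma prismB M p (f g : seq Y -> M) s :
  prism p (fun t => f t - g t) s = prism p f s - prism p g s.
Proof.
elim: s f g => [|x s IH] f g /=; first by rewrite subrr.
by rewrite (IH (fun t => f (x :: t)) (fun t => g (x :: t))); abel.
Qed.

Lemma prism_lin M N (phi : {linear M -> N}) p (f : seq Y -> M) s :
  prism p (fun t => phi (f t)) s = phi (prism p f s).
Proof.
elim: s f => [|x s IH] f /=; first by rewrite raddf0.
by rewrite raddfB (IH (fun t => f (x :: t))).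
Qed.

Lemma prism_size M p (f g : seq Y -> M) s :
  (forall t, size t = (size s).+1 -> f t = g t) -> prism p f s = prism p g s.
Proof.
elim: s f g => [//|x s IH] f g e /=; rewrite e /= ?size_map //; congr (_ - _).
by apply: IH => t st; apply: e; rewrite /= st.
Qed.

(* [prism p] is the simplicial homotopy between the identity and the map induced by [p]. *)
Lemma cobd_prism M p (f : seq Y -> M) s :
  cobd (prism p f) s + prism p (cobd f) s = f (map p s) - f s.
Proof.
elim: s f => [|x s IH] f /=; first by rewrite addr0 subrr.
pose fx t := f (x :: t).
have /= e1 := IH fx.
rewrite (cobdB (fun t => f (x :: p x :: map p t)) (prism p fx)).
rewrite (prismB p f (cobd fx)).
rewrite -[cobd (fun t => f [:: x, p x & t]) _]/(cobd (fun t => fx (p x :: t)) _).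
rewrite (@cobd_map _ p (fun t => fx (p x :: t))).
set A := prism p f s; set B := cobd _ s; set C := cobd (prism p fx) s.
set E := prism p (cobd fx) s.
have -> : E = fx (map p s) - fx s - C by rewrite -e1 /C /E [in RHS]addrC addKr.
rewrite -[f [:: x & map p s]]/(fx (map p s)) -[f (x :: s)]/(fx s).
move: (f _) (fx (map p s)) (fx s) => u v w.
abel.
Qed.
End Coboundary.

Section Splice.
Variables (k : fieldType) (Y : Type) (M : lmodType k).

(* [f] is evaluated on the front [i]-face and the complementary back face,
   which share the vertex number [i]. *)
Definition splice i (f : seq Y -> seq Y -> M) s := f (take i.+1 s) (drop i s).

Lemma splice_cons i (f : seq Y -> seq Y -> M) x s :
  splice i.+1 f (x :: s) = splice i (fun u => f (x :: u)) s.
Proof. by []. Qed.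

(** Leibniz rule of the Alexander-Whitney product: the two terms that omit the shared vertex carry
    opposite signs and cancel, so both coboundaries can be written in full. *)
Lemma cobd_splice i (f : seq Y -> seq Y -> M) s : (i.+1 < size s)%N ->
  cobd (splice i f) s =
  splice i.+1 (fun u t => cobd (f^~ t) u) s +
  (-1) ^+ i *: splice i (fun u t => cobd (f u) t) s.
Proof.
elim: i f s => [|i IH] f [|x [|y s]] // lt_is.
  by rewrite /splice /= take0 expr0 scale1r /=; abel.
have -> : cobd (splice i.+1 f) [:: x, y & s] = splice i.+1 f (y :: s) -
   cobd (splice i (fun u => f (x :: u))) (y :: s) by [].
rewrite (IH _ (y :: s)) //.
rewrite [splice i.+2 _ _]splice_cons [splice i.+1 _ (x :: _)]splice_cons.
rewrite exprS mulN1r scaleNr opprD addrA; congr (_ + _).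
Qed.

(** Without a shared vertex there is no cancellation; this is the form needed when vertices are
    moved from one variable to another in [cobd_interp]. *)
Lemma cobd_cat (f : seq Y -> M) v t : (0 < size v)%N -> (0 < size t)%N ->
  cobd f (v ++ t) =
  cobd (fun w => f (w ++ t)) v + (-1) ^+ size v *: cobd (fun w => f (v ++ w)) t.
Proof.
case: v => [//|x v] _ t0; elim: v x f => [|y v IH] x f.
  by rewrite expr1 scaleN1r /= subr0.
have -> : cobd f ((x :: y :: v) ++ t) = f ((y :: v) ++ t) -
  cobd (fun w => f (x :: w)) ((y :: v) ++ t) by [].
have -> : size [:: x, y & v] = (size (y :: v)).+1 by [].
rewrite IH exprS mulN1r scaleNr.
have -> : cobd (fun w => f (w ++ t)) [:: x, y & v] = f ((y :: v) ++ t) -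
  cobd (fun w => f (x :: w ++ t)) (y :: v) by [].
rewrite /=; abel.
Qed.

End Splice.

Section Cup.
Variables (k : fieldType) (Y : Type) (M : lmodType k).

Definition cup i (z : seq Y -> M) (c : seq Y -> k) : seq Y -> M :=
  splice i (fun u t => c t *: z u).

Lemma cobd_scalar (c : seq Y -> k) (m : M) s :
  cobd (fun t => c t *: m) s = cobd (c : seq Y -> k^o) s *: m.
Proof.
elim: s c => [|x s IH] c /=; first by rewrite scale0r.
by rewrite scalerBl (IH (fun t => c (x :: t))).
Qed.

Lemma cobd_cup i z (c : seq Y -> k) s : (i.+1 < size s)%N ->
  cobd (cup i z c) s =
  cup i.+1 (cobd z) c s + (-1) ^+ i *: cup i z (cobd (c : seq Y -> k^o)) s.
Proof.
move=> lt_is; rewrite cobd_splice // /cup /splice; congr (_ + _ *: _).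
  exact: cobdZ.
exact: cobd_scalar.
Qed.

Lemma cup_cobdl i z (c : seq Y -> k) s m :
  (forall t, size t = m.+2 -> cobd (c : seq Y -> k^o) t = 0) ->
  size s = (i + m).+2 ->
  cobd (cup i z c) s = cup i.+1 (cobd z) c s.
Proof.
move=> cc ss; rewrite cobd_cup ?ss ?ltnS ?leq_addr //.
rewrite /cup/splice (cc (drop i s)) ?scale0r ?scaler0 ?addr0 //.
by rewrite size_drop ss -!addnS addKn.
Qed.

End Cup.

Section Cochains.
Variables (k : fieldType) (gT : finGroupType).
Implicit Types (M N : lmodType k) (H : {group gT}).

Definition act_on (H : {set gT}) M (a : gT -> {linear M -> M}) : Prop :=
  (forall m, a 1%g m = m) /\
  {in H &, forall g h m, a (g * h)%g m = a g (a h m)}.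

Definition shift (h : gT) (s : seq gT) := map (mulg h) s.

Lemma size_shift h s : size (shift h s) = size s. Proof. exact: size_map. Qed.

Lemma shiftM g h s : shift (g * h)%g s = shift g (shift h s).
Proof. by rewrite /shift -map_comp; apply: eq_map => x /=; rewrite mulgA. Qed.

Lemma shift1 s : shift 1%g s = s.
Proof. by rewrite /shift (eq_map (g := id)) ?map_id // => x; rewrite mul1g. Qed.

(** Here and below [n] counts vertices, so the degree is [n.-1]; values on sequences of other
    lengths are arbitrary. Thus [acyclic], with its condition [1 < n], is the vanishing of
    cohomology in all positive degrees. *)
Definition invc (H : {set gT}) M (a : gT -> {linear M -> M}) n (f : seq gT -> M) :=
  forall h s, h \in H -> size s = n -> f (shift h s) = a h (f s).

Definition cocy M n (f : seq gT -> M) := forall s, size s = n.+1 -> cobd f s = 0.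

Definition cob (H : {set gT}) M (a : gT -> {linear M -> M}) n (f : seq gT -> M) :=
  exists2 w, invc H a n.-1 w & forall s, size s = n -> f s = cobd w s.

Definition acyclic (H : {set gT}) M (a : gT -> {linear M -> M}) :=
  forall n f, (1 < n)%N -> invc H a n f -> cocy n f -> cob H a n f.

Definition triv : gT -> {linear k^o -> k^o} := fun _ => idfun.

Lemma invc_cobd (H : {set gT}) M (a : gT -> {linear M -> M}) n f :
  invc H a n f -> invc H a n.+1 (cobd f).
Proof.
move=> If h s hH ss; rewrite /shift cobd_map -(cobd_lin (a h)).
by apply: eq_cobd_size => t; rewrite ss /= => st; apply: If.
Qed.

Lemma shift_cup M (a : gT -> {linear M -> M}) H i m (z : seq gT -> M) c :
  invc H a i.+1 z -> invc H triv m.+1 c -> invc H a (i + m).+1 (cup i z c).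
Proof.
move=> Iz Ic h s hH ss; rewrite /cup/splice /shift -map_take -map_drop.
rewrite (Iz h) ?(Ic h) ?linearZ // ?size_drop ?ss ?size_takel ?ss //.
- by rewrite -addnS addKn.
- by rewrite ltnS leq_addr.
Qed.

Lemma cup_cob M (a : gT -> {linear M -> M}) H i m (z : seq gT -> M) c :
  (0 < i)%N -> invc H triv m.+1 c -> cocy m.+1 (c : seq gT -> k^o) ->
  cob H a i.+1 z -> cob H a (i + m).+1 (cup i z c).
Proof.
move=> i0 Ic cc [w Iw ew]; exists (cup i.-1 w c).
  by case: i i0 Iw ew => // i _ Iw ew /=; rewrite addSn; apply: shift_cup.
move=> s ss; case: i i0 Iw ew ss => // i _ Iw ew ss.
rewrite (@cup_cobdl _ _ _ i w c s m) // /cup /splice ew // size_takel // ss.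
by rewrite ltnS leq_addr.
Qed.

End Cochains.

(** * Higman's criterion *)

Section Higman.
Variables (k : fieldType) (gT : finGroupType).
Implicit Types (H : {group gT}).

Definition trop (H : {set gT}) (M : lmodType k) (a : gT -> {linear M -> M})
  (u : M -> M) m := \sum_(h in H) a h (u (a h^-1%g m)).

(** Higman's criterion serves as the definition of projectivity: it makes sense without finiteness
    and passes easily to induced modules and graded pieces. *)
Definition higman (H : {set gT}) (M : lmodType k) (a : gT -> {linear M -> M}) :=
  exists u : {linear M -> M}, forall m, trop H a u m = m.

Variables (M : lmodType k) (a : gT -> {linear M -> M}).

Lemma actK H g m : act_on H a -> g \in H -> a g^-1%g (a g m) = m.
Proof. by case=> a1 aM gH; rewrite -aM ?groupV // mulVg a1. Qed.

Lemma actKV H g m : act_on H a -> g \in H -> a g (a g^-1%g m) = m.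
Proof. by case=> a1 aM gH; rewrite -aM ?groupV // mulgV a1. Qed.

Lemma act_onS H H' : H' \subset H -> act_on H a -> act_on H' a.
Proof.
move=> sH [a1 aM]; split=> // g h gH hH m; apply: aM; exact: (subsetP sH).
Qed.

(** The usual contraction, coning with a fixed apex, is not equivariant. Summing over all apexes [h]
    in [H], each weighted by the conjugate of [u] by [h], is, and on cocycles the trace identity
    turns the sum into a contraction. *)
Definition higman_contr (H : {set gT}) (u : M -> M) (f : seq gT -> M) s :=
  \sum_(h in H) a h (u (a h^-1%g (f (h :: s)))).

Lemma higman_contr_inv H (u : {linear M -> M}) n f : act_on H a ->
  invc H a n.+1 f -> invc H a n (higman_contr H u f).
Proof.
move=> aH If g s gH ss; rewrite /higman_contr raddf_sum.
rewrite (reindex_inj (mulgI g)) /=.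
rewrite (eq_bigl (fun h => h \in H)) => [|h]; last by rewrite groupMl.
apply: eq_bigr => h hH; rewrite -[_ :: shift g s]/(shift g (h :: s)).
rewrite If //= ?ss // aH.2 // invMg aH.2 ?groupV // (actK _ aH) //.
Qed.

Lemma cobd_higman_contr H (u : {linear M -> M}) n f s :
  size s = n -> cocy n f -> cobd (higman_contr H u f) s = trop H a u (f s).
Proof.
move=> ss cf; rewrite /higman_contr cobd_sum; apply: eq_bigr => h hH.
rewrite (cobd_lin (a h)) (cobd_lin u) (cobd_lin (a h^-1%g)).
by have /= := cf (h :: s); rewrite ss => /(_ erefl) /eqP; rewrite subr_eq0 => /eqP ->.
Qed.

Lemma higman_acyclic H : act_on H a -> higman H a -> acyclic H a.
Proof.
move=> aH [u Hu] n f n1 If cf; exists (higman_contr H u f).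
  by apply: higman_contr_inv; rewrite ?prednK // ltnW.
by move=> s ss; rewrite (cobd_higman_contr _ _ ss).
Qed.

End Higman.

(** * Climbing an exact complex *)

Section Staircase.
Variables (k : fieldType) (gT : finGroupType) (H : {group gT}).
Variables (M1 M2 N : lmodType k).
Variables (a1 : gT -> {linear M1 -> M1}) (a2 : gT -> {linear M2 -> M2}).
Variable (b : gT -> {linear N -> N}).
Variables (D : {linear N -> N}) (eps : {linear N -> M1}) (iota : {linear M2 -> N}).
Variables (L : nat) (K : nat -> N -> Prop).

(** The complex is [M2 -> K L -> ... -> K 1 -> M1]. All its terms are subspaces of one space [N],
    marked by predicates, which avoids types depending on the degree. Exactness is not included; it
    is supplied by [contraction]. *)
Record graded_complex : Prop := GradedComplex {
  gc_L : (0 < L)%N;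
  gc_K0 : forall j, K j 0;
  gc_KB : forall j x y, K j x -> K j y -> K j (x - y);
  gc_Kb : forall j h x, h \in H -> K j x -> K j (b h x);
  gc_D1 : forall x, K 1%N x -> D x = 0;
  gc_DK : forall j x, K j.+2 x -> K j.+1 (D x);
  gc_eps : forall j x, K j.+2 x -> eps x = 0;
  gc_DD : forall j x, K j.+1 x -> D (D x) = 0;
  gc_epsD : forall j x, K j.+1 x -> eps (D x) = 0;
  gc_iotaK : forall m, K L (iota m);
  gc_Diota : forall m, D (iota m) = 0;
  gc_epsiota : forall m, eps (iota m) = 0;
  gc_bD : forall h x, h \in H -> D (b h x) = b h (D x);
  gc_beps : forall h x, h \in H -> eps (b h x) = a1 h (eps x);
  gc_biota : forall h m, h \in H -> iota (a2 h m) = b h (iota m)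
}.

Hypothesis gc : graded_complex.

Definition Kval j n (f : seq gT -> N) := forall s, size s = n -> K j (f s).

(* [y 0], [y 1], ... climbs the complex from [z] (below [eps]) to [z'] (above [iota]). *)
Record link n z z' (y : nat -> seq gT -> N) : Prop := Link {
  lk_inv : forall j, (j < L)%N -> invc H b (n + j) (y j);
  lk_K : forall j, (j < L)%N -> Kval j.+1 (n + j) (y j);
  lk_eps : forall s, size s = n -> eps (y 0%N s) = z s;
  lk_step : forall j s, (j.+1 < L)%N -> size s = (n + j).+1 ->
    cobd (y j) s = D (y j.+1 s);
  lk_iota : forall s, size s = (n + L)%N -> cobd (y L.-1) s = iota (z' s)
}.

Lemma Kval_cobd j n f : Kval j n f -> Kval j n.+1 (cobd f).
Proof.
move=> Kf; elim: n f Kf => [|n IH] f Kf [|x s] //= [ss].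
  case: s ss => //= _; rewrite subr0; exact: Kf.
apply: (gc_KB gc); first exact: Kf.
by apply: (IH (fun t => f (x :: t))) => // t st; apply: Kf; rewrite /= st.
Qed.

(* acyclicity up to cochains killed by the differentials *)
Definition almost_acyclic := forall j n f, (1 < n)%N -> (0 < j)%N ->
  invc H b n f -> Kval j n f -> cocy n f ->
  exists w v, [/\ invc H b n.-1 w, Kval j n.-1 w,
    forall s, size s = n -> f s = cobd w s + v s &
    forall s, size s = n -> D (v s) = 0 /\ eps (v s) = 0].

(** The staircase is descended: a primitive of [z'] makes the top level a cocycle, almost acyclicity
    gives it a primitive, and applying [D] to that primitive corrects the next level. The result
    keeps the shape [eps] of a cochain because [twisted_kill] uses it. *)
Lemma link_inj_eps n z z' y : (1 < n)%N -> almost_acyclic ->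
  link n z z' y -> cob H a2 (n + L) z' ->
  exists2 w, invc H b n.-1 w & forall s, size s = n -> z s = cobd (fun t => eps (w t)) s.
Proof.
move=> n1 QA [Iy Ky ey sy iy] [x0 Ix0 ex0]; have L0 := gc_L gc.
have n0 : (0 < n)%N by apply: ltnW.
(* The level is [L.-1 - i], so this is an induction from the top. Equality holds only after [D] and
   [eps], since the remainder [v] is controlled only there. *)
have claim i : (i < L)%N -> exists w, [/\ invc H b (n + (L.-1 - i)).-1 w,
    Kval (L.-1 - i).+1 (n + (L.-1 - i)).-1 w &
    forall s, size s = (n + (L.-1 - i))%N ->
      D (y (L.-1 - i)%N s) = D (cobd w s) /\ eps (y (L.-1 - i)%N s) = eps (cobd w s)].
  elim: i => [|i IH] iL.
    rewrite subn0.
    have [w [v [Iw Kw ew ev]]] : exists w v, [/\ invc H b (n + L.-1).-1 w,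
        Kval L (n + L.-1).-1 w,
        forall s, size s = (n + L.-1)%N -> y L.-1 s - iota (x0 s) = cobd w s + v s &
        forall s, size s = (n + L.-1)%N -> D (v s) = 0 /\ eps (v s) = 0].
      apply: QA => //; first by rewrite ltn_addr.
      - move=> h s hH ss; rewrite raddfB /= (Iy L.-1) ?prednK // Ix0 //; last first.
          by rewrite ss -(prednK L0) addnS.
        by rewrite (gc_biota gc).
      - move=> s ss; apply: (gc_KB gc); last exact: (gc_iotaK gc).
        by rewrite -[in K L](prednK L0); apply: Ky; rewrite ?prednK.
      - move=> s ss; rewrite (cobdB (y L.-1) (fun t => iota (x0 t))).
        have ss' : size s = (n + L)%N by rewrite ss -addnS prednK.
        by rewrite iy // (cobd_lin iota) ex0 // subrr.
    exists w; rewrite prednK //; split=> // s ss.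
    have -> : y L.-1 s = cobd w s + v s + iota (x0 s).
      by rewrite -ew // subrK.
    have [Dv ev'] := ev s ss.
    by rewrite !linearD /= (gc_Diota gc) (gc_epsiota gc) Dv ev' !addr0.
  have [w [Iw Kw ew]] := IH (ltnW iL).
  set j := (L.-1 - i.+1)%N in ew *.
  have ej : (L.-1 - i)%N = j.+1 by rewrite /j -subSn ?subSS // -ltnS prednK.
  rewrite ej in Iw Kw ew; rewrite addnS /= in Iw Kw.
  have jL : (j.+1 < L)%N by rewrite -ej -[X in (_ < X)%N](prednK L0) ltnS leq_subr.
  have [w' [v [Iw' Kw' ew' ev]]] : exists w' v, [/\ invc H b (n + j).-1 w',
      Kval j.+1 (n + j).-1 w',
      forall s, size s = (n + j)%N -> y j s - D (w s) = cobd w' s + v s &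
      forall s, size s = (n + j)%N -> D (v s) = 0 /\ eps (v s) = 0].
    apply: QA => //; first by rewrite ltn_addr.
    - move=> h s hH ss; rewrite raddfB /= (Iy j) ?(ltnW jL) // Iw //.
      by rewrite (gc_bD gc).
    - move=> s ss; apply: (gc_KB gc); first by apply: Ky; rewrite ?(ltnW jL).
      by apply: (gc_DK gc); apply: Kw.
    - move=> s ss; rewrite (cobdB (y j) (fun t => D (w t))).
      have ss' : size s = (n + j.+1)%N by rewrite addnS.
      by rewrite sy // (cobd_lin D); have [-> _] := ew s ss'; rewrite subrr.
  exists w'; split=> // s ss.
  have -> : y j s = cobd w' s + v s + D (w s) by rewrite -ew' // subrK.
  have [Dv ev'] := ev s ss.
  by rewrite !linearD /= Dv ev' (gc_DD gc (Kw s ss)) (gc_epsD gc (Kw s ss)) !addr0.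
have [|w [Iw Kw ew]] := claim L.-1; first by rewrite prednK.
rewrite subnn addn0 in Iw Kw ew.
exists w => // s ss; rewrite (cobd_lin eps) -ey //.
by have [_ ->] := ew s ss.
Qed.

Lemma link_inj n z z' y : (1 < n)%N -> almost_acyclic ->
  link n z z' y -> cob H a2 (n + L) z' -> cob H a1 n z.
Proof.
move=> n1 QA lk cz'; have [w Iw ew] := link_inj_eps n1 QA lk cz'.
exists (fun s => eps (w s)) => // h s hH ss; rewrite Iw // (gc_beps gc) //.
Qed.

End Staircase.

(** * Equivariant lifts through exact complexes *)

Section EquivariantLift.
Variables (k : fieldType) (gT : finGroupType) (H : {group gT}).

(* an [H]-equivariant retraction of the whole group onto [H] *)
Definition retr (y : gT) : gT := (y * (repr (H :* y)%g)^-1)%g.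

Lemma retr_in y : retr y \in H.
Proof.
have /rcosetP[h hH e] : repr (H :* y)%g \in (H :* y)%g by apply: mem_repr (rcoset_refl H y).
by rewrite /retr e invMg mulgA mulgV mul1g groupV.
Qed.

Lemma retrM h y : h \in H -> retr (h * y)%g = (h * retr y)%g.
Proof.
move=> hH; rewrite /retr mulgA; congr (_ * (repr _)^-1)%g.
by rewrite rcosetM (rcoset_id hH).
Qed.

Variables (M N : lmodType k).
Variables (a : gT -> {linear M -> M}) (b : gT -> {linear N -> N}).

(** A map that is merely linear becomes equivariant on cochains by conjugating it with the
    retraction of the first vertex. No averaging takes place, hence no division by the group
    order. *)
Definition eqv (phi : M -> N) (f : seq gT -> M) s : N :=
  let r := retr (head 1%g s) in b r (phi (a r^-1%g (f s))).

Lemma eqv_inv n (phi : M -> N) f : act_on H a -> act_on H b -> (0 < n)%N ->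
  invc H a n f -> invc H b n (eqv phi f).
Proof.
move=> aH bH n0 If h [|x s] hH ss; first by rewrite -ss in n0.
rewrite /eqv If //= retrM // -(bH.2 h) ?retr_in //.
by rewrite invMg aH.2 ?groupV ?retr_in // (actK _ aH).
Qed.

End EquivariantLift.

Section Exactness.
Variables (k : fieldType) (gT : finGroupType) (H : {group gT}).
Variables (M1 M2 N : lmodType k).
Variables (a1 : gT -> {linear M1 -> M1}) (a2 : gT -> {linear M2 -> M2}).
Variable (b : gT -> {linear N -> N}).
Variables (D : {linear N -> N}) (eps : {linear N -> M1}) (iota : {linear M2 -> N}).
Variables (L : nat) (K : nat -> N -> Prop).
Hypotheses (aH1 : act_on H a1) (aH2 : act_on H a2) (bH : act_on H b).
Hypothesis gc : graded_complex H a1 a2 b D eps iota L K.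

Variables (h : {linear N -> N}) (eta : {linear M1 -> N}) (tau : {linear N -> M2}).

(** The contraction is linear but need not be equivariant; [eqv] repairs this on cochains. The maps
    [eta] and [tau] split the two ends [eps] and [iota]. *)
Record contraction : Prop := Contraction {
  ct_h : forall j x, K j.+1 x -> K j.+2 (h x);
  ct_eta : forall m, K 1%N (eta m);
  ct_id : forall j x, K j.+1 x ->
    x = D (h x) + h (D x) + eta (eps x) + iota (tau x);
  ct_tauD : forall j x, K j.+1 x -> tau (D x) = 0;
  ct_tauiota : forall m, tau (iota m) = m;
  ct_tau : forall j x, K j x -> j != L -> tau x = 0;
  ct_epseta : forall m, eps (eta m) = m;
  ct_top : forall x, K L.+1 x -> x = 0
}.
Hypothesis ct : contraction.

Lemma eqv_id j n f s : K j.+1 (f s) -> size s = n ->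
  f s = D (eqv H b b h f s) + eqv H b b (fun x => h (D x)) f s
      + eqv H a1 b eta (fun t => eps (f t)) s + iota (eqv H b a2 tau f s).
Proof.
move=> Kf ss; set r := retr H (head 1%g s); have rH : r \in H by apply: retr_in.
rewrite /eqv -/r (gc_bD gc) // (gc_biota gc) //.
rewrite -(gc_beps gc) ?groupV // -!linearD /=.
rewrite -(@ct_id ct j); last by apply: (gc_Kb gc); rewrite ?groupV.
by rewrite (actKV _ bH).
Qed.

Lemma eqv_hD0 f s : D (f s) = 0 -> eqv H b b (fun x => h (D x)) f s = 0.
Proof. by move=> Df; rewrite /eqv (gc_bD gc) ?groupV ?retr_in // Df !linear0. Qed.

Lemma eqv_eta0 f s : f s = 0 -> eqv H a1 b eta f s = 0.
Proof. by move=> f0; rewrite /eqv f0 !linear0. Qed.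

Lemma eqv_tau0 j f s : K j (f s) -> j != L -> eqv H b a2 tau f s = 0.
Proof.
move=> Kf jL; rewrite /eqv (@ct_tau ct j) ?linear0 //.
by apply: (gc_Kb gc); rewrite ?groupV ?retr_in.
Qed.

(** The class of [z'] depends only on that of [z]. With [z = 0] each level, corrected by the
    coboundary from below, lies in the kernel of [D] and [eps], hence is [D w + iota v]; at the top
    the remaining [v] is a primitive of [z']. *)
Lemma link_exact n z z' y : (0 < n)%N -> 
  link H b D eps iota L K n z z' y -> (forall s, size s = n -> z s = 0) ->
  cob H a2 (n + L) z'.
Proof.
move=> n0 [Iy Ky ey sy iy] z0; have L0 := gc_L gc.
have dec j f : invc H b (n + j) f -> Kval K j.+1 (n + j) f ->
    (forall s, size s = (n + j)%N -> D (f s) = 0) ->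
    (forall s, size s = (n + j)%N -> eps (f s) = 0) ->
    exists w v, [/\ invc H b (n + j) w, Kval K j.+2 (n + j) w, invc H a2 (n + j) v &
      forall s, size s = (n + j)%N -> f s = D (w s) + iota (v s)].
  move=> If Kf Df ef; exists (eqv H b b h f), (eqv H b a2 tau f).
  split; try by [apply: eqv_inv; rewrite ?addn_gt0 ?n0].
    move=> s ss; apply: (gc_Kb gc); first exact: retr_in.
    by apply: (ct_h ct); apply: (gc_Kb gc); rewrite ?groupV ?retr_in //; apply: Kf.
  move=> s ss; rewrite [LHS](@eqv_id j (n + j)) //; last exact: Kf.
  by rewrite eqv_hD0 ?Df // eqv_eta0 ?ef // !addr0.
have claim i : (i < L)%N -> exists w v, [/\ invc H b (n + i) w,
    Kval K i.+2 (n + i) w, invc H a2 (n + i) v &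
    forall s, size s = (n + i).+1 ->
      cobd (y i) s = D (cobd w s) + iota (cobd v s)].
  elim: i => [|i IH] iL.
    have [w [v [Iw Kw Iv ew]]] : exists w v, [/\ invc H b (n + 0) w,
        Kval K 2 (n + 0) w, invc H a2 (n + 0) v &
        forall s, size s = (n + 0)%N -> y 0%N s = D (w s) + iota (v s)].
      apply: dec; rewrite ?addn0 //.
      - by have := Iy 0%N iL; rewrite addn0.
      - by have := Ky 0%N iL; rewrite addn0.
      - by move=> s ss; apply: (gc_D1 gc); apply: (Ky 0%N); rewrite ?addn0.
      - by move=> s ss; rewrite ey // z0.
    exists w, v; split=> // s ss.
    rewrite -(cobd_lin D) -(cobd_lin iota) -cobdD.
    by apply: eq_cobd_size => t; rewrite ss /=; apply: ew.
  have [w [v [Iw Kw Iv ew]]] := IH (ltnW iL).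
  have Kdw : Kval K i.+2 (n + i.+1) (cobd w) by rewrite addnS; apply: (Kval_cobd gc).
  have dv s : size s = (n + i.+1)%N -> cobd v s = 0.
    move=> ss; rewrite -[LHS](ct_tauiota ct).
    have e : iota (cobd v s) = D (y i.+1 s - cobd w s).
      rewrite linearB /= -sy ?ew // -?addnS //; abel.
    rewrite e; apply: (@ct_tauD ct i.+1).
    by apply: (gc_KB gc); [apply: Ky | apply: Kdw].
  have [w' [v' [Iw' Kw' Iv' ew']]] : exists w' v', [/\ invc H b (n + i.+1) w',
        Kval K i.+3 (n + i.+1) w', invc H a2 (n + i.+1) v' &
        forall s, size s = (n + i.+1)%N -> y i.+1 s - cobd w s = D (w' s) + iota (v' s)].
    apply: (dec i.+1 (fun s => y i.+1 s - cobd w s)).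
    - move=> g s gH ss; rewrite raddfB /= Iy // (@invc_cobd _ _ H _ b (n + i)) //.
      by rewrite -addnS.
    - by move=> s ss; apply: (gc_KB gc); [apply: Ky | apply: Kdw].
    - move=> s ss; rewrite linearB /= -sy ?ew // -?addnS // dv // linear0 addr0.
      exact: subrr.
    - move=> s ss; apply: (@gc_eps _ _ _ _ _ _ _ _ _ _ _ _ _ _ gc i).
      by apply: (gc_KB gc); [apply: Ky | apply: Kdw].
  exists w', v'; split=> // s ss.
  rewrite -(cobd_lin D) -(cobd_lin iota) -cobdD -[LHS]subr0 -(cobd_cobd w s) -cobdB.
  by apply: eq_cobd_size => t; rewrite ss /=; apply: ew'.
have [|w [v [Iw Kw Iv ew]]] := claim L.-1; first by rewrite prednK.
have eL : (n + L.-1).+1 = (n + L)%N by rewrite -addnS prednK.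
exists v; first by rewrite -eL.
move=> s ss; rewrite -[LHS](ct_tauiota ct) -iy // ew ?eL // linearD /=.
rewrite (ct_tauiota ct) (@ct_tauD ct L) ?add0r //.
rewrite -[L in K L.+1](prednK L0); apply: (Kval_cobd gc Kw).
by rewrite eL.
Qed.

(** Each level is the contraction applied to the coboundary of the level below. The obstruction
    [iota (tau _)] vanishes below the top, because [tau] lives on [K L] only, and at the top it is
    [z']. *)
Lemma link_exists n z : (0 < n)%N -> invc H a1 n z -> cocy n z ->
  exists z' y, [/\ link H b D eps iota L K n z z' y, invc H a2 (n + L) z' &
    cocy (n + L) z'].
Proof.
move=> n0 Iz cz; have L0 := gc_L gc.
pose y := fix y j := if j is i.+1 then eqv H b b h (cobd (y i)) else eqv H a1 b eta z.
have Iy j : invc H b (n + j) (y j).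
  elim: j => [|j IH]; first by rewrite addn0; apply: eqv_inv.
  by rewrite addnS; apply: eqv_inv => //; apply: invc_cobd.
have Ky j : Kval K j.+1 (n + j) (y j).
  elim: j => [|j IH] s ss.
    by apply: (gc_Kb gc); [apply: retr_in | apply: (ct_eta ct)].
  apply: (gc_Kb gc); first exact: retr_in.
  apply: (ct_h ct); apply: (gc_Kb gc); first by rewrite groupV retr_in.
  by apply: (Kval_cobd gc IH); rewrite -addnS.
have ey s : size s = n -> eps (y 0%N s) = z s.
  move=> ss; rewrite /= /eqv (gc_beps gc) ?retr_in // (ct_epseta ct).
  by rewrite (actKV _ aH1) ?retr_in.
have epsdy j s : size s = (n + j).+1 -> eps (cobd (y j) s) = 0.
  case: j => [|j] ss.
    rewrite addn0 in ss; rewrite -(cobd_lin eps) -[RHS](cz s ss).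
    by apply: eq_cobd_size => t; rewrite ss; apply: ey.
  by apply: (@gc_eps _ _ _ _ _ _ _ _ _ _ _ _ _ _ gc j); apply: (Kval_cobd gc (Ky j.+1)).
have stepy j : (forall s, size s = (n + j).+1 -> D (cobd (y j) s) = 0) ->
    forall s, size s = (n + j).+1 ->
    cobd (y j) s = D (y j.+1 s) + iota (eqv H b a2 tau (cobd (y j)) s).
  move=> Dy s ss; rewrite [LHS](@eqv_id j (n + j).+1) //; last exact: (Kval_cobd gc (Ky j)).
  by rewrite eqv_hD0 ?Dy // eqv_eta0 ?epsdy // !addr0.
have claim j : (j < L)%N -> forall s, size s = (n + j).+1 -> D (cobd (y j) s) = 0.
  elim: j => [|j IH] jL s ss; rewrite -(cobd_lin D).
    rewrite -[RHS](cobd0 N s); apply: eq_cobd_size => t; rewrite ss /= => st.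
    by apply: (gc_D1 gc); apply: (Ky 0%N).
  rewrite -[RHS](cobd_cobd (y j) s); apply: eq_cobd_size => t; rewrite ss /= => st.
  have st' : size t = (n + j).+1 by rewrite -addnS.
  rewrite (stepy j (IH (ltnW jL)) t st').
  rewrite (@eqv_tau0 j.+1) ?linear0 ?addr0 ?neq_ltn ?jL //.
  by apply: (Kval_cobd gc (Ky j)); rewrite -addnS.
have eL : (n + L.-1).+1 = (n + L)%N by rewrite -addnS prednK.
have Liota s : size s = (n + L)%N ->
    cobd (y L.-1) s = iota (eqv H b a2 tau (cobd (y L.-1)) s).
  have Dc t : size t = (n + L.-1).+1 -> D (cobd (y L.-1) t) = 0.
    by apply: claim; rewrite prednK.
  move=> ss; rewrite [LHS](stepy _ Dc) ?eL //.
  rewrite [D _](_ : _ = 0) ?add0r // [y L.-1.+1 s](_ : _ = 0) ?linear0 //.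
  apply: (ct_top ct); rewrite -[in K _](prednK L0); apply: Ky.
  by rewrite prednK.
exists (eqv H b a2 tau (cobd (y L.-1))), y; split.
- split=> // j s jL ss; rewrite stepy //; last by move=> t; apply: claim; apply: ltnW.
  rewrite (@eqv_tau0 j.+1) ?linear0 ?addr0 ?neq_ltn ?jL //.
  exact: (Kval_cobd gc (Ky j)).
- apply: eqv_inv => //; first by rewrite addn_gt0 n0.
  by rewrite -eL; apply: invc_cobd.
- move=> s ss; rewrite -[LHS](ct_tauiota ct) -(cobd_lin iota).
  rewrite (eq_cobd_size (g := cobd (y L.-1))) ?cobd_cobd ?linear0 // => t.
  by rewrite ss /= => st; rewrite Liota.
Qed.

End Exactness.

Section PointwiseOps.
Variables (k : fieldType) (T : Type) (M : lmodType k).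
Implicit Types (f g : T -> M) (x : T).
Lemma fD f g x : (f + g) x = f x + g x. Proof. by []. Qed.
Lemma fN f x : (- f) x = - f x. Proof. by []. Qed.
Lemma fZ c f x : (c *: f) x = c *: f x. Proof. by []. Qed.
Lemma f0 x : (0 : T -> M) x = 0. Proof. by []. Qed.
Definition fE := (fD, fN, fZ, f0).
End PointwiseOps.

(** * Joins of boundaries of simplices *)

Section AlternatingFunctions.
Variables (k : fieldType) (Z : finType) (M : lmodType k).
Hypothesis two_neq0 : (2%:R : k) != 0.
Notation A := (seq Z -> M).
Implicit Types (F G : A) (x y : Z) (s t : seq Z) (b : {set Z}) (l : seq {set Z}).

(** An alternating function on sequences of vertices is an oriented simplicial chain, with its value
    at [s] as the coefficient of the simplex [s]. As 2 is invertible, degenerate simplices have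
    coefficient zero. *)
Definition alternating F :=
  forall s t x y, F (s ++ x :: y :: t) = - F (s ++ y :: x :: t).

Lemma selfopp_eq0 (m : M) : m = - m -> m = 0.
Proof.
move=> e; apply/eqP; have : 2%:R *: m == 0 by rewrite scaler_nat mulr2n {1}e addNr.
by rewrite scaler_eq0 (negPf two_neq0).
Qed.

Lemma alternating_dup F s x t u : alternating F -> F (s ++ x :: t ++ x :: u) = 0.
Proof.
move=> aF; elim: t s => [|y t IH] s; first by apply: selfopp_eq0; apply: aF.
rewrite cat_cons aF; have := IH (rcons s y); rewrite cat_rcons => ->.
exact: oppr0.
Qed.

Lemma alternating_uniq F s : alternating F -> ~~ uniq s -> F s = 0.
Proof.
move=> aF; rewrite -[s in F s]cat0s; elim: s (Nil Z) => [//|x s IH] r.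
rewrite /= negb_and negbK => /orP[xs|us].
  by case/splitPr: xs => t u; rewrite -cat_cons; apply: alternating_dup.
by rewrite -cat_rcons; apply: IH.
Qed.

Lemma alternating0 : alternating 0. Proof. by move=> *; rewrite !fE oppr0. Qed.
Lemma alternatingB F G : alternating F -> alternating G -> alternating (F - G).
Proof. by move=> aF aG s t x y; rewrite /= !fE /= aF aG opprD. Qed.
Lemma alternatingZ c F : alternating F -> alternating (c *: F).
Proof. by move=> aF s t x y; rewrite !fE aF scalerN. Qed.
Lemma alternatingD F G : alternating F -> alternating G -> alternating (F + G).
Proof. by move=> aF aG s t x y; rewrite !fE aF aG opprD. Qed.

(** The maps [ann x] and [cre x] are the annihilation and creation operators of the exterior
    algebra, related by [ann_cre]; the simplicial boundary is the sum of all [ann x]. *)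
Definition ann x F : A := fun s => F (x :: s).

Fixpoint cref x F s : M :=
  if s is y :: s' then (if y == x then F s' else 0) - cref x (ann y F) s' else 0.
Definition cre x F : A := cref x F.

Lemma ann_lin x : linear (ann x). Proof. by []. Qed.

Lemma cre_lin x : linear (cre x).
Proof.
move=> c F G; apply: funext => s; rewrite !fE /cre.
elim: s F G => [|y s IH] F G /=; first by rewrite scaler0 addr0.
rewrite ann_lin IH scalerBr; case: eqP => _ /=; first by rewrite ?fE; abel.
by rewrite scaler0; abel.
Qed.

Lemma ann_cre x y F :
  ann y (cre x F) = (if y == x then F else 0) - cre x (ann y F).
Proof. by apply: funext => s; rewrite !fE /ann /cre /=; case: ifP. Qed.

Lemma ann_ann x y F : alternating F -> ann x (ann y F) = - ann y (ann x F).
Proof. by move=> aF; apply: funext => s; rewrite fE /ann (aF [::]). Qed.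

Lemma alternating_ann x F : alternating F -> alternating (ann x F).
Proof. by move=> aF s t y z; rewrite /ann; apply: (aF (x :: s)). Qed.

Lemma alternating_cre x F : alternating F -> alternating (cre x F).
Proof.
move=> aF s; rewrite /cre; elim: s F aF => [|u s IH] F aF t y z /=.
  rewrite ann_ann //= [cref x (- _) _](_ : _ = - cref x (ann y (ann z F)) t); last first.
    have /= := cre_lin x (-1) (ann y (ann z F)) 0.
    rewrite scaleN1r addr0 /cre => ->.
    have -> : cref x 0 = 0.
      by have /= := cre_lin x (-1) 0 0; rewrite scaler0 addr0 /cre scaleN1r addNr.
    by rewrite addr0 scaleN1r fE.
  by rewrite /ann; abel.
rewrite (IH (ann u F) (alternating_ann u aF)).
by case: ifP => _; rewrite ?(aF s t y z); abel.
Qed.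

Definition restr (Q : pred (seq Z)) F : A := fun s => if Q s then F s else 0.

Lemma restr_lin Q : linear (restr Q).
Proof.
move=> c F G; apply: funext => s; rewrite !fE /restr; case: ifP => //.
by rewrite scaler0 addr0.
Qed.

Definition swap_inv (Q : pred (seq Z)) :=
  forall s t x y, Q (s ++ x :: y :: t) = Q (s ++ y :: x :: t).

Lemma alternating_restr Q F : swap_inv Q -> alternating F -> alternating (restr Q F).
Proof.
by move=> iQ aF s t x y; rewrite /restr iQ; case: ifP => _; [apply: aF | rewrite oppr0].
Qed.

Lemma ann_restr x Q F : (forall s, Q (x :: s) = Q s) ->
  ann x (restr Q F) = restr Q (ann x F).
Proof. by move=> iQ; apply: funext => s; rewrite /ann/restr iQ. Qed.

Lemma cre_restr x Q F : (forall s t, Q (s ++ x :: t) = Q (s ++ t)) ->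
  cre x (restr Q F) = restr Q (cre x F).
Proof.
move=> iQ; apply: funext => s; rewrite /cre {2}/restr.
elim: s Q F iQ => [|y s IH] Q F iQ /=; first by rewrite if_same.
rewrite (IH (fun t => Q (y :: t)) (ann y F)) => [|t u]; last exact: (iQ (y :: t)).
case: eqP => [->|_]; last by case: ifP => _; rewrite ?subr0.
by rewrite /restr (iQ [::]) /=; case: ifP => _; rewrite ?subr0.
Qed.

Definition sub_seq b s := b \subset [set x in s].

Lemma sub_seq_swap b : swap_inv (sub_seq b).
Proof.
move=> s t x y; rewrite /sub_seq.
suff -> : [set z in s ++ [:: x, y & t]] = [set z in s ++ [:: y, x & t]] by [].
by apply/setP=> z; rewrite !inE !mem_cat !inE (orbCA (z == x)).
Qed.

Lemma sub_seq_notin b s t x : x \notin b -> sub_seq b (s ++ x :: t) = sub_seq b (s ++ t).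
Proof.
move=> xb; apply/subsetP/subsetP => sb z zb; have := sb z zb; rewrite !inE !mem_cat ?inE.
  by case: eqP => [e|_]; [rewrite -e zb in xb | ].
by case/orP=> ->; rewrite ?orbT.
Qed.

Definition keep b := restr (sub_seq b).
Definition drp b := restr (fun s => ~~ sub_seq b s).

Lemma keep_drp b F : F = keep b F + drp b F.
Proof.
by apply: funext => s; rewrite fE /keep/drp/restr; case: ifP => _; rewrite ?addr0 ?add0r.
Qed.

Definition dl b F : A := \sum_(x in b) ann x F.

Lemma dl_lin b : linear (dl b).
Proof.
move=> c F G; rewrite /dl scaler_sumr -big_split; apply: eq_bigr => x _.
exact: ann_lin.
Qed.

HB.instance Definition _ x := GRing.isLinear.Build k A A *:%R (ann x) (ann_lin x).
HB.instance Definition _ x := GRing.isLinear.Build k A A *:%R (cre x) (cre_lin x).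
HB.instance Definition _ Q := GRing.isLinear.Build k A A *:%R (restr Q) (restr_lin Q).
HB.instance Definition _ b := GRing.Linear.on (restr (sub_seq b)).
HB.instance Definition _ b := GRing.Linear.copy (keep b) (restr (sub_seq b)).
HB.instance Definition _ b := GRing.Linear.copy (drp b) (restr (fun s => ~~ sub_seq b s)).
HB.instance Definition _ b := GRing.isLinear.Build k A A *:%R (dl b) (dl_lin b).

Lemma alternating_sum (I : finType) (P : pred I) (f : I -> A) :
  (forall i, P i -> alternating (f i)) -> alternating (\sum_(i | P i) f i).
Proof.
by move=> af; elim/big_rec: _ => [|i F Pi aF]; [apply: alternating0 |
  apply: alternatingD; [apply: af|]].
Qed.

Lemma alternating_dl b F : alternating F -> alternating (dl b F).
Proof. by move=> aF; apply: alternating_sum => x _; apply: alternating_ann. Qed.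
Lemma alternating_keep b F : alternating F -> alternating (keep b F).
Proof. exact/alternating_restr/sub_seq_swap. Qed.
Lemma alternating_drp b F : alternating F -> alternating (drp b F).
Proof. by apply/alternating_restr => s t x y; rewrite sub_seq_swap. Qed.

Lemma dl_dl b b' F : alternating F -> dl b (dl b' F) = - dl b' (dl b F).
Proof.
move=> aF; rewrite /dl -sumrN.
under eq_bigr => x _ do rewrite raddf_sum.
under [RHS]eq_bigr => x _ do rewrite raddf_sum -sumrN.
rewrite exchange_big; apply: eq_bigr => x _; apply: eq_bigr => y _.
by rewrite /= ann_ann.
Qed.

Lemma funM_selfopp F : F = - F -> F = 0.
Proof.
move=> e; apply: funext => s; apply: selfopp_eq0.
by have /= := congr1 (fun f : A => f s) e; rewrite fE.
Qed.

Lemma dl_dl0 b F : alternating F -> dl b (dl b F) = 0.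
Proof. by move=> aF; apply: funM_selfopp; apply: dl_dl. Qed.

Lemma dl_cre b x F : dl b (cre x F) = (if x \in b then F else 0) - cre x (dl b F).
Proof.
rewrite /dl raddf_sum -sumrN; under eq_bigr => y _ do rewrite ann_cre.
rewrite big_split /=; congr (_ + _).
rewrite (eq_bigr (fun y => if y == x then F else 0)) // -big_mkcondr.
case: ifP => xb; last first.
  by rewrite big1 // => y /andP[yb /eqP e]; rewrite -e yb in xb.
by rewrite (big_pred1 x) // => y /=; rewrite andbC; case: eqP => //= ->.
Qed.

Lemma dl_restr b Q F : (forall x s, x \in b -> Q (x :: s) = Q s) ->
  dl b (restr Q F) = restr Q (dl b F).
Proof.
move=> iQ; rewrite /dl raddf_sum; apply: eq_bigr => x xb.
by apply: ann_restr => s; apply: iQ.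
Qed.

Lemma dl_keep b b' F : [disjoint b & b'] -> dl b (keep b' F) = keep b' (dl b F).
Proof.
move=> dbb; apply: dl_restr => x s xb; apply: (sub_seq_notin [::]).
by rewrite (disjointFr dbb).
Qed.

Lemma dl_drp b b' F : [disjoint b & b'] -> dl b (drp b' F) = drp b' (dl b F).
Proof.
move=> dbb; apply: dl_restr => x s xb; congr (~~ _); apply: (sub_seq_notin [::]).
by rewrite (disjointFr dbb).
Qed.

Lemma cre_keep b x F : x \notin b -> cre x (keep b F) = keep b (cre x F).
Proof. by move=> xb; apply: cre_restr => s t; apply: sub_seq_notin. Qed.

(* a set containing [b] gains nothing when an element of [b] is added *)
Lemma keep_dl b F : alternating F -> keep b (dl b F) = 0.
Proof.
move=> aF; apply: funext => s; rewrite /keep/restr; case: ifP => //= sb.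
rewrite /dl fct_sumE big1 // => x xb.
apply: (@alternating_uniq F (x :: s)) => //=.
by have := subsetP sb x xb; rewrite inE => ->.
Qed.

End AlternatingFunctions.

Section JoinOperators.
Variables (k : fieldType) (Z : finType) (M : lmodType k).
Hypothesis two_neq0 : (2%:R : k) != 0.
Notation A := (seq Z -> M).
Implicit Types (F G : A) (x y : Z) (s t : seq Z) (b : {set Z}) (l : seq {set Z}).
Variables (bl : seq {set Z}) (pt : {set Z} -> Z).
Hypotheses (bl_uniq : uniq bl)
  (bl_disj : forall b b', b \in bl -> b' \in bl -> b != b' -> [disjoint b & b'])
  (bl_pt : forall b, b \in bl -> pt b \in b).

Definition supp : {set Z} := \bigcup_(b in bl) b.

Lemma bl_supp b : b \in bl -> b \subset supp.
Proof. by move=> bb; apply: (bigcup_sup b). Qed.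

Definition offX := @restr k Z M (fun s => ~~ all (mem supp) s).
HB.instance Definition _ :=
  GRing.Linear.copy offX (@restr k Z M (fun s => ~~ all (mem supp) s)).

(* the chains of the join of the boundaries of the simplices spanned by the blocks *)
Definition valid F :=
  [/\ alternating F, offX F = 0 & forall b, b \in bl -> keep b F = 0].

Lemma restrC (Q Q' : pred (seq Z)) F : restr Q (restr Q' F) = restr Q' (restr Q F).
Proof. by apply: funext => s; rewrite /restr; do 2 case: ifP. Qed.

Lemma offX_restr Q F : offX (restr Q F) = restr Q (offX F).
Proof. exact: restrC. Qed.
Lemma keep_restr b Q F : keep b (restr Q F) = restr Q (keep b F).
Proof. exact: restrC. Qed.

Lemma offX_cre x F : x \in supp -> offX (cre x F) = cre x (offX F).
Proof.
move=> xX; rewrite /offX cre_restr // => s t; congr (~~ _).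
by rewrite !all_cat /= xX.
Qed.

Lemma offX_dl b F : b \in bl -> offX (dl b F) = dl b (offX F).
Proof.
move=> bb; rewrite /offX dl_restr // => x s xb.
by rewrite /= (subsetP (bl_supp bb)).
Qed.

Lemma valid0 : valid 0.
Proof. by split=> *; rewrite ?linear0 //; apply: alternating0. Qed.
Lemma validB F G : valid F -> valid G -> valid (F - G).
Proof.
move=> [aF oF kF] [aG oG kG]; split; first exact: alternatingB.
  by rewrite linearB /= oF oG subrr.
by move=> b bb; rewrite linearB /= kF // kG // subrr.
Qed.
Lemma validD F G : valid F -> valid G -> valid (F + G).
Proof.
move=> [aF oF kF] [aG oG kG]; split; first exact: alternatingD.
  by rewrite linearD /= oF oG addr0.
by move=> b bb; rewrite linearD /= kF // kG // addr0.
Qed.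

Lemma valid_dl b F : b \in bl -> valid F -> valid (dl b F).
Proof.
move=> bb [aF oF kF]; split; first exact: alternating_dl.
  by rewrite offX_dl // oF linear0.
move=> b' b'b; have [->|nb] := eqVneq b' b; first exact: keep_dl.
by rewrite -dl_keep ?kF ?linear0 // bl_disj // eq_sym.
Qed.

Lemma pt_notin b b' : b \in bl -> b' \in bl -> b != b' -> pt b \notin b'.
Proof.
by move=> bb b'b nb; rewrite (disjointFr (bl_disj bb b'b nb)) ?bl_pt.
Qed.

Lemma pt_supp b : b \in bl -> pt b \in supp.
Proof. by move=> bb; rewrite (subsetP (bl_supp bb)) ?bl_pt. Qed.

(* [hb b] contracts the factor [b] of the join, [Pb b] projects onto its fundamental class;
   [Hl] and [Pl] assemble them as for a tensor product of complexes. *)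
Definition hb b F := drp b (cre (pt b) F).
Definition Pb b F := dl b (keep b (cre (pt b) F)).

Lemma hb_lin b : linear (hb b).
Proof. by move=> c F G; rewrite /hb !linearP. Qed.
Lemma Pb_lin b : linear (Pb b).
Proof. by move=> c F G; rewrite /Pb !linearP. Qed.
HB.instance Definition _ b := GRing.isLinear.Build k A A *:%R (hb b) (hb_lin b).
HB.instance Definition _ b := GRing.isLinear.Build k A A *:%R (Pb b) (Pb_lin b).

Lemma valid_cre_keep b b' F : b \in bl -> b' \in bl -> b != b' -> valid F ->
  keep b' (cre (pt b) F) = 0.
Proof.
by move=> bb b'b nb [_ _ kF]; rewrite -cre_keep ?kF ?linear0 // pt_notin.
Qed.

Lemma valid_hb b F : b \in bl -> valid F -> valid (hb b F).
Proof.
move=> bb vF; have [aF oF kF] := vF; split.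
- exact/alternating_drp/alternating_cre.
- by rewrite /hb offX_restr (offX_cre _ (pt_supp bb)) oF !linear0.
move=> b' b'b; have [->|nb] := eqVneq b' b.
  by apply: funext => s; rewrite /keep /restr; case: ifP => // sb; rewrite /hb /drp /restr sb.
by rewrite /hb keep_restr (@valid_cre_keep b b') ?linear0 // eq_sym.
Qed.

Lemma valid_Pb b F : b \in bl -> valid F -> valid (Pb b F).
Proof.
move=> bb vF; have [aF oF kF] := vF; split.
- exact/alternating_dl/alternating_keep/alternating_cre.
- by rewrite /Pb offX_dl // offX_restr (offX_cre _ (pt_supp bb)) oF !linear0.
move=> b' b'b; have [->|nb] := eqVneq b' b.
  exact/keep_dl/alternating_keep/alternating_cre.
rewrite eq_sym in nb.
by rewrite /Pb -dl_keep ?bl_disj // keep_restr (@valid_cre_keep b b') ?linear0.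
Qed.

(** In the full simplex coning with [pt b] is a contraction; discarding the simplices that contain
    all of [b] costs exactly [Pb b]. *)
Lemma hb_id b F : b \in bl -> valid F -> dl b (hb b F) + hb b (dl b F) = F - Pb b F.
Proof.
move=> bb [aF _ kF].
have e1 : dl b (cre (pt b) F) = F - cre (pt b) (dl b F) by rewrite dl_cre bl_pt.
have e2 : dl b (cre (pt b) F) = Pb b F + dl b (hb b F).
  by rewrite {1}(keep_drp b (cre (pt b) F)) linearD.
have e3 : cre (pt b) (dl b F) = hb b (dl b F).
  rewrite [LHS](keep_drp b) [keep b _](_ : _ = 0) ?add0r //.
  have -> : cre (pt b) (dl b F) = F - dl b (cre (pt b) F) by rewrite e1; abel.
  by rewrite linearB /= kF // keep_dl ?subrr //; apply: alternating_cre.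
have -> : dl b (hb b F) = F - cre (pt b) (dl b F) - Pb b F by rewrite -e1 e2; abel.
by rewrite -e3; abel.
Qed.

Lemma dl_creC b b' F : b \in bl -> b' \in bl -> b' != b ->
  dl b' (cre (pt b) F) = - cre (pt b) (dl b' F).
Proof.
by move=> bb b'b nb; rewrite dl_cre (negPf (pt_notin bb b'b _)) ?sub0r // eq_sym.
Qed.

Lemma dl_hb b b' F : b \in bl -> b' \in bl -> b' != b ->
  dl b' (hb b F) = - hb b (dl b' F).
Proof.
by move=> bb b'b nb; rewrite /hb dl_drp ?bl_disj // dl_creC // linearN.
Qed.

Definition Dfull F := \sum_(b <- bl) dl b F.

Lemma Dfull_lin : linear Dfull.
Proof.
move=> c F G; rewrite /Dfull scaler_sumr -big_split; apply: eq_bigr => x _.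
exact: linearP.
Qed.
HB.instance Definition _ := GRing.isLinear.Build k A A *:%R Dfull Dfull_lin.

Lemma Dfull_ann F : Dfull F = \sum_(x in supp) ann x F.
Proof.
rewrite /Dfull /supp -bigcup_seq.
suff: forall l, uniq l -> {subset l <= bl} ->
    \sum_(b <- l) dl b F = \sum_(x in \bigcup_(b <- l) b) ann x F by apply.
elim => [|b l IH] /=; first by rewrite !big_nil big_set0.
case/andP=> bl' ul sl; rewrite !big_cons IH //; last first.
  by move=> b' b'l; apply: sl; rewrite inE b'l orbT.
rewrite (eq_bigl [predU b & \bigcup_(b' <- l) b']) => [|x]; last by rewrite !inE.
rewrite bigU //=; apply/pred0P => x /=; apply/negP => /andP[xb].
rewrite bigcup_seq => /bigcupP[b' b'l xb']; have [e|nb] := eqVneq b b'.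
  by rewrite e b'l in bl'.
have := bl_disj (sl b _) (sl b' _) nb.
rewrite !inE eqxx b'l orbT => /(_ isT isT) db.
by rewrite (disjointFr db) // in xb'.
Qed.

Lemma valid_sum l F (f : {set Z} -> A) : {subset l <= bl} ->
  (forall b, b \in bl -> valid (f b)) -> valid (\sum_(b <- l) f b).
Proof.
move=> sl vf; elim: l sl => [|b l IH] sl; first by rewrite big_nil; apply: valid0.
rewrite big_cons; apply: validD; first by apply: vf; apply: sl; rewrite mem_head.
by apply: IH => b' b'l; apply: sl; rewrite inE b'l orbT.
Qed.

Lemma valid_Dfull F : valid F -> valid (Dfull F).
Proof. by move=> vF; apply: valid_sum => // b bb; apply: valid_dl. Qed.

Lemma Dfull_Dfull F : alternating F -> Dfull (Dfull F) = 0.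
Proof.
move=> aF; apply: (funM_selfopp two_neq0); rewrite !Dfull_ann.
transitivity (\sum_(x in supp) \sum_(y in supp) ann x (ann y F)).
  by apply: eq_bigr => x _; rewrite raddf_sum.
rewrite exchange_big -sumrN; apply: eq_bigr => x _ /=.
by rewrite raddf_sum -sumrN; apply: eq_bigr => y _ /=; rewrite ann_ann.
Qed.

Lemma Dfull_hb b F : b \in bl -> valid F ->
  Dfull (hb b F) + hb b (Dfull F) = F - Pb b F.
Proof.
move=> bb vF; rewrite /Dfull raddf_sum -big_split /= (bigD1_seq b) //= hb_id //.
by rewrite big1_seq ?addr0 // => b' /andP[nb b'b]; rewrite dl_hb // addNr.
Qed.

Lemma Dfull_Pb b F : b \in bl -> valid F -> Dfull (Pb b F) = Pb b (Dfull F).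
Proof.
move=> bb [aF _ kF]; rewrite /Dfull raddf_sum; apply: eq_big_seq => b' b'b /=.
have aK : alternating (keep b (cre (pt b) F)).
  exact/alternating_keep/alternating_cre.
have [->|nb] := eqVneq b' b.
  rewrite /Pb dl_dl0 // [cre _ (dl b F)](_ : _ = F - dl b (cre (pt b) F)); last first.
    by rewrite dl_cre bl_pt //; abel.
  rewrite linearB /= kF // keep_dl ?subrr ?linear0 //; exact: alternating_cre.
rewrite /Pb dl_dl // dl_keep ?bl_disj // dl_creC //.
by rewrite !linearN opprK.
Qed.

Fixpoint Hl l F := if l is b :: l' then hb b F + Pb b (Hl l' F) else 0.
Fixpoint Pl l F := if l is b :: l' then Pb b (Pl l' F) else F.

Lemma Hl_lin l : linear (Hl l).
Proof.
move=> c F G; elim: l => [|b l IH] /=; first by rewrite scaler0 addr0.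
by rewrite IH !linearP scalerDr; abel.
Qed.
HB.instance Definition _ l := GRing.isLinear.Build k A A *:%R (Hl l) (Hl_lin l).

Lemma valid_Hl l F : {subset l <= bl} -> valid F -> valid (Hl l F).
Proof.
elim: l => [|b l IH] sl vF /=; first exact: valid0.
have bb : b \in bl by apply: sl; rewrite mem_head.
apply: validD; first exact: valid_hb.
by apply: valid_Pb => //; apply: IH => // b' b'l; apply: sl; rewrite inE b'l orbT.
Qed.

Lemma Hl_id l F : {subset l <= bl} -> valid F ->
  Dfull (Hl l F) + Hl l (Dfull F) = F - Pl l F.
Proof.
elim: l => [|b l IH] sl vF /=; first by rewrite linear0 addr0 subrr.
have bb : b \in bl by apply: sl; rewrite mem_head.
have sl' : {subset l <= bl} by move=> b' b'l; apply: sl; rewrite inE b'l orbT.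
rewrite linearD /= Dfull_Pb //; last exact: valid_Hl.
have e1 := Dfull_hb bb vF.
have -> : Dfull (hb b F) = F - Pb b F - hb b (Dfull F) by rewrite -e1; abel.
have -> : Pb b (Dfull (Hl l F)) = Pb b F - Pb b (Pl l F) - Pb b (Hl l (Dfull F)).
  by rewrite -[Pb b F - _]linearB /= -IH // linearD /=; abel.
abel.
Qed.

(** The composite [Pl] is reordered into three stages: create all points [pt b], keep what contains
    every block, apply all block boundaries. The sign of this reordering is [sgs]. *)
Fixpoint dls l G := if l is b :: l' then dl b (dls l' G) else G.
Fixpoint crs l F := if l is b :: l' then cre (pt b) (crs l' F) else F.
Fixpoint keeps l G := if l is b :: l' then keep b (keeps l' G) else G.
Fixpoint sgs l : k := if l is b :: l' then (-1) ^+ size l' * sgs l' else 1.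

Lemma dls_lin l : linear (dls l).
Proof. by move=> c F G; elim: l => [|b l IH] //=; rewrite IH linearP. Qed.
Lemma crs_lin l : linear (crs l).
Proof. by move=> c F G; elim: l => [|b l IH] //=; rewrite IH linearP. Qed.
HB.instance Definition _ l := GRing.isLinear.Build k A A *:%R (dls l) (dls_lin l).
HB.instance Definition _ l := GRing.isLinear.Build k A A *:%R (crs l) (crs_lin l).

Lemma cre_dls b l G : b \in bl -> {subset l <= bl} -> b \notin l ->
  cre (pt b) (dls l G) = (-1) ^+ size l *: dls l (cre (pt b) G).
Proof.
move=> bb; elim: l => [|b' l IH] sl /=; first by rewrite expr0 scale1r.
have b'b : b' \in bl by apply: sl; rewrite mem_head.
have sl' : {subset l <= bl} by move=> c cl; apply: sl; rewrite inE cl orbT.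
rewrite inE negb_or => /andP[nb bl'].
have -> : cre (pt b) (dl b' (dls l G)) = - dl b' (cre (pt b) (dls l G)).
  by rewrite dl_creC ?opprK // eq_sym.
by rewrite IH // linearZ /= exprS mulN1r scaleNr.
Qed.

Lemma keep_dls b l G : b \in bl -> {subset l <= bl} -> b \notin l ->
  keep b (dls l G) = dls l (keep b G).
Proof.
move=> bb; elim: l => [|b' l IH] sl //=.
have b'b : b' \in bl by apply: sl; rewrite mem_head.
have sl' : {subset l <= bl} by move=> c cl; apply: sl; rewrite inE cl orbT.
rewrite inE negb_or eq_sym => /andP[nb bl'].
by rewrite -dl_keep ?bl_disj // IH.
Qed.

Lemma cre_keeps b l G : b \in bl -> {subset l <= bl} -> b \notin l ->
  cre (pt b) (keeps l G) = keeps l (cre (pt b) G).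
Proof.
move=> bb; elim: l => [|b' l IH] sl //=.
have b'b : b' \in bl by apply: sl; rewrite mem_head.
have sl' : {subset l <= bl} by move=> c cl; apply: sl; rewrite inE cl orbT.
rewrite inE negb_or => /andP[nb bl'].
by rewrite cre_keep ?pt_notin // IH.
Qed.

(** In this order the middle stage leaves only simplices on the full vertex set, which exhibits [Pl]
    as the projection onto a single fundamental cycle, see [Pl_iota]. *)
Lemma PlE l F : {subset l <= bl} -> uniq l ->
  Pl l F = sgs l *: dls l (keeps l (crs l F)).
Proof.
elim: l => [|b l IH] sl /=; first by rewrite scale1r.
have bb : b \in bl by apply: sl; rewrite mem_head.
have sl' : {subset l <= bl} by move=> c cl; apply: sl; rewrite inE cl orbT.
case/andP => bl' ul; rewrite IH // linearZ /= /Pb cre_dls //.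
by rewrite !linearZ /= scalerA keep_dls // cre_keeps // mulrC.
Qed.

End JoinOperators.

Section VolumeForm.
Variables (k : fieldType) (Z : finType) (M : lmodType k).
Hypothesis two_neq0 : (2%:R : k) != 0.
Notation A := (seq Z -> M).
Implicit Types (F G : A) (x y : Z) (s t : seq Z) (b : {set Z}) (l : seq {set Z}).

Lemma alternating_move F p x t u : alternating F ->
  F (p ++ x :: t ++ u) = 0 <-> F (p ++ t ++ x :: u) = 0.
Proof.
move=> aF; elim: t p => [//|y t IH] p; rewrite cat_cons aF.
have := IH (rcons p y); rewrite !cat_rcons => <-.
by split=> [/eqP|->]; rewrite ?oppr0 // oppr_eq0 => /eqP.
Qed.

(** Only vanishing is transported, so no sign of a permutation has to be computed; an equality is
    reduced to this case by subtraction. *)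
Lemma alternating_perm F s t : alternating F -> perm_eq s t -> F s = 0 -> F t = 0.
Proof.
move=> aF; move: s t; apply: (catCA_perm_ind (P := fun s => F s = 0)) => s1 s2 s3.
suff: forall p, F (p ++ s1 ++ s2 ++ s3) = 0 -> F (p ++ s2 ++ s1 ++ s3) = 0.
  by move/(_ [::]).
elim: s1 => [//|x s1 IH] p /= e.
apply/alternating_move => //; rewrite -cat_rcons; apply: IH.
by rewrite cat_rcons.
Qed.

Definition graded j F := forall s, size s != j -> F s = 0.

Lemma graded_ann j x F : graded j.+1 F -> graded j (ann x F).
Proof. by move=> gF s ss; apply: gF. Qed.

Lemma graded_cre j x F : graded j F -> graded j.+1 (cre x F).
Proof.
move=> gF s; rewrite /cre; elim: s j F gF => [|y s IH] j F gF //=.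
rewrite eqSS => sj; rewrite gF // if_same sub0r.
case: j gF sj => [|j] gF sj; last by rewrite (IH j) ?oppr0 //; apply: graded_ann.
rewrite (IH (size s)) ?oppr0 //; last by rewrite neq_ltn ltnSn.
by move=> t _; apply: gF.
Qed.

Lemma graded_restr j Q F : graded j F -> graded j (restr Q F).
Proof. by move=> gF s sj; rewrite /restr gF // if_same. Qed.

Lemma graded0 j : graded j 0. Proof. by []. Qed.
Lemma gradedD j F G : graded j F -> graded j G -> graded j (F + G).
Proof. by move=> gF gG s sj; rewrite fD gF // gG // addr0. Qed.
Lemma gradedB j F G : graded j F -> graded j G -> graded j (F - G).
Proof. by move=> gF gG s sj; rewrite fD fN gF // gG // subr0. Qed.

Lemma graded_dl j b F : graded j.+1 F -> graded j (dl b F).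
Proof.
move=> gF; rewrite /dl; elim/big_rec: _ => [|x G xb gG]; first exact: graded0.
by apply: gradedD gG; apply: graded_ann.
Qed.

Definition one (m : M) : A := fun s => if s is [::] then m else 0.

Lemma alternating_one m : alternating (one m).
Proof. by move=> [|z s] t x y /=; rewrite oppr0. Qed.

Definition wedge (m : M) s : A := foldr (@cre k Z M) (one m) s.

Lemma alternating_wedge m s : alternating (wedge m s).
Proof. by elim: s => [|x s IH] /=; [apply: alternating_one | apply: alternating_cre]. Qed.

Lemma graded_wedge m s : graded (size s) (wedge m s).
Proof. by elim: s => [|x s IH] /=; [case | apply: graded_cre]. Qed.

Lemma ann_wedge m y s : y \notin s -> ann y (wedge m s) = 0.
Proof.
elim: s => [|x s IH] //=; rewrite inE negb_or => /andP[yx ys].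
by rewrite ann_cre (negPf yx) sub0r IH // linear0 oppr0.
Qed.

Lemma wedge_at m s : uniq s -> wedge m s s = m.
Proof.
elim: s => [//|x s IH] /= /andP[xs us].
rewrite -[LHS]/(ann x (cre x (wedge m s)) s) ann_cre eqxx ann_wedge //.
by rewrite linear0 subr0 IH.
Qed.

End VolumeForm.

Section TopForm.
Variables (k : fieldType) (Z : finType) (M : lmodType k).
Hypothesis two_neq0 : (2%:R : k) != 0.
Implicit Types (x y : Z) (s t : seq Z) (b : {set Z}) (l : seq {set Z}).
Variables (bl : seq {set Z}) (pt : {set Z} -> Z).
Hypotheses (bl_uniq : uniq bl)
  (bl_disj : forall b b', b \in bl -> b' \in bl -> b != b' -> [disjoint b & b'])
  (bl_pt : forall b, b \in bl -> pt b \in b).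
Notation X := (supp bl).
Notation es := (enum X).

Definition vol : seq Z -> k^o := @wedge k Z k^o 1 es.

Lemma mul_form_alt (f : seq Z -> k^o) (m : M) :
  alternating f -> alternating (fun s => f s *: m).
Proof. by move=> af s t x y; rewrite af scaleNr. Qed.

Lemma offX_wedge (N : lmodType k) (n : N) s :
  {subset s <= X} -> offX bl (wedge n s) = 0.
Proof.
elim: s => [|x s IH] sX /=.
  by apply: funext => -[|y s] //; rewrite /offX /restr; case: ifP.
rewrite offX_cre ?sX ?mem_head // IH ?linear0 // => y ys.
by apply: sX; rewrite inE ys orbT.
Qed.

Lemma offX_out (N : lmodType k) (F : seq Z -> N) s :
  offX bl F = 0 -> ~~ all (mem X) s -> F s = 0.
Proof. by move=> oF nX; have := congr1 (fun f => f s) oF; rewrite /offX /restr nX. Qed.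

Lemma keepsE (N : lmodType k) (F : seq Z -> N) l s :
  keeps l F s = if all (fun b => sub_seq b s) l then F s else 0.
Proof.
by elim: l => [//|b l IH] /=; rewrite /keep /restr; case: ifP => //= _; rewrite IH.
Qed.

Lemma full_perm s : uniq s -> all (mem X) s -> (#|X| <= size s)%N -> perm_eq s es.
Proof.
move=> us sX nX; apply: uniq_perm; rewrite ?enum_uniq //.
apply: (uniq_min_size us _ _).2; last by rewrite -cardE.
by move=> x xs; rewrite mem_enum; apply: (allP sX).
Qed.

Lemma perm_blocks s : perm_eq s es -> all (fun b => sub_seq b s) bl.
Proof.
move=> ps; apply/allP => b bb; apply/subsetP => x xb; rewrite inE (perm_mem ps) mem_enum.
exact: (subsetP (bl_supp bb)).
Qed.

Lemma blocks_full s : all (fun b => sub_seq b s) bl -> {subset es <= s}.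
Proof.
move=> /allP sb x; rewrite mem_enum => /bigcupP[b bb xb].
by have := subsetP (sb b bb) x xb; rewrite inE.
Qed.

(** A nondegenerate simplex inside [X] that contains every block has vertex set [X], so an
    alternating function restricted to such simplices is determined by its value at [es]. *)
Lemma keeps_top (G : seq Z -> M) : alternating G -> offX bl G = 0 ->
  keeps bl G = (fun s => vol s *: G es).
Proof.
move=> aG oG; apply: funext => s; rewrite keepsE.
have [us|us] := boolP (uniq s); last first.
  have -> : vol s = 0 by apply: alternating_uniq us => //; apply: alternating_wedge.
  by rewrite scale0r alternating_uniq // if_same.
have [sX|sX] := boolP (all (mem X) s); last first.
  have -> : vol s = 0 by apply: offX_out sX; apply: offX_wedge => x; rewrite mem_enum.
  by rewrite scale0r (offX_out oG) // if_same.
case: ifP => sb; last first.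
  have [ss|ss] := eqVneq (size s) (size es).
    by rewrite perm_blocks // in sb; apply: full_perm => //; rewrite ss cardE.
  by rewrite /vol (@graded_wedge _ _ _ 1 es s ss) scale0r.
have ps : perm_eq s es.
  by apply: full_perm => //; rewrite cardE; apply: uniq_leq_size; rewrite ?enum_uniq //;
    apply: blocks_full.
apply/eqP; rewrite -subr_eq0; apply/eqP.
apply: (@alternating_perm _ _ _ (fun s => G s - vol s *: G es) es); last 1 first.
- by rewrite /vol wedge_at ?enum_uniq // scale1r subrr.
- apply: alternatingB => //; apply: mul_form_alt; exact: alternating_wedge.
- by rewrite perm_sym.
Qed.

(** The fundamental cycle of the join, up to sign: every block of the volume form is replaced by the
    boundary of its simplex. *)
Definition fund : seq Z -> k^o := dls bl vol.

Lemma dl_form (f : seq Z -> k^o) (m : M) b :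
  dl b (fun s => f s *: m) = (fun s => dl b f s *: m).
Proof. by apply: funext => s; rewrite /dl !fct_sumE scaler_suml. Qed.

Lemma dls_form (f : seq Z -> k^o) (m : M) l :
  dls l (fun s => f s *: m) = (fun s => dls l f s *: m).
Proof. by elim: l => //= b l ->; rewrite dl_form. Qed.

Definition iotaX (m : M) : seq Z -> M := fun s => fund s *: m.
(** The coefficient of the fundamental cycle: adding all the points [pt b] turns that cycle back
    into the volume form, up to the sign [sgs]. *)
Definition tauX (F : seq Z -> M) : M := sgs k bl *: crs pt bl F es.

Lemma iotaX_lin : linear iotaX.
Proof.
move=> c m n; apply: funext => s; rewrite /iotaX !fE scalerDr !scalerA.
by rewrite mulrC.
Qed.
Lemma tauX_lin : linear tauX.
Proof. by move=> c F G; rewrite /tauX linearP /= !fE scalerDr !scalerA mulrC. Qed.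

Lemma offX_crs (F : seq Z -> M) l : {subset l <= bl} -> offX bl F = 0 ->
  offX bl (crs pt l F) = 0.
Proof.
move=> sl oF; elim: l sl => [//|b l IH] sl /=.
have bb : b \in bl by apply: sl; rewrite mem_head.
rewrite (offX_cre _ (pt_supp bl_pt bb)) IH ?linear0 // => b' b'l.
by apply: sl; rewrite inE b'l orbT.
Qed.

Lemma alternating_crs (F : seq Z -> M) l : alternating F -> alternating (crs pt l F).
Proof. by move=> aF; elim: l => //= b l IH; apply: alternating_cre. Qed.

Lemma Pl_iota (F : seq Z -> M) : alternating F -> offX bl F = 0 ->
  Pl pt bl F = iotaX (tauX F).
Proof.
move=> aF oF; rewrite (PlE bl_disj bl_pt) // keeps_top; last first.
- exact: offX_crs.
- exact: alternating_crs.
rewrite [dls bl _](dls_form vol (crs pt bl F es) bl); apply: funext => s; rewrite !fE /iotaX /tauX /fund !scalerA.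
by rewrite mulrC.
Qed.

Lemma sgs_sqr l : sgs k l * sgs k l = 1.
Proof.
elim: l => [|b l IH] /=; first by rewrite mul1r.
by rewrite mulrACA IH mulr1 -exprD addnn -mul2n exprM sqrrN !expr1n.
Qed.

Lemma crs_dl (G : seq Z -> M) b l : b \in bl -> {subset l <= bl} -> b \notin l ->
  crs pt l (dl b G) = (-1) ^+ size l *: dl b (crs pt l G).
Proof.
move=> bb; elim: l => [|b' l IH] sl /=; first by rewrite expr0 scale1r.
have b'b : b' \in bl by apply: sl; rewrite mem_head.
have sl' : {subset l <= bl} by move=> c cl; apply: sl; rewrite inE cl orbT.
rewrite inE negb_or => /andP[nb bl'].
rewrite IH // linearZ /= (dl_creC bl_disj bl_pt) //.
by rewrite exprS mulN1r scaleNr scalerN opprK.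
Qed.

Lemma crs_dls (V : seq Z -> M) l : {subset l <= bl} -> uniq l ->
  (forall b, b \in bl -> cre (pt b) V = 0) -> crs pt l (dls l V) = sgs k l *: V.
Proof.
move=> sl ul V0; elim: l sl ul => [|b l IH] sl /=; first by rewrite scale1r.
have bb : b \in bl by apply: sl; rewrite mem_head.
have sl' : {subset l <= bl} by move=> c cl; apply: sl; rewrite inE cl orbT.
case/andP => bl' ul; rewrite crs_dl // IH // !linearZ /= scalerA; congr (_ *: _).
have := dl_cre b (pt b) V; rewrite V0 // linear0 bl_pt // => /esym /eqP.
by rewrite subr_eq0 => /eqP <-.
Qed.

Lemma cre_vol (m : M) b : b \in bl -> cre (pt b) (fun s => vol s *: m) = 0.
Proof.
move=> bb; apply: funext => s; rewrite f0.
set V := fun _ => _; have aV : alternating V by apply/mul_form_alt/alternating_wedge.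
have oV : offX bl V = 0.
  apply: funext => t; rewrite /offX /restr; case: ifP => // nX.
  by rewrite /V (offX_out _ nX) ?scale0r //; apply: offX_wedge => x; rewrite mem_enum.
have gV : graded (size es) V.
  by move=> t st; rewrite /V /vol (@graded_wedge _ _ _ 1 es t st) scale0r.
have [us|us] := boolP (uniq s); last first.
  by apply: (alternating_uniq two_neq0) us; apply: alternating_cre.
have [sX|sX] := boolP (all (mem X) s); last first.
  have oc : offX bl (cre (pt b) V) = 0.
    by rewrite (offX_cre V (pt_supp bl_pt bb)) oV linear0.
  exact: (offX_out oc sX).
have gc := @graded_cre _ _ _ _ (pt b) _ gV; apply: gc; rewrite neq_ltn ltnS -cardE; apply/orP; left.
rewrite -(card_uniqP us); apply/subset_leq_card/subsetP => x; exact: (allP sX).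
Qed.

Lemma tau_iota (m : M) : tauX (iotaX m) = m.
Proof.
rewrite /tauX /iotaX /fund -(dls_form vol) crs_dls //; last exact: cre_vol.
rewrite -[(sgs k bl *: _) es]/(sgs k bl *: (vol es *: m)) scalerA.
by rewrite sgs_sqr /vol wedge_at ?enum_uniq // !scale1r.
Qed.

Lemma dl_dls0 (V : seq Z -> M) b l : alternating V -> b \in l -> dl b (dls l V) = 0.
Proof.
move=> aV; have aD l' : alternating (dls l' V).
  by elim: l' => //= c l' IH; apply: alternating_dl.
elim: l => [//|c l IH] /=; rewrite inE; have [->|nb] := eqVneq b c.
  by rewrite dl_dl0.
by move=> /= bl'; rewrite dl_dl // IH // linear0 oppr0.
Qed.

Lemma keep_dls0 (V : seq Z -> M) b l : alternating V -> b \in bl -> {subset l <= bl} ->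
  b \in l -> keep b (dls l V) = 0.
Proof.
move=> aV bb; have aD l' : alternating (dls l' V).
  by elim: l' => //= c l' IH; apply: alternating_dl.
elim: l => [//|c l IH] sl /=; rewrite inE; have [->|nb] := eqVneq b c.
  by rewrite keep_dl.
move=> /= bl'; rewrite -dl_keep; last first.
  by apply: bl_disj => //; [apply: sl; rewrite mem_head | rewrite eq_sym].
by rewrite IH ?linear0 // => d dl'; apply: sl; rewrite inE dl' orbT.
Qed.

Lemma valid_iota (m : M) : valid bl (iotaX m).
Proof.
rewrite /iotaX /fund -(dls_form vol); set V := fun _ => _.
have aV : alternating V by apply/mul_form_alt/alternating_wedge.
split.
- by elim: bl => //= b l IH; apply: alternating_dl.
- have oV : offX bl V = 0.
    apply: funext => t; rewrite /offX /restr; case: ifP => // nX.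
    by rewrite /V (offX_out _ nX) ?scale0r //; apply: offX_wedge => x; rewrite mem_enum.
  suff: forall l, {subset l <= bl} -> offX bl (dls l V) = 0 by apply.
  elim=> [//|b l IH] sl /=; rewrite offX_dl ?sl ?mem_head // IH ?linear0 //.
  by move=> c cl; apply: sl; rewrite inE cl orbT.
- by move=> b bb; apply: keep_dls0.
Qed.

Lemma Dfull_iota (m : M) : Dfull bl (iotaX m) = 0.
Proof.
rewrite /iotaX /fund -(dls_form vol) /Dfull big1_seq // => b /andP[_ bb].
by apply: dl_dls0 bb; apply/mul_form_alt/alternating_wedge.
Qed.

Hypothesis bl_big : forall b, b \in bl -> (1 < #|b|)%N.
Hypothesis bl_nil : bl != [::].

(** Every block has a vertex outside [s], and these vertices are distinct because the blocks are
    disjoint. *)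
Lemma blockfree_size s : uniq s -> all (mem X) s ->
  (forall b, b \in bl -> ~~ sub_seq b s) -> (size s + size bl <= #|X|)%N.
Proof.
move=> us sX bf.
pose f b := odflt (pt b) [pick x in b | x \notin s].
have fP b : b \in bl -> f b \in b /\ f b \notin s.
  move=> bb; rewrite /f; case: pickP => [x /andP[]//|no].
  case/negP: (bf b bb); apply/subsetP => x xb; rewrite inE.
  by have := no x; rewrite xb /= => /negbFE.
have uf : uniq (map f bl).
  rewrite map_inj_in_uniq // => b b' bb b'b e; apply/eqP/negPn/negP => nb.
  have := bl_disj bb b'b nb; have [xb _] := fP b bb; have [xb' _] := fP b' b'b.
  by rewrite e in xb => db; rewrite (disjointFr db xb) in xb'.
have ucat : uniq (s ++ map f bl).
  rewrite cat_uniq us uf andbT /= -all_predC; apply/allP => x /mapP[b bb ->] /=.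
  by have [] := fP b bb.
rewrite -(size_map f) -size_cat -(card_uniqP ucat).
apply/subset_leq_card/subsetP => x; rewrite mem_cat => /orP[xs|/mapP[b bb ->]].
  exact: (allP sX).
by have [xb _] := fP b bb; apply: (subsetP (bl_supp bb)).
Qed.

(** Counted in vertices: the size of the maximal simplices of the join, which is the length of the
    exact complex and the degree of its class. *)
Definition dimX := (#|X| - size bl)%N.

Lemma dimX_bound : (size bl < #|X|)%N.
Proof.
have [b bb] : exists b, b \in bl by case: bl bl_nil => // b l _; exists b; apply: mem_head.
have := @blockfree_size [:: pt b]; rewrite /= (pt_supp bl_pt) // add1n; apply=> //.
move=> b' b'b; apply/negP => sb.
have := subset_leq_card sb; rewrite leqNgt (leq_ltn_trans _ (bl_big b'b)) //.
by rewrite (leq_trans (subset_leq_card (_ : _ \subset [set pt b]))) ?cards1 //;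
  apply/subsetP => x; rewrite !inE.
Qed.

Lemma valid_top (F : seq Z -> M) : valid bl F -> graded dimX.+1 F -> F = 0.
Proof.
move=> [aF oF kF] gF; apply: funext => s; rewrite f0.
have [us|us] := boolP (uniq s); last exact: (alternating_uniq two_neq0 aF us).
have [sX|sX] := boolP (all (mem X) s); last exact: (offX_out oF sX).
have [/hasP[b bb sb]|/hasPn bf] := boolP (has (fun b => sub_seq b s) bl).
  by have := congr1 (fun f => f s) (kF b bb); rewrite /keep /restr sb.
apply: gF; apply: contraL (blockfree_size us sX bf) => /eqP ->.
by rewrite /dimX -ltnNge addSn subnK // ltnW // dimX_bound.
Qed.

End TopForm.

(** * The exact complex of a join *)

Record block_system (Z : finType) (bl : seq {set Z}) (pt : {set Z} -> Z) : Prop :=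
  BlockSystem {
    bs_uniq : uniq bl;
    bs_disj : forall b b', b \in bl -> b' \in bl -> b != b' -> [disjoint b & b'];
    bs_pt : forall b, b \in bl -> pt b \in b;
    bs_big : forall b, b \in bl -> (1 < #|b|)%N;
    bs_nil : bl != [::] }.

Section JoinComplex.
Variables (k : fieldType) (gT : finGroupType) (Z : finType) (M : lmodType k).
Hypothesis two_neq0 : (2%:R : k) != 0.
Variables (bl : seq {set Z}) (pt : {set Z} -> Z).
Hypothesis bs : block_system bl pt.
Notation A := (seq Z -> M).
Implicit Types (F G : A).
Let bd := bs_disj bs.
Let bp := bs_pt bs.
Let bu := bs_uniq bs.
Notation L := (dimX bl).

(** The augmentation is split off from the boundary: the value on the empty simplex belongs to
    [jeps], so that the terms of the complex are the [jK j] with [j] positive. *)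
Definition jD F : A := fun s => if s is [::] then 0 else Dfull bl F s.
Definition jeps F : M := Dfull bl F [::].
Definition jh F : A := Hl pt bl F.
Definition jeta (m : M) : A := Hl pt bl (one m).
Definition jK j F := valid bl F /\ graded j F.

Lemma jD_lin : linear jD.
Proof.
move=> c F G; apply: funext => -[|x s]; rewrite /jD !fE ?scaler0 ?addr0 //.
by rewrite linearP.
Qed.
Lemma jeps_lin : linear jeps.
Proof. by move=> c F G; rewrite /jeps linearP. Qed.
Lemma jeta_lin : linear jeta.
Proof.
move=> c m n; rewrite /jeta -linearP; congr Hl.
by apply: funext => -[|x s]; rewrite !fE //= scaler0 addr0.
Qed.
HB.instance Definition _ := GRing.isLinear.Build k A A *:%R jD jD_lin.
HB.instance Definition _ := GRing.isLinear.Build k A M *:%R jeps jeps_lin.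
HB.instance Definition _ := GRing.isLinear.Build k M A *:%R jeta jeta_lin.
HB.instance Definition _ := GRing.Linear.copy jh (Hl pt bl : A -> A).
HB.instance Definition _ :=
  GRing.isLinear.Build k M A *:%R (@iotaX k Z M bl) (@iotaX_lin k Z M bl).
HB.instance Definition _ :=
  GRing.isLinear.Build k A M *:%R (@tauX k Z M bl pt) (@tauX_lin k Z M bl pt).

Variable (op : gT -> Z -> Z).
Variable (a : gT -> {linear M -> M}).

Definition jact g F : A := fun s => a g (F (map (op g^-1%g) s)).
Lemma jact_lin g : linear (jact g).
Proof. by move=> c F G; apply: funext => s; rewrite /jact !fE linearP. Qed.
HB.instance Definition _ g := GRing.isLinear.Build k A A *:%R (jact g) (jact_lin g).

Variable (H : {group gT}).
Hypothesis op1 : op 1%g =1 id.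
Hypothesis opM : forall g h x, op (g * h)%g x = op g (op h x).
Hypothesis op_bl : forall g b, g \in H -> b \in bl -> op g @: b \in bl.
Hypothesis aH : act_on H a.

Lemma opK g x : op g^-1%g (op g x) = x. Proof. by rewrite -opM mulVg op1. Qed.
Lemma op_inj g : injective (op g). Proof. exact: can_inj (opK g). Qed.

Lemma op_supp g x : g \in H -> (op g x \in supp bl) = (x \in supp bl).
Proof.
have sub h y : h \in H -> y \in supp bl -> op h y \in supp bl.
  move=> hH /bigcupP[b bb yb]; apply/bigcupP; exists (op h @: b); first exact: op_bl.
  exact: imset_f.
move=> gH; apply/idP/idP; last exact: sub.
by move/(sub g^-1%g _ (groupVr gH)); rewrite opK.
Qed.

Lemma jact_on : act_on H (fun g => jact g : {linear A -> A}).
Proof.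
split=> [F|g h gH hH F]; apply: funext => s.
  by rewrite /= /jact invg1 aH.1 (eq_map (g := id) op1) map_id.
by rewrite /= /jact aH.2 // invMg -map_comp (eq_map (opM _ _)).
Qed.

Lemma jact_alternating g F : alternating F -> alternating (jact g F).
Proof. by move=> aF s t x y; rewrite /jact !map_cat /= aF linearN. Qed.

Lemma jact_graded g j F : graded j F -> graded j (jact g F).
Proof. by move=> gF s sj; rewrite /jact gF ?linear0 // size_map. Qed.

Lemma jact_valid g F : g \in H -> valid bl F -> valid bl (jact g F).
Proof.
move=> gH [aF oF kF]; have VH : g^-1%g \in H by rewrite groupV.
split; first exact: jact_alternating.
  apply: funext => s; rewrite /offX /restr; case: ifP => // nX.
  rewrite /jact (offX_out oF) ?linear0 //; apply: contra nX; rewrite all_map.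
  by apply: sub_all => x; rewrite /= op_supp.
move=> b bb; apply: funext => s; rewrite /keep /restr; case: ifP => // sb.
rewrite /jact; have := congr1 (fun f => f (map (op g^-1%g) s)) (kF _ (op_bl VH bb)).
rewrite /keep /restr ifT => [->|]; first by rewrite linear0.
apply/subsetP => x /imsetP[y yb ->]; rewrite inE map_f //.
by have := subsetP sb y yb; rewrite inE.
Qed.

Lemma jact_Dfull g F : g \in H -> Dfull bl (jact g F) = jact g (Dfull bl F).
Proof.
move=> gH; rewrite !(Dfull_ann bu bd); apply: funext => s.
rewrite /jact !fct_sumE raddf_sum (reindex_inj (@op_inj g)) /=.
rewrite (eq_bigl (fun x => x \in supp bl)) => [|x]; last by rewrite op_supp.
by apply: eq_bigr => x _; rewrite /ann /= opK.
Qed.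

Lemma jact_jD g F : g \in H -> jD (jact g F) = jact g (jD F).
Proof.
move=> gH; apply: funext => -[|x s]; first by rewrite /jact /= linear0.
by rewrite /jD jact_Dfull.
Qed.

Lemma jact_jeps g F : g \in H -> jeps (jact g F) = a g (jeps F).
Proof. by move=> gH; rewrite /jeps jact_Dfull. Qed.

Lemma jD_Dfull j F : graded j.+2 F -> jD F = Dfull bl F.
Proof.
move=> gF; apply: funext => -[|x s] //; rewrite /jD.
by rewrite (Dfull_ann bu bd) fct_sumE big1 // => x _; rewrite /ann gF.
Qed.

Lemma graded_Dfull j F : graded j.+1 F -> graded j (Dfull bl F).
Proof.
move=> gF; rewrite /Dfull; elim/big_rec: _ => [|b G _ gG]; first exact: graded0.
by apply: gradedD gG; apply: graded_dl.
Qed.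

Lemma graded_Hl j l F : graded j F -> graded j.+1 (Hl pt l F).
Proof.
elim: l => [|b l IH] gF /=; first exact: graded0.
apply: gradedD; first by apply: graded_restr; apply: graded_cre.
by apply: graded_dl; apply: graded_restr; apply: graded_cre; apply: IH.
Qed.

Lemma graded_dls j l F : graded (j + size l)%N F -> graded j (dls l F).
Proof.
elim: l j => [|b l IH] j; first by rewrite addn0.
by rewrite addnS -addSn => gF; apply: graded_dl; apply: IH.
Qed.

Lemma jiota_K m : jK L (iotaX bl m).
Proof.
split; first exact: (valid_iota two_neq0 bd).
rewrite /iotaX /fund -(dls_form (vol k bl)); apply: graded_dls.
rewrite subnK; last by rewrite ltnW // (dimX_bound bu bd bp (bs_big bs) (bs_nil bs)).
by move=> s; rewrite cardE => ss; rewrite /vol graded_wedge ?scale0r.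
Qed.

Lemma jL_gt0 : (0 < L)%N.
Proof. by rewrite subn_gt0 (dimX_bound bu bd bp (bs_big bs) (bs_nil bs)). Qed.

Lemma jKB j F G : jK j F -> jK j G -> jK j (F - G).
Proof. by move=> [vF gF] [vG gG]; split; [apply: validB | apply: gradedB]. Qed.

Lemma jK_Dfull j F : jK j.+1 F -> jK j (Dfull bl F).
Proof.
by move=> [vF gF]; split; [apply: (valid_Dfull two_neq0 bd) | apply: graded_Dfull].
Qed.

Variable (chi : gT -> k).
Variable (achi : gT -> {linear M -> M}).
Hypothesis achiE : forall g m, g \in H -> achi g m = chi g *: a g m.
Hypothesis fund_chi : forall g s, g \in H ->
  fund k bl (map (op g^-1%g) s) = chi g *: fund k bl s.

(** The group may reverse the orientation of the sphere. Hence the module at the upper end is [M]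
    twisted by the character [chi] through which [H] acts on the fundamental cycle. *)
Lemma join_graded_complex :
  graded_complex H a achi (fun g => jact g : {linear A -> A}) jD jeps
    (iotaX bl : {linear M -> A}) L jK.
Proof.
split.
- exact: jL_gt0.
- by move=> j; split; [apply: valid0 | apply: graded0].
- exact: jKB.
- by move=> j h F hH [vF gF]; split; [apply: jact_valid | apply: jact_graded].
- move=> F [vF gF]; apply: funext => -[|x s] //=.
  by rewrite /jD (Dfull_ann bu bd) fct_sumE big1 // => y _; rewrite /ann gF.
- by move=> j F KF /=; rewrite (jD_Dfull KF.2); apply: jK_Dfull.
- by move=> j F [vF gF]; rewrite /= /jeps (Dfull_ann bu bd) fct_sumE big1 // => y _;
    rewrite /ann gF.
- move=> [|[|j]] F KF /=.
  + rewrite [jD F](_ : _ = 0) ?linear0 //; apply: funext => -[|x s] //.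
    by rewrite /jD (Dfull_ann bu bd) fct_sumE big1 // => y _; rewrite /ann KF.2.
  + rewrite (jD_Dfull KF.2); have KD := jK_Dfull KF.
    apply: funext => -[|x s] //.
    by rewrite /jD (Dfull_ann bu bd) fct_sumE big1 // => y _; rewrite /ann KD.2.
  + rewrite (jD_Dfull KF.2) (jD_Dfull (jK_Dfull KF).2).
    by rewrite (Dfull_Dfull two_neq0 bu bd) //; case: KF => -[].
- move=> [|j] F KF /=.
    rewrite [jD F](_ : _ = 0) ?linear0 //; apply: funext => -[|x s] //.
    by rewrite /jD (Dfull_ann bu bd) fct_sumE big1 // => y _; rewrite /ann KF.2.
  rewrite (jD_Dfull KF.2) /jeps (Dfull_Dfull two_neq0 bu bd) //; by case: KF => -[].
- exact: jiota_K.
- move=> m; apply: funext => -[|x s] //=.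
  by rewrite /jD (Dfull_iota two_neq0).
- by move=> m /=; rewrite /jeps (Dfull_iota two_neq0).
- by move=> h F hH /=; rewrite jact_jD.
- by move=> h F hH /=; rewrite jact_jeps.
- move=> h m hH /=; rewrite achiE //; apply: funext => s.
  rewrite /iotaX /jact fund_chi // [in RHS]linearZ scalerA; congr (_ *: _).
  exact: mulrC.
Qed.

Lemma join_id F : valid bl F ->
  F = Dfull bl (Hl pt bl F) + Hl pt bl (Dfull bl F) + iotaX bl (tauX bl pt F).
Proof.
move=> vF; rewrite (Hl_id two_neq0 bu bd bp) //.
by case: vF => aF oF _; rewrite (Pl_iota two_neq0 bu bd bp) // subrK.
Qed.

Lemma graded_crs j l F : graded j F -> graded (j + size l)%N (crs pt l F).
Proof.
elim: l j => [|b l IH] j gF /=; first by rewrite addn0.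
by rewrite addnS; apply: graded_cre; apply: IH.
Qed.

Lemma tauX_graded j F : graded j F -> j != L -> tauX bl pt F = 0.
Proof.
move=> gF jL; rewrite /tauX (graded_crs (l := bl) gF) ?scaler0 //.
rewrite -cardE; apply: contra jL => /eqP e.
by rewrite /dimX e addnK.
Qed.

Lemma valid_one m : valid bl (one m : A).
Proof.
split; first exact: alternating_one.
  by apply: funext => -[|x s] //; rewrite /offX /restr; case: ifP.
move=> b bb; apply: funext => -[|x s]; rewrite /keep /restr //=; last by case: ifP.
rewrite ifF //; apply/negP => /subset_leq_card.
by rewrite leqNgt (leq_ltn_trans _ (bs_big bs bb)) // (eq_card0 (_ : _ =i pred0)) // => x;
  rewrite inE.
Qed.

Lemma graded_one m : graded 0 (one m : A). Proof. by case. Qed.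

Lemma Dfull_one m : Dfull bl (one m : A) = 0.
Proof.
rewrite (Dfull_ann bu bd) big1 // => x _; exact: funext.
Qed.

Lemma join_contraction :
  contraction jD jeps (iotaX bl : {linear M -> A}) L jK jh jeta
    (tauX bl pt : {linear A -> M}).
Proof.
have sbl : {subset bl <= bl} by [].
have jhK j F : jK j F -> jK j.+1 (jh F).
  by move=> [vF gF]; split; [exact: (valid_Hl two_neq0 bd bp sbl vF) | exact: graded_Hl].
have id1 j F : jK j.+1 F ->
    F = jD (jh F) + jh (jD F) + jeta (jeps F) + iotaX bl (tauX bl pt F).
  move=> KF; have [vF gF] := KF; rewrite {1}(join_id vF); congr (_ + _).
  rewrite (jD_Dfull (jhK _ _ KF).2) -addrA; congr (_ + _).
  rewrite /jeta /jh -linearD; congr Hl.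
  apply: funext => -[|x s]; rewrite !fE /= ?add0r ?addr0 //.
split=> //.
- by move=> j F KF; apply: jhK.
- move=> m; split; first exact: (valid_Hl two_neq0 bd bp sbl (valid_one m)).
  exact: (graded_Hl bl (graded_one m)).
- move=> [|j] F KF /=.
    rewrite [jD F](_ : _ = 0) ?linear0 //; apply: funext => -[|x s] //.
    by rewrite /jD (Dfull_ann bu bd) fct_sumE big1 // => y _; rewrite /ann KF.2.
  rewrite /= (jD_Dfull KF.2); set G := Dfull bl F.
  have KG : jK j.+1 G by apply: jK_Dfull.
  have aF : alternating F by case: KF => -[].
  have vH : valid bl (Hl pt bl F) by apply: (valid_Hl two_neq0 bd bp) => //; case: KF.
  have vH' : valid bl (Hl pt bl G) by apply: (valid_Hl two_neq0 bd bp) => //; case: KG.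
  have DG : Dfull bl G = 0 by apply: (Dfull_Dfull two_neq0 bu bd).
  (* The boundary [G] is written in two ways, by the homotopy formula at [G] and by the boundary of
     the formula at [F]; comparison kills its component along the fundamental cycle. *)
  have e1 : G = Dfull bl (Hl pt bl G) + iotaX bl (tauX bl pt G).
    by rewrite {1}(join_id KG.1) DG linear0 addr0.
  have e2 : G = Dfull bl (Hl pt bl G).
    rewrite {1}/G {1}(join_id KF.1) -/G !linearD /= (Dfull_iota two_neq0) addr0.
    by rewrite (Dfull_Dfull two_neq0 bu bd) ?add0r //; case: vH.
  have e3 : iotaX bl (tauX bl pt G) = 0.
    apply: (addrI (Dfull bl (Hl pt bl G))); rewrite addr0 -e1; exact: e2.
  by rewrite -[LHS](tau_iota two_neq0 bu bd bp) e3 linear0.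
- exact: (tau_iota two_neq0 bu bd bp).
- by move=> j F [_ gF] jL; apply: tauX_graded gF jL.
- move=> m; have v1 := valid_one m.
  rewrite /= /jeps /jeta; have := Hl_id two_neq0 bu bd bp sbl v1.
  rewrite Dfull_one linear0 addr0 => ->.
  case: v1 => a1 o1 _; rewrite (Pl_iota two_neq0 bu bd bp) //.
  rewrite (tauX_graded (graded_one m)) ?linear0; first by rewrite addr0.
  by rewrite eq_sym -lt0n jL_gt0.
- by move=> F [vF gF]; apply: (valid_top two_neq0 bu bd bp (bs_big bs) (bs_nil bs)).
Qed.

End JoinComplex.

Section HigmanGraded.
Variables (k : fieldType) (gT : finGroupType) (H : {group gT}).
Variables (M1 M2 N : lmodType k).
Variables (a1 : gT -> {linear M1 -> M1}) (a2 : gT -> {linear M2 -> M2}).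
Variable (b : gT -> {linear N -> N}).
Variables (D : {linear N -> N}) (eps : {linear N -> M1}) (iota : {linear M2 -> N}).
Variables (L : nat) (K : nat -> N -> Prop).
Hypothesis gc : graded_complex H a1 a2 b D eps iota L K.

Lemma gc_KD j x y : K j x -> K j y -> K j (x + y).
Proof.
move=> Kx Ky; rewrite -[y]opprK; apply: (gc_KB gc) => //.
by rewrite -[- y]add0r; apply: (gc_KB gc) => //; apply: (gc_K0 gc).
Qed.

Lemma higman_almost_acyclic (u : {linear N -> N}) : act_on H b ->
  (forall j x, K j x -> K j (u x)) ->
  (forall j x, (0 < j)%N -> K j x -> trop H b u x = x) ->
  almost_acyclic H b D eps K.
Proof.
move=> bH Ku tu j n f n1 j0 If Kf cf.
exists (higman_contr b H u f), (fun _ => 0); split.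
- by apply: higman_contr_inv; rewrite ?prednK // ltnW.
- move=> s ss; rewrite /higman_contr; elim/big_rec: _ => [|h x hH Kx].
    exact: (gc_K0 gc).
  apply: gc_KD Kx; apply: (gc_Kb gc) => //; apply: Ku; apply: (gc_Kb gc).
    by rewrite groupV.
  by apply: Kf; rewrite /= ss prednK // ltnW.
- move=> s ss; rewrite addr0 (cobd_higman_contr b H u ss cf) (tu j) //.
  exact: Kf.
- by move=> s _; rewrite !linear0.
Qed.

End HigmanGraded.

Section SetStabilizer.
Variables (gT : finGroupType) (Z : finType) (op : gT -> Z -> Z) (H : {group gT}).
Hypotheses (op1 : op 1%g =1 id)
  (opM : forall g h x, op (g * h)%g x = op g (op h x)).

Lemma imop1 (T : {set Z}) : op 1%g @: T = T.
Proof. by rewrite (eq_imset _ op1) imset_id. Qed.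

Lemma imopM g h (T : {set Z}) : op (g * h)%g @: T = op g @: (op h @: T).
Proof. by rewrite -imset_comp; apply: eq_imset => x; apply: opM. Qed.

Lemma imopK g (T : {set Z}) : op g^-1%g @: (op g @: T) = T.
Proof. by rewrite -imopM mulVg imop1. Qed.

Lemma imopKV g (T : {set Z}) : op g @: (op g^-1%g @: T) = T.
Proof. by rewrite -imopM mulgV imop1. Qed.

Definition stab (T : {set Z}) := [set g in H | op g @: T == T].

Lemma stab_group_set T : group_set (stab T).
Proof.
apply/group_setP; split=> [|g h]; first by rewrite inE group1 imop1 /=.
by rewrite !inE => /andP[gH /eqP eg] /andP[hH /eqP eh]; rewrite groupM //= imopM eh eg.
Qed.

Definition orb (T : {set Z}) := [set op g @: T | g in H].
(** The chosen set depends on the orbit alone, since [pick] receives the same predicate for all its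
    members. The default is never reached because the orbit contains [T]. *)
Definition orb_rep (T : {set Z}) := odflt T [pick T' in orb T].

Lemma orb_repP T : exists2 g, g \in H & orb_rep T = op g @: T.
Proof.
rewrite /orb_rep; case: pickP => [T' /imsetP[g gH ->]|_]; first by exists g.
by exists 1%g; rewrite ?group1 ?imop1.
Qed.

Lemma orb_rep_inv g (T : {set Z}) : g \in H -> orb_rep (op g @: T) = orb_rep T.
Proof.
move=> gH; rewrite /orb_rep.
have -> : orb (op g @: T) = orb T.
  apply/setP => T'; apply/imsetP/imsetP => -[h hH ->].
    by exists (h * g)%g; rewrite ?groupM // imopM.
  by exists (h * g^-1)%g; rewrite ?groupM ?groupV // -imopM mulgKV.
case: pickP => // /(_ T) /negP []; apply/imsetP; exists 1%g => //.
by rewrite imop1.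
Qed.

End SetStabilizer.

(** * Acyclicity of the chain modules of a join *)

Section JoinAcyclic.
Variables (k : fieldType) (gT : finGroupType) (Z : finType) (M : lmodType k).
Hypothesis two_neq0 : (2%:R : k) != 0.
Variables (bl : seq {set Z}) (pt : {set Z} -> Z).
Hypothesis bs : block_system bl pt.
Notation A := (seq Z -> M).
Variables (op : gT -> Z -> Z) (a : gT -> {linear M -> M}) (H : {group gT}).
Hypothesis op1 : op 1%g =1 id.
Hypothesis opM : forall g h x, op (g * h)%g x = op g (op h x).
Hypothesis op_bl : forall g b, g \in H -> b \in bl -> op g @: b \in bl.
Hypothesis aH : act_on H a.

Definition simplex (T : {set Z}) :=
  [&& T != set0, T \subset supp bl & all (fun b : {set Z} => ~~ (b \subset T)) bl].

Variable u : {set Z} -> {linear M -> M}.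
Hypothesis uP : forall T, simplex T -> forall m, trop (stab op H T) a (u T) m = m.

(** Chains on one orbit of simplices form a module induced from the stabilizer of the
    representative. Accordingly the operator is that of the stabilizer on the representative and
    zero on the rest of the orbit. *)
Definition ju (F : A) : A := fun s =>
  let T := [set x in s] in if T == orb_rep op H T then u T (F s) else 0.

Lemma ju_lin : linear ju.
Proof.
move=> c F G; apply: funext => s; rewrite /ju !fE; case: ifP => _.
  by rewrite linearP.
by rewrite scaler0 addr0.
Qed.
HB.instance Definition _ := GRing.isLinear.Build k A A *:%R ju ju_lin.

Lemma simplex_op g (T : {set Z}) : g \in H -> simplex T -> simplex (op g @: T).
Proof.
move=> gH /and3P[T0 TX /allP Tb]; apply/and3P; split.
- by rewrite imset_eq0.
- apply/subsetP => x /imsetP[y yT ->].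
  by rewrite (op_supp op1 opM op_bl) // (subsetP TX).
- apply/allP => b bb; apply/negP => sb.
  have /negP [] := Tb _ (op_bl (groupVr gH) bb).
  by rewrite -[T](imopK op1 opM g); apply: imsetS.
Qed.

Lemma jK_simplex j (F : A) (s : seq Z) : (0 < j)%N -> jK bl j F -> F s != 0 ->
  simplex [set x in s].
Proof.
move=> j0 [[aF oF kF] gF] Fs; apply/and3P; split.
- apply: contra Fs => /eqP s0; case: s s0 => [_|x s /setP /(_ x)].
    by rewrite gF // eq_sym -lt0n.
  by rewrite !inE eqxx.
- apply/subsetP => x; rewrite inE => xs.
  have [/allP sX|nX] := boolP (all (mem (supp bl)) s); first exact: sX.
  by rewrite (offX_out oF nX) eqxx in Fs.
- apply/allP => b bb; apply: contra Fs => sb.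
  have := congr1 (fun f => f s) (kF b bb); rewrite /keep /restr /sub_seq sb => ->.
  exact: eqxx.
Qed.

Lemma ju_jK j (F : A) : jK bl j F -> jK bl j (ju F).
Proof.
have sw s t x y : [set z in s ++ [:: x, y & t]] = [set z in s ++ [:: y, x & t]].
  by apply/setP=> z; rewrite !inE !mem_cat !inE (orbCA (z == x)).
move=> [[aF oF kF] gF]; split; last first.
  by move=> s sj; rewrite /ju gF // linear0 if_same.
split.
- by move=> s t x y; rewrite /ju sw aF linearN; case: ifP; rewrite ?oppr0.
- apply: funext => s; rewrite /offX /restr; case: ifP => // nX.
  by rewrite /ju (offX_out oF nX) linear0 if_same.
- move=> b bb; apply: funext => s; rewrite /keep /restr; case: ifP => // sb.
  have := congr1 (fun f => f s) (kF b bb); rewrite /keep /restr sb => Fs.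
  by rewrite /ju Fs linear0 if_same.
Qed.

(** At a given simplex only the group elements from one coset of the stabilizer contribute, namely
    those that carry the simplex to the representative. *)
Lemma trop_ju j (F : A) : (0 < j)%N -> jK bl j F ->
  trop H (fun g => jact op a g : {linear A -> A}) ju F = F.
Proof.
move=> j0 KF; apply: funext => s; rewrite /trop fct_sumE.
have mapK (g : gT) : map (op g) (map (op g^-1%g) s) = s.
  rewrite -map_comp (eq_map (g := id)) ?map_id // => x /=.
  by rewrite -opM mulgV op1.
have setm (f : Z -> Z) : [set x in map f s] = f @: [set x in s].
  apply/setP => x; rewrite inE; apply/mapP/imsetP => -[y ys ->]; exists y => //.
    by rewrite inE.
  by rewrite inE in ys.
set T := [set x in s] in setm *; set r := orb_rep op H T.
transitivity (\sum_(g in H) if op g^-1%g @: T == r then a g (u r (a g^-1%g (F s))) else 0).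
  apply: eq_bigr => g gH; rewrite /= /jact /ju setm invgK mapK.
  rewrite (orb_rep_inv op1 opM) ?groupV // -/r.
  by case: eqP => [->|_] //; rewrite linear0.
rewrite -big_mkcondr.
have [Fs|Fs] := eqVneq (F s) 0.
  by rewrite Fs big1 // => g _; rewrite !linear0.
have [g0 g0H er] := orb_repP H op1 T.
have sr : simplex r by rewrite /r er; apply: simplex_op => //; apply: jK_simplex KF Fs.
rewrite (reindex_inj (mulgI g0^-1%g)) /=.
rewrite (eq_bigl (fun h => h \in stab op H r)) => [|h]; last first.
  rewrite inE groupMl ?groupV // invMg invgK; case hH: (h \in H) => //=.
  rewrite (imopM opM) -er -/r; apply/eqP/eqP => [e|{1}<-].
    by rewrite -{1}e (imopKV op1 opM).
  by rewrite (imopK op1 opM).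
transitivity (a g0^-1%g (\sum_(h in stab op H r) a h (u r (a h^-1%g (a g0 (F s)))))).
  rewrite raddf_sum; apply: eq_bigr => h; rewrite inE => /andP[hH _].
  by rewrite invMg invgK !aH.2 // ?groupV.
by have := uP sr (a g0 (F s)); rewrite /trop => ->; rewrite (actK _ aH).
Qed.

End JoinAcyclic.

(** * The class of a join *)

Section CupPower.
Variables (k : fieldType) (gT : finGroupType).
Implicit Types (H : {group gT}).

Definition rsc (c : k) : k^o -> k^o := fun x => c *: x.
Lemma rsc_lin c : linear (rsc c).
Proof. by move=> d x y; rewrite /rsc scalerDr !scalerA mulrC. Qed.
HB.instance Definition _ c := GRing.isLinear.Build k k^o k^o *:%R (rsc c) (rsc_lin c).

Fixpoint cpow (L : nat) (e : seq gT -> k) (m : nat) : seq gT -> k :=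
  if m is m'.+1 then cup (m' * L)%N (cpow L e m' : seq gT -> k^o) e else fun _ => 1.

Lemma cupA (M : lmodType k) i j (z : seq gT -> M) (p : seq gT -> k) (e : seq gT -> k) s :
  (i + j < size s)%N ->
  cup i z (cup j (p : seq gT -> k^o) e) s = cup (i + j) (cup i z p) e s.
Proof.
move=> ss; rewrite /cup /splice /= drop_drop scalerA [(j + i)%N]addnC.
congr (_ * _ *: z _).
  rewrite -addnS -[in RHS](cat_take_drop i (take (i + j.+1) s)).
  rewrite take_takel ?leq_addr // drop_size_cat ?size_takel //; last first.
    by rewrite (leq_trans _ (ltnW ss)) ?leq_addr.
  by rewrite take_drop addnC.
by rewrite take_takel // ltnS leq_addr.
Qed.

(** A power whose exponent kills the character turns a semi-invariant class into an invariant
    one. *)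
Lemma cpow_shift H (chi : gT -> k) L e m :
  (forall g s, g \in H -> size s = L.+1 -> e (shift g s) = chi g * e s) ->
  forall g s, g \in H -> size s = (m * L).+1 ->
  cpow L e m (shift g s) = chi g ^+ m * cpow L e m s.
Proof.
move=> He g; elim: m => [|m IH] s gH ss; first by rewrite expr0 mul1r.
rewrite /= /cup /splice /shift -map_take -map_drop -!/(shift _ _).
rewrite He //; last by rewrite size_drop ss mulSn subSn ?leq_addl // addnK.
rewrite IH //; last by rewrite size_takel // ss ltnS mulSn leq_addl.
by rewrite exprS /GRing.scale /= !mulrA; congr (_ * _); rewrite mulrAC.
Qed.

Lemma cpow_cocy L e m : (0 < L)%N -> cocy L.+1 (e : seq gT -> k^o) ->
  cocy (m * L).+1 (cpow L e m : seq gT -> k^o).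
Proof.
move=> L0 ce; elim: m => [|m IH] s ss.
  by case: s ss => [|x [|y [|]]] //= _; rewrite !subr0 subrr.
rewrite [LHS](@cobd_cup _ _ _ (m * L) (cpow L e m : seq gT -> k^o) e); last first.
  by rewrite ss mulSn !ltnS leq_addl.
rewrite /cup /splice IH ?size_takel ?ss ?mulSn ?ltnS ?leq_addl //.
rewrite scaler0 add0r ce ?scale0r ?scaler0 //.
by rewrite size_drop ss mulSn -!addSn addnK.
Qed.

End CupPower.

Section JoinClass.
Variables (k : fieldType) (gT : finGroupType) (Z : finType).
Hypothesis two_neq0 : (2%:R : k) != 0.
Variables (bl : seq {set Z}) (pt : {set Z} -> Z).
Hypothesis bs : block_system bl pt.
Variables (op : gT -> Z -> Z) (H : {group gT}).
Hypothesis op1 : op 1%g =1 id.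
Hypothesis opM : forall g h x, op (g * h)%g x = op g (op h x).
Hypothesis op_bl : forall g b, g \in H -> b \in bl -> op g @: b \in bl.
Notation L := (dimX bl).
Let bd := bs_disj bs.
Let bp := bs_pt bs.
Let bu := bs_uniq bs.

Lemma triv_act (K : {set gT}) : act_on K (@triv k gT).
Proof. by []. Qed.

(** The orientation character: the coefficient of the translated fundamental cycle. The translate is
    a multiple of the cycle because it is a cycle of top degree. *)
Definition jchi (g : gT) : k := tauX bl pt (jact op (@triv k gT) g (fund k bl)).

Lemma fund_jchi g s : g \in H ->
  fund k bl (map (op g^-1%g) s) = jchi g *: fund k bl s.
Proof.
move=> gH; set F := jact op (@triv k gT) g (fund k bl).
have e1 : fund k bl = iotaX bl (1 : k^o).
  by apply: funext => t; rewrite /iotaX /GRing.scale /= mulr1.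
have KF : jK bl L F.
  have [v1 g1] := jiota_K two_neq0 bs (1 : k^o).
  rewrite /F e1; split; first exact: (jact_valid _ op1 opM op_bl).
  exact: jact_graded.
have DF : Dfull bl F = 0.
  by rewrite (jact_Dfull bs _ op1 opM op_bl) // e1 (Dfull_iota two_neq0) // linear0.
have := join_id two_neq0 bs KF.1; rewrite DF linear0 addr0.
rewrite (_ : Hl pt bl F = 0) ?linear0 ?add0r; last first.
  have sbl : {subset bl <= bl} by [].
  apply: (valid_top two_neq0 bu bd bp (bs_big bs) (bs_nil bs)).
    exact: (valid_Hl two_neq0 bd bp sbl KF.1).
  exact: (graded_Hl _ _ KF.2).
by move/(congr1 (fun f => f s)); rewrite /F /jact /iotaX /= => ->;
  rewrite /GRing.scale /= mulrC.
Qed.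

Lemma fund_neq0 : exists s, fund k bl s != 0.
Proof.
have [//|no] := EM (exists s, fund k bl s != 0).
have := tau_iota two_neq0 bu bd bp (1 : k^o).
rewrite (_ : iotaX bl (1 : k^o) = 0); last first.
  apply: funext => s; rewrite /iotaX; have [->|ns] := eqVneq (fund k bl s) 0.
    by rewrite scale0r.
  by case: no; exists s.
by rewrite linear0 => /esym /eqP; rewrite oner_eq0.
Qed.

Lemma jchiM g h : g \in H -> h \in H -> jchi (g * h)%g = jchi g * jchi h.
Proof.
move=> gH hH; have [s s0] := fund_neq0; apply: (mulIf s0).
rewrite -[LHS]/(jchi (g * h)%g *: fund k bl s) -fund_jchi ?groupM //.
rewrite invMg (_ : map _ s = map (op h^-1%g) (map (op g^-1%g) s)); last first.
  by rewrite -map_comp; apply: eq_map => x; apply: opM.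
by rewrite !fund_jchi // /GRing.scale /= mulrCA mulrA.
Qed.

Lemma jchi1 : jchi 1%g = 1.
Proof.
have [s s0] := fund_neq0; apply: (mulIf s0).
rewrite -[LHS]/(jchi 1%g *: fund k bl s) -fund_jchi ?group1 // invg1.
by rewrite (eq_map op1) map_id mul1r.
Qed.

Lemma jchiX g n : g \in H -> jchi (g ^+ n)%g = jchi g ^+ n.
Proof.
move=> gH; elim: n => [|n IH]; first by rewrite jchi1.
by rewrite expgS jchiM ?groupX // IH exprS.
Qed.

Lemma jchi_expn g n : g \in H -> (#|H| %| n)%N -> jchi g ^+ n = 1.
Proof.
move=> gH /dvdnP[m ->]; rewrite -jchiX // mulnC expgM.
by rewrite expg_cardG // expg1n jchi1.
Qed.

(** In characteristic [p] an element of [p]-power order in the multiplicative group is 1, by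
    additivity of Frobenius. Hence [p]-subgroups do not see the orientation character. *)
Lemma jchi_pgroup p (P : {group gT}) g : p \in [pchar k] -> P \subset H ->
  (p.-group P)%g -> g \in P -> jchi g = 1.
Proof.
move=> pk sPH pP gP; have gH := subsetP sPH g gP.
have e1 : jchi g ^+ #|P| = 1 by rewrite -jchiX // expg_cardG // jchi1.
have pn : [pchar k].-nat #|P|.
  by apply: sub_in_pnat pP => q _ /eqP ->.
have := exprDn_pchar (jchi g - 1) 1 pn; rewrite subrK e1 expr1n.
move/eqP; rewrite -subr_eq subrr eq_sym expf_eq0 => /andP[_].
by rewrite subr_eq0 => /eqP.
Qed.

Let A := (seq Z -> k^o).
Let gck (P : {group gT}) : P \subset H ->
  graded_complex P (@triv k gT) (fun g => rsc (jchi g) : {linear k^o -> k^o})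
    (fun g => jact op (@triv k gT) g : {linear A -> A}) (jD bl) (jeps bl)
    (iotaX bl : {linear k^o -> A}) L (jK bl).
Proof.
move=> sPH; apply: (@join_graded_complex _ _ _ _ two_neq0 _ _ bs _ _ _ op1 opM _ jchi) => //.
- by move=> g b gP; apply: op_bl; apply: (subsetP sPH).
- by move=> g s gP; apply: fund_jchi; apply: (subsetP sPH).
Qed.

Let actA (P : {group gT}) :
  act_on P (fun g => jact op (@triv k gT) g : {linear A -> A}).
Proof. exact: jact_on. Qed.

Let actchi (P : {group gT}) : P \subset H ->
  act_on P (fun g => rsc (jchi g) : {linear k^o -> k^o}).
Proof.
move=> sPH; split=> [x|g h gP hP x]; rewrite /= /rsc ?jchi1 ?scale1r //.
by rewrite jchiM ?(subsetP sPH) // scalerA.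
Qed.

(** The cochain [e] represents the image of the unit class under the iterated connecting
    homomorphism of the join complex, and [y] records the intermediate lifts. *)
Definition join_link (P : {group gT}) e y := link P
  (fun g => jact op (@triv k gT) g : {linear A -> A}) (jD bl) (jeps bl)
  (iotaX bl : {linear k^o -> A}) L (jK bl) 1 (fun _ => 1 : k^o) e y.

Lemma join_class_exists : exists e : seq gT -> k^o, exists y,
  [/\ forall g s, g \in H -> size s = L.+1 -> e (shift g s) = jchi g * e s,
      cocy L.+1 e & join_link H e y].
Proof.
have I1 : invc H (@triv k gT) 1 (fun _ => 1 : k^o) by [].
have c1 : cocy 1 (fun _ : seq gT => 1 : k^o).
  by move=> [|x [|y [|]]] //= _; rewrite subr0 subrr.
have [e [y [lk Ie ce]]] := link_exists (triv_act H) (actchi (subxx H)) (actA H)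
  (gck (subxx H)) (join_contraction _ two_neq0 bs) (ltnSn 0) I1 c1.
by exists e, y; split=> // g s gH ss; rewrite Ie.
Qed.

Lemma join_linkS (P : {group gT}) e y : P \subset H -> join_link H e y ->
  join_link P e y.
Proof.
move=> sPH [Iy Ky ey sy iy]; split=> // j jL g s gP; apply: Iy => //.
exact: (subsetP sPH).
Qed.

End JoinClass.

Section ScalarForms.
Variables (k : fieldType) (gT : finGroupType) (Z : finType) (M : lmodType k).
Notation A := (seq Z -> M).
Notation Ak := (seq Z -> k^o).

Definition scalr (G : Ak) (m : M) : A := fun t => G t *: m.
Lemma scalr_lin G : linear (scalr G).
Proof.
move=> c m n; apply: funext => t; rewrite /scalr !fE scalerDr !scalerA.
by rewrite mulrC.
Qed.
HB.instance Definition _ G := GRing.isLinear.Build k M A *:%R (scalr G) (scalr_lin G).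

Definition scall (m : M) (G : Ak) : A := scalr G m.
Lemma scall_lin m : linear (scall m).
Proof.
move=> c G F; apply: funext => t; rewrite /scall /scalr !fE scalerDl.
by rewrite -[(c *: G t) *: m]/((c * G t) *: m) scalerA.
Qed.
HB.instance Definition _ m := GRing.isLinear.Build k Ak A *:%R (scall m) (scall_lin m).

Variables (bl : seq {set Z}).

Lemma Dfull_scalr G m : Dfull bl (scalr G m) = scalr (Dfull bl G) m.
Proof.
rewrite /Dfull -[RHS]/(scall m (\sum_(b <- bl) dl b G)) raddf_sum.
by apply: eq_bigr => b _; apply: dl_form.
Qed.

Lemma jD_scalr G m : jD bl (scalr G m) = scalr (jD bl G) m.
Proof.
apply: funext => -[|x s]; rewrite /jD; first by rewrite /scalr scale0r.
by rewrite Dfull_scalr.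
Qed.

Lemma jeps_scalr G m : jeps bl (scalr G m) = (jeps bl G : k) *: m.
Proof. by rewrite /jeps Dfull_scalr. Qed.

Lemma jK_scalr j G m : jK bl j G -> jK bl j (scalr G m).
Proof.
move=> [[aG oG kG] gG]; split; last by move=> s sj; rewrite /scalr gG ?scale0r.
split; first exact: mul_form_alt.
  apply: funext => s; rewrite /offX /restr; case: ifP => // nX.
  by rewrite /scalr (offX_out oG nX) scale0r.
move=> b bb; apply: funext => s; rewrite /keep /restr; case: ifP => // sb.
have := congr1 (fun f => f s) (kG b bb); rewrite /keep /restr sb /scalr => ->.
exact: scale0r.
Qed.

Lemma jKZ j c (F : A) : jK bl j F -> jK bl j (c *: F).
Proof.
move=> [[aF oF kF] gF]; split; last by move=> s sj; rewrite fZ gF ?scaler0.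
split; first exact: alternatingZ.
  by rewrite linearZ /= oF scaler0.
by move=> b bb; rewrite linearZ /= kF ?scaler0.
Qed.

Lemma jact_scalr op (a : gT -> {linear M -> M}) g G m :
  jact op a g (scalr G m) = scalr (jact op (@triv k gT) g G) (a g m).
Proof. by apply: funext => s; rewrite /jact /scalr linearZ. Qed.

End ScalarForms.

Section JoinClassAction.
Variables (k : fieldType) (gT : finGroupType) (Z : finType).
Hypothesis two_neq0 : (2%:R : k) != 0.
Variables (bl : seq {set Z}) (pt : {set Z} -> Z).
Hypothesis bs : block_system bl pt.
Variables (op : gT -> Z -> Z) (H P : {group gT}).
Hypothesis op1 : op 1%g =1 id.
Hypothesis opM : forall g h x, op (g * h)%g x = op g (op h x).
Hypothesis op_bl : forall g b, g \in H -> b \in bl -> op g @: b \in bl.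
Notation L := (dimX bl).
Hypothesis sPH : P \subset H.
Variables (e : seq gT -> k^o) (y : nat -> seq gT -> seq Z -> k^o).
Hypothesis ley : join_link bl op P e y.

Let op_blP g b : g \in P -> b \in bl -> op g @: b \in bl.
Proof. by move=> gP; apply: op_bl; apply: (subsetP sPH). Qed.

Section Injectivity.
Variables (M : lmodType k) (a : gT -> {linear M -> M}).
Hypotheses (aP : act_on P a) (chiP : forall g, g \in P -> jchi k bl pt op g = 1).
Notation A := (seq Z -> M).

Let gcM : graded_complex P a a (fun g => jact op a g : {linear A -> A})
  (jD bl) (jeps bl) (iotaX bl : {linear M -> A}) L (jK bl).
Proof.
apply: (@join_graded_complex _ _ _ _ two_neq0 _ _ bs _ _ _ op1 opM _ (fun _ => 1)) => //.
- by move=> g m _; rewrite scale1r.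
- move=> g s gP; rewrite (fund_jchi two_neq0 bs op1 opM op_bl) ?(subsetP sPH) //.
  by rewrite chiP.
Qed.

(** Splicing [z] in front of the lifts of [e] lifts [z] through the complex with coefficients in
    [M]; each level costs the sign of the Leibniz rule, whence the total sign. *)
Lemma cup_link i (z : seq gT -> M) : (0 < i)%N -> invc P a i.+1 z -> cocy i.+1 z ->
  exists y', link P (fun g => jact op a g : {linear A -> A}) (jD bl) (jeps bl)
    (iotaX bl : {linear M -> A}) L (jK bl) i.+1 z
    (fun s => (-1) ^+ (i * L) *: cup i z e s) y'.
Proof.
move=> i0 Iz cz; have L0 := jL_gt0 bs; case: ley => Iy Ky ey sy iy.
pose f j u v := scalr (y j v) (z u).
exists (fun j s => (-1) ^+ (i * j) *: splice i (f j) s).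
have szd j (s : seq gT) : size s = (i.+1 + j)%N -> size (drop i s) = (1 + j)%N.
  by move=> ss; rewrite size_drop ss addSnnS addKn.
have szt j (s : seq gT) : size s = (i.+1 + j)%N -> size (take i.+1 s) = i.+1.
  by move=> ss; rewrite size_takel ?ss ?leq_addr.
have cf j s : size s = (i.+1 + j).+1 -> cobd (splice i (f j)) s =
    (-1) ^+ i *: scalr (cobd (y j) (drop i s)) (z (take i.+1 s)).
  move=> ss; rewrite cobd_splice ?ss ?ltnS ?leq_addr // {1}/splice /f.
  rewrite (cobd_lin (scalr (y j (drop i.+1 s)))) cz ?linear0 ?add0r; last first.
    by rewrite size_takel // ss ltnS leq_addr.
  by congr (_ *: _); rewrite /splice (cobd_lin (scall (z (take i.+1 s)))).
split.
- move=> j jL g s gP ss; rewrite [RHS]linearZ; congr (_ *: _).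
  rewrite /splice /f /shift -map_take -map_drop -!/(shift _ _) Iz //; last exact: (szt _ _ ss).
  by rewrite Iy //= ?jact_scalr //; exact: (szd _ _ ss).
- by move=> j jL s ss; apply: jKZ; apply: jK_scalr; exact: (Ky j jL _ (szd _ _ ss)).
- move=> s ss; rewrite muln0 expr0 scale1r /splice /f /= jeps_scalr ey ?scale1r.
    by rewrite take_oversize ?ss.
  by rewrite (szd 0%N) ?addn0.
- move=> j s jL ss; rewrite cobdZ cf // [RHS]linearZ.
  rewrite -[splice _ (f j.+1) _]/(scalr (y j.+1 (drop i s)) (z (take i.+1 s))) /= jD_scalr -sy //; last first.
    by rewrite (szd j.+1) ?addnS.
  by rewrite scalerA -exprD mulnS addnC.
- move=> s ss; rewrite cobdZ cf; last by rewrite -addnS prednK.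
  rewrite iy; last by rewrite (szd L).
  rewrite scalerA -exprD -mulnSr prednK //.
  rewrite linearZ; congr (_ *: _); apply: funext => t.
  by rewrite /scalr /iotaX /cup /splice [RHS]scalerA.
Qed.

(** Dimension shifting: the product with [e] is, up to sign, the connecting homomorphism of the
    complex with coefficients in [M], whose terms are acyclic when the Higman condition holds on the
    stabilizers of simplices. *)
Lemma join_class_inj i (z : seq gT -> M) :
  (forall T, simplex bl T -> exists u : {linear M -> M},
     forall m, trop (stab op P T) a u m = m) ->
  (0 < i)%N -> invc P a i.+1 z -> cocy i.+1 z ->
  cob P a (i + L).+1 (cup i z e) -> cob P a i.+1 z.
Proof.
move=> Hst i0 Iz cz [w Iw ew].
have [u uP] : exists u : {set Z} -> {linear M -> M}, forall T, simplex bl T ->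
    forall m, trop (stab op P T) a (u T) m = m.
  apply: (fin_all_exists (P := fun T (u : {linear M -> M}) => simplex bl T ->
    forall m, trop (stab op P T) a u m = m)) => T.
  have [sT|nT] := boolP (simplex bl T); last by exists idfun.
  by have [v vP] := Hst T sT; exists v.
have [y' lk] := cup_link i0 Iz cz.
apply: (link_inj gcM _ _ lk) => //.
  apply: (higman_almost_acyclic gcM (u := ju op P u)).
  - exact: jact_on.
  - by move=> j F; apply: ju_jK.
  - by move=> j F; apply: (trop_ju op1 opM op_blP aP uP).
exists (fun s => (-1) ^+ (i * L) *: w s).
  by move=> g s gP ss; rewrite linearZ /= -Iw.
by move=> s ss; rewrite cobdZ -ew.
Qed.

End Injectivity.

Section Vanishing.
Variable T0 : {set Z}.
Hypotheses (T0s : simplex bl T0) (T0P : forall g, g \in P -> op g @: T0 = T0).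
Notation A := (seq Z -> k^o).

Lemma wedge_out (xs t : seq Z) x : x \in t -> x \notin xs -> wedge (1 : k^o) xs t = 0.
Proof.
move=> /splitPr[t1 t2] nx.
apply: (@alternating_perm _ _ _ _ (x :: t1 ++ t2)); first exact: alternating_wedge.
  by rewrite perm_sym -cat1s perm_catCA.
by rewrite -[LHS]/(ann x (wedge (1 : k^o) xs) (t1 ++ t2)) ann_wedge.
Qed.

Lemma valid_wedge xs : {subset xs <= T0} -> valid bl (wedge (1 : k^o) xs).
Proof.
move=> sx; case/and3P: T0s => _ TX /allP Tb; split; first exact: alternating_wedge.
  by apply: offX_wedge => x /sx; apply: (subsetP TX).
move=> b bb; apply: funext => s; rewrite /keep /restr; case: ifP => // sb.
have [x xb nx] := subsetPn (Tb b bb).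
apply: (@wedge_out _ _ x); last by apply: contra nx => /sx.
by have := subsetP sb x xb; rewrite inE.
Qed.

Lemma jact_wedge g xs :
  jact op (@triv k gT) g (wedge (1 : k^o) xs) = wedge (1 : k^o) (map (op g) xs).
Proof.
elim: xs => [|x xs IH] /=; first by apply: funext => -[|y' s].
rewrite -IH; set F := wedge _ _; apply: funext => s; rewrite /jact /=.
elim: s F {IH} => [//|y' s IHs] F /=; rewrite /cre /=.
have -> : (op g^-1%g y' == x) = (y' == op g x).
  apply/eqP/eqP => [<-|->]; first by rewrite -opM mulgV op1.
  by rewrite -opM mulVg op1.
congr (_ - _); rewrite -[LHS]/(cre x (ann (op g^-1%g y') F) (map (op g^-1%g) s)).
by rewrite IHs.
Qed.

Lemma Dfull_wedge x xs : x \in supp bl ->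
  Dfull bl (wedge (1 : k^o) (x :: xs)) =
  wedge (1 : k^o) xs - cre x (Dfull bl (wedge (1 : k^o) xs)).
Proof.
move=> xX; rewrite !(Dfull_ann (bs_uniq bs) (bs_disj bs)) /= raddf_sum -sumrN.
under eq_bigr => y' _ do rewrite ann_cre.
rewrite big_split /=; congr (_ + _).
rewrite -big_mkcondr (big_pred1 x) // => y' /=; rewrite andbC.
by case: eqP => //= ->.
Qed.

(** The standard simplices map equivariantly into the chains on the invariant simplex [T0]. This
    lifts the unit class without ever meeting the fundamental cycle. Subtracting it from the given
    link leaves one that starts at 0, and [link_exact] applies. *)
Lemma join_class_vanish : cob P (fun g => rsc (jchi k bl pt op g) : {linear k^o -> k^o})
  L.+1 e.
Proof.
have L0 := jL_gt0 bs; case/and3P: T0s => T0n TX Tb.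
have [x0 x0T] := set0Pn _ T0n.
(* An equivariant vertex map from the whole ambient group to [T0]; the retraction onto [P] makes it
   equivariant. *)
pose v (g : gT) := op (retr P g) x0.
have vT g : v g \in T0 by rewrite -(T0P (retr_in P g)); apply: imset_f.
pose yB (s : seq gT) : A := wedge (1 : k^o) (map v s).
have sv s : {subset map v s <= T0} by move=> x /mapP[g _ ->].
have vy s : valid bl (yB s) by apply: valid_wedge.
have gy s : graded (size s) (yB s).
  by have := @graded_wedge k Z k^o 1 (map v s); rewrite size_map.
have Dy s : Dfull bl (yB s) = cobd yB s.
  elim: s => [|g s IH]; first by rewrite /yB /= (Dfull_one bs).
  rewrite /yB [map _ _]/= Dfull_wedge ?(subsetP TX) // -/(yB s) IH [RHS]/=.
  by congr (_ - _); rewrite -(cobd_lin (cre (v g))).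
have gck : graded_complex P (@triv k gT) (fun g => rsc (jchi k bl pt op g) : {linear k^o -> k^o})
    (fun g => jact op (@triv k gT) g : {linear A -> A}) (jD bl) (jeps bl)
    (iotaX bl : {linear k^o -> A}) L (jK bl).
  apply: (@join_graded_complex _ _ _ _ two_neq0 _ _ bs _ _ _ op1 opM _ (jchi k bl pt op)) => //.
  by move=> g s gP; apply: (fund_jchi two_neq0 bs op1 opM op_bl); apply: (subsetP sPH).
have Iy j : invc P (fun g => jact op (@triv k gT) g : {linear A -> A}) j yB.
  move=> g s gP _; rewrite /= jact_wedge /yB; congr (wedge _ _).
  rewrite -!map_comp; apply: eq_map => h /=; rewrite /v retrM //.
case: ley => Ie Ke ee se ie.
have lk : link P (fun g => jact op (@triv k gT) g : {linear A -> A}) (jD bl) (jeps bl)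
   (iotaX bl : {linear k^o -> A}) L (jK bl) 1 (fun _ => 0 : k^o) e
   (fun j s => y j s - yB s).
  have fold_gc := gc_KB gck.
  split.
  - by move=> j jL g s gP ss; rewrite linearB /= (Ie j) // (Iy (1 + j)%N).
  - move=> j jL s ss; apply: fold_gc; first exact: Ke.
    by split; [apply: vy | have := gy s; rewrite ss].
  - move=> s ss; rewrite linearB /= ee // /jeps Dy.
    by case: s ss => [|g [|]] //= _; rewrite subr0 subrr.
  - move=> j s jL ss; rewrite cobdB se // linearB /=; congr (_ - _).
    by rewrite -Dy (jD_Dfull bs (j := j)) //; have := gy s; rewrite ss.
  - move=> s ss; rewrite cobdB ie // -Dy [Dfull bl _](_ : _ = 0) ?subr0 //.
    rewrite [yB s](_ : _ = 0) ?linear0 //.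
    apply: (valid_top two_neq0 (bs_uniq bs) (bs_disj bs) (bs_pt bs) (bs_big bs) (bs_nil bs)) => //.
    by have := gy s; rewrite ss.
have actchi : act_on P (fun g => rsc (jchi k bl pt op g) : {linear k^o -> k^o}).
  split=> [x|g h gP hP x]; rewrite /= /rsc.
    by rewrite (jchi1 two_neq0 bs op1 opM op_bl) scale1r.
  by rewrite (jchiM two_neq0 bs op1 opM op_bl) ?(subsetP sPH) // scalerA.
by apply: (link_exact actchi (jact_on op1 opM (@triv_act _ _ P)) gck
  (join_contraction _ two_neq0 bs) (ltnSn 0) lk).
Qed.

End Vanishing.

End JoinClassAction.

Section CupPowers.
Variables (k : fieldType) (gT : finGroupType).
Implicit Types (H : {group gT}) (e : seq gT -> k^o).

Lemma eq_cob H (M : lmodType k) (a : gT -> {linear M -> M}) n f f' :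
  (forall s, size s = n -> f s = f' s) -> cob H a n f -> cob H a n f'.
Proof. by move=> ff' [w Iw ew]; exists w => // s ss; rewrite -ff' // ew. Qed.

Lemma cup_cocy (M : lmodType k) i m (z : seq gT -> M) (c : seq gT -> k^o) :
  cocy i.+1 z -> cocy m.+1 c -> cocy (i + m).+1 (cup i z c).
Proof.
move=> cz cc s ss; rewrite (@cup_cobdl _ _ _ i z c s m) //.
by rewrite /cup /splice cz ?scaler0 // size_takel // ss ltnS ltnS leq_addr.
Qed.

Lemma cpow_invc H L e m : invc H (@triv k gT) L.+1 e ->
  invc H (@triv k gT) (m * L).+1 (cpow L e m : seq gT -> k^o).
Proof.
move=> Ie; elim: m => [|m IH] //= g s gH ss.
by apply: (shift_cup (m := L) IH Ie gH); rewrite ss addnC.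
Qed.

(** The recursion peels off the last factor; peeling off the first one is what allows [cup_cob] to
    propagate a primitive of [e] to its powers. *)
Lemma cpowSl L e m s : size s = (m.+1 * L).+1 ->
  cpow L e m.+1 s = cup L e (cpow L e m) s.
Proof.
elim: m s => [|m IH] s ss.
  rewrite /= /cup /splice drop0 scale1r take_oversize ?ss ?mul1n //.
  by rewrite -[LHS]/(_ * _) mulr1.
rewrite -[LHS]/(cup (m.+1 * L) (cpow L e m.+1 : seq gT -> k^o) e s).
rewrite -[cpow L e m.+1 in RHS]/(cup (m * L) (cpow L e m : seq gT -> k^o) e).
rewrite [RHS]cupA; last by rewrite ss ltnS -mulSn leq_mul2r leqnSn orbT.
rewrite -mulSn {1}/cup {1}/splice [in RHS]/cup [in RHS]/splice IH //.
by rewrite size_takel // ss ltnS leq_mul2r ltnW ?orbT.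
Qed.

Lemma cup_cpow_inj H (M : lmodType k) (a : gT -> {linear M -> M}) L e m :
  (0 < L)%N -> invc H (@triv k gT) L.+1 e -> cocy L.+1 e ->
  (forall i z, (0 < i)%N -> invc H a i.+1 z -> cocy i.+1 z ->
    cob H a (i + L).+1 (cup i z e) -> cob H a i.+1 z) ->
  forall i z, (0 < i)%N -> invc H a i.+1 z -> cocy i.+1 z ->
    cob H a (i + m * L).+1 (cup i z (cpow L e m)) -> cob H a i.+1 z.
Proof.
move=> L0 Ie ce inj i z i0 Iz cz; elim: m => [|m IH] cb.
  rewrite addn0 in cb; apply: (eq_cob _ cb) => s ss.
  by rewrite /cup /splice take_oversize ?ss // scale1r.
apply: IH; apply: (inj (i + m * L)%N); first by rewrite addn_gt0 i0.
- by move=> g s gH ss; apply: (shift_cup Iz (cpow_invc (m := m) Ie)).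
- exact: (cup_cocy cz (cpow_cocy (m := m) L0 ce)).
rewrite -addnA -mulSnr; apply: (eq_cob _ cb) => s ss; rewrite /= cupA //.
by rewrite ss ltnS mulSnr addnA leq_addr.
Qed.

Lemma cpow_cob H L e m : (0 < L)%N -> (0 < m)%N -> invc H (@triv k gT) L.+1 e ->
  cocy L.+1 e -> cob H (@triv k gT) L.+1 e ->
  cob H (@triv k gT) (m * L).+1 (cpow L e m : seq gT -> k^o).
Proof.
case: m => // m L0 _ Ie ce cb.
have := cup_cob L0 (cpow_invc (m := m) Ie) (cpow_cocy (m := m) L0 ce) cb.
by rewrite -mulSn; apply: eq_cob => s ss; rewrite cpowSl.
Qed.

End CupPowers.

(** * Classes of the elementary abelian subgroups *)

(** Invariance under the normalizer allows a coherent choice along conjugates, [sc_inj] is the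
    property sought on [E], and [sc_vanish] ensures that the classes of other subgroups of the same
    order do not disturb it after restriction. *)
Record subgroup_class (k : fieldType) (gT : finGroupType) (p : nat) (G E : {set gT})
    d (e : seq gT -> k^o) : Prop := SubgroupClass {
  sc_inv : invc 'N_G(E)%g (@triv k gT) d.+1 e;
  sc_cocy : cocy d.+1 e;
  sc_inj : forall (M : lmodType k) (a : gT -> {linear M -> M}), act_on E a ->
    (forall S : {group gT}, S \proper E -> higman S a) ->
    forall i z, (0 < i)%N -> invc E a i.+1 z -> cocy i.+1 z ->
    cob E a (i + d).+1 (cup i z e) -> cob E a i.+1 z;
  sc_vanish : forall F : {group gT}, F \subset 'N_G(E)%g -> (p.-group F)%g ->
    ~~ (E \subset F) -> cob F (@triv k gT) d.+1 e }.

(* A multiple of [2 * L * #|'N_G(E)|] for every [E]: a join of cosets of [E] in ['N_G(E)] has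
   dimension [L <= #|G|], and a suitable power of its class is invariant under ['N_G(E)],
   which acts on the class itself through a linear character. *)
Definition class_deg (gT : finGroupType) (G : {set gT}) : nat := (#|G| * (#|G|)`!).*2.

Section SubgroupClass.
Variables (k : fieldType) (p : nat) (gT : finGroupType) (G E : {group gT}).
Hypotheses (pk : p \in [pchar k]) (two_neq0 : (2%:R : k) != 0).
Hypotheses (sEG : E \subset G) (pE : (p.-group E)%g) (E2 : (1 < #|E|)%N).
Local Notation N := 'N_G(E)%G.
Local Notation bl := (enum (lcosets E N)).
Local Notation pt := (@repr gT).
Local Notation op := (fun g x : gT => (g * x)%g).

Let sEN : E \subset N. Proof. by rewrite subsetI sEG normG. Qed.

Lemma coset_blocks : block_system bl pt.
Proof.
split.
- exact: enum_uniq.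
- move=> b b'; rewrite !mem_enum => /lcosetsP[x xN ->] /lcosetsP[y yN ->] ne.
  rewrite -setI_eq0; apply/set0Pn => -[t /setIP[tx ty]]; case/negP: ne.
  by rewrite -(lcoset_eqP tx) -(lcoset_eqP ty).
- move=> b; rewrite mem_enum => /lcosetsP[x xN ->]; apply: (mem_repr x).
  exact: lcoset_refl.
- by move=> b; rewrite mem_enum => /lcosetsP[x xN ->]; rewrite card_lcoset.
- apply/eqP => b0; have : (1%g *: E)%g \in bl by rewrite mem_enum; apply/lcosetsP; exists 1%g; rewrite ?group1.
  by rewrite b0.
Qed.

Lemma coset_supp : supp bl = N.
Proof.
apply/setP => x; apply/bigcupP/idP => [[b]|xN].
  rewrite mem_enum => /lcosetsP[y yN ->] /lcosetP[h hE ->].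
  by rewrite groupM // (subsetP sEN).
exists (x *: E)%g; last exact: lcoset_refl.
by rewrite mem_enum; apply/lcosetsP; exists x.
Qed.

Lemma coset_op_bl g b : g \in N -> b \in bl -> op g @: b \in bl.
Proof.
rewrite !mem_enum => gN /lcosetsP[y yN ->].
apply/lcosetsP; exists (g * y)%g; first exact: groupM.
by rewrite lcosetM -[RHS]lcosetE /lcoset.
Qed.

(** If [E] preserved [T], then [T] would contain the right coset of some [x] in [T]. As [x]
    normalizes [E] this is also a left coset, hence a block. Therefore the vertices are taken in the
    normalizer. *)
Lemma coset_simplex_stab (T : {set gT}) : simplex bl T -> stab op E T \proper E.
Proof.
case/and3P=> /set0Pn[x xT] TX /allP Tb; rewrite properE.
apply/andP; split; first by apply/subsetP => g; rewrite inE => /andP[].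
apply/negP => /subsetP sS.
have xN : x \in N by rewrite -coset_supp (subsetP TX).
have /Tb/negP[] : (x *: E)%g \in bl by rewrite mem_enum; apply/lcosetsP; exists x.
have nx : x \in 'N(E)%g by case/setIP: xN.
rewrite -(norm_rlcoset nx); apply/subsetP => y /rcosetP[h hE ->].
have := sS h hE; rewrite inE hE => /eqP <-; exact: imset_f.
Qed.

Lemma subgroup_class_exists :
  exists e : seq gT -> k^o, subgroup_class p G E (class_deg G) e.
Proof.
have bs := coset_blocks.
have op1 : op 1%g =1 id by move=> x; rewrite mul1g.
have opM g h x : op (g * h)%g x = op g (op h x) by rewrite mulgA.
have [e [y [se ce ley]]] := join_class_exists two_neq0 bs op1 opM coset_op_bl.
set L := dimX bl in se ce ley; have L0 : (0 < L)%N := jL_gt0 bs.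
have LG : (L <= #|G|)%N.
  rewrite /L /dimX coset_supp (leq_trans (leq_subr _ _)) // subset_leq_card //.
  exact: subsetIl.
have [m m0 [md Gm]] : exists2 m, (0 < m)%N & (m * L)%N = class_deg G /\ (#|N| %| m)%N.
  exists (#|G| * ((#|G|)`! %/ L)).*2%N.
    rewrite double_gt0 muln_gt0 cardG_gt0 divn_gt0 //.
    by rewrite dvdn_leq ?fact_gt0 // dvdn_fact // L0.
  rewrite /class_deg -!muln2 -mulnA [(2 * L)%N]mulnC mulnA -[(_ * _ * L)%N]mulnA divnK.
    by split=> //; rewrite -mulnA dvdn_mulr // cardSg // subsetIl.
  by rewrite dvdn_fact // L0.
have shm := cpow_shift (m := m) se.
have chiP (P : {group gT}) g : P \subset N -> (p.-group P)%g -> g \in P ->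
    jchi k bl pt op g = 1.
  exact: (jchi_pgroup two_neq0 bs op1 opM coset_op_bl pk).
have Ie (P : {group gT}) : P \subset N -> (p.-group P)%g -> invc P (@triv k gT) L.+1 e.
  by move=> sP pP g s gP ss; rewrite se ?(subsetP sP) // (chiP P) // mul1r.
exists (cpow L e m); rewrite -md; split.
- move=> g s gN ss; rewrite shm //.
  by rewrite (jchi_expn two_neq0 bs op1 opM coset_op_bl) // mul1r.
- exact: cpow_cocy.
- move=> M a aE hE i z i0 Iz cz.
  apply: (cup_cpow_inj L0 (Ie E sEN pE) ce _ i0 Iz cz) => {}i {i0 Iz cz}z i0 Iz cz.
  apply: (join_class_inj two_neq0 bs op1 opM coset_op_bl sEN (join_linkS sEN ley) aE) => //.
    by move=> g; apply: chiP.
  move=> T sT; have := coset_simplex_stab sT.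
  by rewrite -[stab _ _ _]/(gval (Group (stab_group_set E op1 opM T))) => /hE.
- move=> F sF pF nEF; apply: cpow_cob => //; first exact: (Ie F).
  (* The invariant simplex is [F] itself: it is stable under left multiplication by [F], and as a
     subgroup not containing [E] it contains no coset of [E]. *)
  have := join_class_vanish two_neq0 bs op1 opM coset_op_bl sF (join_linkS sF ley)
    (T0 := F).
  case.
  + apply/and3P; split; first by apply/set0Pn; exists 1%g.
      by rewrite coset_supp.
    apply/allP => b; rewrite mem_enum => /lcosetsP[x xN ->].
    apply: contra nEF => sxF; have xF : x \in F by rewrite (subsetP sxF) // lcoset_refl.
    apply/subsetP => h hE; rewrite -(groupMl _ xF) (subsetP sxF) //.
    by rewrite mem_lcoset mulgA mulVg mul1g.
  + move=> g gF; apply/setP => x; apply/imsetP/idP => [[h hF ->]|xF].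
      exact: groupM.
    by exists (g^-1 * x)%g; rewrite ?mulKVg // groupM ?groupV.
  move=> w Iw ew; exists w => // g s gF ss; rewrite Iw //= /rsc (chiP F) //.
  exact: scale1r.
Qed.

End SubgroupClass.

(** * Choices coherent under conjugation *)

Section CoherentChoice.
Variables (gT : finGroupType) (Z : finType) (V : nmodType) (op : gT -> Z -> Z) (H : {group gT}).
Hypothesis op1 : op 1%g =1 id.
Hypothesis opM : forall g h x, op (g * h)%g x = op g (op h x).
Variables (n : nat) (Om : pred {set Z}) (Pr : {set Z} -> (seq gT -> V) -> Prop).
Hypothesis Om_op : forall T g, g \in H -> Om T -> Om (op g @: T).
Hypothesis Pr_inv : forall T f g s, Pr T f -> g \in H -> op g @: T = T -> size s = n ->
  f (shift g s) = f s.
Hypothesis Pr_op : forall T f g, g \in H -> Pr T f ->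
  Pr (op g @: T) (fun s => f (shift g^-1 s)).
Hypothesis Pr_ex : forall T, Om T -> exists f, Pr T f.

(** A choice is made on one representative of each orbit and transported. The result does not depend
    on the transporting element because [Pr_inv] makes the choice invariant under the stabilizer. *)
Lemma coherent_choice : exists F : {set Z} -> seq gT -> V,
  (forall T, Om T -> Pr T (F T)) /\
  (forall T g s, Om T -> g \in H -> size s = n -> F (op g @: T) (shift g s) = F T s).
Proof.
have [e eP] : exists e : {set Z} -> seq gT -> V, forall T, Om T -> Pr T (e T).
  apply: (fin_all_exists (P := fun T f => Om T -> Pr T f)) => T.
  have [oT|nT] := boolP (Om T); last by exists (fun=> 0).
  by have [f Pf] := Pr_ex oT; exists f.
have [x xP] : exists x : {set Z} -> gT,
    forall T, x T \in H /\ op (x T) @: (orb_rep op H T) = T.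
  apply: (fin_all_exists (P := fun T x => x \in H /\ op x @: (orb_rep op H T) = T)) => T.
  have [g gH ->] := orb_repP H op1 T; exists g^-1%g.
  by rewrite groupV (imopK op1 opM).
have Or T : Om T -> Om (orb_rep op H T).
  by move=> oT; have [g gH ->] := orb_repP H op1 T; apply: Om_op.
exists (fun T s => e (orb_rep op H T) (shift (x T)^-1 s)); split.
  move=> T oT; have [xH eT] := xP T.
  by rewrite -{1}eT; apply: Pr_op => //; apply: eP; apply: Or.
move=> T g s oT gH ss; rewrite (orb_rep_inv op1 opM) //.
have [xH eT] := xP T; have [x'H eT'] := xP (op g @: T).
rewrite (orb_rep_inv op1 opM) // in eT'.
have -> : shift (x (op g @: T))^-1 (shift g s) =
    shift ((x (op g @: T))^-1 * g * x T)%g (shift (x T)^-1 s).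
  by rewrite -!shiftM mulgK.
apply: (Pr_inv (eP _ (Or _ oT))).
- by rewrite !groupM ?groupV.
- by rewrite !(imopM opM) eT -{2}eT' (imopK op1 opM).
- by rewrite /shift size_map.
Qed.

End CoherentChoice.

Section ElabClass.
Variables (k : fieldType) (p : nat) (gT : finGroupType) (G : {group gT}).
Hypotheses (pk : p \in [pchar k]) (two_neq0 : (2%:R : k) != 0).
Local Notation cj := (fun g x : gT => (x ^ g^-1)%g).
Local Notation d := (class_deg G).

Lemma cj1 : cj 1%g =1 id. Proof. by move=> x; rewrite invg1 conjg1. Qed.
Lemma cjM g h x : cj (g * h)%g x = cj g (cj h x).
Proof. by rewrite /= invMg conjgM. Qed.
Lemma imcj g (E : {set gT}) : cj g @: E = (E :^ g^-1)%g.
Proof. by []. Qed.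

(** Left translation of the vertices by the inverse of [g] intertwines the conjugate subgroup with
    [E], so each clause is transported along [shift]. *)
Lemma subgroup_class_conj (E : {group gT}) (e : seq gT -> k^o) g : g \in G ->
  subgroup_class p G E d e ->
  subgroup_class p G (E :^ g^-1)%g d (fun s => e (shift g^-1 s)).
Proof.
move=> gG [Ie ce inj van].
have szs h (s : seq gT) : size (shift h s) = size s by rewrite /shift size_map.
have norm_conj h : h \in 'N_G((E :^ g^-1)%g)%g -> (h ^ g)%g \in 'N_G(E)%g.
  case/setIP=> hG; rewrite normJ mem_conjgV => hN; rewrite inE hN groupJ //.
have shJ h (s : seq gT) : shift g^-1 (shift h s) = shift (h ^ g)%g (shift g^-1 s).
  by rewrite -!shiftM conjgE !mulgA mulgK.
split.
- move=> h s hN ss; rewrite shJ Ie ?szs //; exact: norm_conj.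
- move=> s ss; rewrite -[cobd _ s](cobd_map (mulg g^-1%g)) -/(shift g^-1%g s).
  by rewrite ce ?szs.
- move=> M a aE hE i z i0 Iz cz [w Iw ew].
  pose a' h := a (h ^ g^-1)%g; pose z' s := z (shift g s).
  have inE h : h \in E -> (h ^ g^-1)%g \in (E :^ g^-1)%g by rewrite memJ_conjg.
  have shJV h (s : seq gT) : shift g (shift h s) = shift (h ^ g^-1)%g (shift g s).
    by rewrite -!shiftM conjgE invgK !mulgA mulgKV.
  have shK (s : seq gT) : shift g (shift g^-1 s) = s.
    by rewrite -shiftM mulgV /shift (eq_map (g := id)) ?map_id // => y; rewrite mul1g.
  have a'E : act_on E a'.
    case: aE => a1 aM; split=> [m|h1 h2 h1E h2E m]; rewrite /a'.
      by rewrite conj1g a1.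
    by rewrite conjMg aM ?inE.
  have [//|//|||w' Iw' ew'] := inj M a' a'E _ i z' i0.
  + move=> S pS; have [|u uP] := hE (S :^ g^-1)%G.
      by rewrite properJ.
    exists u => m; rewrite -[RHS]uP /trop [RHS](reindex_inj (conjg_inj g^-1%g)) /=.
    by apply: eq_big => h; rewrite ?memJ_conjg // -conjVg.
  + by move=> h s hE' ss; rewrite /z' shJV Iz ?szs ?inE.
  + move=> s ss; rewrite -[cobd _ s](cobd_map (mulg g)) -/(shift g s).
    by rewrite cz ?szs.
  + exists (fun s => w (shift g s)).
      by move=> h s hE' ss; rewrite shJV Iw ?szs ?inE.
    move=> s ss; rewrite -[cobd _ s](cobd_map (mulg g)) -/(shift g s) -ew ?szs //.
    rewrite /cup /splice /z' /shift -!map_take -!map_drop; congr (e _ *: _).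
    rewrite -map_comp (eq_map (g := id)) ?map_id // => y /=.
    by rewrite mulKg.
  exists (fun s => w' (shift g^-1 s)).
    move=> h s hE' ss; rewrite shJ Iw' ?szs // -?mem_conjgV // /a' conjgK //.
  move=> s ss; rewrite -[cobd _ s](cobd_map (mulg g^-1%g)) -/(shift g^-1%g s).
  by rewrite -ew' ?szs // /z' shK.
- move=> F sF pF nEF; have [|||w Iw ew] := van (F :^ g)%G.
  + apply/subsetP => _ /imsetP[h hF ->]; apply: norm_conj; exact: (subsetP sF).
  + by rewrite pgroupJ.
  + by rewrite -sub_conjgV.
  exists (fun s => w (shift g^-1 s)).
    by move=> h s hF ss; rewrite shJ Iw ?szs // memJ_conjg.
  move=> s ss; rewrite -[cobd _ s](cobd_map (mulg g^-1%g)) -/(shift g^-1%g s).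
  by rewrite -ew ?szs.
Qed.

Definition elabs s (E : {set gT}) :=
  [&& group_set E, E \subset G, (p.-abelem E)%g & #|E| == (p ^ s)%N].

Lemma elabs_conj s E g : g \in G -> elabs s E -> elabs s (cj g @: E).
Proof.
move=> gG /and4P[gE sE aE cE]; rewrite imcj; apply/and4P; split.
- exact: (groupP ((Group gE) :^ g^-1)%G).
- by rewrite -(conjGid (groupVr gG)) conjSg.
- by rewrite -[E]/(gval (Group gE)) abelemJ.
- by rewrite cardJg.
Qed.

Lemma elabs_conjE s (E : {set gT}) g : g \in G -> elabs s (cj g @: E) = elabs s E.
Proof.
move=> gG; apply/idP/idP => [oE|]; last exact: elabs_conj.
by rewrite -(imopK cj1 cjM g E); apply: elabs_conj; rewrite ?groupV.
Qed.

Lemma elab_class_exists s : (0 < s)%N -> exists e : {set gT} -> seq gT -> k^o,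
  (forall E, elabs s E -> subgroup_class p G E d (e E)) /\
  (forall E g t, elabs s E -> g \in G -> size t = d.+1 ->
     e (cj g @: E) (shift g t) = e E t).
Proof.
move=> s0; have pp : prime p by case/andP: pk.
have [||||e [eP ce]] := coherent_choice cj1 cjM (n := d.+1) (Om := elabs s) (H := G) (V := k^o)
  (Pr := fun E f => elabs s E /\ subgroup_class p G E d f).
- by move=> E g; apply: elabs_conj.
- move=> E f g t [oE sc] gG gE tt; rewrite (sc_inv sc) // inE gG inE.
  have := imopK cj1 cjM g E; rewrite gE imcj invgK => ->; exact: subxx.
- move=> E f g gG [oE sc]; split; first exact: elabs_conj.
  case/and4P: oE => gE sE aE cE.
  exact: (@subgroup_class_conj (Group gE)).
- move=> E oE; case/and4P: (oE) => gE sE aE /eqP cE.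
  have [||f fP] := @subgroup_class_exists k p gT G (Group gE) pk two_neq0 sE.
  + exact: abelem_pgroup aE.
  + by rewrite /= cE -(exp1n s) ltn_exp2r ?prime_gt1.
  by exists f.
exists e; split=> // E oE; exact: (eP E oE).2.
Qed.

(** Summing over all elementary abelian subgroups of rank [s] makes the class invariant under [G].
    Over a fixed [E] the other summands add up to a coboundary, although each alone is one only over
    the smaller group ['N_E(F)]. *)
Lemma elab_class_sum s : (0 < s)%N -> exists zeta : seq gT -> k^o,
  [/\ invc G (@triv k gT) d.+1 zeta, cocy d.+1 zeta &
  forall E : {group gT}, elabs s E ->
  forall (M : lmodType k) (a : gT -> {linear M -> M}), act_on E a ->
    (forall S : {group gT}, S \proper E -> higman S a) ->
    forall i z, (0 < i)%N -> invc E a i.+1 z -> cocy i.+1 z ->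
    cob E a (i + d).+1 (cup i z zeta) -> cob E a i.+1 z].
Proof.
move=> s0; have [e [eP ce]] := elab_class_exists s0.
exists (fun t => \sum_(E : {set gT} | elabs s E) e E t); split.
- move=> g t gG tt; rewrite (reindex_inj (h := fun E : {set gT} => cj g @: E)) /=; last first.
    by move=> A B /= e1; rewrite -(imopK cj1 cjM g A) e1 (imopK cj1 cjM).
  apply: eq_big => [E|E]; rewrite elabs_conjE // => oE; exact: ce.
- by move=> t tt; rewrite cobd_sum big1 // => E oE; apply: (sc_cocy (eP E oE)).
move=> E oE M a aE hE i z i0 Iz cz cb.
apply: (sc_inj (eP E oE) aE hE i0 Iz cz).
have [gE sE abE /eqP cE] := and4P oE.
(* Since [F] and [E] have equal order, ['N_E(F)] cannot contain [F], so [sc_vanish] gives a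
   primitive there. Choosing the primitives compatibly with conjugation makes their sum [W]
   invariant under [E]. *)
have [w [wP cw]] : exists w : {set gT} -> seq gT -> k^o,
  (forall F, elabs s F && (F != E) ->
     invc 'N_E(F)%g (@triv k gT) d (w F) /\ forall t, size t = d.+1 -> e F t = cobd (w F) t)
  /\ (forall F g t, elabs s F && (F != E) -> g \in E -> size t = d ->
     w (cj g @: F) (shift g t) = w F t).
  have [||||w [wP cw]] := coherent_choice cj1 cjM (n := d) (Om := fun F => elabs s F && (F != E))
    (H := E) (V := k^o) (Pr := fun F f => elabs s F /\ (invc 'N_E(F)%g (@triv k gT) d f /\
      forall t, size t = d.+1 -> e F t = cobd f t)).
  + move=> F g gE' /andP[oF nF]; rewrite elabs_conj ?(subsetP sE) //=.
    apply: contra nF => /eqP eF; rewrite -(imopK cj1 cjM g F) eF imcj invgK.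
    by rewrite conjGid.
  + move=> F f g t [oF [If _]] gE' gF tt; rewrite If // inE gE' inE.
    have := imopK cj1 cjM g F; rewrite gF imcj invgK => ->; exact: subxx.
  + move=> F f g gE' [oF [If ef]]; have gG := subsetP sE g gE'.
    split; first exact: elabs_conj.
    split=> [h t hN tt|t tt].
      rewrite -shiftM (_ : g^-1 * h = h ^ g * g^-1)%g; last by rewrite conjgE !mulgA mulgK.
      rewrite shiftM If ?size_map //; case/setIP: hN => hE' hN.
      by rewrite inE groupJ //= -mem_conjgV -normJ -imcj.
    rewrite -[cobd _ t](cobd_map (mulg g^-1%g)) -/(shift g^-1%g t) -ef ?size_map //.
    by rewrite -[RHS](ce _ g) ?size_map // -shiftM mulgV shift1.
  + move=> F /andP[oF nF]; have [gF sF abF /eqP cF] := and4P oF.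
    have [||| w Iw ew] := sc_vanish (eP F oF) (F := 'N_E(F)%G).
    * by rewrite setSI.
    * by apply: pgroupS (subsetIl _ _) (abelem_pgroup abE).
    * apply: contra nF => sFN; rewrite eqEcard cF cE leqnn andbT.
      by rewrite (subset_trans sFN) // subsetIl.
    by exists w; split.
  exists w; split=> // F oF; exact: (wP F oF).2.
pose W : seq gT -> k^o := fun t => \sum_(F : {set gT} | elabs s F && (F != E)) w F t.
(* As [z] is a cocycle, its product with [W] accounts for every summand of the class other than that
   of [E]. *)
case: cb => v Iv ev; exists (fun t => v t - (-1) ^+ i *: cup i z W t).
  move=> g t gE' tt; suff sW : cup i z W (shift g t) = a g (cup i z W t).
    rewrite Iv // sW linearB /=; congr (_ - _).
    by rewrite [RHS]linearZ.
  have dd : (i + d = (i + d.-1).+1)%N by rewrite -addnS prednK // /class_deg double_gt0 muln_gt0 cardG_gt0 fact_gt0.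
  apply: (@shift_cup k gT M a E i d.-1 z W) => //; last by rewrite -dd.
  move=> h u hE' uu; rewrite prednK in uu; last first.
    by rewrite /class_deg double_gt0 muln_gt0 cardG_gt0 fact_gt0.
  rewrite /W /= (reindex_inj (h := fun F : {set gT} => cj h @: F)) /=; last first.
    by move=> A B /= e1; rewrite -(imopK cj1 cjM h A) e1 (imopK cj1 cjM).
  have Ec (F : {set gT}) : (cj h @: F == E) = (F == E).
    apply/eqP/eqP => [e1|->]; last by rewrite imcj conjGid ?groupV.
    by rewrite -(imopK cj1 cjM h F) e1 imcj invgK conjGid.
  apply: eq_big => [F|F]; rewrite elabs_conjE ?(subsetP sE) // Ec // => oF.
  exact: cw.
move=> t tt; rewrite cobdB cobdZ -ev // cobd_cup; last first.
  by rewrite tt ltnS -[X in (X < _)%N]addn0 ltn_add2l /class_deg double_gt0 muln_gt0 cardG_gt0 fact_gt0.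
rewrite scalerDr signrZK.
have -> : cup i.+1 (cobd z) W t = 0.
  rewrite /cup /splice cz ?scaler0 // size_takel // tt !ltnS -[X in (X < _)%N]addn0 ltn_add2l.
  by rewrite /class_deg double_gt0 muln_gt0 cardG_gt0 fact_gt0.
rewrite scaler0 add0r /cup /splice -scalerBl; congr (_ *: _).
rewrite [X in _ = X - _](bigD1 (E : {set gT})) //= /W cobd_sum.
rewrite [X in _ = _ + X - _](eq_bigr (fun F => cobd (w F) (drop i t))) ?addrK //.
by move=> F oF; apply: (wP F oF).2; rewrite size_drop tt -addnS addKn.
Qed.

End ElabClass.

(** * Modules annihilated by the square of a class *)

Section LinkOperations.
Variables (k : fieldType) (gT : finGroupType) (H : {group gT}).
Variables (M1 M2 N : lmodType k) (b : gT -> {linear N -> N}).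
Variables (D : {linear N -> N}) (eps : {linear N -> M1}) (iota : {linear M2 -> N}).
Variables (L : nat) (K : nat -> N -> Prop).
Hypothesis L0 : (0 < L)%N.
Hypothesis KZ : forall j (c : k) x, K j x -> K j (c *: x).
Hypothesis KB : forall j x y, K j x -> K j y -> K j (x - y).

Lemma link_subZ n z1 z1' y1 z2 z2' y2 (c : k) :
  link H b D eps iota L K n z1 z1' y1 -> link H b D eps iota L K n z2 z2' y2 ->
  link H b D eps iota L K n (fun s => z1 s - c *: z2 s) (fun s => z1' s - c *: z2' s)
    (fun j s => y1 j s - c *: y2 j s).
Proof.
move=> [I1 K1 e1 s1 i1] [I2 K2 e2 s2 i2]; split.
- by move=> j jL g s gH ss; rewrite linearB [in RHS]linearZ /= I1 // I2.
- by move=> j jL s ss; apply: KB; [apply: K1 | apply: KZ; apply: K2].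
- by move=> s ss; rewrite linearB linearZ /= e1 // e2.
- by move=> j s jL ss; rewrite cobdB cobdZ s1 // s2 // [RHS]linearB; congr (_ - _); rewrite [RHS]linearZ.
- by move=> s ss; rewrite cobdB cobdZ i1 // i2 // [RHS]linearB; congr (_ - _); rewrite [RHS]linearZ.
Qed.

Lemma link_cup n z z' y d (c : seq gT -> k^o) : (0 < n)%N ->
  invc H (@triv k gT) d.+1 c -> cocy d.+1 c ->
  link H b D eps iota L K n z z' y ->
  link H b D eps iota L K (n + d) (cup n.-1 z c) (cup (n + L).-1 z' c)
    (fun j => cup (n + j).-1 (y j) c).
Proof.
move=> n0 Ic cc [Iy Ky ey sy iy].
have nj j : (n + j = (n + j).-1.+1)%N by rewrite prednK // addn_gt0 n0.
have take_sz j (s : seq gT) : size s = (n + d + j)%N -> size (take (n + j).-1.+1 s) = (n + j)%N.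
  by move=> ss; rewrite -nj size_takel // ss addnAC leq_addr.
have cupd j s : size s = (n + d + j).+1 ->
    cobd (cup (n + j).-1 (y j) c) s = cup (n + j.+1).-1 (cobd (y j)) c s.
  move=> ss; have := @cup_cobdl k gT N (n + j).-1 (y j) c s d cc.
  by rewrite addnS -nj; apply; lia.
split.
- move=> j jL g s gH ss; have := @shift_cup k gT N b H (n + j).-1 d (y j) c.
  rewrite -nj => /(_ (Iy j jL) Ic g s gH) -> //.
  by rewrite ss addnAC {1}nj addSn.
- by move=> j jL s ss; rewrite /cup /splice; apply: KZ; apply: Ky => //; apply: take_sz.
- move=> s ss; rewrite /cup /splice linearZ /= addn0 ey //.
  by have := take_sz 0%N s; rewrite !addn0 => ->.
- move=> j s jL ss; rewrite cupd // /cup /splice [RHS]linearZ /= sy //.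
  by have := take_sz j.+1 s; rewrite !addnS /=; apply.
- move=> s ss; have L1 : L = L.-1.+1 by rewrite prednK.
  rewrite cupd; last by rewrite ss {1}L1 addnS.
  rewrite -L1 /cup /splice [RHS]linearZ /= iy //.
  exact: take_sz.
Qed.

End LinkOperations.

(** * The truncated standard coresolution *)

Section FunctionResolution.
Variables (k : fieldType) (gT : finGroupType) (E : {group gT}).
Variables (X : lmodType k) (a : gT -> {linear X -> X}).
Hypothesis aE : act_on E a.
Variable d : nat.
Hypothesis d2 : (1 < d)%N.
Local Notation N := (seq gT -> X).

Lemma cobd_ev (T : Type) (F : seq T -> N) s t : cobd F s t = cobd (fun u => F u t) s.
Proof. by elim: s F => [//|x s IH] F /=; rewrite fD fN IH. Qed.

Definition freg g : N -> N := jact (fun g x => (g * x)%g) a g.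
Lemma freg_lin g : linear (freg g). Proof. exact: jact_lin. Qed.
HB.instance Definition _ g := GRing.isLinear.Build k N N *:%R (freg g) (freg_lin g).
Local Notation b := (fun g => freg g : {linear N -> N}).

Lemma fregE g F s : freg g F s = a g (F (shift g^-1%g s)).
Proof. by []. Qed.

Lemma freg_on : act_on E b.
Proof.
apply: (jact_on _ _ aE); first by move=> x; rewrite mul1g.
by move=> g h x; rewrite mulgA.
Qed.

Lemma cobd_freg g F t : cobd (freg g F) t = a g (cobd F (shift g^-1%g t)).
Proof. by rewrite (cobd_lin (a g)) /shift cobd_map. Qed.

Lemma invc_freg n (f : seq gT -> N) :
  (forall g s t, g \in E -> size s = n -> f (shift g s) (shift g t) = a g (f s t)) ->
  invc E b n f.
Proof.
move=> If g s gE ss; apply: funext => t; rewrite /= fregE -If // -shiftM mulgV.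
by rewrite shift1.
Qed.

(* the standard coresolution of [X], whose term [rK j] consists of the functions on
   sequences of size [d - j] *)
Definition rK j (f : N) := forall s, ~~ ((0 < size s)%N && (size s + j == d)%N) -> f s = 0.
Definition rD (f : N) : N := fun s => if (1 < size s < d)%N then cobd f s else 0.
Definition reps (f : N) : N := fun s => if size s == d then cobd f s else 0.
Definition riota (x : X) : N := fun s => if size s == 1%N then x else 0.

Lemma rD_lin : linear rD.
Proof.
move=> c f g; apply: funext => s; rewrite /rD !fE; case: ifP => _.
  by rewrite [LHS](cobdD (fun t => c *: f t)) cobdZ.
by rewrite scaler0 addr0.
Qed.
HB.instance Definition _ := GRing.isLinear.Build k N N *:%R rD rD_lin.
Lemma reps_lin : linear reps.
Proof.
move=> c f g; apply: funext => s; rewrite /reps !fE; case: ifP => _.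
  by rewrite [LHS](cobdD (fun t => c *: f t)) cobdZ.
by rewrite scaler0 addr0.
Qed.
HB.instance Definition _ := GRing.isLinear.Build k N N *:%R reps reps_lin.
Lemma riota_lin : linear riota.
Proof.
move=> c f g; apply: funext => s; rewrite /riota !fE; case: ifP => _ //.
by rewrite scaler0 addr0.
Qed.
HB.instance Definition _ := GRing.isLinear.Build k X N *:%R riota riota_lin.

Lemma rKZ j c f : rK j f -> rK j (c *: f).
Proof. by move=> Kf s /Kf; rewrite !fE => ->; rewrite scaler0. Qed.

Lemma rKB j f g : rK j f -> rK j g -> rK j (f - g).
Proof. by move=> Kf Kg s ns; rewrite !fE Kf // Kg // subr0. Qed.

Lemma cobd_supp (f : N) n s : (forall t, size t = n -> f t = 0) -> size s = n.+1 ->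
  cobd f s = 0.
Proof.
move=> f0 ss; rewrite (@eq_cobd_size _ _ _ f (fun=> 0)) ?cobd0 // => t.
by rewrite ss => /f0.
Qed.

Lemma cobd_rD (f : N) s : f [::] = 0 -> (size s <= d)%N -> cobd (rD f) s = 0.
Proof.
move=> f0 ss; rewrite (@eq_cobd_size _ _ _ _ (cobd f)) ?cobd_cobd // => t st.
rewrite /rD; case: ifP => // /negbT; rewrite negb_and -!leqNgt => /orP[t1|].
  by case: t st t1 => [//|x [|//]] _ _ /=; rewrite f0 subr0.
by rewrite st => ds; case: s ss st ds => [|y s] /=; move: d2; lia.
Qed.

Lemma cobd_riota x s : cobd (riota x) s = 0.
Proof.
case: s => [|y [|y' [|y'' s]]] //; first by rewrite /= /riota /= subrr.
  by rewrite /= /riota /= subr0 subrr.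
apply: (@cobd_supp _ (size s).+2) => // t st.
by rewrite /riota st.
Qed.

Lemma function_resolution : graded_complex E b a b rD reps riota d.-1 rK.
Proof.
have dE : d = d.-1.+1 by rewrite prednK // ltnW.
have K0 j f : rK j f -> f [::] = 0 by move=> Kf; apply: Kf.
split.
- by rewrite -ltnS -dE.
- by move=> j s _.
- exact: rKB.
- by move=> j h f hE Kf s ns; rewrite /= fregE Kf ?linear0 // size_shift.
- move=> f Kf; apply: funext => s; rewrite /= /rD; case: ifP => // /andP[s1 sd].
  apply: (@cobd_supp _ (size s).-1); last by rewrite prednK // ltnW.
  by move=> t st; apply: Kf; lia.
- move=> j f Kf s ns; rewrite /= /rD; case: ifP => // /andP[s1 sd].
  apply: (@cobd_supp _ (size s).-1); last by rewrite prednK // ltnW.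
  by move=> t st; apply: Kf; lia.
- move=> j f Kf; apply: funext => s; rewrite /= /reps; case: ifP => // /eqP ss.
  apply: (@cobd_supp _ (size s).-1); last by rewrite prednK // ss ltnW.
  by move=> t st; apply: Kf; lia.
- move=> j f Kf; apply: funext => s; rewrite /= {1}/rD; case: ifP => // /andP[s1 sd].
  by rewrite cobd_rD ?(K0 _ _ Kf) // ltnW.
- move=> j f Kf; apply: funext => s; rewrite /= /reps; case: ifP => // /eqP ss.
  by rewrite cobd_rD ?(K0 _ _ Kf) // ss.
- move=> x s ns; rewrite /= /riota; case: eqP => // s1.
  by rewrite s1 add1n -dE eqxx in ns.
- by move=> x; apply: funext => s; rewrite /= /rD cobd_riota if_same.
- by move=> x; apply: funext => s; rewrite /= /reps cobd_riota if_same.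
- move=> h f hE; apply: funext => s; rewrite /= fregE /rD size_shift.
  by case: ifP; rewrite ?linear0 // cobd_freg.
- move=> h f hE; apply: funext => s; rewrite /= fregE /reps size_shift.
  by case: ifP; rewrite ?linear0 // cobd_freg.
- move=> h x hE; apply: funext => s; rewrite /= fregE /riota size_shift.
  by case: ifP; rewrite ?linear0.
Qed.

(** Functions on nonempty sequences form a coinduced module; [rU] restricts them to the fundamental
    domain where the first vertex retracts to 1. *)
Definition rU (F : N) : N := fun s => if retr E (head 1%g s) == 1%g then F s else 0.
Lemma rU_lin : linear rU.
Proof.
move=> c f g; apply: funext => s; rewrite /rU !fE; case: ifP => _ //.
by rewrite scaler0 addr0.
Qed.
HB.instance Definition _ := GRing.isLinear.Build k N N *:%R rU rU_lin.

Lemma trop_rU (F : N) : F [::] = 0 -> trop E b rU F = F.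
Proof.
move=> F0; apply: funext => -[|x s].
  rewrite /trop fct_sumE F0 big1 // => g gE.
  by rewrite /= fregE /= /rU fregE /= F0; case: ifP; rewrite ?linear0.
rewrite /trop fct_sumE (bigD1 (retr E x)) ?retr_in //= big1 ?addr0 => [|g /andP[gE gx]].
  have hd g : head 1%g (shift g (x :: s)) = (g * x)%g by [].
  rewrite fregE /rU hd retrM ?groupV ?retr_in // mulVg eqxx [freg _^-1 _ _]fregE.
  rewrite -shiftM invgK mulgV shift1.
  by rewrite -aE.2 ?groupV ?retr_in // mulgV aE.1.
rewrite fregE /rU -[head _ _]/(g^-1 * x)%g retrM ?groupV //; case: eqP => [e|]; last by rewrite linear0.
by case/eqP: gx; rewrite -[g]mulg1 -e mulKVg.
Qed.

Lemma function_resolution_acyclic : almost_acyclic E b rD reps rK.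
Proof.
apply: (higman_almost_acyclic function_resolution (u := rU)).
- exact: freg_on.
- by move=> j f Kf s ns; rewrite /= /rU Kf // if_same.
- by move=> j f j0 Kf; apply: trop_rU; apply: Kf.
Qed.

End FunctionResolution.

Section Interpolation.
Variables (k : fieldType) (gT : finGroupType) (E : {group gT}).
Variables (X : lmodType k) (a : gT -> {linear X -> X}).
Hypothesis aE : act_on E a.
Variable d : nat.
Hypothesis d2 : (1 < d)%N.
Local Notation N := (seq gT -> X).
Local Notation b := (fun g => freg a g : {linear N -> N}).
Local Notation rlink := (link E b (rD d : {linear N -> N}) (reps d : {linear N -> N})
  (@riota k gT X : {linear X -> N}) d.-1 (rK d)).

(** The vertices of [u] beyond number [q] are placed in front of [t]. This passes gradually between
    a cochain in [u] with values in functions of [t] and a cochain in [u] alone. *)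
Definition interp q (g : seq gT -> seq gT -> X) (u t : seq gT) : X :=
  splice q (fun s v => g s (v ++ t)) u.

(** If [g] is a cocycle in each variable, the coboundary over the transferred vertices and the one
    over [t] add up to zero with signs, so one coboundary can be traded for the other. *)
Lemma cobd_interp q g j u t : size u = (q + j).+2 -> (0 < size t)%N ->
  (forall s t', size s = q.+2 -> size t' = (j.+1 + size t)%N -> cobd (g^~ t') s = 0) ->
  (forall s t', size s = q.+1 -> size t' = (j.+2 + size t)%N -> cobd (g s) t' = 0) ->
  cobd (fun u' => interp q g u' t) u =
    (-1) ^+ (q + j).+1 *: cobd (fun t' => interp q g u t') t.
Proof.
move=> su t0 g0 g1; have qu : (q.+1 < size u)%N by lia.
rewrite -[LHS]/(cobd (splice q (fun s v => g s (v ++ t))) u) cobd_splice // {1}/splice g0 ?add0r; first last.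
- by rewrite size_cat size_drop su; lia.
- by rewrite size_takel.
have /eqP : cobd (g (take q.+1 u)) (drop q u ++ t) = 0.
  apply: g1; first by rewrite size_takel // ltnW.
  by rewrite size_cat size_drop su; lia.
rewrite cobd_cat // ?size_drop ?su; last by lia.
have -> : ((q + j).+2 - q = j.+2)%N by lia.
rewrite addr_eq0 {1}/splice => /eqP ->.
rewrite scalerN scalerA -scaleNr; congr (_ *: _).
by rewrite !exprS exprD; ring.
Qed.

Definition esign q j := (\sum_(i < j) (q + i).+1)%N.

Section InterpLink.
Variables (q j0 : nat) (g : seq gT -> seq gT -> X).
Hypothesis gI : forall h s t, h \in E -> size s = q.+1 ->
  size t = (d + j0)%N -> g (shift h s) (shift h t) = a h (g s t).
Hypothesis gs : forall s t, size s = q.+2 -> size t = (d + j0)%N -> cobd (g^~ t) s = 0.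
Hypothesis gt : forall s t, size s = q.+1 -> size t = (d + j0).+1 -> cobd (g s) t = 0.

Definition interp_link j u : N := fun t =>
  if (0 < size t)%N && (size t + j.+1 == d)%N
  then (-1) ^+ esign (q + j0) j *: interp q g u t else 0.

Lemma interp_shift h u t : h \in E -> (q < size u)%N ->
  (size u - q + size t = d + j0)%N ->
  interp q g (shift h u) (shift h t) = a h (interp q g u t).
Proof.
move=> hE qu st; rewrite /interp /splice /shift -map_take -map_drop -map_cat.
by rewrite -gI // ?size_takel // size_cat size_drop.
Qed.

(** An explicit lift through the coresolution: at level [j] the inner sequence has size [d - j.+1],
    each step moves one vertex from [t] to [u], and when [t] is exhausted only [splice q g u]
    remains. The sum [esign] collects the signs of [cobd_interp]. *)
Lemma interp_linkP z : (forall u t, size u = (q + j0).+1 -> 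
    z u t = if size t == d then cobd (interp q g u) t else 0) ->
  rlink (q + j0).+1 z (fun u => (-1) ^+ esign (q + j0) d.-1 *: splice q g u) interp_link.
Proof.
have cI j u t : size u = ((q + j0).+1 + j).+1 -> (0 < size t)%N -> (size t + j.+1 = d)%N ->
    cobd (fun u' => interp q g u' t) u =
    (-1) ^+ (q + j0 + j).+1 *: cobd (interp q g u) t.
  move=> su t0 td; have := @cobd_interp q g (j0 + j) u t; rewrite addnA; apply => //.
    by move=> s t' ss st; apply: gs => //; lia.
  by move=> s t' ss st; apply: gt => //; lia.
have eS j : esign (q + j0) j.+1 = (esign (q + j0) j + (q + j0 + j).+1)%N.
  by rewrite /esign big_ord_recr.
move=> hz; split.
- move=> j jd; apply: invc_freg => // h s t hE ss; rewrite /interp_link size_shift.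
  case: ifP => [/andP[t0 /eqP td]|_]; last by rewrite linear0.
  by rewrite [RHS]linearZ interp_shift // ss; lia.
- by move=> j jd s ss t nt; rewrite /interp_link (negbTE nt).
- move=> u su; apply: funext => t; rewrite hz //.
  rewrite /= /reps; case: eqP => // td; apply: eq_cobd_size => t' st'.
  rewrite /interp_link /esign big_ord0 scale1r ifT //; move: d2; lia.
- move=> j s jd ss; apply: funext => t; rewrite cobd_ev /= /rD /interp_link.
  have [/andP[t0 /eqP td]|nt] := boolP ((0 < size t)%N && (size t + j.+1 == d)%N).
    rewrite cobdZ (cI j) // ifT; last by lia.
    rewrite scalerA -exprD -eS -cobdZ; apply: eq_cobd_size => t' st'.
    by rewrite ifT //; lia.
  rewrite cobd0; case: ifP => // td.
  rewrite (@eq_cobd_size _ _ _ _ (fun=> 0)) ?cobd0 // => t' st'.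
  by rewrite ifF //; lia.
- move=> s ss; have [i ei] : exists i, d = i.+2 by exists d.-2; move: d2; lia.
  apply: funext => t; rewrite cobd_ev /= /riota /interp_link.
  have -> : d.-2 = i by lia.
  have [/andP[t0 /eqP td]|nt] := boolP ((0 < size t)%N && (size t + i.+1 == d)%N).
    rewrite cobdZ (cI i) //; last by lia.
    have t1 : size t = 1%N by lia.
    rewrite t1 eqxx scalerA -exprD -eS.
    have -> : i.+1 = d.-1 by lia.
    case: t t1 {t0 td} => [|x []] //= _; rewrite subr0 /interp.
    by congr (_ *: _); rewrite /splice cats0.
  by rewrite cobd0 ifF //; lia.
Qed.

End InterpLink.
End Interpolation.

Lemma cobd_swap (Y Z : Type) (k : fieldType) (M : lmodType k) (F : seq Y -> seq Z -> M) s t :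
  cobd (fun u => cobd (F^~ u) s) t = cobd (fun u => cobd (F u) t) s.
Proof.
elim: s F => [|x s IH] F /=; first exact: cobd0.
by rewrite (cobdB (F s)) IH.
Qed.

Lemma scale_swap (k : fieldType) (M : lmodType k) (c c1 c2 : k) (x y : M) :
  c1 *: (c *: x) + c2 *: (c *: y) = c *: (c1 *: x + c2 *: y).
Proof. by rewrite scalerDr !scalerA [c1 * c]mulrC [c2 * c]mulrC. Qed.

Section TwistedKilling.
Variables (k : fieldType) (gT : finGroupType) (E : {group gT}).
Variables (X : lmodType k) (a : gT -> {linear X -> X}).
Hypothesis aE : act_on E a.
Variable d : nat.
Hypothesis d2 : (1 < d)%N.
Variable zeta : seq gT -> k^o.
Hypotheses (Iz : invc E (@triv k gT) d.+1 zeta) (cz : cocy d.+1 zeta).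
Local Notation N := (seq gT -> X).
Local Notation b := (fun g => freg a g : {linear N -> N}).

(** The cone of the cocycle [zeta] with apex [x] is a primitive of [zeta], which gives one of
    [zeta t *: m] as well. *)
Definition coneX (x : gT) (m : X) : N :=
  fun t => if size t == d then zeta (x :: t) *: m else 0.

Lemma cobd_coneX x m t : size t = d.+1 -> cobd (coneX x m) t = zeta t *: m.
Proof.
move=> st; have -> : cobd (coneX x m) t = cobd (fun u => zeta (x :: u) *: m) t.
  by apply: eq_cobd_size => u; rewrite st /= => su; rewrite /coneX su eqxx.
rewrite cobd_scalar; congr (_ *: _).
have /eqP : cobd zeta (x :: t) = 0 by apply: cz; rewrite /= st.
by rewrite /= subr_eq0 => /eqP ->.
Qed.

Lemma coneX_shift h x m t : h \in E ->
  coneX (h * x)%g (a h m) (shift h t) = a h (coneX x m t).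
Proof.
move=> hE; rewrite /coneX size_shift; case: eqP => [st|_]; last by rewrite linear0.
by rewrite [RHS]linearZ -[_ :: shift h t]/(shift h (x :: t)) Iz //= st.
Qed.

Lemma last_shift h (u : seq gT) : (0 < size u)%N -> last 1%g (shift h u) = (h * last 1%g u)%g.
Proof. by case: u => //= x u _; rewrite /shift last_map. Qed.

Lemma invc_fregE n (f : seq gT -> N) g s t : invc E b n f -> g \in E -> size s = n ->
  f (shift g s) (shift g t) = a g (f s t).
Proof.
by move=> If gE ss; rewrite If //= fregE -shiftM mulVg shift1.
Qed.

(** The pair of [f] and [av] is a cocycle in the part of a twisted module formed by the top
    functions and the slot. The first product with [zeta] makes [av] a coboundary and reduces [f] to
    a cocycle [z1] of functions with zero coboundary. The second product kills [z1], by comparing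
    two lifts through the coresolution that end in the same cochain. *)
Lemma twisted_kill i (f : seq gT -> N) (av : seq gT -> X) : (0 < i)%N ->
  invc E b i.+1 f -> cocy i.+1 f -> invc E a i.+1 av -> cocy i.+1 av ->
  (forall s t, size s = i.+1 -> size t != d -> f s t = 0) ->
  (forall s t, size s = i.+1 -> size t = d.+1 -> cobd (f s) t = zeta t *: av s) ->
  exists F A, [/\ invc E b (i + d + d) F, invc E a (i + d + d) A,
    (forall u t, size u = (i + d + d)%N -> size t != d -> F u t = 0),
    (forall u t, size u = (i + d + d)%N -> size t = d.+1 -> cobd (F u) t = zeta t *: A u) &
    (forall u, size u = (i + d + d).+1 ->
      cup (i + d) (cup i f zeta) zeta u = cobd F u /\
      cup (i + d) (cup i av zeta) zeta u = cobd A u)].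
Proof.
move=> i0 If cf Ia ca sf rf.
pose b' u := (-1) ^+ i *: splice i f u.
have b'I : invc E a (i + d) b'.
  move=> h u hE su; rewrite /b' [RHS]linearZ /splice /shift -map_take -map_drop.
  by rewrite (invc_fregE _ If hE) // size_takel // su; lia.
have b'd u : size u = (i + d).+1 -> cobd b' u = cup i av zeta u.
  move=> su; rewrite cobdZ cobd_splice ?su; last by lia.
  rewrite {1}/splice -cobd_ev cf ?add0r; last by rewrite size_takel // su; lia.
  rewrite signrZK /splice rf //; first by rewrite size_takel // su; lia.
  by rewrite size_drop su; lia.
(* The last vertex of [u] serves as apex, which keeps the cone equivariant. *)
pose y u : N := coneX (last 1%g u) (b' u).
have yI : invc E b (i + d) y.
  apply: invc_freg => // h s t hE ss; rewrite /y b'I // last_shift ?coneX_shift //.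
  by rewrite ss; lia.
pose z1 u : N := cup i f zeta u - cobd y u.
have z1I : invc E b (i + d).+1 z1.
  move=> h s hE ss; rewrite /z1 (shift_cup If Iz hE ss) (invc_cobd yI hE ss).
  by rewrite linearB.
have z1c : cocy (i + d).+1 z1.
  move=> s ss; rewrite (cobdB (cup i f zeta)) cobd_cobd (cup_cocy cf cz) //.
  by rewrite subr0.
have z1s u t : size u = (i + d).+1 -> size t != d -> z1 u t = 0.
  move=> su nt; rewrite /z1 fD fN cobd_ev /cup /splice fZ sf ?scaler0 //; last first.
    by rewrite size_takel // su; lia.
  rewrite (@eq_cobd _ _ _ _ (fun=> 0)) ?cobd0 ?subr0 // => u'.
  by rewrite /y /coneX (negbTE nt).
have z1r u t : size u = (i + d).+1 -> size t = d.+1 -> cobd (z1 u) t = 0.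
  move=> su st; rewrite (cobdB (cup i f zeta u)).
  have -> : cobd (cobd y u) t = zeta t *: cup i av zeta u.
    transitivity (cobd (fun t' => cobd (fun u' => y u' t') u) t).
      by apply: eq_cobd => t'; apply: cobd_ev.
    rewrite cobd_swap -b'd //; transitivity (cobd (fun u' => zeta t *: b' u') u).
      by apply: eq_cobd_size => u' _; rewrite cobd_coneX.
    exact: cobdZ.
  rewrite /cup /splice [cobd _ t](_ : _ = zeta (drop i u) *: cobd (f (take i.+1 u)) t); last exact: cobdZ.
  rewrite rf //; last by rewrite size_takel // su; lia.
  by rewrite !scalerA mulrC subrr.
pose m := (i + d)%N; pose q := (m + d).-1.
have qE : (m + d = q.+1)%N by rewrite /q /m; lia.
pose w u := splice m z1 u.
have wI : invc E a q.+1 w.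
  move=> h u hE su; rewrite /w /splice /shift -map_take -map_drop.
  by rewrite (invc_fregE _ z1I hE) // size_takel // su /m; lia.
have wc : cocy q.+1 w.
  move=> u su; rewrite cobd_splice ?su; last by rewrite /m; lia.
  rewrite {1}/splice -cobd_ev z1c ?add0r; last by rewrite size_takel // su /m; lia.
  rewrite /splice z1r ?scaler0 //; first by rewrite size_takel // su /m; lia.
  by rewrite size_drop su /m; lia.
pose g s t := zeta t *: w s.
have L0 : (0 < d.-1)%N by move: d2; lia.
(* One link starts at the product of [z1] with [zeta], the other at the coboundary, up to sign, of
   the cones of [w]. Both end in [zeta] times [w] up to sign, so a signed difference ends in 0 and
   its start is the coboundary of a cochain in the image of [reps]. *)
have [v0 [eps [vI ve]]] : exists v0, exists eps : nat, invc E b q.+1 v0 /\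
    forall u, size u = q.+2 -> cup m z1 zeta u - (-1) ^+ eps *: cobd (fun u' => coneX (last 1%g u') (w u')) u =
      cobd (fun u' => reps d (v0 u')) u.
  have h1 u t : size u = (m + 0).+1 -> z1 u t = if size t == d then cobd (interp m z1 u) t else 0.
    move=> su; case: eqP => [st|/eqP nt]; last by rewrite z1s // su addn0.
    have [x ex] : exists x, drop m u = [:: x].
      have := size_drop m u; rewrite su addn0 subSnn.
      by case: (drop m u) => [|x []] //= _; exists x.
    have -> : cobd (interp m z1 u) t = cobd (fun t' => z1 u (x :: t')) t.
      apply: eq_cobd => t'; rewrite /interp /splice ex take_oversize ?su ?addn0 //.
    have /eqP : cobd (z1 u) (x :: t) = 0 by apply: z1r; rewrite ?su ?addn0 //= st.
    by rewrite /= subr_eq0 => /eqP.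
  have lk1 : link E b (rD d : {linear N -> N}) (reps d : {linear N -> N})
      (@riota k gT X : {linear X -> N}) d.-1 (rK d) m.+1 z1
      (fun u => (-1) ^+ esign m d.-1 *: splice m z1 u) (interp_link d m 0 z1).
    have gI h s t : h \in E -> size s = m.+1 -> size t = (d + 0)%N ->
        z1 (shift h s) (shift h t) = a h (z1 s t).
      by move=> hE ss _; rewrite (invc_fregE t z1I hE).
    have gs s t : size s = m.+2 -> size t = (d + 0)%N -> cobd (fun u => z1 u t) s = 0.
      by move=> ss st; rewrite -cobd_ev z1c.
    have gt s t : size s = m.+1 -> size t = (d + 0).+1 -> cobd (z1 s) t = 0.
      by move=> ss st; rewrite z1r // st addn0.
    by have := interp_linkP d2 gI gs gt h1; rewrite !addn0.
  have lk1c := link_cup L0 (@rKZ _ _ _ _) (ltn0Sn m) Iz cz lk1.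
  pose c u : N := fun t => if size t == d then cobd (interp q g u) t else 0.
  have lk2 : link E b (rD d : {linear N -> N}) (reps d : {linear N -> N})
      (@riota k gT X : {linear X -> N}) d.-1 (rK d) (q + 1).+1 c
      (fun u => (-1) ^+ esign (q + 1) d.-1 *: splice q g u) (interp_link d q 1 g).
    apply: (@interp_linkP k gT E X a d d2 q 1 g _ _ _ c) => //.
    - move=> h s t hE ss st; rewrite /g wI // [RHS]linearZ; congr (_ *: _).
      by rewrite Iz // st addn1.
    - move=> s t ss st; rewrite [LHS](_ : _ = zeta t *: cobd w s); last exact: cobdZ.
      by rewrite wc ?scaler0.
    - move=> s t ss st; rewrite /g cobd_scalar cz ?scale0r //.
      by rewrite st; lia.
  rewrite /= in lk1c.
  have nE : (m.+1 + d = (q + 1).+1)%N by rewrite /q; lia.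
  rewrite nE in lk1c.
  pose ep := (esign m d.-1 + esign (q + 1) d.-1)%N.
  have lk3 := link_subZ (@rKZ _ _ _ _) (@rKB _ _ _ _) ((-1) ^+ ep) lk1c lk2.
  have [||v0 vI ve] := link_inj_eps (function_resolution E a d2) _
    (function_resolution_acyclic aE d2) lk3.
  - by rewrite ltnS addn1.
  - exists (fun=> 0); first by move=> h s _ _; rewrite linear0.
    move=> s ss; rewrite cobd0 /ep exprD -scalerA signrZK /g /cup /splice.
    have -> : (m + d.-1)%N = q by rewrite /q; lia.
    rewrite scalerA mulrC -scalerA -/(splice m z1 _) -/(w _).
    by rewrite subrr.
  exists v0, (ep + q.+1)%N; split; first by move: vI; rewrite /= addn1.
  move=> u su; rewrite -ve; last by rewrite su addn1.
  congr (_ - _); rewrite exprD -scalerA; congr (_ *: _).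
  apply: funext => t; rewrite fZ cobd_ev /c; case: eqP => [st|/eqP nt]; last first.
    rewrite (@eq_cobd _ _ _ _ (fun=> 0)) ?cobd0 ?scaler0 // => u'.
    by rewrite /coneX (negbTE nt).
  (* On sequences of size [q.+1] the interpolation places only the last vertex in front of [t], and
     this is the cone with that vertex as apex. *)
  have -> : cobd (fun u' => coneX (last 1%g u') (w u') t) u =
      cobd (fun u' => interp q g u' t) u.
    apply: eq_cobd_size => u'; rewrite su /= => su'.
    rewrite /coneX st eqxx /interp /splice /g take_oversize ?su' //.
    have [x [s eu]] : exists x s, u' = rcons s x.
      by case/lastP: u' su' => // s x _; exists x, s.
    by rewrite eu last_rcons -cats1 drop_size_cat //; move: su'; rewrite eu size_rcons => -[].
  rewrite [X in _ *: X](_ : _ = (-1) ^+ q.+1 *: cobd (interp q g u) t) ?signrZK //.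
  have := @cobd_interp k gT X d d2 q g 0 u t; rewrite addn0; apply => //.
  - by rewrite st ltnW.
  - move=> s t' ss st'; rewrite [LHS](_ : _ = zeta t' *: cobd w s); last exact: cobdZ.
    by rewrite wc ?scaler0.
  - move=> s t' ss st'; rewrite /g cobd_scalar cz ?scale0r //.
    by rewrite st' st; lia.
exists (fun u => (-1) ^+ eps *: coneX (last 1%g u) (w u) + reps d (v0 u) + cup m.-1 y zeta u).
exists (fun u => (-1) ^+ eps *: w u + cup m.-1 b' zeta u).
have mE : m.-1.+1 = m by rewrite /m; lia.
have qE' : (i + d + d = q.+1)%N by rewrite -qE.
rewrite qE'; split.
- move=> h s hE ss; rewrite [RHS]linearD [X in _ = X + _]linearD [X in _ = X + _ + _]linearZ /=.
  have -> : coneX (last 1%g (shift h s)) (w (shift h s)) = freg a h (coneX (last 1%g s) (w s)).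
    apply: funext => t; rewrite fregE wI // last_shift ?ss //.
    by rewrite -[t in LHS](shift1 t) -(mulgV h) shiftM coneX_shift.
  have -> : reps d (v0 (shift h s)) = freg a h (reps d (v0 s)).
    by rewrite vI //=; apply: (gc_beps (function_resolution E a d2)).
  congr (_ + _); have := @shift_cup k gT _ b E m.-1 d y zeta.
  by rewrite mE; apply=> //; rewrite ss -addSn mE qE.
- move=> h s hE ss; rewrite [RHS]linearD [in RHS]linearZ /= wI //.
  congr (_ + _); have := @shift_cup k gT _ a E m.-1 d b' zeta.
  by rewrite mE; apply=> //; rewrite ss -addSn mE qE.
- move=> u t su nt; rewrite !fD fZ /coneX /reps /cup /splice (negbTE nt) scaler0 !add0r.
  by rewrite fZ /y /coneX (negbTE nt) scaler0.
- move=> u t su st.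
  rewrite (cobdD (fun t => ((-1) ^+ eps *: coneX (last 1%g u) (w u) + reps d (v0 u)) t)).
  rewrite (cobdD (fun t => ((-1) ^+ eps *: coneX (last 1%g u) (w u)) t)).
  rewrite (cobdZ _ (coneX (last 1%g u) (w u))) cobd_coneX //.
  have -> : cobd (reps d (v0 u)) t = 0.
    rewrite (@eq_cobd_size _ _ _ _ (cobd (v0 u))) ?cobd_cobd // => t'.
    by rewrite st /= => st'; rewrite /reps st' eqxx.
  rewrite addr0 /cup /splice (cobdZ _ (y (take m.-1.+1 u))) cobd_coneX //.
  exact: scale_swap.
- move=> u su; have cc (M : lmodType k) (z : seq gT -> M) : cobd (cup m.-1 z zeta) u = cup m (cobd z) zeta u.
    by have := @cup_cobdl k gT M m.-1 z zeta u d cz; rewrite mE su; apply; lia.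
  split.
    rewrite (cobdD (fun u => (-1) ^+ eps *: coneX (last 1%g u) (w u) + reps d (v0 u))).
    rewrite (cobdD (fun u => (-1) ^+ eps *: coneX (last 1%g u) (w u))) cobdZ -ve //.
    rewrite [X in X + _]addrC subrK cc /cup /splice -scalerDr /z1 subrK //.
  by rewrite (cobdD (fun u => (-1) ^+ eps *: w u)) cobdZ wc // scaler0 add0r cc
    /cup /splice b'd // size_takel ?su // /q; lia.
Qed.

End TwistedKilling.

(** * Coordinates on twisted functions *)

Section RowOperators.
Variables (k : fieldType) (X : lmodType k).

(** Tuples of vectors of [X] under scalar matrices are the tensor products of [X] with row spaces;
    no basis of [X] is involved, so [X] may have infinite dimension. *)
Definition rmx m n (v : 'I_m -> X) (A : 'M[k]_(m, n)) : 'I_n -> X :=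
  fun j => \sum_i A i j *: v i.

Lemma rmxM m n q (v : 'I_m -> X) (A : 'M[k]_(m, n)) (B : 'M_(n, q)) j :
  rmx (rmx v A) B j = rmx v (A *m B) j.
Proof.
rewrite /rmx; under eq_bigr => i _ do rewrite scaler_sumr.
rewrite exchange_big /=; apply: eq_bigr => i _; rewrite mxE scaler_suml.
by apply: eq_bigr => l _; rewrite scalerA mulrC.
Qed.

Lemma rmx1 m (v : 'I_m -> X) j : rmx v 1%:M j = v j.
Proof.
rewrite /rmx (bigD1 j) //= mxE eqxx scale1r big1 ?addr0 // => i ij.
by rewrite mxE (negbTE ij) scale0r.
Qed.

Lemma rmxD m n (v : 'I_m -> X) (A B : 'M[k]_(m, n)) j :
  rmx v (A + B) j = rmx v A j + rmx v B j.
Proof.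
by rewrite /rmx -big_split /=; apply: eq_bigr => i _; rewrite mxE scalerDl.
Qed.

Lemma eq_rmx m n (v w : 'I_m -> X) (A : 'M[k]_(m, n)) j : v =1 w -> rmx v A j = rmx w A j.
Proof. by move=> vw; apply: eq_bigr => i _; rewrite vw. Qed.

Lemma rmx0 m n (A : 'M[k]_(m, n)) j : rmx (fun=> 0) A j = 0.
Proof. by rewrite /rmx big1 // => i _; rewrite scaler0. Qed.

Lemma rmxP m n (c : k) (v w : 'I_m -> X) (A : 'M[k]_(m, n)) j :
  rmx (fun i => c *: v i + w i) A j = c *: rmx v A j + rmx w A j.
Proof.
rewrite /rmx scaler_sumr -big_split /=; apply: eq_bigr => i _.
by rewrite scalerDr !scalerA mulrC.
Qed.

End RowOperators.

Lemma rmx_lin (k : fieldType) (X Y : lmodType k) (phi : {linear X -> Y}) m n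
    (v : 'I_m -> X) (A : 'M[k]_(m, n)) j :
  phi (rmx v A j) = rmx (phi \o v) A j.
Proof. by rewrite /rmx linear_sum; apply: eq_bigr => i _; rewrite linearZ. Qed.

Section TwistedCoordinates.
Variables (k : fieldType) (gT : finGroupType) (d : nat) (zeta : seq gT -> k^o).

(* An element of the complex obtained by twisting the truncated standard coresolution of [X]
   by [zeta]: the values on the sequences of size 1, ..., [d] and one element [a] of [X]
   such that the coboundary in top degree is [a] times [zeta]; the slot [F [::]] stores [a]. *)
Definition twisted (X : lmodType k) (F : seq gT -> X) :=
  (forall s, (d < size s)%N -> F s = 0) /\
  (forall s, size s = d.+1 -> cobd F s = zeta s *: F [::]).

Local Notation I := (d.-bseq gT).
Local Notation V := #|{: I}|.
Local Notation W := #|{: d.+1.-tuple gT}|.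

Definition kdelta (j : 'I_V) : seq gT -> k^o := fun s => (s == enum_val j :> seq gT)%:R.
(** The twisting condition has coefficients in [k]. Its solutions with values in [X] are thus the
    tensor product of [X] with the kernel of this matrix, in coordinates that are natural in [X]. *)
Definition tw_mx : 'M[k]_(V, W) :=
  \matrix_(j, l) (cobd (kdelta j) (enum_val l : d.+1.-tuple gT)
                  - zeta (enum_val l : d.+1.-tuple gT) * kdelta j [::]).
Definition tw_basis := row_base (kermx tw_mx).
Definition tw_dim := \rank (kermx tw_mx).

Section Values.
Variable X : lmodType k.

Definition ext (v : 'I_V -> X) : seq gT -> X :=
  fun s => if (size s <= d)%N then v (enum_rank (insub_bseq d s)) else 0.
Definition vals (F : seq gT -> X) : 'I_V -> X := fun j => F (enum_val j : I).

Lemma insub_bseqK (s : seq gT) : (size s <= d)%N -> insub_bseq d s = s :> seq gT.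
Proof. by move=> sd; rewrite /insub_bseq insubdK. Qed.

Lemma ext_vals F s : (forall t, (d < size t)%N -> F t = 0) -> ext (vals F) s = F s.
Proof.
move=> F0; rewrite /ext /vals; case: leqP => [sd|/F0 //].
by rewrite enum_rankK insub_bseqK.
Qed.

Lemma vals_ext v : vals (ext v) =1 v.
Proof.
move=> j; rewrite /ext /vals size_bseq; congr v.
by apply: (canLR enum_valK); apply: val_inj; apply: insub_bseqK; apply: size_bseq.
Qed.

Lemma extE v s : ext v s = \sum_j kdelta j s *: v j.
Proof.
rewrite /ext; case: leqP => [sd|ds]; last first.
  rewrite big1 // => j _; rewrite /kdelta; case: eqP => [e|_]; last by rewrite scale0r.
  by move: ds; rewrite e ltnNge size_bseq.
rewrite (bigD1 (enum_rank (insub_bseq d s))) //= /kdelta enum_rankK insub_bseqK // eqxx.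
rewrite scale1r big1 ?addr0 // => j; case: (s =P _) => [e|_ _]; last by rewrite scale0r.
case/eqP; apply: (canRL enum_valK); apply: val_inj => /=.
by rewrite insub_bseqK.
Qed.

Lemma rmx_tw_mx v l : rmx v tw_mx l =
  cobd (ext v) (enum_val l : d.+1.-tuple gT) - zeta (enum_val l : d.+1.-tuple gT) *: ext v [::].
Proof.
set t := (X in cobd _ X); rewrite extE scaler_sumr.
have -> : cobd (ext v) t = \sum_j cobd (kdelta j) t *: v j.
  transitivity (cobd (fun s => \sum_j kdelta j s *: v j) t).
    by apply: eq_cobd => s; apply: extE.
  by rewrite cobd_sum; apply: eq_bigr => j _; apply: cobd_scalar.
rewrite -sumrB; apply: eq_bigr => j _; rewrite mxE scalerBl scalerA.
by [].
Qed.

Definition unf (F : 'I_tw_dim -> X) : seq gT -> X := ext (rmx F tw_basis).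
Definition fold (G : seq gT -> X) : {ffun 'I_tw_dim -> X} :=
  [ffun i => rmx (vals G) (pinvmx tw_basis) i].

Lemma twisted_unf F : twisted (unf F).
Proof.
split=> [s ds|s ss]; first by rewrite /unf /ext leqNgt ds.
have st : size s == d.+1 by apply/eqP.
have := rmx_tw_mx (rmx F tw_basis) (enum_rank (Tuple st)).
rewrite enum_rankK rmxM (_ : tw_basis *m tw_mx = 0); last first.
  by apply/sub_kermxP; rewrite eq_row_base.
rewrite /rmx big1 => [|i _]; last by rewrite mxE scale0r.
by move/esym/eqP; rewrite subr_eq0 => /eqP.
Qed.

Lemma unfK (F : {ffun 'I_tw_dim -> X}) : fold (unf F) = F.
Proof.
apply/ffunP => i; rewrite ffunE (eq_rmx _ _ (vals_ext _)) rmxM.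
by rewrite mulmxVp ?rmx1 // row_base_free.
Qed.

Lemma foldK G : twisted G -> unf (fold G) = G.
Proof.
move=> [G0 Gz]; apply: funext => s; rewrite /unf -[RHS](ext_vals s G0).
(* The projector built from the pseudo-inverse maps into the kernel and so factors through its
   basis; applied to values satisfying the condition it changes nothing. *)
have [D eD] : exists D, 1%:M - tw_mx *m pinvmx tw_mx = D *m tw_basis.
  apply/submxP; rewrite eq_row_base; apply/sub_kermxP.
  by rewrite mulmxBl mul1mx mulmxKpV ?subrr.
have vE j : vals G j = rmx (rmx (vals G) D) tw_basis j.
  rewrite rmxM -eD -[LHS]rmx1 -[in LHS](subrK (tw_mx *m pinvmx tw_mx) 1%:M) rmxD.
  suff -> : rmx (vals G) (tw_mx *m pinvmx tw_mx) j = 0 by rewrite addr0.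
  rewrite -rmxM -[RHS](rmx0 X (pinvmx tw_mx) j); apply: eq_rmx => l.
  rewrite rmx_tw_mx ext_vals //.
  have -> : cobd (ext (vals G)) (enum_val l : d.+1.-tuple gT) =
      cobd G (enum_val l : d.+1.-tuple gT).
    by apply: eq_cobd => t; apply: ext_vals.
  by rewrite Gz ?size_tuple // subrr.
rewrite /ext; case: ifP => // _; set j := enum_rank _.
rewrite [RHS]vE; apply: eq_rmx => i; rewrite ffunE (eq_rmx _ _ vE) rmxM.
by rewrite mulmxVp ?rmx1 // row_base_free.
Qed.

Lemma unf_linP c (F G : {ffun 'I_tw_dim -> X}) : unf (c *: F + G) = c *: unf F + unf G.
Proof.
apply: funext => s; rewrite !fE /unf /ext; case: ifP => _; last by rewrite scaler0 addr0.
by rewrite -rmxP; apply: eq_rmx => i; rewrite !ffunE.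
Qed.

Lemma fold_linP c G G' : fold (c *: G + G') = c *: fold G + fold G'.
Proof.
apply/ffunP => i; rewrite !ffunE -rmxP; apply: eq_rmx => j.
by rewrite /vals !fE.
Qed.

End Values.

Lemma unf_nat (X Y : lmodType k) (phi : {linear X -> Y}) (F : 'I_tw_dim -> X) s :
  unf (phi \o F) s = phi (unf F s).
Proof.
rewrite /unf /ext; case: ifP => _; last by rewrite linear0.
by rewrite rmx_lin.
Qed.

Lemma fold_nat (X Y : lmodType k) (phi : {linear X -> Y}) (G : seq gT -> X) i :
  fold (phi \o G) i = phi (fold G i).
Proof. by rewrite !ffunE rmx_lin. Qed.

End TwistedCoordinates.
Arguments unf {k gT} d zeta {X} F s.
Arguments fold {k gT} d zeta {X} G.

Section TwistedModules.
Variables (k : fieldType) (gT : finGroupType) (G : {group gT}).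

Section Tensor.
Variables (d : nat) (zeta : seq gT -> k^o).
Hypothesis (Iz : invc G (@triv k gT) d.+1 zeta).
Local Notation n := (tw_dim d zeta).
Variables (M : lmodType k).
Local Notation T := {ffun 'I_n -> M}.

Variable (a : gT -> {linear M -> M}).

Lemma twisted_freg g F : g \in G -> twisted d zeta F -> twisted d zeta (freg a g F).
Proof.
move=> gG [F0 Fz]; split=> [s ds|s ss].
  by rewrite fregE F0 ?linear0 // size_shift.
rewrite cobd_freg Fz ?size_shift // [LHS]linearZ; congr (_ *: _).
by rewrite (Iz (h := g^-1%g)) ?groupV.
Qed.

Definition tact g (F : T) : T := fold d zeta (freg a g (unf d zeta F)).
Lemma tact_lin g : linear (tact g).
Proof. by move=> c F F'; rewrite /tact unf_linP linearP fold_linP. Qed.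
HB.instance Definition _ g := GRing.isLinear.Build k T T *:%R (tact g) (tact_lin g).

Lemma unf_tact g F : g \in G -> unf d zeta (tact g F) = freg a g (unf d zeta F).
Proof. by move=> gG; apply/foldK/twisted_freg => //; apply: twisted_unf. Qed.

Lemma tact_on : act_on G a -> act_on G (fun g => tact g : {linear T -> T}).
Proof.
move=> aG; have [f1 fM] := freg_on aG; split=> [F|g h gG hG F] /=.
  by rewrite /tact [freg a _ _]f1 unfK.
by rewrite {1}/tact [freg a _ _]fM // {1}/tact unf_tact.
Qed.

End Tensor.
Arguments tact d zeta {M} a g F.

Section Representation.
Variables (d : nat) (zeta : seq gT -> k^o).
Hypothesis (Iz : invc G (@triv k gT) d.+1 zeta).

(** A module is equivariantly identified with the twisted functions in some module [X]. As a mere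
    existence statement this survives further tensor factors and cones, and so can be kept for every
    class at once. *)
Definition tw_repr (M : lmodType k) (aM : gT -> {linear M -> M}) :=
  exists (X : lmodType k) (a : gT -> {linear X -> X})
    (u : {linear M -> (seq gT -> X)}) (f : {linear (seq gT -> X) -> M}),
  act_on G a /\
  [/\ forall m, twisted d zeta (u m), forall m, f (u m) = m,
      forall H, twisted d zeta H -> u (f H) = H &
      forall g m, g \in G -> u (aM g m) = freg a g (u m)].

Lemma tw_repr_tens0 (X : lmodType k) (a : gT -> {linear X -> X}) : act_on G a ->
  tw_repr (fun g => tact d zeta a g : {linear {ffun 'I_(tw_dim d zeta) -> X} -> _}).
Proof.
move=> aG; exists X, a.
have lu : linear (fun F : {ffun 'I_(tw_dim d zeta) -> X} => unf d zeta F).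
  by move=> c F F'; rewrite unf_linP.
have lf : linear (fun G : seq gT -> X => fold d zeta G) by move=> c F F'; rewrite fold_linP.
exists (mklin lu), (mklin lf); split=> //; split=> [m|m|H|g m gG] /=.
- exact: twisted_unf.
- exact: unfK.
- exact: foldK.
- exact: unf_tact.
Qed.

(** The two twists concern different variables and commute: the new factor is absorbed into the
    coefficients [X]. *)
Lemma tw_repr_tens d' zeta' (M : lmodType k) (aM : gT -> {linear M -> M}) :
  tw_repr aM ->
  invc G (@triv k gT) d'.+1 zeta' -> 
  tw_repr (fun g => tact d' zeta' aM g : {linear {ffun 'I_(tw_dim d' zeta') -> M} -> _}).
Proof.
move=> [X [a [u [f [aG [tu fu uf ua]]]]]] Iz'.
set n := tw_dim d' zeta'.
exists {ffun 'I_n -> X}, (fun g => tact d' zeta' a g : {linear {ffun 'I_n -> X} -> _}).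
pose u' (F : {ffun 'I_n -> M}) : seq gT -> {ffun 'I_n -> X} := fun s => [ffun i => u (F i) s].
pose f' (H : seq gT -> {ffun 'I_n -> X}) : {ffun 'I_n -> M} := [ffun i => f (fun s => H s i)].
have lu : linear u'.
  move=> c F F'; apply: funext => s; apply/ffunP => i.
  by rewrite fD fZ !ffunE linearP fD fZ.
have lf : linear f'.
  move=> c H H'; apply/ffunP => i; rewrite !ffunE -linearP; congr (f _).
  by apply: funext => s; rewrite fD fZ !ffunE fD fZ.
have cobdff (H : seq gT -> {ffun 'I_n -> X}) s i : cobd H s i = cobd (fun t => H t i) s.
  by elim: s H => [|x s IH] H /=; rewrite ?ffunE // IH.
exists (mklin lu), (mklin lf); split; first exact: tact_on.
split=> [F|F|H [H0 Hz]|g F gG] /=.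
- split=> [s ds|s ss]; apply/ffunP => i.
    by rewrite !ffunE (tu _).1.
  rewrite cobdff (@eq_cobd _ _ _ _ (u (F i))) => [|t]; last by rewrite ffunE.
  by rewrite (tu _).2 // !ffunE.
- apply/ffunP => i; rewrite ffunE -[RHS]fu; congr (f _).
  by apply: funext => s; rewrite ffunE.
- apply: funext => s; apply/ffunP => i; rewrite !ffunE uf //; split=> [t dt|t st].
    by rewrite H0 ?ffunE.
  by rewrite -cobdff Hz // !ffunE.
- apply: funext => s; rewrite fregE.
  have lev t : linear (fun m => u m t) by move=> c m m'; rewrite linearP fD fZ.
  have ev (F' : {ffun 'I_n -> M}) t : u' F' t = [ffun i => (mklin (lev t)) (F' i)] by [].
  apply/ffunP => i; rewrite ev ffunE /tact -[in LHS](@fold_nat k gT d' zeta' M X (mklin (lev s))).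
  rewrite !ffunE; apply: eq_rmx => j; rewrite /vals /= fregE ua // fregE.
  rewrite fregE; congr (a g _).
  rewrite -[LHS](@unf_nat k gT d' zeta' M X (mklin (lev (shift g^-1%g s))) F).
  rewrite /unf /ext; case: ifP => // _; apply: eq_rmx => l.
  by rewrite /= ffunE.
Qed.

Lemma tw_repr_prod (M : lmodType k) (aM : gT -> {linear M -> M})
    (aMM : gT -> {linear (M * M)%type -> (M * M)%type}) :
  (forall g m, g \in G -> aMM g m = (aM g m.1, aM g m.2)) ->
  tw_repr aM -> tw_repr aMM.
Proof.
move=> eMM [X [a [u [f [aG [tu fu uf ua]]]]]].
have la g : linear (fun x : X * X => (a g x.1, a g x.2)).
  by move=> c x y; rewrite !linearP.
exists (X * X)%type, (fun g => mklin (la g)).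
have lu : linear (fun m : M * M => (fun s => (u m.1 s, u m.2 s)) : seq gT -> X * X).
  by move=> c m n; apply: funext => s; rewrite !linearP fD fZ /= !fD !fZ.
have lf : linear (fun H : seq gT -> X * X => (f (fun s => (H s).1), f (fun s => (H s).2))).
  move=> c H H'; transitivity (c *: f (fun s => (H s).1) + f (fun s => (H' s).1),
      c *: f (fun s => (H s).2) + f (fun s => (H' s).2)); last by [].
  by rewrite -!linearP; congr (f _, f _); apply: funext => s; rewrite fD fZ.
have cobdp (H : seq gT -> X * X) s :
    cobd H s = (cobd (fun t => (H t).1) s, cobd (fun t => (H t).2) s).
  elim: s H => [|x s IH] H //=; rewrite IH.
  by case: (H s).
exists (mklin lu), (mklin lf); split.
  by split=> [[x y]|g h gG hG [x y]] /=; rewrite ?aG.1 ?aG.2.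
split=> [[m n]|[m n]|H [H0 Hz]|g [m n] gG] /=.
- split=> [s ds|s ss]; first by rewrite !(tu _).1.
  by rewrite cobdp /= !(tu _).2.
- by rewrite !fu.
- rewrite !uf; first by apply: funext => s; case: (H s).
    split=> [s ds|s ss]; first by rewrite H0.
    by have := Hz s ss; rewrite cobdp => /(congr1 snd).
  split=> [s ds|s ss]; first by rewrite H0.
  by have := Hz s ss; rewrite cobdp => /(congr1 fst).
- rewrite eMM //= !ua //; apply: funext => s; rewrite fregE /=.
Qed.

Variables (M : lmodType k) (aM : gT -> {linear M -> M}).
Hypotheses (cz : cocy d.+1 zeta) (d2 : (1 < d)%N).

(* The square of [zeta] annihilates the cohomology of a twisted module. *)
Lemma tw_acyclic (E : {group gT}) : E \subset G -> act_on G aM -> tw_repr aM ->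
  (forall i z, (0 < i)%N -> invc E aM i.+1 z -> cocy i.+1 z ->
     cob E aM (i + d).+1 (cup i z zeta) -> cob E aM i.+1 z) ->
  acyclic E aM.
Proof.
move=> sEG aMG [X [a [u [f [aG [tu fu uf ua]]]]]] inj n z n1 Iz0 cz0.
have IzE : invc E (@triv k gT) d.+1 zeta by move=> g s gE; apply: Iz; apply: (subsetP sEG).
have aE : act_on E a := act_onS sEG aG.
pose i := n.-1; have ei : n = i.+1 by rewrite prednK // ltnW.
have i0 : (0 < i)%N by rewrite -ltnS -ei.
rewrite ei in Iz0 cz0 *.
apply: (inj i z i0 Iz0 cz0); apply: (inj (i + d)%N); first by rewrite addn_gt0 i0.
- by move=> g s gE ss; apply: (shift_cup Iz0 IzE).
- exact: cup_cocy cz0 cz.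
pose b := (fun g => freg a g : {linear (seq gT -> X) -> (seq gT -> X)}).
pose uz s := u (z s).
have uzI g s t : g \in E -> size s = i.+1 -> uz (shift g s) (shift g t) = a g (uz s t).
  move=> gE ss; rewrite /uz Iz0 // ua ?(subsetP sEG) // fregE -shiftM mulVg.
  by rewrite shift1.
have uzc s t : size s = i.+2 -> cobd (fun s' => uz s' t) s = 0.
  by move=> ss; rewrite -cobd_ev /uz (cobd_lin u) cz0 // linear0.
(* The twisting condition involves only the values of size [d] and the slot at [[::]]; the
   intermediate sizes are free and are separated off as [bot]. *)
pose top s : seq gT -> X := fun t => if size t == d then uz s t else 0.
pose bot s : seq gT -> X := fun t => if (0 < size t < d)%N then uz s t else 0.
have topI : invc E b i.+1 top.
  apply: invc_freg => // g s t gE ss; rewrite /top size_shift.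
  by case: ifP; rewrite ?linear0 // uzI.
have botI : invc E b i.+1 bot.
  apply: invc_freg => // g s t gE ss; rewrite /bot size_shift.
  by case: ifP; rewrite ?linear0 // uzI.
have topc : cocy i.+1 top.
  move=> s ss; apply: funext => t; rewrite cobd_ev /top.
  by case: (boolP (size t == d)) => _; [apply: uzc | apply: cobd0].
have botc : cocy i.+1 bot.
  move=> s ss; apply: funext => t; rewrite cobd_ev /bot.
  by case: (boolP (0 < size t < d)%N) => _; [apply: uzc | apply: cobd0].
(* Unconstrained functions on nonempty sequences form a coinduced module, so this part is a
   coboundary before any product with [zeta]. *)
have botb : cob E b i.+1 bot.
  exists (higman_contr b E (@rU k gT E X) bot).
    exact: (@higman_contr_inv k gT _ b E (@rU k gT E X : {linear (seq gT -> X) -> _}) i bot (freg_on aE) botI).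
  move=> s ss; rewrite (cobd_higman_contr b E (@rU k gT E X : {linear (seq gT -> X) -> _}) ss botc).
  by rewrite trop_rU.
have [F [A [FI AI F0 FA FE]]] : exists F A, [/\ invc E b (i + d + d) F, invc E a (i + d + d) A,
    (forall u t, size u = (i + d + d)%N -> size t != d -> F u t = 0),
    (forall u t, size u = (i + d + d)%N -> size t = d.+1 -> cobd (F u) t = zeta t *: A u) &
    (forall u, size u = (i + d + d).+1 ->
      cup (i + d) (cup i top zeta) zeta u = cobd F u /\
      cup (i + d) (cup i (fun s => uz s [::]) zeta) zeta u = cobd A u)].
  apply: (twisted_kill aE d2 IzE cz i0) => //.
  - by move=> g s gE ss; rewrite -[in LHS](erefl : shift g [::] = [::]) uzI.
  - by move=> s ss; apply: uzc.
  - by move=> s t ss st; rewrite /top (negbTE st).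
  - move=> s t ss st; rewrite (@eq_cobd_size _ _ _ _ (uz s)); first exact: (tu _).2.
    by move=> t' ; rewrite st /= => st'; rewrite /top st' eqxx.
have [w wI wE] : cob E b (i + d + d).+1 (cup (i + d) (cup i bot zeta) zeta).
  apply: cup_cob => //; first by rewrite addn_gt0 i0.
  exact: cup_cob.
(* The primitives for the slot, for the intermediate sizes and for size [d] are glued; the relation
   between [F] and [A] says that the result is twisted. *)
pose Wf s : seq gT -> X := fun t => if size t == 0%N then A s else
  if (size t < d)%N then w s t else F s t.
have WfT s : size s = (i + d + d)%N -> twisted d zeta (Wf s).
  move=> ss; split=> t st; rewrite /Wf.
    by rewrite ifF ?ifF ?F0 // ?gtn_eqF //; lia.
  rewrite (@eq_cobd_size _ _ _ _ (F s)) ?FA //.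
  by move=> t'; rewrite st /= => st'; rewrite st' ltnn ifF //; move: d2; lia.
exists (fun s => f (Wf s)).
  move=> g s gE ss /=; rewrite -[RHS]fu; congr (f _).
  rewrite ua ?(subsetP sEG) // uf; last exact: WfT.
  apply: funext => t; rewrite fregE /Wf !size_shift.
  case: ifP => [t0|_]; first by rewrite AI.
  case: ifP => _; first by rewrite wI //= fregE.
  by rewrite FI //= fregE.
move=> s ss; rewrite (cobd_lin f) -[LHS]fu; congr (f _); apply: funext => t.

have -> : u (cup (i + d) (cup i z zeta) zeta s) t = zeta (drop (i + d) s) *:
    (zeta (drop i (take (i + d).+1 s)) *: uz (take i.+1 (take (i + d).+1 s)) t).
  by rewrite /cup /splice linearZ /= fZ; congr (_ *: _); rewrite linearZ.
rewrite cobd_ev.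
have szt : size (take (i + d).+1 s) = (i + d).+1 by rewrite size_takel // ss ltnS leq_addr.
have [t0|tn0] := eqVneq (size t) 0%N.
  rewrite (@eq_cobd _ _ _ _ A) => [|s']; last by rewrite /Wf t0.
  by have [_ <-] := FE s ss; case: t t0.
have [td|td] := ltnP (size t) d.
  rewrite (@eq_cobd _ _ _ _ (fun s' => w s' t)) => [|s']; last first.
    by rewrite /Wf (negbTE tn0) td.
  by rewrite -cobd_ev -wE // /cup /splice !fZ /bot lt0n tn0 td.
rewrite (@eq_cobd _ _ _ _ (fun s' => F s' t)) => [|s']; last first.
  by rewrite /Wf (negbTE tn0) ltnNge td.
have [e1 _] := FE s ss; rewrite -cobd_ev -e1.
rewrite /cup /splice !fZ /top; case: eqP => // /eqP nt.
by rewrite /uz (tu _).1 // ltn_neqAle eq_sym nt.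
Qed.

End Representation.

End TwistedModules.

(** * Groups that are not elementary abelian *)

Section MoreCochains.
Variables (k : fieldType) (gT : finGroupType) (H : {group gT}).
Variables (M : lmodType k) (a : gT -> {linear M -> M}).

Lemma cup_cobr i m (z : seq gT -> M) (c : seq gT -> k^o) : (0 < m)%N ->
  invc H a i.+1 z -> cocy i.+1 z -> cob H (@triv k gT) m.+1 c ->
  cob H a (i + m).+1 (cup i z c).
Proof.
move=> m0 Iz cz [W IW eW]; exists (fun s => (-1) ^+ i *: cup i z W s).
  move=> g s gH ss; rewrite [RHS]linearZ; congr (_ *: _).
  apply: (@shift_cup k gT M a H i m.-1 z W) => //; first by rewrite prednK.
  by rewrite -addnS prednK.
move=> s ss; rewrite cobdZ cobd_cup; last by rewrite ss; lia.
have -> : cup i.+1 (cobd z) W s = 0.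
  by rewrite /cup /splice cz ?scaler0 // size_takel // ss; lia.
rewrite add0r signrZK /cup /splice eW // size_drop ss; lia.
Qed.

Lemma cobZ n c f : cob H a n f -> cob H a n (fun s => c *: f s).
Proof.
move=> [w Iw ew]; exists (fun s => c *: w s); last by move=> s ss; rewrite cobdZ ew.
by move=> g s gH ss; rewrite Iw // linearZ.
Qed.

Lemma cobB n f f' : cob H a n f -> cob H a n f' -> cob H a n (fun s => f s - f' s).
Proof.
move=> [w Iw ew] [w' Iw' ew']; exists (fun s => w s - w' s).
  by move=> g s gH ss; rewrite Iw // Iw' // linearB.
by move=> s ss; rewrite cobdB ew // ew'.
Qed.

Lemma cob0 n : cob H a n (fun=> 0).
Proof.
by exists (fun=> 0) => [g s _ _|s _]; rewrite ?linear0 ?cobd0.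
Qed.

Lemma cob_sum (I : Type) (r : seq I) n (f : I -> seq gT -> M) :
  (forall i, cob H a n (f i)) -> cob H a n (fun s => \sum_(i <- r) f i s).
Proof.
move=> cf; elim: r => [|i r IH].
  by apply: eq_cob (cob0 n) => s _; rewrite big_nil.
apply: (eq_cob _ (cobB (cf i) (cobZ (-1) IH))) => s _.
by rewrite big_cons scaleN1r opprK.
Qed.

End MoreCochains.

Lemma cobd_map2 (k : fieldType) (M : lmodType k) (Y Y' : Type) (p : Y' -> Y)
    (f : seq Y -> M) s : cobd f (map p s) = cobd (fun t => f (map p t)) s.
Proof. by elim: s f => [//|x s IH] f /=; rewrite IH. Qed.

Section LinkLift.
Variables (k : fieldType) (gT : finGroupType) (H : {group gT}).
Variables (M1 M2 N : lmodType k).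
Variables (a1 : gT -> {linear M1 -> M1}) (a2 : gT -> {linear M2 -> M2}).
Variable (b : gT -> {linear N -> N}).
Variables (D : {linear N -> N}) (eps : {linear N -> M1}) (iota : {linear M2 -> N}).
Variables (L : nat) (K : nat -> N -> Prop).
Hypothesis gc : graded_complex H a1 a2 b D eps iota L K.
Variable u : {linear N -> N}.
Hypotheses (bH : act_on H b) (Ku : forall j x, K j x -> K j (u x)).
Hypothesis tu : forall j x, (0 < j)%N -> K j x -> trop H b u x = x.

(** The contractions provided by the Higman operator are used downwards from [z'], one level at a
    time. The cocycle at the bottom is a preimage of [z'] under the connecting homomorphism. *)
Lemma link_lift n z' : invc H a2 (n + L) z' -> cocy (n + L) z' ->
  exists z y, [/\ link H b D eps iota L K n z z' y, invc H a1 n z & cocy n z].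
Proof.
move=> Iz cz; have L0 := gc_L gc.
pose ctr f := higman_contr b H u f.
pose Y := fix Y i := if i is j.+1 then ctr (fun s => D (Y j s)) else ctr (fun s => iota (z' s)).
have Kctr j m (f : seq gT -> N) : Kval K j m.+1 f -> Kval K j m (ctr f).
  move=> Kf s ss; rewrite /ctr /higman_contr; elim/big_rec: _ => [|h x hH Kx].
    exact: (gc_K0 gc).
  apply: (gc_KD gc) Kx; apply: (gc_Kb gc) => //; apply: Ku; apply: (gc_Kb gc).
    by rewrite groupV.
  by apply: Kf; rewrite /= ss.
have YP i : (i < L)%N -> [/\ invc H b (n + (L.-1 - i)) (Y i),
    Kval K (L - i) (n + (L.-1 - i)) (Y i),
    (forall s, size s = (n + (L - i))%N ->
      cobd (Y i) s = if i is j.+1 then D (Y j s) else iota (z' s)) &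
    (forall s, size s = (n + (L - i))%N -> D (cobd (Y i) s) = 0 /\ eps (cobd (Y i) s) = 0)].
  elim: i => [|i IH] iL.
    have nL : (n + L = (n + (L.-1 - 0)).+1)%N by lia.
    have cY s : size s = (n + (L - 0))%N -> cobd (Y 0%N) s = iota (z' s).
      rewrite subn0 => ss; rewrite [LHS](@cobd_higman_contr k gT N b H u (n + L)) //.
        by rewrite (tu L0) //; apply: (gc_iotaK gc).
      by move=> t st; rewrite (cobd_lin iota) cz // linear0.
    split=> //.
    - apply: higman_contr_inv => //; rewrite -nL => g s gH ss.
      by rewrite Iz // (gc_biota gc).
    - by rewrite subn0; apply: Kctr => s _; apply: (gc_iotaK gc).
    - by move=> s ss; rewrite cY // (gc_Diota gc) (gc_epsiota gc).
  have [IY KY cY dY] := IH (ltnW iL).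
  have nL : (n + (L - i.+1) = (n + (L.-1 - i.+1)).+1)%N by lia.
  have nL' : (L - i.+1 = L.-1 - i)%N by lia.
  have nL'' : (L - i = (L - i.+1).+1)%N by lia.
  have [j0 ej] : exists j0, (L - i.+1 = j0.+1)%N by exists (L - i.+1).-1; lia.
  have KD s : size s = (n + (L.-1 - i))%N -> K (L - i.+1) (D (Y i s)).
    by move=> ss; rewrite ej; apply: (gc_DK gc); rewrite -ej -nL''; apply: KY.
  have cY' s : size s = (n + (L - i.+1))%N -> cobd (Y i.+1) s = D (Y i s).
    move=> ss; rewrite [LHS](@cobd_higman_contr k gT N b H u (n + (L - i.+1))) //.
      by apply: (tu (j := (L - i.+1))); [lia | apply: KD; rewrite -nL'].
    move=> t st; rewrite (cobd_lin D); apply: (dY t _).1.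
    by rewrite st nL'' addnS.
  split=> //.
  - apply: higman_contr_inv => //; rewrite -nL nL' => g s gH ss.
    rewrite -[LHS]/(D (Y i (shift g s))) IY //.
    exact: (gc_bD gc).
  - by apply: Kctr; rewrite -nL nL' => s ss; rewrite -nL'; apply: KD.
  - move=> s ss; rewrite cY' //; have K1 := KY s _.
    rewrite nL'' in K1; split; first by apply: (gc_DD gc (K1 _)); rewrite -nL'.
    by apply: (gc_epsD gc (K1 _)); rewrite -nL'.
pose y j := Y (L.-1 - j)%N.
exists (fun s => eps (y 0%N s)), y; split.
- split=> [j jL|j jL|s ss //|j s jL ss|s ss].
  + have [|IY _ _ _] := YP (L.-1 - j)%N; first by lia.
    have e1 : (L.-1 - (L.-1 - j) = j)%N by lia.
    by rewrite e1 in IY.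
  + have [|_ KY _ _] := YP (L.-1 - j)%N; first by lia.
    have e1 : (L.-1 - (L.-1 - j) = j)%N by lia.
    have e2 : (L - (L.-1 - j) = j.+1)%N by lia.
    by rewrite e1 e2 in KY.
  + have [|_ _ cY _] := YP (L.-1 - j)%N; first by lia.
    rewrite /y cY; last by rewrite ss; lia.
    by have -> : (L.-1 - j = (L.-1 - j.+1).+1)%N by lia.
  + have [//|_ _ cY _] := YP 0%N.
    by rewrite /y subnn cY // subn0.
- have [|IY _ _ _] := YP L.-1; first by lia.
  rewrite subnn addn0 in IY => g s gH ss; rewrite /y subn0 IY //.
  by rewrite (gc_beps gc).
- have [|_ _ _ dY] := YP L.-1; first by lia.
  move=> s ss; rewrite (cobd_lin eps) /y subn0; apply: (dY s _).2.
  by rewrite ss; lia.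
Qed.

End LinkLift.

(** Cochains of a fixed size on a finite group with values in a finite dimensional module form a
    finite dimensional space. The index [l] is the least one with a nonzero coefficient, so that the
    relation can be solved for it. *)
Lemma cochain_dependence (k : fieldType) (gT : finGroupType) (M : vectType k) n
    (f : nat -> seq gT -> M) : exists N (c : nat -> k) l,
  [/\ (l < N)%N, c l != 0, (forall j, (j < l)%N -> c j = 0) &
    forall s, size s = n -> \sum_(j < N) c j *: f j s = 0].
Proof.
pose V := {ffun n.-tuple gT -> M}.
pose v j : V := [ffun t => f j (tval t)].
pose X := [seq v j | j <- iota 0 (\dim {:V}).+1].
have nfr : ~~ free X.
  apply/negP; rewrite /free => /eqP e; have := dimvS (subvf <<X>>%VS).
  by rewrite e size_map size_iota ltnn.
have szX : size X = (\dim {:V}).+1 by rewrite size_map size_iota.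
have [c0 [l0 cl0] e0] : exists2 c : 'I_(\dim {:V}).+1 -> k, (exists l, c l != 0) &
    \sum_j c j *: v j = 0.
  apply: contrapT => nc; case/negP: nfr; rewrite -[X]/(tval (Tuple (introT eqP szX))).
  apply/freeP => c e i; apply: contrapT => /eqP ci; apply: nc; exists c; first by exists i.
  rewrite -[RHS]e; apply: eq_bigr => j _; congr (_ *: _).
  by rewrite /= (nth_map 0%N) ?size_iota // nth_iota.
pose c j := if insub j is Some i then c0 i else 0.
have cE (i : 'I_(\dim {:V}).+1) : c i = c0 i.
  by rewrite /c; case: insubP => [i' _ e|]; [congr c0; apply: val_inj | rewrite ltn_ord].
have ex : exists l, c l != 0 by exists l0; rewrite cE.
pose l := ex_minn ex.
have [cl lmin] : c l != 0 /\ forall j, c j != 0 -> (l <= j)%N.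
  by rewrite /l; case: ex_minnP.
exists (\dim {:V}).+1, c, l; split=> //.
- by rewrite (leq_ltn_trans (lmin l0 _)) ?cE.
- by move=> j jl; apply/eqP; apply: contraTT jl => /lmin; rewrite -leqNgt.
move=> s ss; have st : size s == n by apply/eqP.
have := congr1 (fun F : V => F (Tuple st)) e0; rewrite sum_ffunE ffunE => e1.
rewrite -[RHS]e1; apply: eq_bigr => i _; rewrite cE ffunE.
by rewrite /v ffunE.
Qed.

Section LinkScalar.
Variables (k : fieldType) (gT : finGroupType) (H : {group gT}) (M Nk N : lmodType k).
Variables (a : gT -> {linear M -> M}) (bk : gT -> {linear Nk -> Nk}) (b : gT -> {linear N -> N}).
Variables (Dk : {linear Nk -> Nk}) (D : {linear N -> N}).
Variables (epsk : {linear Nk -> k^o}) (eps : {linear N -> M}).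
Variables (iotak : {linear k^o -> Nk}) (iota : {linear M -> N}).
Variables (L : nat) (Kk : nat -> Nk -> Prop) (K : nat -> N -> Prop) (be : Nk -> M -> N).
Hypothesis bel : forall m, linear (be^~ m).
Hypothesis ber : forall G, linear (be G).
Hypothesis beD : forall G m, be (Dk G) m = D (be G m).
Hypothesis beeps : forall G m, eps (be G m) = (epsk G : k) *: m.
Hypothesis beK : forall j G m, Kk j G -> K j (be G m).
Hypothesis KZ : forall j (c : k) x, K j x -> K j (c *: x).
Hypothesis beiota : forall c m, be (iotak c) m = iota ((c : k) *: m).
Hypothesis beact : forall g G m, g \in H -> be (bk g G) (a g m) = b g (be G m).

(** The argument of [cup_link] for any complex that arises from one over [k] by a pairing [be] with
    coefficients in [M]. *)
Lemma link_scalar e y i (z : seq gT -> M) : (0 < L)%N -> (0 < i)%N ->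
  link H bk Dk epsk iotak L Kk 1 (fun _ => 1) e y ->
  invc H a i.+1 z -> cocy i.+1 z ->
  link H b D eps iota L K i.+1 z (fun s => (-1) ^+ (i * L) *: cup i z e s)
   (fun j s => (-1) ^+ (i * j) *: splice i (fun u v => be (y j v) (z u)) s).
Proof.
move=> L0 i0 [Iy Ky ey sy iy] Iz cz; pose f j u v := be (y j v) (z u).
have szd j (s : seq gT) : size s = (i.+1 + j)%N -> size (drop i s) = (1 + j)%N.
  by move=> ss; rewrite size_drop ss addSnnS addKn.
have szt j (s : seq gT) : size s = (i.+1 + j)%N -> size (take i.+1 s) = i.+1.
  by move=> ss; rewrite size_takel ?ss ?leq_addr.
have cf j s : size s = (i.+1 + j).+1 -> cobd (splice i (f j)) s =
    (-1) ^+ i *: be (cobd (y j) (drop i s)) (z (take i.+1 s)).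
  move=> ss; rewrite cobd_splice ?ss ?ltnS ?leq_addr // {1}/splice /f.
  rewrite (cobd_lin (mklin (ber (y j (drop i.+1 s))))) cz ?linear0 ?add0r; last first.
    by rewrite size_takel // ss ltnS leq_addr.
  by congr (_ *: _); rewrite /splice (cobd_lin (mklin (bel (z (take i.+1 s))))).
split.
- move=> j jL g s gH ss; rewrite [RHS]linearZ; congr (_ *: _).
  rewrite /splice /f /shift -map_take -map_drop -!/(shift _ _) Iz //; last exact: (szt _ _ ss).
  by rewrite Iy //= ?beact //; exact: (szd _ _ ss).
- by move=> j jL s ss; apply: KZ; apply: beK; exact: (Ky j jL _ (szd _ _ ss)).
- move=> s ss; rewrite muln0 expr0 scale1r /splice /f /= beeps ey ?scale1r.
    by rewrite take_oversize ?ss.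
  by rewrite (szd 0%N) ?addn0.
- move=> j s jL ss; rewrite cobdZ cf // [RHS]linearZ.
  rewrite -[splice _ (f j.+1) _]/(be (y j.+1 (drop i s)) (z (take i.+1 s))) /= -beD -sy //; last first.
    by rewrite (szd j.+1) ?addnS.
  by rewrite scalerA -exprD mulnS addnC.
- move=> s ss; rewrite cobdZ cf; last by rewrite -addnS prednK.
  rewrite iy; last by rewrite (szd L).
  rewrite scalerA -exprD -mulnSr prednK // beiota.
  by rewrite [RHS]linearZ.
Qed.

End LinkScalar.

Lemma cobd_evf (k : fieldType) (X : lmodType k) (A T : Type) (F : seq T -> (A -> X)) s x :
  cobd F s x = cobd (fun u => F u x) s.
Proof. by elim: s F => [//|y s IH] F /=; rewrite fD fN IH. Qed.

(** * The period class of a cyclic factor *)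

Section PeriodicClass.
Variables (k : fieldType) (gT : finGroupType) (Q : {group gT}) (z : gT).
Local Notation hT := (gT * gT)%type.
Local Notation C := <[z]>%G.
Hypothesis z0 : ((#[z])%g%:R : k) = 0.

Section Complex.
Variables (M : lmodType k) (a : gT -> {linear M -> M}).
Hypothesis aQ : act_on Q a.
Variable P : {group hT}.
Hypothesis sP : P \subset setX Q C.
Local Notation N := ((gT -> M) * (gT -> M))%type.

Definition aX (g : hT) := a g.1.

Lemma aX_on : act_on P aX.
Proof.
split=> [m|[q c] [q' c'] gP gP' m]; rewrite /aX /=; first exact: aQ.1.
by apply: aQ.2; [have := subsetP sP _ gP | have := subsetP sP _ gP'];
  rewrite in_setX => /andP[].
Qed.

(* one period of the periodic resolution of the cyclic factor [C] *)
Definition pfun (g : hT) (f : gT -> M) : gT -> M := fun x => a g.1 (f (g.2^-1 * x)%g).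
Definition pact (g : hT) (F : N) : N := (pfun g F.1, pfun g F.2).
Definition pD (F : N) : N := ((fun x => if x \in C then F.2 (z * x)%g - F.2 x else 0), 0).
Definition peps (F : N) : M := \sum_(c in C) F.1 c.
Definition piota (m : M) : N := (0, fun x => if x \in C then m else 0).

Lemma pact_lin g : linear (pact g).
Proof.
move=> c F F'; congr (_, _); apply: funext => x; rewrite /pfun /= !fE; exact: linearP.
Qed.
HB.instance Definition _ g := GRing.isLinear.Build k N N *:%R (pact g) (pact_lin g).
Lemma pD_lin : linear pD.
Proof.
move=> c F F'; congr (_, _); last by rewrite /= scaler0 addr0.
apply: funext => x; rewrite /= !fE; case: ifP => _; last by rewrite scaler0 addr0.
by rewrite scalerBr; abel.
Qed.
HB.instance Definition _ := GRing.isLinear.Build k N N *:%R pD pD_lin.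
Lemma peps_lin : linear peps.
Proof.
move=> c F F'; rewrite /peps scaler_sumr -big_split /=; apply: eq_bigr => x _.
by rewrite !fE.
Qed.
HB.instance Definition _ := GRing.isLinear.Build k N M *:%R peps peps_lin.
Lemma piota_lin : linear piota.
Proof.
move=> c m n; congr (_, _); first by rewrite /= scaler0 addr0.
by apply: funext => x; rewrite /= !fE; case: ifP => // _; rewrite scaler0 addr0.
Qed.
HB.instance Definition _ := GRing.isLinear.Build k M N *:%R piota piota_lin.

Definition psupp (f : gT -> M) := forall x, x \notin C -> f x = 0.
(** The two components of [N] are the two terms. The complex reads: constants from [M] into
    functions on [C], difference along [z], functions on [C] again, summation to [M]. Functions on
    [gT] supported on [C] replace functions on [C]. *)
Definition pK j (F : N) := match j with
  | 1 => psupp F.1 /\ F.2 = 0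
  | 2 => F.1 = 0 /\ psupp F.2
  | _ => F = 0 end.

Lemma pK2 j F : pK j.+2 F -> F.1 = 0.
Proof. by case: j => [[]|j ->]. Qed.

Lemma sP1 g : g \in P -> g.1 \in Q.
Proof. by move/(subsetP sP); case: g => q c; rewrite in_setX => /andP[]. Qed.
Lemma sP2 g : g \in P -> g.2 \in C.
Proof. by move/(subsetP sP); case: g => q c; rewrite in_setX => /andP[]. Qed.

Lemma pKZ j c F : pK j F -> pK j (c *: F).
Proof.
case: F => F1 F2; case: j => [|[|[|j]]] /=; try by move=> ->; rewrite scaler0.
  by move=> [s1 ->]; split; [move=> x /s1; rewrite fZ => ->; rewrite scaler0|rewrite scaler0].
by move=> [-> s2]; split; [rewrite scaler0|move=> x /s2; rewrite fZ => ->; rewrite scaler0].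
Qed.

Lemma zCc c x : c \in C -> x \in C -> (c * x = x * c)%g.
Proof. by move=> cC xC; apply: (centsP (cycle_abelian z)). Qed.

Lemma pact_on : act_on P (fun g => pact g : {linear N -> N}).
Proof.
split=> [[F1 F2]|g h gP hP [F1 F2]]; rewrite /= /pact /pfun /=.
  by congr (_, _); apply: funext => x; rewrite aQ.1 invg1 mul1g.
by congr (_, _); apply: funext => x; rewrite aQ.2 ?sP1 // invMg mulgA.
Qed.

Lemma periodic_complex : graded_complex P aX aX (fun g => pact g : {linear N -> N})
  (pD : {linear N -> N}) (peps : {linear N -> M}) (piota : {linear M -> N}) 2 pK.
Proof.
split=> //.
- by move=> [|[|[|j]]] //=; split.
- move=> j [F1 F2] [G1 G2]; case: j => [|[|[|j]]] /=.
  + by move=> -> ->; rewrite subr0.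
  + move=> [s1 ->] [t1 ->]; split; last by rewrite subr0.
    by move=> x nx; rewrite fD fN s1 // t1 // subr0.
  + move=> [-> s1] [-> t1]; split; first by rewrite subr0.
    by move=> x nx; rewrite fD fN s1 // t1 // subr0.
  + by move=> -> ->; rewrite subr0.
- have f0 h : pfun h 0 = 0 by apply: funext => x; rewrite /pfun linear0.
  have fs h f : h \in P -> psupp f -> psupp (pfun h f).
    move=> hP sf x nx; rewrite /pfun sf ?linear0 //; apply: contra nx => xC.
    by rewrite -(groupMl _ (groupVr (sP2 hP))).
  move=> [|[|[|j]]] h [F1 F2] hP /=; try by case=> -> ->; rewrite /pact /= f0.
    by move=> [s1 ->]; rewrite f0; split=> //; apply: fs.
  by move=> [-> s2]; rewrite f0; split=> //; apply: fs.
- move=> [F1 F2] [_ /= ->]; congr (_, _); apply: funext => x /=.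
  by rewrite subr0 if_same.
- move=> [|j] [F1 F2] KF.
    split=> // x nx; rewrite /pD /= (negbTE nx) //.
  have -> : ((F1, F2) : N) = 0 by case: j KF.
  by rewrite linear0; case: j {KF} => [|j] //=; split.
- by move=> j F KF; rewrite /= /peps (pK2 KF) big1.
- by move=> j F _; congr (_, _); apply: funext => x; rewrite /= subr0 if_same.
- move=> j F _; rewrite /= /peps /=.
  rewrite (eq_bigr (fun c => F.2 (z * c)%g - F.2 c)) => [|c ->] //.
  rewrite sumrB (reindex_inj (mulgI z^-1%g)) /=; apply/eqP; rewrite subr_eq0; apply/eqP.
  by apply: eq_big => [x|x _]; rewrite ?mulKVg // groupMl // groupV cycle_id.
- by move=> m; split=> // x nx; rewrite /= (negbTE nx).
- move=> m; congr (_, _); apply: funext => x; rewrite /=; case: ifP => // xC.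
  by rewrite groupMl ?cycle_id // subrr.
- by move=> m; rewrite /= /peps big1.
- move=> h F hP; have hC := sP2 hP; congr (_, _); apply: funext => x; rewrite /= /pfun /=; last first.
    by rewrite linear0.
  rewrite groupMl ?groupV //; case: ifP => xC; last by rewrite linear0.
  rewrite linearB; congr (a _ (F.2 _) - _).
  by rewrite !mulgA (zCc (c := h.2^-1%g)) ?groupV ?cycle_id.
- move=> h F hP; have hC := sP2 hP; rewrite /= /peps /= /pfun linear_sum.
  rewrite (reindex_inj (mulgI h.2)) /=; apply: eq_big => [x|x _]; rewrite ?mulKg //.
  by rewrite groupMl.
- move=> h m hP; have hC := sP2 hP; congr (_, _); apply: funext => x; rewrite /= /pfun /=.
    by rewrite linear0.
  by rewrite groupMl ?groupV //; case: ifP; rewrite ?linear0.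
Qed.

(** The discrete logarithm to the base [z], which orders [C] so that partial sums invert the
    difference operator. *)
Definition plog (x : gT) : nat := odflt 0%N (omap val [pick j : 'I_#[z]%g | z ^+ j == x]%g).

Lemma plogX j : (j < #[z]%g)%N -> plog (z ^+ j)%g = j.
Proof.
move=> jz; rewrite /plog; case: pickP => [i|/(_ (Ordinal jz))]; last by rewrite eqxx.
rewrite eq_expg_mod_order => /eqP; rewrite !modn_small //.
Qed.

Lemma big_cycle (F : gT -> M) : \sum_(c in C) F c = \sum_(l < #[z]%g) F (z ^+ l)%g.
Proof.
have inj : {in [set: 'I_#[z]%g] &, injective (fun l : 'I_#[z]%g => z ^+ l)%g}.
  move=> i j _ _ /eqP; rewrite eq_expg_mod_order !modn_small // => /eqP e; exact: val_inj.
rewrite -[RHS](eq_bigl _ _ (fun i => in_setT i)) -(big_imset _ inj) /=.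
apply: eq_bigl => x; apply/idP/imsetP => [/cyclePmin[l lz ->]|[l _ ->]].
  by exists (Ordinal lz); rewrite ?inE.
exact: mem_cycle.
Qed.

Definition ph (F : N) : N :=
  (0, fun x => if x \in C then \sum_(l < plog x) F.1 (z ^+ l)%g else 0).
(** The mass sits at the inverse of [z], the last power, because that is where the partial sums wrap
    around and the total sum is missing. *)
Definition peta (m : M) : N := ((fun x => if x == z^-1%g then m else 0), 0).
Definition ptau (F : N) : M := F.2 1%g.

Lemma ph_lin : linear ph.
Proof.
move=> c F F'; congr (_, _); first by rewrite /= scaler0 addr0.
apply: funext => x; rewrite /= !fE; case: ifP => _; last by rewrite scaler0 addr0.
by rewrite scaler_sumr -big_split /=; apply: eq_bigr => l _; rewrite !fE.
Qed.
HB.instance Definition _ := GRing.isLinear.Build k N N *:%R ph ph_lin.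
Lemma peta_lin : linear peta.
Proof.
move=> c m n; congr (_, _); last by rewrite /= scaler0 addr0.
by apply: funext => x; rewrite /= !fE; case: ifP => // _; rewrite scaler0 addr0.
Qed.
HB.instance Definition _ := GRing.isLinear.Build k M N *:%R peta peta_lin.
Lemma ptau_lin : linear ptau.
Proof. by move=> c F F'; rewrite /ptau /= !fE. Qed.
HB.instance Definition _ := GRing.isLinear.Build k N M *:%R ptau ptau_lin.

Lemma periodic_contraction : contraction (pD : {linear N -> N}) (peps : {linear N -> M})
  (piota : {linear M -> N}) 2 pK (ph : {linear N -> N}) (peta : {linear M -> N})
  (ptau : {linear N -> M}).
Proof.
have oz : (0 < #[z]%g)%N := order_gt0 z.
have l1 : plog 1%g = 0%N by rewrite -(expg0 z) plogX.
have zV : (z^-1 = z ^+ #[z]%g.-1)%g by rewrite -invg_expg.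
split.
- move=> [|j] F KF /=.
    by split=> // x nx; rewrite /= (negbTE nx).
  have -> : ph F = 0.
    congr (_, _); apply: funext => x; rewrite /= (pK2 KF); case: ifP => // _.
    by rewrite big1.
  by case: j {KF}.
- move=> m; split=> // x nx; rewrite /= ifF //; apply: contraNF nx => /eqP ->.
  by rewrite groupV cycle_id.
- move=> j [F1 F2]; case: j => [|[|j]] KF; last first.
  + by rewrite [(F1, F2)]KF !linear0 !addr0.
  + case: KF => /= -> s2.
    have -> : ph (0, F2) = 0.
      congr (_, _); apply: funext => x; rewrite /=; case: ifP => // _.
      by rewrite big1.
    have -> : peps (0, F2) = 0 by rewrite /peps big1.
    rewrite !linear0 add0r addr0; congr (_, _); first by rewrite /= addr0.
    apply: funext => x; rewrite /= !fE; case: ifP => [xC|/negbT/s2 ->]; last by rewrite addr0.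
    have /cyclePmin[l lz ->] := xC; rewrite plogX // /ptau /=.
    rewrite (eq_bigr (fun i : 'I_l => F2 (z ^+ i.+1)%g - F2 (z ^+ i)%g)) => [|i _].
      by rewrite -(big_mkord xpredT (fun i => F2 (z ^+ i.+1)%g - F2 (z ^+ i)%g))
        telescope_sumr // expg0 subrK.
    by rewrite mem_cycle -expgS.
  + case: KF => s1 e2; rewrite /= in s1 e2; rewrite e2.
    congr (_, _); last first.
      apply: funext => x; rewrite /= !fE /ptau /=.
      rewrite big1 => [|l _]; last by rewrite subr0 if_same.
      by rewrite !if_same !addr0.
    apply: funext => x; rewrite /= !fE !addr0; case: ifP => [xC|nx]; last first.
      rewrite s1 ?nx // add0r ifF //; apply: contraFF nx => /eqP ->.
      by rewrite groupV cycle_id.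
    have /cyclePmin[l lz ex] := xC; rewrite ex groupMl ?cycle_id // mem_cycle -expgS.
    rewrite plogX // zV eq_expg_mod_order !modn_small ?prednK //.
    have [el|nl] := eqVneq l (#[z]%g.-1).
      rewrite el prednK // expg_order l1 big_ord0 /peps /= big_cycle.
      have gen m (Gf : nat -> M) : (0 < m)%N -> \sum_(l < m) Gf l = \sum_(l < m.-1) Gf l + Gf m.-1.
        by case: m => // m _; rewrite big_ord_recr.
      by rewrite (gen _ (fun l => F1 (z ^+ l)%g) oz) sub0r addKr.
    have lz' : (l.+1 < #[z]%g)%N by move: lz nl oz; lia.
    by rewrite plogX // big_ord_recr /= addr0 addrC addrK.
- by [].
- by move=> m; rewrite /= /ptau /= group1.
- move=> j [F1 F2]; case: j => [|[|[|j]]] //=; try by case=> _ ->.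
- move=> m; rewrite /= /peps /= (bigD1 z^-1%g) ?groupV ?cycle_id //= eqxx big1 ?addr0 //.
  by move=> c /andP[_ /negbTE ->].
- by [].
Qed.

Definition pr1 (g : hT) : hT := (g.1, 1%g).

(** Shapiro's lemma made explicit: [f] is determined by its value at 1, which is invariant under [Q]
    only. The prism over [pr1] replaces that value by one that forgets second coordinates;
    transported back it becomes a function constant on [C]. *)
Lemma inflated_split n (f : seq hT -> gT -> M) : (1 < n)%N -> P = setX Q C :> {set hT} ->
  (forall g s x, g \in P -> size s = n -> f (shift g s) x = a g.1 (f s (g.2^-1 * x)%g)) ->
  (forall s, size s = n -> psupp (f s)) ->
  (forall s x, size s = n.+1 -> cobd (f^~ x) s = 0) ->
  exists w v : seq hT -> gT -> M,
  [/\ forall g s x, g \in P -> size s = n.-1 -> w (shift g s) x = a g.1 (w s (g.2^-1 * x)%g),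
      forall s, psupp (w s),
      forall s x, size s = n -> f s x = cobd (w^~ x) s + v s x &
      forall s, exists m, v s = fun x => if x \in C then m else 0].
Proof.
move=> n1 eP fI fs fc.
pose g s := f s 1%g; pose tx (x : gT) : hT := (1%g, x^-1%g).
have txP x : x \in C -> tx x \in P by move=> xC; rewrite eP in_setX group1 groupV.
have gx s x : x \in C -> size s = n -> g (shift (tx x) s) = f s x.
  by move=> xC ss; rewrite /g fI ?txP // aQ.1 /= invgK mulg1.
have prx x (s : seq hT) : map pr1 (shift (tx x) s) = map pr1 s.
  by rewrite -map_comp; apply: eq_map => h; rewrite /pr1 /= mul1g.
have gQ q s : q \in Q -> size s = n -> g (shift (q, 1%g) s) = a q (g s).
  move=> qQ ss; rewrite /g fI //= ?invg1 ?mul1g // eP in_setX qQ group1 //.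
have pr1Q (q : gT) h : pr1 ((q, 1%g) * h)%g = ((q, 1) * pr1 h)%g.
  by rewrite /pr1 -[RHS]/(q * h.1, 1 * 1)%g mulg1.
have prQ (q : gT) (s : seq hT) : map pr1 (shift (q, 1%g) s) = shift (q, 1%g) (map pr1 s).
  by rewrite /shift -!map_comp; apply: eq_map => h; apply: pr1Q.
have prismQ q s : q \in Q -> size s = n.-1 ->
    prism pr1 g (shift (q, 1%g) s) = a q (prism pr1 g s).
  move=> qQ ss; rewrite -prism_lin.
  have gen (h : seq hT -> M) t : prism pr1 h (shift (q, 1%g) t) =
      prism pr1 (fun t => h (shift (q, 1%g) t)) t.
    elim: t h => [//|y t IHt] h; rewrite [shift _ _]/= [LHS]/= [RHS]/= prQ.
    by rewrite pr1Q IHt.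
  rewrite gen; apply: prism_size => t; rewrite ss => st; apply: gQ => //.
  by rewrite st prednK // ltnW.
exists (fun s x => if x \in C then - prism pr1 g (shift (tx x) s) else 0).
exists (fun s x => if x \in C then g (map pr1 s) else 0); split.
- move=> h s x hP ss; have hQ := sP1 hP; have hC := sP2 hP.
  rewrite groupMl ?groupV //; case: ifP => xC; last by rewrite linear0.
  rewrite linearN; congr (- _); rewrite -prismQ ?size_map //; congr (prism _ _ _).
  rewrite -!shiftM; congr (shift _ s); rewrite /tx; case: h {hP} hQ hC => q c /= hQ hC.
  congr (_, _); rewrite /= ?mul1g ?mulg1 //.
  by rewrite invMg invgK.
- by move=> s x nx; rewrite (negbTE nx).
- move=> s x ss; case: (boolP (x \in C)) => xC; last first.
    by rewrite cobd0 addr0; apply: (fs s ss x xC).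
  have := cobd_prism pr1 g (shift (tx x) s); rewrite prx gx // (@prism_size _ _ _ _ _ (fun=> 0)).
    rewrite /shift cobd_map -/(shift _ _).
    have -> : prism pr1 (fun=> 0 : M) (shift (tx x) s) = 0.
      by elim: (shift _ _) => //= y t ->; rewrite subr0.
    rewrite addr0 => e; rewrite (cobd_lin (-%R : {linear M -> M})) e.
    rewrite /=; abel.
  move=> t; rewrite size_shift ss => st; rewrite -(shift1 t).
  apply: fc; by rewrite shift1.
- by move=> s; exists (g (map pr1 s)).
Qed.

(** The constant remainders are killed by the difference operator, and by summation since the order
    of [z] is zero in [k]. They need not be coboundaries, hence the weak form of acyclicity. *)
Lemma periodic_acyclic : P = setX Q C :> {set hT} ->
  almost_acyclic P (fun g => pact g : {linear N -> N}) (pD : {linear N -> N})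
    (peps : {linear N -> M}) pK.
Proof.
move=> eP j n f n1 j0 If Kf cf.
pose cst (m : M) : gT -> M := fun x => if x \in C then m else 0.
have core (J : {linear (gT -> M) -> N}) (pj : {linear N -> (gT -> M)}) :
    (forall g F, pact g (J F) = J (pfun g F)) -> (forall g F, pj (pact g F) = pfun g (pj F)) ->
    (forall F, psupp F -> pK j (J F)) ->
    (forall s, size s = n -> psupp (pj (f s)) /\ f s = J (pj (f s))) ->
    (forall m, pD (J (cst m)) = 0 /\ peps (J (cst m)) = 0) ->
    exists w v, [/\ invc P (fun g => pact g : {linear N -> N}) n.-1 w, Kval pK j n.-1 w,
      forall s, size s = n -> f s = cobd w s + v s &
      forall s, size s = n -> pD (v s) = 0 /\ peps (v s) = 0].
  move=> Jp pjp JK fJ Jc.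
  have [w [v [wI ws wv vc]]] : exists w v : seq hT -> gT -> M,
    [/\ forall g s x, g \in P -> size s = n.-1 -> w (shift g s) x = a g.1 (w s (g.2^-1 * x)%g),
      forall s, psupp (w s),
      forall s x, size s = n -> pj (f s) x = cobd (w^~ x) s + v s x &
      forall s, exists m, v s = fun x => if x \in C then m else 0].
    apply: (inflated_split (f := fun s => pj (f s)) n1 eP).
    - by move=> g s x gP ss; rewrite If //= pjp.
    - by move=> s ss; apply: (fJ s ss).1.
    - by move=> s x ss; rewrite -(cobd_evf (fun s => pj (f s))) (cobd_lin pj) cf // linear0.
  exists (fun s => J (w s)), (fun s => J (v s)); split.
  - move=> g s gP ss; rewrite /= Jp; congr (J _); apply: funext => x.
    by rewrite wI.
  - by move=> s _; apply: JK; apply: ws.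
  - move=> s ss; rewrite (cobd_lin J) -linearD (fJ s ss).2; congr (J _).
    by apply: funext => x; rewrite fD cobd_evf wv //.
  - by move=> s ss; have [m ->] := vc s; apply: Jc.
have e0 g : pfun g (0 : gT -> M) = 0 by apply: funext => x; rewrite /pfun linear0.
have l1 : linear (fun F : gT -> M => (F, 0) : N).
  by move=> c F F'; congr (_, _); rewrite /= scaler0 addr0.
have l2 : linear (fun F : gT -> M => (0, F) : N).
  by move=> c F F'; congr (_, _); rewrite /= scaler0 addr0.
have p1 : linear (fun F : N => F.1) by [].
have p2 : linear (fun F : N => F.2) by [].
have eC m : peps (cst m, 0) = 0.
  rewrite /peps /= (eq_bigr (fun=> m)) => [|c cC]; last by rewrite /cst cC.
  by rewrite sumr_const -scaler_nat -/(#[z]%g) z0 scale0r.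
case: j j0 Kf core => [//|[|[|j]]] _ Kf core.
- apply: (core (mklin l1) (mklin p1)) => [g F|g [F1 F2]|F sF|s ss|m] //=.
  + by rewrite /pact /= e0.
  + by have := Kf s ss; case: (f s) => F1 F2 [/= s1 ->].
  + split=> //; congr (_, _); apply: funext => x; rewrite /= subr0; exact: if_same.
- apply: (core (mklin l2) (mklin p2)) => [g F|g [F1 F2]|F sF|s ss|m] //=.
  + by rewrite /pact /= e0.
  + by have := Kf s ss; case: (f s) => F1 F2 [/= -> s2].
  + split; last by rewrite /peps big1.
    congr (_, _); apply: funext => x; rewrite /= /cst; case: ifP => // xC.
    by rewrite groupMl ?cycle_id // subrr.
exists (fun=> 0), (fun=> 0); split=> //.
- by move=> g s _ _; rewrite linear0.
- by move=> s ss; rewrite cobd0 addr0; apply: (Kf s ss).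
- by move=> s _; rewrite !linear0.
Qed.

End Complex.

Local Notation Nk := ((gT -> k^o) * (gT -> k^o))%type.
Notation triv1 := (@triv k gT).

Lemma triv_on : act_on Q triv1. Proof. exact: triv_act. Qed.

(** The connecting homomorphism of one period yields a class of degree 2, that is of 3 vertices.
    Injectivity is dimension shifting through the two terms. *)
Lemma periodic_class_exists : exists xi : seq hT -> k^o,
  [/\ invc (setX Q C) (@triv k hT) 3 xi, cocy 3 xi,
   cob (setX_group Q 1%G) (@triv k hT) 3 xi &
   forall (M : lmodType k) (a : gT -> {linear M -> M}), act_on Q a ->
   forall i z, (0 < i)%N -> invc (setX Q C) (aX a) i.+1 z -> cocy i.+1 z ->
   cob (setX Q C) (aX a) (i + 2).+1 (cup i z xi) -> cob (setX Q C) (aX a) i.+1 z].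
Proof.
pose Ga := setX Q C.
have gck := periodic_complex triv1 (subxx Ga).
have ctk := periodic_contraction k^o (P := setX_group Q C) (subxx _).
have actk := aX_on triv_on (subxx Ga).
have actN := pact_on triv_on (subxx Ga).
have [||xi [y [ly Ixi cxi]]] := link_exists actk actk actN gck ctk (n := 1)
    (z := fun _ => 1 : k^o) (ltnSn 0).
- by [].
- by move=> s; case: s => [|x [|x' [|]]] //= _; rewrite subr0 subrr.
exists xi; split=> //.
- have sP : setX_group Q 1%G \subset Ga by rewrite setXS // sub1G.
  have gcP := periodic_complex triv1 sP.
  have actP := pact_on triv_on sP.
  (* Over [setX_group Q 1%G] the element [peta 1] is invariant and lifts the unit class; subtracting
     it from the bottom level gives a link that starts at 0. *)
  have ly0 : link (setX_group Q 1%G) (fun g => pact triv1 g : {linear Nk -> Nk})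
      (@pD k^o : {linear Nk -> Nk})
      (@peps k^o : {linear Nk -> k^o}) (@piota k^o : {linear k^o -> Nk}) 2
      (@pK k^o) 1 (fun _ => 0 : k^o) xi
      (fun j s => y j s - (if j == 0%N then peta (1 : k^o) else 0)).
    case: ly => Iy Ky ey sy iy; split.
    + move=> j jL g s gP ss; rewrite linearB /= (Iy j) ?(subsetP sP) //; congr (_ - _).
      case: ifP => _; last by rewrite linear0.
      congr (_, _); apply: funext => x; rewrite /pfun //=.
      case: g gP => q c; rewrite in_setX => /andP[_]; rewrite inE => /eqP /= ->.
      by rewrite invg1 mul1g.
    + move=> j jL s ss; apply: (gc_KB gck); first exact: Ky.
      case: j jL ss => [|[|]] //= _ _.
      by have := ct_eta ctk 1.
    + by move=> s ss; rewrite linearB /= ey // (ct_epseta ctk) subrr.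
    + move=> [|[|j]] s // jL ss; rewrite cobdB sy //= subr0.
      by case: s ss => [|x [|x' [|]]] //= _; rewrite subr0 subrr subr0.
    + by move=> s ss; rewrite cobdB /= iy // cobd0 subr0.
  by apply: (link_exact _ actP gcP ctk (ltnSn 0) ly0).
move=> M a aQ i z1 i0 Iz cz cb.
have sG := subxx (setX Q C).
pose be (G : Nk) (m : M) : (gT -> M) * (gT -> M) :=
  (fun x => (G.1 x : k) *: m, fun x => (G.2 x : k) *: m).
have lk := @link_scalar k _ (setX_group Q C) M Nk _ (aX a)
  (fun g => pact triv1 g : {linear Nk -> Nk}) (fun g => pact a g : {linear _ -> _})
  (@pD k^o : {linear Nk -> Nk}) (@pD M : {linear _ -> _})
  (@peps k^o : {linear Nk -> k^o}) (@peps M : {linear _ -> _})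
  (@piota k^o : {linear k^o -> Nk}) (@piota M : {linear _ -> _}) 2
  (@pK k^o) (@pK M) be _ _ _ _ _ _ _ _ xi y i z1 isT i0 ly Iz cz.
have {}lk := lk _ _ _ _ _ _ _ _.
apply: (link_inj (periodic_complex a (subxx Ga)) _
  (periodic_acyclic aQ (subxx Ga) erefl) (lk _ _ _ _ _ _ _ _)) => //.
- move=> m c G G'; congr (_, _); apply: funext => x; rewrite /= !fE scalerDl.
    by rewrite -[(c *: G.1 x) *: m]/((c * G.1 x) *: m) scalerA.
  by rewrite -[(c *: G.2 x) *: m]/((c * G.2 x) *: m) scalerA.
- move=> G c m m'; congr (_, _); apply: funext => x; rewrite /= !fE scalerDr !scalerA mulrC //.
- move=> G m; congr (_, _); apply: funext => x; rewrite /= ?scale0r //.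
  by case: ifP => _; rewrite ?scale0r // scalerBl.
- by move=> G m; rewrite /= /peps /= scaler_suml.
- move=> [|[|[|j]]] [G1 G2] m /=.
  + by case=> -> ->; congr (_, _); apply: funext => x; rewrite /= scale0r.
  + move=> [s1 ->]; split; first by move=> x /s1 ->; rewrite scale0r.
    by apply: funext => x; rewrite /= scale0r.
  + move=> [-> s1]; split; last by move=> x /s1 ->; rewrite scale0r.
    by apply: funext => x; rewrite /= scale0r.
  + by case=> -> ->; congr (_, _); apply: funext => x; rewrite /= scale0r.
- by move=> j c F; apply: pKZ.
- move=> c m; congr (_, _); apply: funext => x; rewrite /= ?scale0r //.
  by case: ifP; rewrite // scale0r.
- by move=> g G m gP; congr (_, _); apply: funext => x; rewrite /= /pfun /= linearZ.
- apply: (eq_cob _ (cobZ ((-1) ^+ (i * 2)) cb)) => s ss //.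
Qed.

End PeriodicClass.

Section JoinClassSurjective.
Variables (k : fieldType) (gT : finGroupType) (Z : finType).
Hypothesis two_neq0 : (2%:R : k) != 0.
Variables (bl : seq {set Z}) (pt : {set Z} -> Z).
Hypothesis bs : block_system bl pt.
Variables (op : gT -> Z -> Z) (P : {group gT}).
Hypothesis op1 : op 1%g =1 id.
Hypothesis opM : forall g h x, op (g * h)%g x = op g (op h x).
Hypothesis op_bl : forall g b, g \in P -> b \in bl -> op g @: b \in bl.
Notation L := (dimX bl).
Variables (e : seq gT -> k^o) (y : nat -> seq gT -> seq Z -> k^o).
Hypothesis ley : join_link bl op P e y.
Variables (M : lmodType k) (a : gT -> {linear M -> M}).
Hypotheses (aP : act_on P a) (chiP : forall g, g \in P -> jchi k bl pt op g = 1).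
Notation A := (seq Z -> M).

(** The link descending from [z'] and the link of the product with [e] both start at [z], so by
    exactness their ends are cohomologous. The scalar is the sign of [cup_link]. *)
Lemma join_class_surj i (z' : seq gT -> M) :
  (forall T, simplex bl T -> exists u : {linear M -> M},
     forall m, trop (stab op P T) a u m = m) ->
  (0 < i)%N -> invc P a (i + L).+1 z' -> cocy (i + L).+1 z' ->
  exists z c, [/\ invc P a i.+1 z, cocy i.+1 z &
    cob P a (i + L).+1 (fun s => z' s - c *: cup i z e s)].
Proof.
move=> Hst i0 Iz' cz'.
have [u uP] : exists u : {set Z} -> {linear M -> M}, forall T, simplex bl T ->
    forall m, trop (stab op P T) a (u T) m = m.
  apply: (fin_all_exists (P := fun T (u : {linear M -> M}) => simplex bl T ->
    forall m, trop (stab op P T) a u m = m)) => T.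
  have [sT|nT] := boolP (simplex bl T); last by exists idfun.
  by have [v vP] := Hst T sT; exists v.
have gcM : graded_complex P a a (fun g => jact op a g : {linear A -> A})
  (jD bl) (jeps bl) (iotaX bl : {linear M -> A}) L (jK bl).
  apply: (@join_graded_complex _ _ _ _ two_neq0 _ _ bs _ _ _ op1 opM _ (fun _ => 1)) => //.
  - by move=> g m _; rewrite scale1r.
  - move=> g s gP; rewrite (fund_jchi two_neq0 bs op1 opM op_bl) //.
    by rewrite chiP.
have jon : act_on P (fun g => jact op a g : {linear A -> A}) := jact_on op1 opM aP.
have [z [y1 [lk1 Iz cz]]] := link_lift gcM (u := ju op P u) jon
  (fun j F => @ju_jK _ _ _ _ _ op P u j F)
  (fun j F => @trop_ju _ _ _ _ _ _ _ P op1 opM op_bl aP u uP j F) (n := i.+1) Iz' cz'.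
have [y2 lk2] := cup_link bs ley i0 Iz cz.
have lk := link_subZ (@jKZ _ _ _ _) (@gc_KB _ _ _ _ _ _ _ _ _ _ _ _ _ _ gcM) 1 lk1 lk2.
exists z, ((-1) ^+ (i * L)); split=> //.
have c0 := link_exact aP jon gcM (join_contraction M two_neq0 bs) (ltn0Sn i) lk.
have {}c0 := c0 (fun s _ => etrans (congr1 (fun x => z s - x) (scale1r (z s))) (subrr (z s))).
by apply: (eq_cob _ c0) => s ss; rewrite scale1r.
Qed.

End JoinClassSurjective.

(** * A Frattini element and the group [Q] times [C] *)

Section NonElementary.
Variables (k : fieldType) (p : nat) (gT : finGroupType) (Q : {group gT}).
Hypotheses (pk : p \in [pchar k]) (two_neq0 : (2%:R : k) != 0).
Hypotheses (pQ : (p.-group Q)%g) (nab : ~~ (p.-abelem Q)%g).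
Local Notation hT := (gT * gT)%type.

(** The Frattini subgroup is nontrivial because [Q] is not elementary abelian, and a nontrivial
    normal subgroup of a [p]-group meets the centre. *)
Lemma Phi_central : exists z, [/\ z \in 'Phi(Q)%g, z \in 'Z(Q)%g & #[z]%g = p].
Proof.
have pp : prime p by case/andP: pk.
have nPhi : 'Phi(Q)%g != 1%g by rewrite (trivg_Phi pQ).
have nI : ('Phi(Q) :&: 'Z(Q))%g != 1%g.
  by apply: meet_center_nil; rewrite ?(pgroup_nil pQ) ?Phi_normal.
have pI : (p.-group ('Phi(Q) :&: 'Z(Q)))%g.
  by apply: pgroupS pQ; rewrite (subset_trans (subsetIl _ _)) ?Phi_sub.
have [||z /setIP[z1 z2] oz] := @Cauchy gT p ('Phi(Q) :&: 'Z(Q))%G.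
- by [].
- have [_ pd _] := pgroup_pdiv pI nI; exact: pd.
by exists z.
Qed.

Variable z : gT.
Hypotheses (zPhi : z \in 'Phi(Q)%g) (zZ : z \in 'Z(Q)%g) (oz : #[z]%g = p).
Local Notation C := <[z]>%G.
Local Notation Ga := (setX_group Q C).
Local Notation bl := (enum (lcosets C 'N_Q(C)%G)).
Local Notation op := (fun (g : hT) (x : gT) => (g.1 * x * g.2^-1)%g).

Let zQ : z \in Q. Proof. by case/setIP: zZ. Qed.
Let CQ : C \subset Q. Proof. by rewrite cycle_subG. Qed.
Let cC x c : x \in Q -> c \in C -> (x * c = c * x)%g.
Proof.
move=> xQ cC; have sC : C \subset 'C(Q)%g by rewrite cycle_subG; case/setIP: zZ.
by have /centP -> := subsetP sC c cC.
Qed.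
Let NQ : 'N_Q(C)%G = Q.
Proof.
apply/group_inj/setIidPl; apply/subsetP => x xQ; apply/normP; apply/eqP.
rewrite eqEcard cardJg leqnn andbT; apply/subsetP => _ /imsetP[c cC' ->].
by rewrite conjgE -(cC xQ cC') mulKg.
Qed.

Lemma centre_op1 : op 1%g =1 id. Proof. by move=> x; rewrite /= invg1 mulg1 mul1g. Qed.
Lemma centre_opM g h x : op (g * h)%g x = op g (op h x).
Proof. by rewrite /= invMg !mulgA. Qed.

Lemma centre_op_bl g b : g \in Ga -> b \in bl -> op g @: b \in bl.
Proof.
case: g => q c; rewrite in_setX => /andP[qQ cC']; rewrite !mem_enum.
case/lcosetsP=> x xN ->; apply/lcosetsP; exists (q * x)%g.
  by rewrite NQ in xN *; rewrite groupM.
apply/setP => t; apply/imsetP/lcosetP => [[_ /lcosetP[d dC ->] ->]|[d dC ->]] /=.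
  by exists (d * c^-1)%g; rewrite ?groupM ?groupV // !mulgA.
exists (x * (d * c))%g; first by apply/lcosetP; exists (d * c)%g; rewrite ?groupM.
by rewrite !mulgA mulgK.
Qed.

Section Stabilizers.
Variables (P : {group hT}) (T : {set gT}).
Hypotheses (sP : P \subset Ga) (sT : simplex bl T).
Let S := Group (stab_group_set P centre_op1 centre_opM T).

Let simplex_cyc : ~ (forall c, c \in C -> op (1%g, c) @: T = T).
Proof.
move=> TC; case/and3P: sT => /set0Pn[x xT] TX /allP Tb.
have xN : x \in 'N_Q(C)%G by rewrite -(coset_supp CQ) (subsetP TX).
have /Tb/negP[] : (x *: C)%g \in bl by rewrite mem_enum; apply/lcosetsP; exists x.
apply/subsetP => _ /lcosetP[c cC' ->].
rewrite -(TC c^-1%g) ?groupV //; apply/imsetP; exists x => //=.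
by rewrite invgK mul1g.
Qed.

Let prime_cyc c : c \in C -> c != 1%g -> op (1%g, c) @: T = T ->
  forall d, d \in C -> op (1%g, d) @: T = T.
Proof.
move=> cC' c1 cT d dC; have pp : prime p by case/andP: pk.
have Cc : <[c]>%g = C.
  apply/eqP; rewrite eqEcard cycle_subG cC' /= -!orderE oz.
  have : (#[c]%g %| p)%N by rewrite -oz order_dvdG.
  by case/primeP: (pp) => _ H d1; have := H _ d1; rewrite order_eq1 (negbTE c1) => /= /eqP ->.
rewrite -Cc in dC; case/cycleP: dC => n ->; elim: n => [|n IH].
  by rewrite expg0 (imop1 centre_op1).
have -> : ((1, c ^+ n.+1) = (1, c) * (1, c ^+ n) :> hT)%g by rewrite expgS -[RHS]/(_, _) mulg1.
by rewrite (imopM centre_opM) IH.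
Qed.

(** Two elements of the stabilizer with the same first coordinate differ by an element of [C] acting
    alone. If it were not 1, it would generate [C], and [T] would contain a whole coset of [C]. *)
Lemma stab_fst_inj : {in S &, injective (@fst gT gT)}.
Proof.
move=> [q c] [q' c']; rewrite !inE => /andP[gP /eqP gT1] /andP[gP' /eqP gT2] /= qq'.
subst q'; congr (_, _); apply: contrapT => /eqP ne; apply: simplex_cyc.
have cC' : c \in C by move: (subsetP sP _ gP); rewrite in_setX => /andP[].
have cC'' : c' \in C by move: (subsetP sP _ gP'); rewrite in_setX => /andP[].
apply: (prime_cyc (c := (c^-1 * c')%g)); first by rewrite groupM ?groupV.
  by rewrite -eq_mulVg1 //.
have -> : ((1, c^-1 * c') = (q, c)^-1 * (q, c') :> hT)%g by rewrite -[RHS]/(_, _) mulVg.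
by rewrite (imopM centre_opM) gT2 -[in LHS]gT1 (imopK centre_op1 centre_opM).
Qed.

(** If the stabilizer [S] mapped onto [Q], its Frattini subgroup would map onto that of [Q] and
    contain an element over [z]. Its second coordinate is 1 since [C] is elementary abelian. As [z]
    is central it acts on [T] like an element of [C], which is excluded. *)
Lemma stab_fst_proper : (fst_morphism gT gT @* S)%G \proper Q.
Proof.
have fE (B : {set hT}) : (fst_morphism gT gT @* B)%g = [set g.1 | g in B].
  by rewrite morphimEsub ?subsetT.
have sSQ : (fst_morphism gT gT @* S)%g \subset Q.
  rewrite fE; apply/subsetP => _ /imsetP[g gS ->]; move: gS; rewrite inE => /andP[gP _].
  by have := subsetP sP _ gP; case: g gP => q c _; rewrite in_setX => /andP[].
rewrite properEneq sSQ andbT; apply/negP => /eqP eS.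
have pC : (p.-abelem C)%g.
  have pp : prime p by case/andP: pk.
  by rewrite cycle_abelem ?oz ?dvdnn // pp orbT.
have pG : (p.-group S)%g.
  have pGa : (p.-group Ga)%g.
    rewrite /pgroup cardsX pnatM; apply/andP; split; first exact: pQ.
    exact: abelem_pgroup pC.
  apply: pgroupS pGa; apply: subset_trans sP; apply/subsetP => g; rewrite inE.
  by case/andP.
have : z \in (fst_morphism gT gT @* 'Phi(S))%g.
  by rewrite (morphim_Phi _ pG) ?subsetT // eS.
rewrite fE => /imsetP[[q c] gPhi /= ez].
have : c \in (snd_morphism gT gT @* 'Phi(S))%g.
  by rewrite morphimEsub ?subsetT //; apply/imsetP; exists (q, c).
rewrite (morphim_Phi _ pG) ?subsetT // => cPhi.
have sSC : (snd_morphism gT gT @* S)%g \subset C.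
  rewrite morphimEsub ?subsetT //; apply/subsetP => _ /imsetP[g gS ->].
  move: gS; rewrite inE => /andP[gP _].
  by have := subsetP sP _ gP; case: g gP => q' c' _; rewrite in_setX => /andP[].
have c1 : c = 1%g.
  have := trivg_Phi (pgroupS sSC (abelem_pgroup pC)).
  rewrite (abelemS sSC pC) => /eqP e1; rewrite e1 in cPhi; exact/set1P.
have := subsetP (Phi_sub S) _ gPhi; rewrite inE c1 -ez => /andP[_ /eqP zT].
apply: simplex_cyc; apply: (prime_cyc (c := z^-1%g)).
- by rewrite groupV cycle_id.
- rewrite eq_invg1; apply/eqP => z1; have pp : prime p by case/andP: pk.
  by move: oz pp; rewrite z1 order1 => <-.
- rewrite -[RHS]zT; apply: eq_in_imset => x xT /=.
  rewrite invg1 mulg1 invgK mul1g; apply: cC (cycle_id z).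
  have := xT; case/and3P: sT => _ TX _ /(subsetP TX).
  by rewrite (coset_supp CQ) NQ.
Qed.

(** The action factors through the first coordinate, which identifies the stabilizer with a proper
    subgroup of [Q]. *)
Lemma stab_higman (M : lmodType k) (a : gT -> {linear M -> M}) :
  (forall S : {group gT}, S \proper Q -> higman S a) ->
  exists u : {linear M -> M}, forall m, trop (stab op P T) (aX a) u m = m.
Proof.
move=> hQ; have [u uP] := hQ _ stab_fst_proper; exists u => m.
rewrite -[RHS]uP /trop /= morphimEsub ?subsetT //= big_imset; last exact: stab_fst_inj.
by apply: eq_bigr => g _.
Qed.

End Stabilizers.

(* The join class [e] is bijective on the cohomology of [setX Q C], whereas the power [xm] of
   the period class [xi] is injective and vanishes on [setX Q 1]. Choose [zs] with
   [zs j.+1 * e] cohomologous to [zs j * xm]. All [zs j] lie in one finite dimensional space,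
   and a linear dependence between them, restricted to [setX Q 1], kills [zs 0]. *)
Lemma non_elementary_acyclic_at (M : vectType k) (a : gT -> {linear M -> M}) :
  act_on Q a -> (forall S : {group gT}, S \proper Q -> higman S a) -> acyclic Q a.
Proof.
move=> aQ hQ n f n1 If cf; pose i := n.-1.
have ei : n = i.+1 by rewrite /i prednK // ltnW.
have i0 : (0 < i)%N by rewrite -ltnS -ei.
rewrite ei in If cf *.
have zk : (#[z]%g%:R : k) = 0 by case/andP: pk => _ /eqP; rewrite oz.
have [xi [Ixi cxi xi1 xinj]] := periodic_class_exists Q zk.
have bs : block_system bl (@repr gT).
  by apply: coset_blocks; rewrite /= -orderE oz prime_gt1 //; case/andP: pk.
have [e [y [se ce ley]]] := join_class_exists two_neq0 bs centre_op1 centre_opM centre_op_bl.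
set L := dimX bl in se ce ley; have L0 : (0 < L)%N := jL_gt0 bs.
have pC : (p.-group C)%g by rewrite /pgroup /= -orderE oz pnat_id //; case/andP: pk.
have pG : (p.-group Ga)%g.
  by rewrite /pgroup cardsX pnatM; apply/andP; split; [exact: pQ | exact: pC].
have chi1 g : g \in Ga -> jchi k bl (@repr gT) op g = 1.
  exact: (jchi_pgroup two_neq0 bs centre_op1 centre_opM centre_op_bl pk (subxx _) pG).
have Ie : invc Ga (@triv k hT) L.+1 e by move=> g s gG ss; rewrite se // chi1 // mul1r.
(* Here [L] is [p - 1] times the index of [C] in [Q], an even number as [p] is odd, so a power of
   the class of degree 2 has the degree of [e]. *)
have [m [m0 mL]] : exists m, (0 < m)%N /\ (m * 2 = L)%N.
  have pp : prime p by case/andP: pk.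
  have p2 : p != 2.
    apply: contraNneq two_neq0 => p2; case/andP: pk => _ /eqP; rewrite p2 => ->.
    exact: eqxx.
  have evL : ~~ odd L.
    rewrite /L /dimX (coset_supp CQ) NQ -cardE card_lcosets.
    have -> : (#|Q : C|%g = #|Q| %/ p)%N by rewrite -divgS ?CQ //= -orderE oz.
    have pdQ : (p %| #|Q|)%N by rewrite -oz order_dvdG.
    have /dvdnP[r er] := pdQ; rewrite er mulnK ?prime_gt0 // oddB ?leq_pmulr ?prime_gt0 //.
    have : odd p by case: (even_prime pp) p2 => [->|].
    by rewrite oddM => ->; rewrite andbT addbb.
  have e2 := even_halfK evL; exists L./2; split; last by rewrite muln2.
  by rewrite -double_gt0 e2.
pose xm := cpow 2 xi m.
have Ixm : invc Ga (@triv k hT) L.+1 xm by rewrite -mL; apply: cpow_invc.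
have cxm : cocy L.+1 (xm : seq hT -> k^o) by rewrite -mL; apply: cpow_cocy.
have aG : act_on Ga (aX a) := aX_on aQ (subxx Ga).
pose Q1 : {group hT} := setX_group Q 1%G; have sQ1 : Q1 \subset Ga by rewrite setXS // sub1G.
have aQ1 : act_on Q1 (aX a) := aX_on aQ sQ1.
have einj (P : {group hT}) j w : P \subset Ga -> (0 < j)%N -> invc P (aX a) j.+1 w -> cocy j.+1 w ->
    cob P (aX a) (j + L).+1 (cup j w e) -> cob P (aX a) j.+1 w.
  move=> sP; apply: (join_class_inj two_neq0 bs centre_op1 centre_opM centre_op_bl sP
    (join_linkS sP ley) (aX_on aQ sP)) => [g gP|T sT]; first exact: chi1 (subsetP sP g gP).
  exact: stab_higman.
have esurj (w' : seq hT -> M) : invc Ga (aX a) (i + L).+1 w' -> cocy (i + L).+1 w' ->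
    exists w, [/\ invc Ga (aX a) i.+1 w, cocy i.+1 w &
      cob Ga (aX a) (i + L).+1 (fun s => w' s - cup i w e s)].
  move=> Iw cw; have [w [c [Iw1 cw1 ew]]] := join_class_surj two_neq0 bs centre_op1 centre_opM
    centre_op_bl ley aG chi1 (fun T sT => stab_higman (subxx Ga) sT hQ) i0 Iw cw.
  exists (fun s => c *: w s); split.
  - by move=> g s gG ss; rewrite Iw1 // linearZ.
  - by move=> s ss; rewrite cobdZ cw1 // scaler0.
  - apply: (eq_cob _ ew) => s ss; rewrite /cup /splice !scalerA mulrC //.
have xminj w : invc Ga (aX a) i.+1 w -> cocy i.+1 w ->
    cob Ga (aX a) (i + L).+1 (cup i w xm) -> cob Ga (aX a) i.+1 w.
  rewrite -mL => Iw cw; apply: (cup_cpow_inj _ Ixi cxi _ i0 Iw cw) => // j w' j0 Iw' cw'.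
  exact: xinj.
pose good w := invc Ga (aX a) i.+1 w /\ cocy i.+1 w.
have step w : good w -> exists w', good w' /\
    cob Ga (aX a) (i + L).+1 (fun s => cup i w xm s - cup i w' e s).
  move=> [Iw cw]; have [||w' [Iw' cw' ew']] := esurj (cup i w xm).
  - by move=> g s gG ss; apply: (shift_cup Iw Ixm).
  - exact: cup_cocy.
  by exists w'.
pose z0 (s : seq hT) := f (map fst s).
have gz0 : good z0.
  split=> [g s gG ss|s ss].
    rewrite /z0 /aX -If ?size_map //; last by case: g gG => q c; rewrite in_setX => /andP[].
    by rewrite /shift -!map_comp.
  by rewrite -[cobd _ s](cobd_map2 fst) cf ?size_map.
have [zs [zs0 zsg zsc]] : exists zs : nat -> seq hT -> M, [/\ zs 0%N = z0, forall j, good (zs j) &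
    forall j, cob Ga (aX a) (i + L).+1 (fun s => cup i (zs j) xm s - cup i (zs j.+1) e s)].
  pose T := {w : seq hT -> M | good w}.
  have [nx nxP] := choice (fun w : T => step (sval w) (svalP w)).
  pose it := fix it j : T := if j is j'.+1 then exist _ (nx (it j')) (nxP (it j')).1
                         else exist _ z0 gz0.
  exists (fun j => sval (it j)); split=> // j; first exact: svalP (it j).
  exact: (nxP (it j)).2.
have [N [c [l [lN cl clt dep]]]] := cochain_dependence i.+1 zs.
(* The dependence relation with all indices lowered by [l - j]. The terms below [l], where natural
   subtraction would truncate, have their coefficients replaced by 0. *)
pose comb j := fun s => \sum_(r < N) (if (r < l)%N then 0 else c r) *: zs (r - l + j)%N s.
have gcomb j : good (comb j).
  split=> [g s gG ss|s ss].
    rewrite /comb linear_sum; apply: eq_bigr => r _; rewrite [RHS]linearZ; congr (_ *: _).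
    exact: (zsg _).1.
  rewrite /comb cobd_sum big1 // => r _; rewrite cobdZ (zsg _).2 //; exact: scaler0.
have combS j : cob Ga (aX a) (i + L).+1 (fun s => cup i (comb j) xm s - cup i (comb j.+1) e s).
  have := cob_sum (index_enum 'I_N) (fun r : 'I_N =>
    cobZ (if (r < l)%N then 0 else c r) (zsc (r - l + j)%N)).
  apply: eq_cob => s ss; rewrite /cup /splice /comb !scaler_sumr -sumrB.
  apply: eq_bigr => r _; rewrite scalerBr !scalerA addnS.
  by rewrite ![(if _ then _ else _) * _]mulrC.
have combl : cob Ga (aX a) i.+1 (comb l).
  apply: eq_cob (cob0 Ga (aX a) i.+1) => s ss; rewrite -(dep s ss) /comb.
  apply: eq_bigr => r _; case: ltnP => rl; first by rewrite clt // !scale0r.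
  by rewrite subnK.
(* The product of [comb j] with [xm] is cohomologous to that of [comb j.+1] with [e]; injectivity of
   [xm] therefore carries triviality from [comb l] down to [comb 0]. *)
have comb0 : forall j, (j <= l)%N -> cob Ga (aX a) i.+1 (comb (l - j)%N).
  elim=> [|j IH] jl; first by rewrite subn0.
  have lj : (l - j = (l - j.+1).+1)%N by rewrite subnSK.
  have := IH (ltnW jl); rewrite lj => cj.
  have [Ic cc] := gcomb (l - j.+1)%N; apply: (xminj _ Ic cc).
  have ce1 := cup_cob i0 Ie ce cj.
  have := cobB (combS (l - j.+1)%N) (cobZ (-1) ce1).
  by apply: eq_cob => s ss; rewrite scaleN1r opprK subrK.
have {}comb0 : cob Ga (aX a) i.+1 (comb 0%N) by rewrite -(subnn l); apply: comb0.
(* The sequence [comb 0] is the multiple [c l] of [z0] plus [rest 1], and [rest 0] is the same sum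
   one index earlier, which links [rest 1] times [e] to [rest 0] times [xm]. *)
pose rest j := fun s => \sum_(r < N) (if (r <= l)%N then 0 else c r) *: zs (r - l.+1 + j)%N s.
have grest j : good (rest j).
  split=> [g s gG ss|s ss].
    rewrite /rest linear_sum; apply: eq_bigr => r _; rewrite [RHS]linearZ; congr (_ *: _).
    exact: (zsg _).1.
  rewrite /rest cobd_sum big1 // => r _; rewrite cobdZ (zsg _).2 //; exact: scaler0.
have restS : cob Ga (aX a) (i + L).+1 (fun s => cup i (rest 0%N) xm s - cup i (rest 1%N) e s).
  have := cob_sum (index_enum 'I_N) (fun r : 'I_N =>
    cobZ (if (r <= l)%N then 0 else c r) (zsc (r - l.+1 + 0)%N)).
  apply: eq_cob => s ss; rewrite /cup /splice /rest !scaler_sumr -sumrB.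
  apply: eq_bigr => r _; rewrite scalerBr !scalerA addn1 addn0.
  by rewrite ![(if _ then _ else _) * _]mulrC.
have combE s : comb 0%N s = c l *: z0 s + rest 1%N s.
  rewrite /comb /rest (bigD1 (Ordinal lN)) //= ltnn subnn addn0 zs0; congr (_ + _).
  rewrite [RHS](bigD1 (Ordinal lN)) //= leqnn scale0r add0r; apply: eq_bigr => r nr.
  have nr' : r != l :> nat by apply: contra nr => /eqP e1; apply/eqP/val_inj.
  case: (ltngtP r l) nr' => //= lr _; first by rewrite !scale0r.
  by rewrite addn0 addn1 subnSK.
have sub1 j w : cob Ga (aX a) j w -> cob Q1 (aX a) j w.
  by move=> [v Iv ev]; exists v => // g s gQ; apply: Iv; apply: (subsetP sQ1).
have xm1 : cob Q1 (@triv k hT) L.+1 xm.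
  rewrite -mL; apply: cpow_cob => //.
  by move=> g s gQ; apply: Ixi; apply: (subsetP sQ1).
(* On [Q1] the class [xm] vanishes while [e] remains injective, so [rest 1] is a coboundary there
   and only the multiple of [z0] is left. *)
have rest1 : cob Q1 (aX a) (i + L).+1 (cup i (rest 1%N) e).
  have [Ir cr] := grest 0%N.
  have Ir1 : invc Q1 (aX a) i.+1 (rest 0%N).
    by move=> g s gQ; apply: Ir; apply: (subsetP sQ1).
  have := cobB (cup_cobr L0 Ir1 cr xm1) (sub1 _ _ restS).
  by apply: eq_cob => s ss; rewrite opprB addrC subrK.
have {}rest1 : cob Q1 (aX a) i.+1 (rest 1%N).
  have [Ir cr] := grest 1%N; apply: (einj _ _ _ sQ1 i0 _ cr rest1).
  by move=> g s gQ; apply: Ir; apply: (subsetP sQ1).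
have : cob Q1 (aX a) i.+1 z0.
  apply: (eq_cob _ (cobZ (c l)^-1 (cobB (sub1 _ _ comb0) rest1))) => s ss.
  by rewrite combE addrK scalerA mulVf // scale1r.
move=> [v Iv ev]; exists (fun s => v (map (fun g => (g, 1%g)) s)).
  move=> q s qQ ss; have := Iv (q, 1%g) (map (fun g => (g, 1%g)) s).
  rewrite in_setX qQ group1 size_map => /(_ isT ss) /= <-.
  by congr v; rewrite /shift -!map_comp; apply: eq_map => g; rewrite /= -[RHS]/(_, _) mulg1.
move=> s ss; rewrite -[RHS](cobd_map2 (fun g => (g, 1%g))) -ev ?size_map //.
by rewrite /z0 -map_comp map_id.
Qed.

End NonElementary.

Lemma non_elementary_acyclic (k : fieldType) p (gT : finGroupType) (Q : {group gT})
    (M : vectType k) (a : gT -> {linear M -> M}) :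
  p \in [pchar k] -> (2%:R : k) != 0 -> (p.-group Q)%g -> ~~ (p.-abelem Q)%g ->
  act_on Q a -> (forall S : {group gT}, S \proper Q -> higman S a) -> acyclic Q a.
Proof.
move=> pk k2 pQ nQ; have [z [zPhi zZ oz]] := Phi_central pk pQ nQ.
exact: (non_elementary_acyclic_at pk k2 pQ zPhi zZ oz).
Qed.

(** * From vanishing cohomology to projectivity *)

Section FixedPoints.
Variables (k : fieldType) (p : nat) (gT : finGroupType).
Hypothesis pk : p \in [pchar k].
Variables (V : lmodType k) (b : gT -> {linear V -> V}) (U W : V -> Prop).
Hypotheses (W0 : W 0) (WB : forall x y, W x -> W y -> W (x - y)).
Hypothesis UB : forall x y, U x -> U y -> U (x - y).

(** The identity $(x-1)^p = x^p - 1$ for an operator, read off from the coefficients in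
    [{poly k}]. *)
Lemma iter_sub_id (x : {linear V -> V}) v :
  iter p (fun w => x w - w) v = iter p x v - v.
Proof.
have pp : prime p by case/andP: pk.
have key n : (n <= p)%N -> iter n (fun w => x w - w) v =
    \sum_(i < p.+1) (('X - 1) ^+ n : {poly k})`_i *: iter i x v.
  elim: n => [_|n IH np].
    rewrite (bigD1 ord0) //= expr0 coef1 eqxx scale1r big1 ?addr0 // => i.
    by rewrite -val_eqE /= coef1 => /negbTE ->; rewrite scale0r.
  rewrite iterS (IH (ltnW np)) linear_sum exprS mulrBl mul1r.
  set q := _ ^+ n; have q0 : q`_p = 0.
    apply: nth_default; rewrite /q -[1]polyC1.
    by rewrite size_exp_XsubC.
  under [RHS]eq_bigr => i _ do rewrite coefB scalerBl.
  rewrite sumrB; congr (_ - _).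
  rewrite big_ord_recr [RHS]big_ord_recl /= coefXM /= scale0r add0r q0 scale0r linear0 addr0.
  by apply: eq_bigr => i _; rewrite linearZ coefXM.
rewrite key //.
have -> : ('X - 1 : {poly k}) ^+ p = 'X^p - 1.
  have pP : p \in [pchar {poly k}] by apply: (rmorph_pchar (@polyC k)).
  rewrite -(pFrobenius_autE pP) pFrobenius_autB_comm ?pFrobenius_aut1 //.
  exact: mulrC.
have p0 := prime_gt0 pp.
rewrite (bigD1 ord0) //= (bigD1 ord_max) /=; last by rewrite -val_eqE /= -lt0n.
rewrite !coefB !coefXn !coef1 eqxx /= [p == 0%N]eqn0Ngt [0%N == p]eq_sym [p == 0%N]eqn0Ngt p0 /=.
rewrite subr0 scale1r sub0r scaleN1r big1 ?addr0 => [|i /andP[i0 ip]].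
  by rewrite addrC.
rewrite -val_eqE /= in i0; rewrite -val_eqE /= in ip.
by rewrite coefB coefXn coef1 (negbTE i0) (negbTE ip) subrr scale0r.
Qed.

(* [U] and [W] are subspaces given by predicates, since [U / W] may be infinite dimensional. *)
Lemma pgroup_fixed_point (P : {group gT}) : (p.-group P)%g -> act_on P b ->
  (forall g v, g \in P -> W v -> W (b g v)) ->
  (forall g v, g \in P -> U v -> U (b g v)) -> (exists2 v, U v & ~ W v) ->
  exists v, [/\ U v, ~ W v & forall g, g \in P -> W (b g v - v)].
Proof.
have pp : prime p by case/andP: pk.
have WD x y : W x -> W y -> W (x + y).
  by move=> Wx Wy; rewrite -[y]opprK -[- y]sub0r; apply: (WB Wx); apply: WB.
have [n] := ubnP #|P|; elim: n P => // n IH P /ltnSE-leP pP bP Wb Ub [v0 Uv0 nv0].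
have [P1|[M maxM _]] := maximal_exists (sub1G P).
  exists v0; split=> // g; rewrite -P1 => /set1P ->.
  by rewrite bP.1 subrr.
have nM := p_maximal_normal pP maxM; have iM := p_maximal_index pP maxM.
have sMP := normal_sub nM.
have [/properP[_ [x xP xM]] Mmax] := maxgroupP maxM.
have [||||||v [Uv nv vM]] := IH M.
- by apply: leq_trans leP; apply: proper_card; case/maxgroupP: maxM.
- exact: pgroupS pP.
- exact: act_onS bP.
- by move=> g w gM; apply: Wb; apply: (subsetP sMP).
- by move=> g w gM; apply: Ub; apply: (subsetP sMP).
- by exists v0.
have xpM : (x ^+ p \in M)%g.
  have nx : x \in 'N(M)%g by apply: (subsetP (normal_norm nM)).
  apply: coset_idr; first by rewrite groupX.
  rewrite morphX //= -iM -card_quotient ?normal_norm //.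
  by rewrite expg_cardG // mem_quotient.
(* This operator preserves the vectors fixed by [M] modulo [W], and its [p]-th power is that of
   [x ^+ p] minus the identity, which maps [v] into [W] because [x ^+ p] lies in [M]. *)
pose D w := b x w - w.
have DM j : forall g, g \in M -> W (b g (iter j D v) - iter j D v).
  elim: j => [|j IHj] g gM; first exact: vM.
  rewrite iterS /D linearB /=; set w := iter j D v in IHj *.
  have gP := subsetP sMP g gM.
  have -> : b g (b x w) - b g w - (b x w - w) = b x (b (g ^ x)%g w - w) - (b g w - w).
    have e : b g (b x w) = b x (b (g ^ x)%g w) by rewrite -!bP.2 ?groupJ // conjgC.
    by rewrite (linearB (b x)) e; abel.
  apply: WB; last exact: IHj.
  by apply: Wb => //; apply: IHj; rewrite memJ_norm // (subsetP (normal_norm nM)).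
have xit j w : iter j (b x) w = b (x ^+ j)%g w.
  elim: j => [|j IHj]; first by rewrite bP.1.
  by rewrite iterS IHj -bP.2 ?groupX // expgS.
have Wp : W (iter p D v) by rewrite (iter_sub_id (b x)) xit; apply: vM.
have [j [nj Wj]] : exists j, ~ W (iter j D v) /\ W (iter j.+1 D v).
  have ex : exists j, `[< W (iter j D v) >] by exists p; apply/asboolP.
  have := ex_minnP ex; case=> m /asboolP Wm minm.
  case: m Wm minm => [//|m] Wm minm; exists m; split=> // Wm'.
  by have := minm m (introT (asboolP _) Wm'); rewrite ltnn.
have UD i : U (iter i D v) by elim: i => //= i IHi; apply: UB => //; apply: Ub.
exists (iter j D v); split=> //; move: (UD j); set w := iter j D v in nj Wj * => _.
(* The elements fixing [w] modulo [W] form a subgroup containing [M] and [x], hence all of [P] by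
   maximality of [M]. *)
pose S := [set g in P | `[< W (b g w - w) >]].
have gS : group_set S.
  apply/group_setP; split=> [|g h].
    by rewrite inE group1; apply/asboolP; rewrite bP.1 subrr.
  rewrite !inE => /andP[gP /asboolP Wg] /andP[hP /asboolP Wh].
  rewrite groupM //; apply/asboolP; rewrite bP.2 //.
  have -> : b g (b h w) - w = b g (b h w - w) + (b g w - w) by rewrite linearB /= addrA subrK.
  by apply: WD => //; apply: Wb.
have sS : S \subset P by apply/subsetP => g; rewrite inE => /andP[].
have MS : M \subset S.
  by apply/subsetP => g gM; rewrite inE (subsetP sMP) //; apply/asboolP/DM.
have xS : x \in S by rewrite inE xP; apply/asboolP.
have [eS|pS] := eqVproper sS.
  by move=> g; rewrite -eS inE => /andP[_ /asboolP].
have := Mmax (Group gS) pS MS => /(congr1 (fun B : {set gT} => x \in B)) /=.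
by rewrite xS (negbTE xM).
Qed.

End FixedPoints.

(** * Acyclic modules over [p]-groups are free *)

Section AcyclicFree.
Variables (k : fieldType) (p : nat) (gT : finGroupType) (P : {group gT}).
Hypotheses (pk : p \in [pchar k]) (pP : (p.-group P)%g).
Variables (M : vectType k) (a : gT -> {linear M -> M}).
Hypotheses (aP : act_on P a) (ac : acyclic P a).

Definition fixv : {vspace M} := (\bigcap_(g in P) lker (linfun (a g) - \1%VF))%VS.

Lemma fixvP m : reflect (forall g, g \in P -> a g m = m) (m \in fixv).
Proof.
have e g : (m \in lker (linfun (a g) - \1%VF)) = (a g m == m).
  by rewrite memv_ker add_lfunE opp_lfunE id_lfunE lfunE subr_eq0.
have fE : (m \in fixv) = [forall g in P, m \in lker (linfun (a g) - \1%VF)].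
  by rewrite memvE; apply/subv_bigcapP/forall_inP => h g /h; rewrite -memvE.
rewrite fE; apply: (iffP forall_inP) => h g gP; last by rewrite e; apply/eqP/h.
by apply/eqP; rewrite -e h.
Qed.

Local Notation V := (gT -> M).

(** An equivariant map into the free module of functions on [P] with values in the fixed points,
    built from an arbitrary linear projection onto them. It turns out to be an isomorphism. *)
Definition fix_proj (m : M) : V := fun g => if g \in P then projv fixv (a g^-1%g m) else 0.
Lemma fix_proj_lin : linear fix_proj.
Proof.
move=> c x y; apply: funext => g; rewrite /fix_proj !fE; case: ifP => _.
  by rewrite !linearP.
by rewrite scaler0 addr0.
Qed.
HB.instance Definition _ := GRing.isLinear.Build k M V *:%R fix_proj fix_proj_lin.

Definition ltrans (h : gT) (f : V) : V := fun g => f (h^-1 * g)%g.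
Lemma ltrans_lin h : linear (ltrans h).
Proof. by move=> c f f'; apply: funext => g; rewrite /ltrans !fE. Qed.
HB.instance Definition _ h := GRing.isLinear.Build k V V *:%R (ltrans h) (ltrans_lin h).

Lemma ltrans_on : act_on P (fun h => ltrans h : {linear V -> V}).
Proof.
split=> [f|g h _ _ f]; apply: funext => x; rewrite /= /ltrans ?invg1 ?mul1g //.
by rewrite invMg mulgA.
Qed.

Lemma fix_projM h m : h \in P -> fix_proj (a h m) = ltrans h (fix_proj m).
Proof.
move=> hP; apply: funext => g; rewrite /ltrans /fix_proj groupMl ?groupV //.
by case: ifP => // gP; rewrite -aP.2 ?groupV // invMg invgK.
Qed.

(** A nonzero kernel would contain a nonzero fixed vector, but on a fixed vector the value at 1 is
    the vector itself. *)
Lemma fix_proj_inj m : fix_proj m = 0 -> m = 0.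
Proof.
move=> m0; apply: contra_notP (_ : ~ False) => // nm.
have [||||||v [Uv nv vP]] := @pgroup_fixed_point k p gT pk M a (fun m => fix_proj m = 0)
  (fun m => m = 0) _ _ _ P pP aP.
- by [].
- by move=> x y -> ->; rewrite subr0.
- by move=> x y ex ey; rewrite [LHS]linearB /= ex ey subr0.
- by move=> g v _ ->; rewrite linear0.
- by move=> g v gP ev; rewrite fix_projM // ev linear0.
- by exists m.
apply: nv; have vF : v \in fixv by apply/fixvP => g gP; apply/eqP; rewrite -subr_eq0 vP.
have := congr1 (fun f : V => f 1%g) Uv.
by rewrite /fix_proj group1 invg1 aP.1 projv_id.
Qed.

(** If the image were too small, some function outside it would be fixed modulo the image. The
    failure to be fixed is a cocycle of degree 1 in [M]; a primitive corrects the function to a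
    fixed one, and fixed functions come from fixed vectors. *)
Lemma fix_proj_surj (f : V) : (forall g, f g \in fixv) -> (forall g, g \notin P -> f g = 0) ->
  exists m, fix_proj m = f.
Proof.
move=> fF fP; apply: contrapT => nf.
pose U (f : V) := (forall g, f g \in fixv) /\ (forall g, g \notin P -> f g = 0).
have pinj m m' : fix_proj m = fix_proj m' -> m = m'.
  move=> e; apply/eqP; rewrite -subr_eq0; apply/eqP/fix_proj_inj.
  by rewrite [LHS]linearB /= e subrr.
have [||||||v [Uv nv vP]] := @pgroup_fixed_point k p gT pk V
  (fun h => ltrans h : {linear V -> V}) U (fun f => exists m, fix_proj m = f) _ _ _ P pP ltrans_on.
- by exists 0; rewrite linear0.
- by move=> x y [m <-] [m' <-]; exists (m - m'); rewrite [LHS]linearB.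
- move=> x y [xF x0] [yF y0]; split=> g; rewrite fD fN; first exact: rpredB.
  by move=> gP; rewrite x0 // y0 // subr0.
- by move=> g v gP [m <-]; exists (a g m); rewrite fix_projM.
- move=> g v gP [vF v0]; split=> h; rewrite /= /ltrans; first exact: vF.
  by move=> hP; rewrite v0 // groupMl ?groupV.
- by exists f.
apply: nv.
pose r := retr P; have rP x : r x \in P by apply: retr_in.
have rM h x : h \in P -> r (h * x)%g = (h * r x)%g by apply: retrM.
pose Vx x := ltrans (r x) v.
have Vh h x : h \in P -> Vx (h * x)%g = ltrans h (Vx x).
  by move=> hP; rewrite /Vx rM // ltrans_on.2.
have eV x y : exists m, fix_proj m = Vx y - Vx x.
  have [m em] := vP (r y) (rP y); have [m' em'] := vP (r x) (rP x).
  by exists (m - m'); rewrite [LHS]linearB /= em em' /Vx; abel.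
pose mu x y := sval (cid (eV x y)); have muE x y : fix_proj (mu x y) = Vx y - Vx x.
  by rewrite /mu; case: cid.
(* The difference of two translates of [v] lies in the image, and its unique preimage is a
   homogeneous cochain with two vertices. *)
pose f2 (s : seq gT) := mu (nth 1%g s 0) (nth 1%g s 1).
have I2 : invc P a 2 f2.
  move=> h [|x [|y []]] // hP _; apply: pinj; rewrite fix_projM // !muE /= !Vh //.
have c2 : cocy 2 f2.
  move=> [|x [|y [|z []]]] // _; apply: fix_proj_inj; rewrite /= /f2 /=.
  rewrite !linearB /= !muE linear0; abel.
have [w Iw ew] := ac (isT : (1 < 2)%N) I2 c2.
(* By [cE] the corrected translate is independent of the vertex, and equivariance then makes it
   invariant. *)
pose c := Vx 1%g - fix_proj (w [:: 1%g]).
have cE x : Vx x - fix_proj (w [:: x]) = c.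
  have := congr1 fix_proj (ew [:: 1%g; x] erefl); rewrite muE /= /c subr0.
  by rewrite [RHS]linearB /= => e; rewrite -[Vx x](subrK (Vx 1%g)) e; abel.
have cI h : h \in P -> ltrans h c = c.
  move=> hP; rewrite -[in RHS](cE (h * 1)%g) Vh // -[[:: _]]/(shift h [:: 1%g]) Iw //.
  by rewrite fix_projM // -[RHS]linearB.
have Uc1 : c 1%g \in fixv.
  rewrite /c fD fN rpredB //; first by rewrite /Vx /ltrans Uv.1.
  by rewrite /fix_proj group1 memv_proj.
have eC : fix_proj (c 1%g) = c.
  apply: funext => g; rewrite /fix_proj; case: ifPn => gP.
    move/fixvP: (Uc1) => ->; rewrite ?groupV // projv_id //.
    by rewrite -[in RHS](cI g gP) /ltrans mulVg.
  rewrite /c fD fN /fix_proj (negbTE gP) subr0 /Vx /ltrans Uv.2 //.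
  by rewrite groupMl ?groupV.
have e1 : Vx 1%g = fix_proj (c 1%g + w [:: 1%g]).
  by rewrite [RHS]linearD /= eC /c subrK.
exists (a (r 1%g)^-1%g (c 1%g + w [:: 1%g])).
rewrite fix_projM ?groupV // -e1 /Vx.
exact: (actK v ltrans_on).
Qed.

(** Under [fix_proj] the element [u m] is the function concentrated at 1 with value the projection
    of [m]; summing the translates reconstructs a function from its values. The second clause makes
    the images under [u] of a basis of [fixv] a free basis. *)
Lemma acyclic_retract : exists u : {linear M -> M},
  [/\ forall m, trop P a u m = m, forall m, u (projv fixv m) = u m &
   forall m, fix_proj (u m) = fun g => if g == 1%g then projv fixv m else 0].
Proof.
have pinj m m' : fix_proj m = fix_proj m' -> m = m'.
  move=> e; apply/eqP; rewrite -subr_eq0; apply/eqP/fix_proj_inj.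
  by rewrite [LHS]linearB /= e subrr.
have ex m : exists m', fix_proj m' = fun g => if g == 1%g then projv fixv m else 0.
  apply: fix_proj_surj => g; first by case: ifP => _; rewrite ?memv_proj ?mem0v.
  by case: eqP => // ->; rewrite group1.
pose u m := sval (cid (ex m)).
have uE m : fix_proj (u m) = fun g => if g == 1%g then projv fixv m else 0.
  by rewrite /u; case: cid.
have lu : linear u.
  move=> c x y; apply: pinj; rewrite linearP /= !uE; apply: funext => g.
  by rewrite !fE; case: ifP => _; rewrite ?linearP // scaler0 addr0.
exists (mklin lu); split=> // m; last first.
  by apply: pinj; rewrite !uE projv_id ?memv_proj.
apply: pinj; rewrite /trop linear_sum /=; apply: funext => h.
rewrite fct_sumE; case: (boolP (h \in P)) => hP; last first.
  rewrite [RHS]/fix_proj (negbTE hP) big1 // => g gP.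
  rewrite fix_projM // uE /ltrans ifF //; apply: contraNF hP => /eqP e.
  by rewrite -[h](mulKVg g) e mulg1.
rewrite (bigD1 h) //= big1 ?addr0 => [|g /andP[gP gh]].
  by rewrite fix_projM // uE /ltrans mulVg eqxx /fix_proj hP.
rewrite fix_projM // uE /ltrans ifF //.
by apply: contraNF gh => /eqP e; rewrite -[h](mulKVg g) e mulg1.
Qed.

Lemma acyclic_higman : higman P a.
Proof. by have [u [Hu _ _]] := acyclic_retract; exists u. Qed.

Lemma acyclic_free : exists m (E : 'I_m -> M),
  (forall v, exists c : 'I_m -> gT -> k, v = \sum_(j < m) \sum_(g in P) c j g *: a g (E j)) /\
  (forall c : 'I_m -> gT -> k, \sum_(j < m) \sum_(g in P) c j g *: a g (E j) = 0 ->
     forall j g, g \in P -> c j g = 0).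
Proof.
have [u [Hu up uE]] := acyclic_retract.
exists (\dim fixv), (fun j => u (vbasis fixv)`_j); split=> [v|c c0 j g gP].
  exists (fun j g => coord (vbasis fixv) j (projv fixv (a g^-1%g v))).
  rewrite exchange_big /= -{1}[v]Hu; apply: eq_bigr => g gP.
  rewrite -up {1}(coord_vbasis (memv_proj fixv (a g^-1%g v))) linear_sum linear_sum.
  by apply: eq_bigr => j _; rewrite !linearZ.
have bF := vbasisP fixv.
have /freeP fF := basis_free bF; apply: (fF (fun j => c j g)).
have := congr1 (fun m => fix_proj m g) c0.
rewrite linear0 linear_sum fct_sumE => e; rewrite -[RHS]e; apply: eq_bigr => i _.
rewrite linear_sum fct_sumE (bigD1 g) //= big1 ?addr0 => [|h /andP[hP hg]].
  rewrite linearZ /= fZ fix_projM // uE /ltrans mulVg eqxx projv_id //.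
  by apply/vbasis_mem/mem_nth; rewrite size_tuple.
rewrite linearZ /= fZ fix_projM // uE /ltrans ifF ?scaler0 //.
by apply: contraNF hg => /eqP e'; rewrite -[g](mulKVg h) e' mulg1.
Qed.

End AcyclicFree.

Section Projectivity.
Variables (k : fieldType) (p : nat) (gT : finGroupType) (G : {group gT}).
Hypotheses (pk : p \in [pchar k]) (k2 : (2%:R : k) != 0).

(** The operator of the Sylow subgroup is averaged over its cosets, whose number is invertible in
    [k]. *)
Lemma higman_sylow (S : {group gT}) (M : lmodType k) (a : gT -> {linear M -> M}) :
  p.-Sylow(G)%g S -> act_on G a -> higman S a -> higman G a.
Proof.
move=> SG aG [u Hu]; have sSG := pHall_sub SG; have aS := act_onS sSG aG.
pose n := #|G : S|%g; have n0 : (n%:R : k) != 0.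
  rewrite -(dvdn_pcharf pk); have [_ _] := and3P SG.
  by rewrite p'natE ?(pcharf_prime pk).
have lu : linear (fun m => n%:R^-1 *: u m).
  by move=> c x y; rewrite linearP scalerDr !scalerA mulrC.
exists (mklin lu) => m; rewrite /trop (reindex_inj invg_inj) /=.
rewrite (eq_bigl (fun g => g \in G)) => [|g]; last by rewrite groupV.
rewrite (set_partition_big _ (rcosets_partition sSG)) /=.
transitivity (\sum_(A in rcosets S G) n%:R^-1 *: m); last first.
  by rewrite sumr_const -/n -scaler_nat scalerA mulfV // scale1r.
apply: eq_bigr => _ /rcosetsP[x xG ->].
rewrite -[in RHS](actK m aG xG) -[in RHS](Hu (a x m)) -linearZ /= /trop scaler_sumr linear_sum.
rewrite [in RHS](reindex_inj invg_inj) /=.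
rewrite [in RHS](eq_bigl (fun g => g \in S)) => [|g]; last by rewrite groupV.
rewrite (reindex_inj (mulIg x)) /= (eq_bigl (fun g => g \in S)) => [|h]; last first.
  by rewrite mem_rcoset mulgK.
apply: eq_bigr => h hS; have hG := subsetP sSG h hS.
by rewrite !invMg !invgK !aG.2 ?groupV ?groupM // !linearZ.
Qed.

Definition class_twisted (zeta : nat -> seq gT -> k^o) (M : lmodType k)
    (a : gT -> {linear M -> M}) :=
  forall s, (0 < s <= 'r_p(G)%g)%N -> tw_repr G (class_deg G) (zeta s) a.

(** Acyclicity over proper subgroups is turned by [acyclic_higman] into the Higman condition, which
    is the hypothesis of both cases of the induction step. This conversion needs finite
    dimension. *)
Lemma class_twisted_acyclic : exists zeta : nat -> seq gT -> k^o,
  (forall s, invc G (@triv k gT) (class_deg G).+1 (zeta s) /\ cocy (class_deg G).+1 (zeta s)) /\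
  forall (M : vectType k) (a : gT -> {linear M -> M}), act_on G a ->
    class_twisted zeta a -> forall P : {group gT}, (p.-group P)%g -> P \subset G ->
    acyclic P a.
Proof.
have d2 : (1 < class_deg G)%N.
  by rewrite /class_deg -[X in (X < _)%N]/(0.*2.+1) ltn_Sdouble muln_gt0 cardG_gt0 fact_gt0.
have ex s : exists z : seq gT -> k^o, invc G (@triv k gT) (class_deg G).+1 z /\
   cocy (class_deg G).+1 z /\ ((0 < s)%N -> 
     forall E : {group gT}, elabs p G s E ->
     forall (M : lmodType k) (a : gT -> {linear M -> M}), act_on E a ->
     (forall S : {group gT}, S \proper E -> higman S a) ->
     forall i f, (0 < i)%N -> invc E a i.+1 f -> cocy i.+1 f ->
     cob E a (i + class_deg G).+1 (cup i f z) -> cob E a i.+1 f).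
  have [s0|s0] := posnP s.
    by exists (fun=> 0); split=> //; split=> [t _|]; rewrite ?cobd0 ?s0.
  by have [z [Iz cz zP]] := elab_class_sum G pk k2 s0; exists z; split=> //; split=> // _.
exists (fun s => sval (cid (ex s))).
split=> [s|M a aG tw P]; first by case: cid => z [? []].
have [n] := ubnP #|P|; elim: n P => // n IH P /ltnSE-leP pP sP.
have aP := act_onS sP aG.
have hS (S : {group gT}) : S \proper P -> higman S a.
  move=> SP; have sSP := proper_sub SP; have pS := pgroupS sSP pP.
  apply: (acyclic_higman pk pS (act_onS sSP aP)); apply: IH => //; last exact: subset_trans sP.
  exact: leq_trans (proper_card SP) leP.
have [abP|nabP] := boolP (p.-abelem P)%g; last exact: non_elementary_acyclic pk k2 pP nabP aP hS.
have pp := pcharf_prime pk; pose s := logn p #|P|.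
have cP : #|P| = (p ^ s)%N by apply: card_pgroup.
have [s0|s0] := posnP s.
  apply: higman_acyclic => //; exists idfun => m.
  have P1 : P :=: 1%g by apply/card1_trivg; rewrite cP s0.
  by rewrite /trop P1 big_set1 /= invg1 !aP.1.
have sr : (s <= 'r_p(G)%g)%N by apply: logn_le_p_rank; rewrite !inE sP.
have oP : elabs p G s P by rewrite /elabs groupP sP abP cP eqxx.
(* For [P] only the class of its own rank is used; the other twists serve the subgroups of other
   ranks. *)
have := tw s (introT andP (conj s0 sr)); case: cid => z [Iz] [cz /(_ s0) zP] /= twz.
by apply: (tw_acyclic Iz cz d2 sP aG twz) => i f; apply: (zP P oP).
Qed.

End Projectivity.

Arguments tact {k gT} d zeta {M} a g F.

(** * Complexes with an operator *)

Section OperatorComplexes.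
Variables (k : fieldType) (gT : finGroupType) (G : {group gT}).

(* [od] has degree 1, [ow] has degree [- c] for the parameter [c] of [opcx_ok], [og i] is the
   projection onto degree [i], and all degrees are at most [ob] in absolute value. *)
Record opcx := Opcx {
  oM : vectType k;
  oa : gT -> {linear oM -> oM};
  od : {linear oM -> oM};
  ow : {linear oM -> oM};
  og : int -> {linear oM -> oM};
  ob : nat }.

Record opcx_ok (c : int) (X : opcx) : Prop := OpcxOk {
  ok_act : act_on G (oa X);
  ok_da : forall g m, g \in G -> od X (oa X g m) = oa X g (od X m);
  ok_wa : forall g m, g \in G -> ow X (oa X g m) = oa X g (ow X m);
  ok_ga : forall i g m, g \in G -> og X i (oa X g m) = oa X g (og X i m);
  ok_dd : forall m, od X (od X m) = 0;
  ok_dw : forall m, od X (ow X m) = ow X (od X m);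
  ok_gg : forall i j m, og X i (og X j m) = if i == j then og X i m else 0;
  ok_g0 : forall i m, (ob X < `|i|)%N -> og X i m = 0;
  ok_gx : forall m, (forall i, og X i m = 0) -> m = 0;
  ok_gd : forall i m, og X (i + 1) (od X m) = od X (og X i m);
  ok_gw : forall i m, og X (i - c) (ow X m) = ow X (og X i m) }.

Section Tensor.
Variables (d : nat) (zeta : seq gT -> k^o).
Hypotheses (Iz : invc G (@triv k gT) d.+1 zeta) (d2 : (1 < d)%N) (od' : ~~ odd d).

Section Lift.
Variable M : vectType k.
Local Notation T := {ffun 'I_(tw_dim d zeta) -> M}.

Definition tlift (Phi : {linear (seq gT -> M) -> (seq gT -> M)}) (F : T) : T :=
  fold d zeta (Phi (unf d zeta F)).
Lemma tlift_lin Phi : linear (tlift Phi).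
Proof. by move=> c F F'; rewrite /tlift unf_linP linearP fold_linP. Qed.
HB.instance Definition _ Phi := GRing.isLinear.Build k T T *:%R (tlift Phi) (tlift_lin Phi).

Lemma unf_tlift (Phi : {linear (seq gT -> M) -> (seq gT -> M)}) (F : T) :
  (forall H, twisted d zeta H -> twisted d zeta (Phi H)) ->
  unf d zeta (tlift Phi F) = Phi (unf d zeta F).
Proof. by move=> tP; apply/foldK/tP/twisted_unf. Qed.

Lemma unf_inj (F F' : T) : unf d zeta F =1 unf d zeta F' -> F = F'.
Proof. by move=> /funext e; rewrite -[F]unfK e unfK. Qed.

Lemma unf0 s : unf d zeta (0 : T) s = 0.
Proof. by have := @unf_linP k gT d zeta M (-1) 0 0; rewrite scaler0 addr0 scaleN1r addNr => ->. Qed.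

Variables (dM : {linear M -> M}) (gM : int -> {linear M -> M}).

(* The value at [[::]] sits in degree [d]. As [d] is even, its sign [(-1) ^+ 0] is correct. *)
Definition fdiff (F : seq gT -> M) : seq gT -> M := fun s =>
  (-1) ^+ size s *: dM (F s) + if (1 < size s <= d)%N then cobd F s else 0.
Lemma fdiff_lin : linear fdiff.
Proof.
move=> c F F'; apply: funext => s; rewrite /fdiff !fE linearP.
rewrite scalerDr !scalerA [_ * c]mulrC -scalerA.
case: ifP => _; last by rewrite !addr0.
have -> : cobd (c *: F + F') s = c *: cobd F s + cobd F' s.
  by rewrite [LHS](cobdD (fun t => c *: F t)) cobdZ.
by rewrite scalerDr; abel.
Qed.
HB.instance Definition _ := GRing.isLinear.Build k (seq gT -> M) (seq gT -> M) *:%R fdiff fdiff_lin.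

Definition tdeg (s : seq gT) : nat := if s is [::] then d else size s.
Definition fgrade i (F : seq gT -> M) : seq gT -> M := fun s => gM (i - (tdeg s)%:Z) (F s).
Lemma fgrade_lin i : linear (fgrade i).
Proof. by move=> c F F'; apply: funext => s; rewrite /fgrade !fE linearP. Qed.
HB.instance Definition _ i := GRing.isLinear.Build k (seq gT -> M) (seq gT -> M) *:%R
  (fgrade i) (fgrade_lin i).

(* With [phi = id], this sends the top homology class of the twisted complex to the bottom one. *)
Definition fconst (phi : M -> M) (F : seq gT -> M) : seq gT -> M := fun s =>
  if size s == 1%N then phi (F [::]) else 0.
Lemma fconst_lin (phi : {linear M -> M}) : linear (fconst phi).
Proof.
move=> c F F'; apply: funext => s; rewrite /fconst !fE; case: ifP => _; rewrite ?linearP //.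
by rewrite scaler0 addr0.
Qed.
HB.instance Definition _ (phi : {linear M -> M}) :=
  GRing.isLinear.Build k (seq gT -> M) (seq gT -> M) *:%R (fconst phi) (fconst_lin phi).

Lemma tdegE s : (0 < size s)%N -> tdeg s = size s. Proof. by case: s. Qed.

Lemma twisted_fdiff F : twisted d zeta F -> twisted d zeta (fdiff F).
Proof.
move=> [F0 Fz]; split=> s ss.
  by rewrite /fdiff F0 // linear0 scaler0 add0r [(size s <= d)%N]leqNgt ss andbF.
rewrite (@eq_cobd_size _ _ _ _ (fun t => dM (F t) + cobd F t)) => [|t]; last first.
  by rewrite ss /fdiff => -[->]; rewrite d2 leqnn /= -signr_odd (negbTE od') expr0 scale1r.
rewrite [LHS](cobdD (fun t => dM (F t))) cobd_cobd addr0 (cobd_lin dM) Fz //.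
by rewrite /fdiff /= addr0 scale1r [LHS]linearZ.
Qed.

Lemma twisted_fgrade i F : twisted d zeta F -> twisted d zeta (fgrade i F).
Proof.
move=> [F0 Fz]; split=> s ss; first by rewrite /fgrade F0 // linear0.
rewrite (@eq_cobd_size _ _ _ _ (fun t => gM (i - d%:Z) (F t))) => [|t]; last first.
  by rewrite ss /fgrade => -[st]; rewrite tdegE st // ltnW.
by rewrite (cobd_lin (gM _)) Fz // [LHS]linearZ.
Qed.

Lemma twisted_fconst (phi : {linear M -> M}) F : twisted d zeta F -> twisted d zeta (fconst phi F).
Proof.
move=> _; split=> s ss; first by rewrite /fconst ifF // gtn_eqF // (ltn_trans d2).
rewrite (@eq_cobd_size _ _ _ _ (fun t => 0)) ?cobd0 /fconst /= ?scaler0 // => t.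
by rewrite ss => -[->]; rewrite gtn_eqF.
Qed.

End Lift.

Definition tmap (M : vectType k) (phi : {linear M -> M}) (F : {ffun 'I_(tw_dim d zeta) -> M}) :
  {ffun 'I_(tw_dim d zeta) -> M} := [ffun i => phi (F i)].
Lemma tmap_lin (M : vectType k) (phi : {linear M -> M}) : linear (tmap phi).
Proof. by move=> c F F'; apply/ffunP => i; rewrite !ffunE linearP. Qed.
HB.instance Definition _ (M : vectType k) (phi : {linear M -> M}) := GRing.isLinear.Build k
  {ffun 'I_(tw_dim d zeta) -> M} {ffun 'I_(tw_dim d zeta) -> M} *:%R (tmap phi) (tmap_lin phi).

Lemma unf_tmap (M : vectType k) (phi : {linear M -> M}) (F : {ffun 'I_(tw_dim d zeta) -> M}) s :
  unf d zeta (tmap phi F) s = phi (unf d zeta F s).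
Proof.
rewrite -[RHS]unf_nat /unf /ext; case: ifP => // _.
by apply: eq_rmx => i; rewrite ffunE.
Qed.

Variable X : opcx.
Local Notation T := {ffun 'I_(tw_dim d zeta) -> oM X}.

(** The tensor product of [X] with the twisted complex of [zeta], realized as twisted functions with
    values in [X]. *)
Definition tens : opcx := {| oM := T;
  oa := fun g => tact d zeta (oa X) g; od := tlift (fdiff (od X));
  ow := tmap (ow X); og := fun i => tlift (fgrade (og X) i); ob := (ob X + d)%N |}.

Lemma unf_od (F : T) : unf d zeta (od tens F) = fdiff (od X) (unf d zeta F).
Proof. by apply: unf_tlift; apply: twisted_fdiff. Qed.
Lemma unf_og i (F : T) : unf d zeta (og tens i F) = fgrade (og X) i (unf d zeta F).
Proof. by apply: unf_tlift; apply: twisted_fgrade. Qed.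
Lemma unf_oa g (F : T) : g \in G -> unf d zeta (oa tens g F) = freg (oa X) g (unf d zeta F).
Proof. exact: unf_tact. Qed.

Lemma tens_ok c : opcx_ok c X -> opcx_ok c tens.
Proof.
case=> aG da wa ga dd dw gg g0 gx gd gw; split.
- exact: tact_on.
- move=> g F gG; apply: unf_inj => s; rewrite unf_od !unf_oa // unf_od.
  rewrite fregE /fdiff cobd_freg size_shift fregE da // linearD linearZ /=.
  by case: ifP; rewrite ?linear0.
- move=> g F gG; apply: unf_inj => s; rewrite unf_tmap !unf_oa // !fregE unf_tmap.
  exact: wa.
- move=> i g F gG; apply: unf_inj => s; rewrite unf_og !unf_oa // unf_og.
  rewrite fregE /fgrade fregE ga //.
  by have -> : tdeg (shift g^-1 s) = tdeg s by case: s => //= x s; rewrite size_map.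
- move=> F; apply: unf_inj => s; rewrite !unf_od unf0; set H := unf _ _ _.
  have dZ n v : od X ((-1) ^+ n *: v) = (-1) ^+ n *: od X v by rewrite linearZ.
  rewrite {1}/fdiff; case: ifP => ss; last first.
    by rewrite /fdiff ss !addr0 dZ dd !scaler0.
  rewrite [in od X _]/fdiff ss (linearD (od X)) dZ dd scaler0 add0r.
  rewrite [cobd (fdiff _ _) _](cobdD (fun t => (-1) ^+ size t *: od X (H t))).
  rewrite (@eq_cobd_size _ _ _ (fun t => _ *: _) (fun t => (-1) ^+ (size s).-1 *: od X (H t))); last first.
    by move=> t <-.
  rewrite cobdZ (cobd_lin (od X)) addrA -scalerDl.
  have [n es] : exists n, size s = n.+1 by case: (size s) ss => // n _; exists n.
  rewrite es in ss *; rewrite exprS mulN1r addNr scale0r add0r.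
  have [n1|n1] := ltnP 1 n.
    rewrite (@eq_cobd_size _ _ _ _ (cobd H)) ?cobd_cobd // => t; rewrite es => -[->].
    by rewrite n1 /= ltnW // -ltnS; case/andP: ss.
  rewrite (@eq_cobd_size _ _ _ _ (fun=> 0)) ?cobd0 // => t; rewrite es => -[->].
  by rewrite ltnNge n1.
- move=> F; apply: unf_inj => s; rewrite unf_od unf_tmap unf_od /fdiff unf_tmap dw.
  rewrite linearD linearZ; congr (_ + _); case: ifP => _; last by rewrite linear0.
  rewrite -(cobd_lin (ow X)); apply: eq_cobd => t; exact: unf_tmap.
- move=> i j F; apply: unf_inj => s; rewrite !unf_og /fgrade gg.
  rewrite (can_eq (addrK _)); case: eqP => _; first by rewrite unf_og.
  by rewrite unf0.
- move=> i F bi; apply: unf_inj => s; rewrite unf_og unf0 /fgrade.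
  have [sd|sd] := leqP (size s) d; last by rewrite (@twisted_unf k gT d zeta _ F).1 // linear0.
  apply: g0; have : (tdeg s <= d)%N by case: s sd.
  by move: bi => /=; lia.
- move=> F F0; apply: unf_inj => s; rewrite unf0; apply: gx => i.
  have := congr1 (fun F : T => unf d zeta F s) (F0 (i + (tdeg s)%:Z)).
  by rewrite unf_og unf0 /fgrade addrK.
- move=> i F; apply: unf_inj => s; rewrite unf_og !unf_od unf_og.
  rewrite /fgrade /fdiff linearD linearZ; congr (_ *: _ + _).
    by rewrite -gd; congr (og X _ _); ring.
  case: ifP => [/andP[s1 sd]|_]; last by rewrite linear0.
  rewrite -(cobd_lin (og X _)); apply: eq_cobd_size => t st /=.
  rewrite !tdegE ?st //; last by apply: leq_trans s1.
    congr (og X _ _); rewrite -[size s]prednK; last by apply: leq_trans s1.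
    lia.
  by case: (size s) s1.
- move=> i F; apply: unf_inj => s; rewrite unf_og unf_tmap unf_og /fgrade unf_tmap.
  by rewrite -gw; congr (og X _ _); ring.
Qed.

End Tensor.

End OperatorComplexes.

(** * Homology of a tensor product with a twisted complex *)

Section TensorHomology.
Variables (k : fieldType) (gT : finGroupType) (d : nat) (zeta : seq gT -> k^o).
Hypotheses (cz : cocy d.+1 zeta) (d2 : (1 < d)%N) (od' : ~~ odd d).
Variable X : opcx k gT.
Local Notation T := {ffun 'I_(tw_dim d zeta) -> oM X}.
Local Notation M := (oM X).

Lemma unfB (F H : T) s : unf d zeta (F - H : T) s = unf d zeta F s - unf d zeta H s.
Proof. have -> : F - H = -1 *: H + F by rewrite scaleN1r addrC.
by rewrite unf_linP fD fZ scaleN1r addrC. Qed.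

(** Representatives of the two homology classes: the constant [b] on singletons, and [a] in the slot
    together with the cone of [zeta], whose coboundary the twisting condition requires. *)
Definition fgen (b a : M) : seq gT -> M := fun s =>
  if size s == 1%N then b else if size s == d then zeta (1%g :: s) *: a
  else if size s == 0%N then a else 0.

Lemma fgen1 b a x : fgen b a [:: x] = b. Proof. by []. Qed.
Lemma fgen0 b a : fgen b a [::] = a.
Proof. by rewrite /fgen /= ifF // ltn_eqF // ltnW. Qed.

Lemma twisted_fgen b a : twisted d zeta (fgen b a).
Proof.
split=> s ss.
  by rewrite /fgen !ifF // gtn_eqF // ?(leq_trans _ ss) // ltnW.
have fs (t : seq gT) : size t = (size s).-1 -> fgen b a t = zeta (1%g :: t) *: a.
  by rewrite ss /= => st; rewrite /fgen st eqxx gtn_eqF.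
rewrite (eq_cobd_size fs) cobd_scalar fgen0.
congr (_ *: _); have := cz (s := 1%g :: s); rewrite /= ss => /(_ erefl) /eqP.
by rewrite subr_eq0 => /eqP.
Qed.

Lemma fdiff_fgen b a : fdiff d (od X) (fgen b a) = fgen (- od X b) (od X a).
Proof.
apply: funext => s; rewrite /fdiff.
have -> : (if (1 < size s <= d)%N then cobd (fgen b a) s else 0) = 0.
  case: ifP => // /andP[s1 sd].
  have fs (t : seq gT) : size t = (size s).-1 -> fgen b a t = if size s == 2%N then b else 0.
    move=> st; have -> : (size s == 2%N) = (size t == 1%N) by lia.
    by rewrite /fgen; case: ifP => // _; rewrite !ifF //; move: s1 sd; lia.
  rewrite (eq_cobd_size fs); case: eqP => [|_]; last by rewrite cobd0.
  case: s s1 sd fs => [|x [|y []]] //= _ _ _ _; by rewrite subr0 subrr.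
rewrite addr0 /fgen; case: eqP => [->|_]; first by rewrite expr1 scaleN1r.
case: eqP => [->|_].
  by rewrite -signr_odd (negbTE od') expr0 scale1r [LHS]linearZ.
by case: eqP => [->|_]; rewrite ?linear0 ?scaler0 // scale1r.
Qed.

Definition tgen (b a : M) : T := fold d zeta (fgen b a).
Lemma unf_tgen b a : unf d zeta (tgen b a) = fgen b a.
Proof. exact/foldK/twisted_fgen. Qed.

Local Notation TX := (tens d zeta X).

Lemma od_tgen b a : od TX (tgen b a) = tgen (- od X b) (od X a).
Proof. by apply: unf_inj => s; rewrite unf_od // !unf_tgen fdiff_fgen. Qed.

Lemma od_unf1 (F : T) x : unf d zeta (od TX F) [:: x] = - od X (unf d zeta F [:: x]).
Proof. by rewrite unf_od // /fdiff /= expr1 scaleN1r addr0. Qed.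
Lemma od_unf0 (F : T) : unf d zeta (od TX F) [::] = od X (unf d zeta F [::]).
Proof. by rewrite unf_od // /fdiff /= scale1r addr0. Qed.

(** The cone with apex 1 contracts the complex: the zero slot removes the twist in top size, and the
    zero value at the singleton removes the constants. *)
Lemma tens_boundary0 (F : T) : od TX F = 0 -> unf d zeta F [:: 1%g] = 0 ->
  unf d zeta F [::] = 0 -> exists H : T, F = od TX H.
Proof.
move=> zF F1 F0; set f := unf d zeta F in F1 F0.
have [f0 fz] : twisted d zeta f := twisted_unf F.
pose h : seq gT -> M := fun s => if (0 < size s < d)%N then f (1%g :: s) else 0.
have th : twisted d zeta h.
  split=> s ss; first by rewrite /h ifF // [(size s < d)%N]ltnNge (ltnW ss) andbF.
  have hs (t : seq gT) : size t = (size s).-1 -> h t = 0.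
    by rewrite ss /= => st; rewrite /h st ltnn andbF.
  by rewrite (eq_cobd_size hs) cobd0 /h /= scaler0.
have zf s : (-1) ^+ size s *: od X (f s) + (if (1 < size s <= d)%N then cobd f s else 0) = 0.
  by have := unf_od d2 od' F => /(congr1 (fun f => f s)); rewrite zF unf0 => /esym.
exists (fold d zeta h); apply: unf_inj => s; rewrite unf_od // foldK // -/f /fdiff /h.
case: s => [|x s]; first by rewrite /= linear0 scaler0 addr0 F0.
set u := x :: s; have [dn|nd] := ltnP d (size u).
  have -> : (size u < d)%N = false by apply/negbTE; rewrite -leqNgt ltnW.
  by rewrite f0 // andbF linear0 scaler0 add0r andbF.
have eh : (1 < size u)%N -> cobd h u = cobd (fun t => f (1%g :: t)) u.
  move=> u1; apply: eq_cobd_size => t st; rewrite /h ifT //.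
  by rewrite st; move: u1 nd; lia.
have cS f' : cobd f' (1%g :: u) = f' u - cobd (fun t => f' (1%g :: t)) u by [].
have sS : size (1%g :: u) = (size u).+1 by [].
have [du|ud] := leqP d (size u).
  have eu : size u = d by apply/eqP; rewrite eqn_leq nd.
  rewrite andbF linear0 scaler0 add0r andbT eu d2 -/h eh ?eu //.
  have := fz (1%g :: u); rewrite sS eu cS => /(_ erefl); rewrite F0 scaler0 => /eqP.
  by rewrite subr_eq0 => /eqP.
have u0 : (0 < size u)%N by [].
have := zf (1%g :: u); rewrite sS ltnS ud u0 exprS mulN1r scaleNr cS !andbT => /eqP.
rewrite addrC subr_eq0 subr_eq => /eqP ->.
congr (_ + _); case: s @u {cS sS u0} nd eh ud => [|y s] u nd eh ud.
  by rewrite /= F1 subr0.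
by rewrite -eh.
Qed.

(** Subtracting the boundary of a generator reduces to the case where both values vanish. *)
Lemma tens_boundary (F : T) b a : (forall m, od X (od X m) = 0) -> od TX F = 0 ->
  unf d zeta F [:: 1%g] = od X b -> unf d zeta F [::] = od X a -> exists H : T, F = od TX H.
Proof.
move=> dd zF F1 F0.
have [|||H eH] := @tens_boundary0 (F - od TX (tgen (- b) a)).
- rewrite linearB [od TX F]zF od_tgen od_tgen linearN !dd linearN linear0 oppr0.
  apply: unf_inj => s; rewrite unfB unf_tgen unf0 sub0r /fgen; case: ifP; rewrite ?oppr0 // => _.
  by case: ifP => _; rewrite ?scaler0 ?oppr0 // if_same oppr0.
- by rewrite unfB F1 od_tgen unf_tgen fgen1 (linearN (od X)) opprK subrr.
- by rewrite unfB F0 od_tgen unf_tgen fgen0 subrr.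
by exists (H + tgen (- b) a); rewrite linearD -eH subrK.
Qed.

End TensorHomology.

Section HomologyBounds.
Variables (k : fieldType) (gT : finGroupType).

Definition hom_via (X : opcx k gT) (S : vectType k) (P : {linear oM X -> S}) :=
  [/\ forall m, P (od X m) = 0, forall s, exists m, od X m = 0 /\ P m = s &
      forall m, od X m = 0 -> P m = 0 -> exists n, m = od X n].

Definition hom_bounded N (X : opcx k gT) := exists (S : vectType k) (P : {linear oM X -> S}),
  (\dim {: S} <= N)%N /\ forall m, od X m = 0 -> P m = 0 -> exists n, m = od X n.

Definition hom_nonzero (X : opcx k gT) := exists m, od X m = 0 /\ forall n, m <> od X n.

Section Tensor.
Variables (d : nat) (zeta : seq gT -> k^o).
Hypotheses (cz : cocy d.+1 zeta) (d2 : (1 < d)%N) (od' : ~~ odd d).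
Variable X : opcx k gT.
Hypothesis dd : forall m, od X (od X m) = 0.
Local Notation T := {ffun 'I_(tw_dim d zeta) -> oM X}.

Definition tens_hom (S : vectType k) (P : {linear oM X -> S}) (F : T) : S * S :=
  (P (unf d zeta F [:: 1%g]), P (unf d zeta F [::])).
Lemma tens_hom_lin (S : vectType k) (P : {linear oM X -> S}) : linear (tens_hom P).
Proof. by move=> c F F'; rewrite /tens_hom unf_linP !fE !linearP. Qed.
HB.instance Definition _ (S : vectType k) (P : {linear oM X -> S}) :=
  GRing.isLinear.Build k T (S * S)%type *:%R (tens_hom P) (tens_hom_lin P).

Lemma tens_hom_inj (S : vectType k) (P : {linear oM X -> S}) :
  (forall m, od X m = 0 -> P m = 0 -> exists n, m = od X n) ->
  forall F : T, od (tens d zeta X) F = 0 -> tens_hom P F = 0 ->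
  exists H : T, F = od (tens d zeta X) H.
Proof.
move=> Pi F zF [P1 P0].
have [|b eb] := Pi (unf d zeta F [:: 1%g]) _ P1.
  by apply/oppr_inj; rewrite -(od_unf1 d2 od') zF unf0 oppr0.
have [|a ea] := Pi (unf d zeta F [::]) _ P0.
  by rewrite -(od_unf0 d2 od') zF unf0.
exact: (tens_boundary cz d2 od' dd zF eb ea).
Qed.

Lemma tens_hom_via (S : vectType k) (P : {linear oM X -> S}) : hom_via P ->
  @hom_via (tens d zeta X) (S * S)%type (tens_hom P).
Proof.
case=> P0 Ps Pi; split; last exact: tens_hom_inj.
- by move=> F; rewrite /= /tens_hom od_unf1 // od_unf0 // linearN !P0 oppr0.
- move=> [s1 s0]; have [m1 [z1 e1]] := Ps s1; have [m0 [z0 e0]] := Ps s0.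
  exists (tgen d zeta m1 m0); rewrite od_tgen // z1 z0 oppr0; split.
    apply: unf_inj => s; rewrite unf0 unf_tgen // /fgen; case: ifP => // _.
    by case: ifP => _; rewrite ?scaler0 ?if_same.
  by rewrite /= /tens_hom unf_tgen // fgen1 fgen0 // e1 e0.
Qed.

Lemma tens_hom_bounded N : hom_bounded N X -> hom_bounded (N + N) (tens d zeta X).
Proof.
move=> [S [P [dS Pi]]]; exists (S * S)%type, (tens_hom P); split; last exact: tens_hom_inj.
by rewrite dimvf /dim /= -!dimvf leq_add.
Qed.

Lemma tens_hom_nonzero : hom_nonzero X -> hom_nonzero (tens d zeta X).
Proof.
move=> [m [zm nm]]; exists (tgen d zeta m 0); split.
  rewrite od_tgen // zm oppr0 linear0; apply: unf_inj => s.
  rewrite unf0 unf_tgen // /fgen; case: ifP => // _.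
  by case: ifP => _; rewrite ?scaler0 ?if_same.
move=> F /(congr1 (fun F : T => unf d zeta F [:: 1%g])).
by rewrite unf_tgen // od_unf1 // fgen1 -linearN; apply: nm.
Qed.

End Tensor.

(** * The mapping cone of the operator *)

Section Cone.
Variables (G : {group gT}) (c : int) (X : opcx k gT).
Local Notation M := (oM X).
Local Notation MM := (M * M)%type.

Lemma cone_a_lin g : linear (fun m : MM => (oa X g m.1, oa X g m.2)).
Proof. by move=> a x y; rewrite !linearP. Qed.
Lemma cone_d_lin : linear (fun m : MM => (od X m.1 + ow X m.2, - od X m.2)).
Proof.
move=> a x y; congr (_, _) => /=; first by rewrite !linearP scalerDr addrACA.
by rewrite (linearP (od X)) opprD scalerN.
Qed.
Lemma cone_g_lin i : linear (fun m : MM => (og X i m.1, og X (i + 1 + c) m.2)).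
Proof. by move=> a x y; rewrite !linearP. Qed.
Lemma cone_w_lin : linear (fun m : MM => 0 : MM).
Proof. by move=> a x y; rewrite scaler0 addr0. Qed.

(** The second summand is read in degree [i + 1 + c]: the operator lowers it by [c], to the degree
    [i + 1] reached by the differential of the first. *)
Definition cone := @Opcx k gT MM (fun g => mklin (cone_a_lin g)) (mklin cone_d_lin)
  (mklin cone_w_lin) (fun i => mklin (cone_g_lin i)) (ob X + absz (1 + c)%R)%N.

Lemma cone_ok : opcx_ok G c X -> opcx_ok G c cone.
Proof.
case=> aG da wa ga dd dw gg g0 gx gd gw; split=> /=.
- split=> [[x y]|g h gG hG [x y]] /=; by rewrite ?aG.1 ?aG.2.
- by move=> g m gG; rewrite !da // wa // linearD linearN.
- by move=> g m gG; rewrite !linear0.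
- by move=> i g m gG; rewrite !ga.
- by move=> m; rewrite linearD dd add0r linearN dw subrr linearN dd !oppr0.
- by move=> m; rewrite !(linear0, addr0, oppr0).
- move=> i j m; rewrite !gg; have -> : (i + 1 + c == j + 1 + c) = (i == j) by rewrite !(can_eq (addrK _)).
  by case: eqP.
- move=> i m bi; rewrite !g0 //; first by move: bi; lia.
  by move: bi; lia.
- move=> [x y] m0; have m1 i := congr1 fst (m0 i); have m2 i := congr1 snd (m0 i).
  congr (_, _); apply: gx => i; first exact: m1.
  by have := m2 (i - c - 1); rewrite /= !subrK.
- move=> i m; rewrite linearD !gd -gw; congr (_ + og X _ _, _); first by ring.
  by rewrite linearN -gd; congr (- og X _ _); ring.
- by move=> i m; rewrite !linear0.
Qed.

(** The bound is a linear map injective on the kernel, and such maps can be combined componentwise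
    for pairs. A bare function [om] allows composites to be used directly. *)
Definition ker_bounded N (S : vectType k) (om : S -> S) :=
  exists (U : vectType k) (th : {linear S -> U}), (\dim {: U} <= N)%N /\
    forall x, om x = 0 -> th x = 0 -> x = 0.

(** By the rank formula the cokernel of an endomorphism has the dimension of its kernel; it is
    realized as the image of a projection along [limg w]. *)
Lemma coker_bounded N (S : vectType k) (om : {linear S -> S}) : ker_bounded N om ->
  exists (U : vectType k) (th : {linear S -> U}), (\dim {: U} <= N)%N /\
    forall x, th x = 0 -> exists y, x = om y.
Proof.
move=> [U [th [dU thi]]]; pose w := linfun om; pose f : 'End(S) := (\1 - projv (limg w))%VF.
have fE v : f v = v - projv (limg w) v by rewrite add_lfunE opp_lfunE id_lfunE.
exists (subvs_of (limg f)), (vsproj (limg f) \o f); split; last first.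
  move=> x /= /(congr1 vsval); rewrite vsprojK ?memv_img ?memvf // linear0 fE => /eqP.
  rewrite subr_eq0 => /eqP ->; have /memv_imgP[y _ ->] := memv_proj (limg w) x.
  by exists y; rewrite lfunE.
apply: leq_trans dU; rewrite dimvf -[X in (X <= _)%N]/(\dim (limg f)).
have kf : lker f = limg w.
  apply/vspaceP => v; rewrite memv_ker fE subr_eq0; apply/eqP/idP => [->|vw].
    exact: memv_proj.
  by rewrite projv_id.
have e1 := limg_ker_dim f fullv; have e2 := limg_ker_dim w fullv.
have -> : \dim (limg f) = \dim (lker w).
  by move: e1 e2; rewrite !capfv kf; lia.
rewrite -(limg_dim_eq (f := linfun th)) ?dimvS ?subvf //.
apply/eqP; rewrite -subv0; apply/subvP => v /memv_capP[]; rewrite !memv_ker !lfunE /= => /eqP v1 /eqP v2.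
by rewrite (thi v) ?mem0v.
Qed.

Variables (S : vectType k) (P : {linear M -> S}) (om : {linear S -> S}).
Hypotheses (okX : opcx_ok G c X) (PX : hom_via P) (Pw : forall m, P (ow X m) = om (P m)).

(** This is the long exact sequence of the cone: its homology is an extension of the kernel of [om]
    by its cokernel, both bounded by [N]. *)
Lemma cone_hom_bounded N : ker_bounded N om -> hom_bounded (N + N) cone.
Proof.
move=> kb; have [V [th' [dV th'i]]] := coker_bounded kb; have [U [th [dU thi]]] := kb.
case: PX => P0 Ps Pi; case: okX => _ _ _ _ dd dw _ _ _ _ _.
have lT : linear (fun m : MM => (th (P m.2), th' (P m.1))) by move=> a x y; rewrite !linearP.
exists (U * V)%type, (mklin lT); split; first by rewrite dimvf /dim /= -!dimvf leq_add.
move=> [x y] /= [/eqP]; rewrite addr_eq0 => /eqP dx /eqP; rewrite oppr_eq0 => /eqP dy [t1 /th'i [s es]].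
have Py : P y = 0.
  by apply: thi t1; rewrite -Pw -[ow X y]opprK -dx linearN P0 oppr0.
have [y1 ey] := Pi y dy Py.
have [z [dz ez]] := Ps (s + P y1 : S).
have [||x1 ex] := Pi (x + ow X y1 - ow X z).
- by rewrite linearB linearD dx !dw dz -ey linear0 subr0 addNr.
- by rewrite linearB linearD !Pw es ez linearD subrr.
exists (x1, z - y1) => /=; rewrite -ex linearB linearB dz sub0r opprK -ey; congr (_, _).
abel.
Qed.

Lemma cone_hom_nonzero : (exists s, forall x, s <> om x) -> hom_nonzero cone.
Proof.
move=> [s ns]; case: PX => P0 Ps _; have [z [dz ez]] := Ps s.
exists (z, 0); split; first by rewrite /= dz !(linear0, addr0, oppr0).
move=> [x y] /= [e _]; apply: (ns (P y)).
by rewrite -ez e linearD P0 Pw add0r.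
Qed.

End Cone.

End HomologyBounds.

Lemma dim_prod (k : fieldType) (U V : vectType k) :
  \dim {: (U * V)%type} = (\dim {: U} + \dim {: V})%N.
Proof. by rewrite !dimvf. Qed.

(** * Adding a pair of factors to the operator *)

Section Pairs.
Variables (k : fieldType) (gT : finGroupType) (G : {group gT}) (d : nat).
Hypotheses (d2 : (1 < d)%N) (od' : ~~ odd d).

Section Single.
Variable zeta : seq gT -> k^o.
Hypothesis (Iz : invc G (@triv k gT) d.+1 zeta).
Variable X : opcx k gT.
Local Notation T := {ffun 'I_(tw_dim d zeta) -> oM X}.
Local Notation TX := (tens d zeta X).

Definition tconst (phi : {linear oM X -> oM X}) : {linear oM TX -> oM TX} :=
  tlift (d:=d) (zeta:=zeta) (fconst phi : {linear (seq gT -> oM X) -> (seq gT -> oM X)}).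

Lemma unf_tconst phi (F : T) s :
  unf d zeta (tconst phi F : T) s = if size s == 1%N then phi (unf d zeta F [::]) else 0.
Proof. by rewrite unf_tlift // => H; apply: twisted_fconst. Qed.

Lemma unfZ a (F : T) s : unf d zeta (a *: F : T) s = a *: unf d zeta F s.
Proof. by have := @unf_linP k gT d zeta _ a F 0; rewrite addr0 => ->; rewrite fD fZ unf0 addr0. Qed.

(** The sign is the one that [fdiff] puts on singletons, the slot [[::]] having none. *)
Lemma od_tconst a (phi : {linear oM X -> oM X}) (F : T) :
  (forall m, od X (phi m) = a *: phi (od X m)) ->
  od TX (tconst phi F) = - a *: tconst phi (od TX F).
Proof.
move=> dp; apply: unf_inj => s; rewrite unfZ unf_tconst od_unf0 // unf_od //.
rewrite /fdiff unf_tconst; case: eqP => [s1|s1].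
  by rewrite s1 /= addr0 expr1 scaleN1r dp scaleNr.
rewrite linear0 !scaler0 add0r; case: ifP => // /andP[s2 _].
have e (t : seq gT) : size t = (size s).-1 -> unf d zeta (tconst phi F : T) t =
    if size s == 2%N then phi (unf d zeta F [::]) else 0.
  by move=> st; rewrite unf_tconst st; case: (size s) s2 => [|[]].
rewrite (eq_cobd_size e); case: eqP => [|_]; last by rewrite cobd0.
by case: s {s1 s2 e} => [|x [|y []]] //= _; rewrite subr0 subrr.
Qed.

Lemma oa_tconst (phi : {linear oM X -> oM X}) g (F : T) : g \in G ->
  (forall m, phi (oa X g m) = oa X g (phi m)) ->
  tconst phi (oa TX g F) = oa TX g (tconst phi F).
Proof.
move=> gG pa; apply: unf_inj => s; rewrite unf_tconst !(unf_oa Iz) // !fregE unf_tconst size_shift.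
by case: eqP => _; rewrite ?linear0 // -pa.
Qed.

Lemma og_tconst e (phi : {linear oM X -> oM X}) i (F : T) :
  (forall i m, og X (i - e) (phi m) = phi (og X i m)) ->
  og TX (i - (e + d%:Z - 1)) (tconst phi F) = tconst phi (og TX i F).
Proof.
move=> gp; apply: unf_inj => s; rewrite unf_tconst !unf_og // /fgrade unf_tconst /=.
case: eqP => [s1|_]; last by rewrite linear0.
by rewrite -gp tdegE s1 //; congr (og X _ _); ring.
Qed.

End Single.

Definition add_w (Z : opcx k gT) (eps : {linear oM Z -> oM Z}) : opcx k gT :=
  @Opcx k gT (oM Z) (oa Z) (od Z) (ow Z \+ eps) (og Z) (ob Z).

Lemma add_w_ok c (Z : opcx k gT) (eps : {linear oM Z -> oM Z}) : opcx_ok G c Z ->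
  (forall g m, g \in G -> eps (oa Z g m) = oa Z g (eps m)) ->
  (forall m, od Z (eps m) = eps (od Z m)) ->
  (forall i m, og Z (i - c) (eps m) = eps (og Z i m)) -> opcx_ok G c (add_w eps).
Proof.
case=> aG da wa ga dd dw gg g0 gx gd gw ea ed eg; split=> //=.
- by move=> g m gG; rewrite linearD wa // ea.
- by move=> m; rewrite linearD dw ed.
- by move=> i m; rewrite linearD gw eg.
Qed.

Section Pair.
Variables (zeta zeta' : seq gT -> k^o).
Hypotheses (Iz : invc G (@triv k gT) d.+1 zeta) (Iz' : invc G (@triv k gT) d.+1 zeta').
Hypotheses (cz : cocy d.+1 zeta) (cz' : cocy d.+1 zeta').
Variable X : opcx k gT.
Local Notation Y := (tens d zeta X).
Local Notation Z := (tens d zeta' Y).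
Local Notation T := {ffun 'I_(tw_dim d zeta) -> oM X}.
Local Notation U := {ffun 'I_(tw_dim d zeta') -> T}.

(** The operators of the two factors each lower the degree by [d - 1] and anticommute with the
    differential, so their product commutes with it and has the degree of the operator [ow]. *)
Definition pair_eps : {linear oM Z -> oM Z} := @tconst zeta' Y (@tconst zeta X idfun).

Definition pair_cx : opcx k gT := @add_w Z pair_eps.

Local Notation c := ((d%:Z - 1) *+ 2).

Lemma pair_ok : opcx_ok G c X -> opcx_ok G c pair_cx.
Proof.
move=> okX; have okY := tens_ok Iz d2 od' okX; have okZ := tens_ok Iz' d2 od' okY.
apply: add_w_ok okZ _ _ _.
- move=> g m gG; apply: (@oa_tconst zeta' Iz' Y _ g m gG) => m'.
  exact: (@oa_tconst zeta Iz X _ g m' gG).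
- move=> m; rewrite [LHS](@od_tconst zeta' Y (-1)) ?opprK ?scale1r // => m'.
  by rewrite [LHS](@od_tconst zeta X 1) // => x; rewrite scale1r.
- move=> i m; rewrite -[RHS](@og_tconst zeta' Y (0 + d%:Z - 1)).
    by congr (og Z _ _); ring.
  by move=> j m'; apply: og_tconst => l x; rewrite subr0.
Qed.

Variables (S : vectType k) (P : {linear oM X -> S}) (om : {linear S -> S}).
Local Notation SS := ((S * S) * (S * S))%type.

Definition pair_hom1 : {linear oM Y -> (S * S)%type} := @tens_hom k gT d zeta X S P.
Definition pair_hom : {linear oM pair_cx -> SS} :=
  @tens_hom k gT d zeta' Y (S * S)%type pair_hom1.

(** On homology the product of the two new operators takes the component of the two top classes, the
    last one, to that of the two bottom classes, the first one. *)
Definition pair_om (x : SS) : SS :=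
  ((om x.1.1 + x.2.2, om x.1.2), (om x.2.1, om x.2.2)).
Lemma pair_om_lin : linear pair_om.
Proof.
move=> a x y; rewrite /pair_om /= !linearP; congr ((_, _), _).
by rewrite /= scalerDr addrACA.
Qed.
HB.instance Definition _ := GRing.isLinear.Build k SS SS *:%R pair_om pair_om_lin.

Lemma pair_hom_via : opcx_ok G c X -> hom_via P -> hom_via pair_hom.
Proof.
move=> okX hP; have okY := tens_ok Iz d2 od' okX.
apply: (@tens_hom_via _ _ d zeta' cz' d2 od' Y (ok_dd okY)).
exact: (tens_hom_via cz d2 od' (ok_dd okX)).
Qed.

Lemma pair_hom_om : (forall m, P (ow X m) = om (P m)) ->
  forall m, pair_hom (ow pair_cx m) = pair_om (pair_hom m).
Proof.
move=> Pw F.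
have PE (H : U) : pair_hom H = ((P (unf d zeta (unf d zeta' H [:: 1%g]) [:: 1%g]),
    P (unf d zeta (unf d zeta' H [:: 1%g]) [::])),
    (P (unf d zeta (unf d zeta' H [::]) [:: 1%g]), P (unf d zeta (unf d zeta' H [::]) [::]))).
  by [].
have wE : ow pair_cx F = ow Z F + pair_eps F by [].
have wZ (H : U) s t : P (unf d zeta (unf d zeta' (ow Z H) s) t) =
    om (P (unf d zeta (unf d zeta' H s) t)) by rewrite !unf_tmap Pw.
have eZ (H : U) s t : unf d zeta (unf d zeta' (pair_eps H) s) t =
    if (size s == 1%N) && (size t == 1%N) then unf d zeta (unf d zeta' H [::]) [::] else 0.
  rewrite unf_tconst; case: eqP => _; last by rewrite unf0.
  by rewrite unf_tconst.
rewrite wE linearD !PE !wZ !eZ /= linear0.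
by congr ((_, _), (_, _)); rewrite /= ?addr0.
Qed.

(** In the kernel [x4] is determined by [x1], and applying [om] once more puts [x1] into the kernel
    of its square; [x2] and [x3] lie in the kernel of [om]. *)
Lemma pair_ker n K K2 : (\dim {: S} <= n)%N -> ker_bounded K om ->
  ker_bounded K2 (om \o om) -> ker_bounded (K2 + (K + K)) pair_om.
Proof.
move=> dS [U1 [t1 [d1 i1]]] [U2 [t2 [d2' i2]]].
have lt : linear (fun x : SS => (t2 x.1.1, (t1 x.1.2, t1 x.2.1))) by move=> a x y; rewrite !linearP.
exists (U2 * (U1 * U1))%type, (mklin lt); split.
  by rewrite !dim_prod !leq_add.
move=> [[x1 x2] [x3 x4]] [e1 e2 e3 e4] /= [f1 f2 f3].
rewrite /= in e1 e2 e3 e4; have x10 : x1 = 0.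
  have ex : om x1 = - x4 by apply/eqP; rewrite -addr_eq0 e1.
  by apply: i2 f1; rewrite /= ex linearN e4 oppr0.
by rewrite x10 linear0 add0r in e1; rewrite x10 e1 (i1 x2) // (i1 x3).
Qed.

(* [om] enters the upper corner of the square twice, hence [2 != 0]. *)
Lemma pair_ker2 n K K2 : (2%:R : k) != 0 -> (\dim {: S} <= n)%N -> ker_bounded K om ->
  ker_bounded K2 (om \o om) -> ker_bounded (n + K + (K2 + K2)) (pair_om \o pair_om).
Proof.
move=> k2 dS [U1 [t1 [d1 i1]]] [U2 [t2 [d2' i2]]].
have lt : linear (fun x : SS => (x.1.1, t1 x.2.2, (t2 x.1.2, t2 x.2.1))) by move=> a x y; rewrite !linearP.
exists ((S * U1) * (U2 * U2))%type, (mklin lt); split.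
  by rewrite !dim_prod !leq_add.
move=> [[x1 x2] [x3 x4]] [e1 e2 e3 e4] /= [f1 f2 f3 f4].
rewrite /= in e1 e2 e3 e4 f1.
have x40 : om x4 = 0.
  move: e1; rewrite f1 linear0 add0r -mulr2n -scaler_nat => /eqP.
  by rewrite scaler_eq0 (negbTE k2) => /eqP.
by rewrite f1 (i1 x4) // (i2 x2) // (i2 x3).
Qed.

Lemma pair_not_onto : (exists s, forall x, s <> om x) -> exists s, forall x, s <> pair_om x.
Proof. by move=> [s ns]; exists ((0, s), (0, 0)) => x [_ e _ _]; apply: (ns x.1.2). Qed.

End Pair.

End Pairs.

Section Stages.
Variables (k : fieldType) (gT : finGroupType) (G : {group gT}) (d : nat).
Hypotheses (d2 : (1 < d)%N) (od' : ~~ odd d) (k2 : (2%:R : k) != 0).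
Variable zeta : nat -> seq gT -> k^o.
Hypotheses (Iz : forall s, invc G (@triv k gT) d.+1 (zeta s)) (cz : forall s, cocy d.+1 (zeta s)).
Local Notation c := ((d%:Z - 1) *+ 2).

Definition twisted_upto j (X : opcx k gT) :=
  forall s, (0 < s <= j)%N -> tw_repr G d (zeta s) (oa X).

Lemma tens_twisted_upto j c' X : opcx_ok G c' X -> twisted_upto j X ->
  twisted_upto j.+1 (tens d (zeta j.+1) X).
Proof.
move=> okX tX s /andP[s0]; rewrite leq_eqVlt => /predU1P[->|sj].
  exact: (tw_repr_tens0 (Iz _) (ok_act okX)).
by apply: (tw_repr_tens _ (Iz _)); apply: tX; rewrite s0.
Qed.

Lemma cone_twisted_upto j c' X : twisted_upto j X -> twisted_upto j (cone c' X).
Proof. by move=> tX s sj; apply: tw_repr_prod (tX s sj). Qed.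

(* [n], [K] and [K2] bound the dimensions of the homology, of the kernel of the operator on
   it, and of the kernel of its square. *)
Definition stage j n K K2 := exists (X : opcx k gT) (S : vectType k) (P : {linear oM X -> S})
    (om : {linear S -> S}),
  [/\ opcx_ok G c X, twisted_upto j X, hom_via P & forall m, P (ow X m) = om (P m)] /\
  [/\ (\dim {: S} <= n)%N, ker_bounded K om, ker_bounded K2 (om \o om) &
      exists s, forall x, s <> om x].

Lemma stage_step j n K K2 : stage j n K K2 ->
  stage j.+2 (n + n + (n + n)) (K2 + (K + K)) (n + K + (K2 + K2)).
Proof.
move=> [X [S [P [om [[okX tX hP Pw] [dS k1 k2' nS]]]]]].
exists (pair_cx d (zeta j.+1) (zeta j.+2) X), ((S * S) * (S * S))%type,
  (pair_hom d (zeta j.+1) (zeta j.+2) P), (pair_om om : {linear _ -> _}).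
have okY := tens_ok (Iz j.+1) d2 od' okX.
split; split.
- exact: pair_ok.
- exact: (@tens_twisted_upto _ _ _ okY (tens_twisted_upto okX tX)).
- by apply: (pair_hom_via (G := G)).
- exact: pair_hom_om.
- by rewrite !dim_prod !leq_add.
- exact: (pair_ker dS k1 k2').
- exact: (pair_ker2 k2 dS k1 k2').
- exact: pair_not_onto.
Qed.

Lemma zero_lin : linear (fun _ : k^o => 0 : k^o).
Proof. by move=> a x y; rewrite scaler0 addr0. Qed.

Lemma unit_grade_lin (i : int) : linear (fun x : k^o => if i == 0 then x else 0 : k^o).
Proof. by move=> a x y; case: eqP => // _; rewrite scaler0 addr0. Qed.

Definition unit_cx : opcx k gT := @Opcx k gT k^o (@triv k gT) (mklin zero_lin) (mklin zero_lin)
  (fun i => mklin (unit_grade_lin i)) 0.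

Lemma unit_ok : opcx_ok G c unit_cx.
Proof.
split=> //=.
- move=> i j m; have [->|i0] := eqVneq i 0; first by rewrite [0 == j]eq_sym.
  by rewrite if_same.
- by move=> i m; rewrite absz_gt0 => /negbTE ->.
- by move=> m /(_ 0).
- by move=> i _; rewrite if_same.
- by move=> i _; rewrite if_same.
Qed.

Lemma stage0 : stage 0 1 1 1.
Proof.
have d1 : (\dim {: (k^o : vectType k)} <= 1)%N by rewrite dimvf.
exists unit_cx, k^o, idfun, (mklin zero_lin); split; split=> //.
- exact: unit_ok.
- by move=> s /andP[s0]; rewrite leqNgt s0.
- split=> //; first by move=> s; exists s.
  by move=> m _ /= ->; exists 0.
- by exists k^o, idfun; split.
- by exists k^o, idfun; split.
- by exists 1 => x /= /eqP; rewrite oner_eq0.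
Qed.

Lemma small_complex m : exists X : opcx k gT,
  [/\ opcx_ok G c X, twisted_upto (8 + m) X, hom_bounded (252 * 2 ^ m) X & hom_nonzero X].
Proof.
elim: m => [|m [X [okX tX bX nX]]].
  (* The triples of bounds are (1, 1, 1), (4, 3, 4), (16, 10, 15), (64, 35, 56), (256, 126, 211). *)
  have [X [S [P [om [[okX tX hP Pw] [dS k1 _ nS]]]]]] :=
    stage_step (stage_step (stage_step (stage_step stage0))).
  exists (cone c X); split.
  - exact: cone_ok.
  - exact: cone_twisted_upto.
  - exact: (@cone_hom_bounded _ _ _ _ _ _ _ _ okX hP Pw 126).
  - exact: (@cone_hom_nonzero _ _ _ _ _ _ _ hP Pw).
exists (tens d (zeta (8 + m).+1) X); split.
- exact: tens_ok.
- by rewrite addnS; apply: (tens_twisted_upto okX tX).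
- rewrite expnS mulnCA mul2n -addnn; apply: tens_hom_bounded => //; exact: (ok_dd okX).
- exact: tens_hom_nonzero.
Qed.

End Stages.

(** * Matrix representations *)

Section LinearMatrices.
Variables (k : fieldType).
Import VectorInternalTheory.

Definition mxl (V W : vectType k) (f : {linear V -> W}) : 'M_(dim V, dim W) :=
  f2mx (linfun f).

Lemma v2r_mxl (V W : vectType k) (f : {linear V -> W}) v : v2r v *m mxl f = v2r (f v).
Proof.
have e (g : 'Hom(V, W)) : v2r v *m f2mx g = v2r (g v) by rewrite [in RHS]unlock /= r2vK.
by rewrite e lfunE.
Qed.

Lemma eq_mxl_rows (V : vectType k) n (A B : 'M_(dim V, n)) :
  (forall v : V, v2r v *m A = v2r v *m B) -> A = B.
Proof.
move=> e; apply/row_matrixP => i; rewrite !rowE -[delta_mx 0 i]r2vK.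
exact: e.
Qed.

Lemma rank_mxl (V W : vectType k) (f : {linear V -> W}) :
  \rank (mxl f) = \dim (limg (linfun f)).
Proof.
have := limg_ker_dim (linfun f) fullv; rewrite capfv dimvf.
have -> : \dim (lker (linfun f)) = (dim V - \rank (mxl f))%N.
  by rewrite /lker /dimv mx2vsK mxrank_ker.
have := rank_leq_row (mxl f); move: (\rank _) (\dim _) => x y; lia.
Qed.

Section Representations.
Variables (gT : finGroupType) (G : {group gT}).

(* Matrix representations act on the right. *)
Definition lin_mx_of (V : vectType k) (a : gT -> {linear V -> V}) g : 'M_(dim V) :=
  mxl (a g^-1%g).

Lemma vrep_subproof (V : vectType k) (a : gT -> {linear V -> V}) :
  act_on G a -> mx_repr G (lin_mx_of a).
Proof.
move=> [a1 aM]; split.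
  by apply: eq_mxl_rows => v; rewrite v2r_mxl invg1 a1 mulmx1.
move=> g h gG hG; apply: eq_mxl_rows => v.
by rewrite mulmxA !v2r_mxl invMg aM ?groupV.
Qed.

Definition vrep (V : vectType k) (a : gT -> {linear V -> V}) (aG : act_on G a) : mx_representation k G (dim V) :=
  MxRepresentation (@vrep_subproof V a aG).

Lemma vrep_hom (V W : vectType k) (a : gT -> {linear V -> V}) (b : gT -> {linear W -> W})
    (aG : act_on G a) (bG : act_on G b) (f : {linear V -> W}) :
  (forall g v, g \in G -> f (a g v) = b g (f v)) -> kG_hom (vrep aG) (vrep bG) (mxl f).
Proof.
move=> fa g gG; apply: eq_mxl_rows => v; rewrite !mulmxA /= !v2r_mxl fa ?groupV //.
Qed.

Definition free_action (V : vectType k) (a : gT -> {linear V -> V}) :=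
  exists m (E : 'I_m -> V),
  (forall v, exists c : 'I_m -> gT -> k, v = \sum_(j < m) \sum_(g in G) c j g *: a g (E j)) /\
  (forall c : 'I_m -> gT -> k, \sum_(j < m) \sum_(g in G) c j g *: a g (E j) = 0 ->
     forall j g, g \in G -> c j g = 0).

Lemma vrep_free (V : vectType k) (a : gT -> {linear V -> V}) (aG : act_on G a) :
  free_action a -> kG_free (vrep aG).
Proof.
move=> [m [E [Es Ei]]]; exists m, (\matrix_i v2r (E i)).
have eE (c : 'I_m -> gT -> k) :
    \sum_(j < m) \sum_(g in G) c j g *: (row j (\matrix_i v2r (E i)) *m vrep aG g) =
    v2r (\sum_(j < m) \sum_(g in G) c j g^-1%g *: a g (E j)).
  rewrite linear_sum; apply: eq_bigr => j _; rewrite (reindex_inj invg_inj) linear_sum /=.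
  apply: eq_big => [g|g gG]; first by rewrite groupV.
  by rewrite rowK v2r_mxl invgK linearZ.
split=> [w|c].
  have [c ec] := Es (r2v w); exists (fun j g => c j g^-1%g); rewrite eE -[LHS]r2vK ec.
  by congr v2r; apply: eq_bigr => j _; apply: eq_bigr => g _; rewrite invgK.
rewrite eE => /(congr1 r2v); rewrite v2rK linear0 => /Ei c0 j g gG.
by have := c0 j g^-1%g; rewrite invgK groupV; apply.
Qed.

Section Induced.
Variables (V : vectType k) (a : gT -> {linear V -> V}).
Hypothesis aG : act_on G a.
Local Notation W := {ffun subg_of G -> V}.

Definition ind_act g (f : W) : W := [ffun x => f ((subg G g)^-1 * x)%g].
Lemma ind_act_lin g : linear (ind_act g).
Proof. by move=> c f f'; apply/ffunP => x; rewrite !ffunE. Qed.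
HB.instance Definition _ g := GRing.isLinear.Build k W W *:%R (ind_act g) (ind_act_lin g).

Lemma ind_on : act_on G (fun g => ind_act g : {linear W -> W}).
Proof.
split=> [f|g h gG hG f]; apply/ffunP => x; rewrite !ffunE.
  by rewrite morph1 invg1 mul1g.
by rewrite subgM // invMg mulgA.
Qed.

(** The functions concentrated at 1 with values in a basis of [V] form a free basis. *)
Lemma ind_free : free_action (fun g => ind_act g : {linear W -> W}).
Proof.
pose b := vbasis (fullv : {vspace V}).
pose E (j : 'I_(\dim {: V})) : W := [ffun x => if x == 1%g then b`_j else 0].
have eE (c : 'I_(\dim {: V}) -> gT -> k) x :
    (\sum_j \sum_(g in G) c j g *: ind_act g (E j)) x = \sum_j c j (sgval x) *: b`_j.
  rewrite sum_ffunE; apply: eq_bigr => j _; rewrite sum_ffunE (bigD1 (sgval x)) ?subgP //=.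
  rewrite big1 ?addr0 => [|g /andP[gG gx]]; rewrite !ffunE.
    by rewrite sgvalK mulVg eqxx.
  case: eqP => [e|]; last by rewrite scaler0.
  have ex : x = subg G g by rewrite -[x](mulKVg (subg G g)) e mulg1.
  by case/eqP: gx; rewrite ex subgK.
exists (\dim {: V}), E; split=> [f|c c0 j g gG].
  exists (fun j g => coord b j (f (subg G g))); apply/ffunP => x; rewrite eE sgvalK.
  by rewrite {1}(coord_vbasis (memvf (f x))).
have /freeP fb := basis_free (vbasisP (fullv : {vspace V})).
apply: (fb (fun j => c j g)); have := congr1 (fun f : W => f (subg G g)) c0.
by rewrite /= eE ffunE subgK.
Qed.

(** The module is a direct summand of the free module of functions from the group to [V]: the Higman
    operator provides the section of the map that sums the translated values. *)
Lemma vrep_projective : higman G a -> kG_projective (vrep aG).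
Proof.
move=> [u Hu].
have ls : linear (fun v => [ffun x : subg_of G => u (a (sgval x)^-1%g v)] : W).
  by move=> c x y; apply/ffunP => z; rewrite !ffunE !linearP.
have lr : linear (fun f : W => \sum_(g in G) a g (f (subg G g))).
  move=> c f f'; rewrite scaler_sumr -big_split; apply: eq_bigr => g _ /=.
  by rewrite !ffunE linearP.
exists (dim W), (vrep ind_on); split; first exact: vrep_free ind_free.
exists (mxl (mklin ls)), (mxl (mklin lr)); split.
  apply: vrep_hom => g v gG; apply/ffunP => x; rewrite /= !ffunE -aG.2 ?groupV ?subgP //.
  by rewrite morphM ?inE // morphV ?inE //= subgK // invMg invgK.
split; last first.
  apply: eq_mxl_rows => v; rewrite mulmxA !v2r_mxl mulmx1 /=; congr v2r.
  rewrite -[RHS]Hu; apply: eq_bigr => g gG; by rewrite ffunE subgK.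
apply: vrep_hom => g f gG /=; rewrite linear_sum (reindex_inj (mulgI g)) /=.
apply: eq_big => [h|h]; first by rewrite groupMl.
rewrite groupMl // => hG; rewrite ffunE aG.2 // subgM // mulKg.
by [].
Qed.

End Induced.

End Representations.

End LinearMatrices.

(** * From operator complexes to graded matrix complexes *)

Section GradedPieces.
Import VectorInternalTheory.
Variables (k : fieldType) (gT : finGroupType) (G : {group gT}) (c : int) (X : opcx k gT).
Hypothesis okX : opcx_ok G c X.
Local Notation M := (oM X).

Definition piece j : {vspace M} := limg (linfun (og X j)).

Lemma pieceP j v : reflect (og X j v = v) (v \in piece j).
Proof.
apply: (iffP memv_imgP) => [[w _ ->]|e]; first by rewrite lfunE /= (ok_gg okX) eqxx.
by exists v; rewrite ?memvf // lfunE /= e.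
Qed.

Local Notation V := (fun j => subvs_of (piece j)).

Lemma og_vsval j (v : V j) : og X j (vsval v) = vsval v.
Proof. exact/pieceP/subvsP. Qed.

Definition piece_act j g : {linear V j -> V j} := vsproj (piece j) \o oa X g \o vsval.
(** The target index is free and the equation [j' = j + 1] is required only to evaluate the map,
    which avoids casts between degrees that are equal only provably. *)
Definition piece_diff j j' : {linear V j -> V j'} := vsproj (piece j') \o od X \o vsval.

Lemma vsval_piece_act j g (v : V j) : g \in G -> vsval (piece_act j g v) = oa X g (vsval v).
Proof.
by move=> gG; rewrite /= vsprojK //; apply/pieceP; rewrite (ok_ga okX) // og_vsval.
Qed.

Lemma vsval_piece_diff j j' (v : V j) : j' = j + 1 ->
  vsval (piece_diff j j' v) = od X (vsval v).
Proof.
by move=> ->; rewrite /= vsprojK //; apply/pieceP; rewrite (ok_gd okX) og_vsval.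
Qed.

Lemma piece_act_on j : act_on G (piece_act j).
Proof.
split=> [v|g h gG hG v]; apply: val_inj.
  by rewrite [LHS]vsval_piece_act // (ok_act okX).1.
by rewrite /= -!/(vsval _) !vsval_piece_act ?groupM // (ok_act okX).2.
Qed.

(** The projection [og X j] commutes with the group, so composing the Higman operator with it
    preserves the trace identity on the piece. *)
Lemma piece_higman j : higman G (oa X) -> higman G (piece_act j).
Proof.
move=> [u Hu]; exists (vsproj (piece j) \o og X j \o u \o vsval) => v.
apply: val_inj; rewrite -!/(vsval _) /trop linear_sum /=.
rewrite -[RHS]og_vsval -[in RHS](Hu (vsval v)) linear_sum; apply: eq_bigr => g gG.
rewrite -[vsproj _ (oa X g _)]/(piece_act j g _) vsval_piece_act // vsprojK; last first.
  by apply/pieceP; rewrite (ok_gg okX) eqxx.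
rewrite -[vsproj _ (oa X _ _)]/(piece_act j g^-1%g _) vsval_piece_act ?groupV //.
by rewrite (ok_ga okX).
Qed.

Lemma piece_dim0 j : (ob X < `|j|)%N -> dim (V j) = 0%N.
Proof.
move=> bj; apply/eqP; rewrite -[dim _]/(\dim (piece j)) dimv_eq0 -subv0; apply/subvP => v /pieceP <-.
by rewrite (ok_g0 okX) // mem0v.
Qed.

Variable N : int.
Local Notation sd i := (piece_diff (N - i) (N - (i - 1))).

Lemma shiftS i : N - (i - 1) = N - i + 1. Proof. by rewrite opprB addrA addrAC. Qed.

Lemma vsval_sd i (v : V (N - i)) : vsval (sd i v) = od X (vsval v).
Proof. by rewrite vsval_piece_diff // shiftS. Qed.

Lemma cx_hom_subproof i :
  kG_hom (vrep (piece_act_on (N - i))) (vrep (piece_act_on (N - (i - 1)))) (mxl (sd i)).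
Proof.
apply: vrep_hom => g v gG; apply: val_inj.
rewrite [LHS]vsval_sd [RHS]vsval_piece_act // vsval_piece_act // vsval_sd.
exact: (ok_da okX).
Qed.

Lemma cx_sq_subproof i : mxl (sd i) *m mxl (sd (i - 1)) = 0.
Proof.
apply: eq_mxl_rows => v; rewrite mulmxA !v2r_mxl mulmx0.
have -> : sd (i - 1) (sd i v) = 0.
  by apply: val_inj; rewrite [LHS]vsval_sd vsval_sd (ok_dd okX) [RHS]linear0.
by rewrite linear0.
Qed.

Lemma cx_bound_subproof (i : int) : (ob X + `|N| < `|i|)%N -> dim (V (N - i)) = 0%N.
Proof. by move=> bi; apply: piece_dim0; move: bi; lia. Qed.

(* homological degree [i] is cohomological degree [N - i] *)
Definition shifted_cx : kG_complex k G :=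
  KGComplex cx_hom_subproof cx_sq_subproof cx_bound_subproof.

Lemma shifted_cx_projective : higman G (oa X) -> cx_projective shifted_cx.
Proof. by move=> H i; apply: vrep_projective; apply: piece_higman. Qed.

Lemma shifted_cx_free p : p \in [pchar k] -> (p.-group G)%g -> higman G (oa X) ->
  cx_free shifted_cx.
Proof.
move=> pk pG H i; apply: vrep_free.
apply: (acyclic_free pk pG (piece_act_on _)).
exact: higman_acyclic (piece_act_on _) (piece_higman _ H).
Qed.

Lemma rank_piece_diff j j' : j' = j + 1 ->
  \rank (mxl (piece_diff j j')) = \dim (linfun (od X) @: piece j)%VS.
Proof.
move=> ej; rewrite rank_mxl.
pose f i : 'Hom(V i, M) := linfun (vsval : {linear V i -> M}).
have fE i v : f i v = vsval v by rewrite lfunE.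
have fi i : limg (f i) = piece i.
  apply/vspaceP => v; apply/memv_imgP/idP => [[w _ ->]|vi]; first by rewrite fE subvsP.
  by exists (vsproj (piece i) v); rewrite ?memvf // fE vsprojK.
rewrite -(limg_dim_eq (f := f j')); last first.
  apply/eqP; rewrite -subv0; apply/subvP => v /memv_capP[_]; rewrite memv_ker fE => /eqP v0.
  by rewrite (_ : v = 0) ?mem0v //; apply: val_inj.
transitivity (\dim (linfun (od X) @: limg (f j))%VS); last by rewrite fi.
rewrite -!limg_comp; congr (\dim (_ @: _)%VS).
by apply/lfunP => v; rewrite !comp_lfunE !fE !lfunE vsval_piece_diff.
Qed.

Lemma homology_dim_le i : (homology_dim shifted_cx i <=
  \dim ((piece (N - i) :&: lker (linfun (od X))) :\: (linfun (od X) @: piece (N - i - 1))))%N.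
Proof.
rewrite /homology_dim /= mxrank_ker rank_piece_diff ?shiftS // rank_piece_diff ?shiftS //.
rewrite -[dim _]/(\dim (piece (N - i))) opprD addrA.
have := limg_ker_dim (linfun (od X)) (piece (N - i)).
set Z := (_ :&: _)%VS; set B := (_ @: piece (N - i - 1))%VS.
have := dimv_cap_compl Z B; have := dimvS (capvSr Z B).
by lia.
Qed.

(** Complements of the boundaries in the cycles of the single degrees have a direct sum inside the
    space of [X], and [P] is injective on this sum. *)
Lemma total_homology_dim_le D : hom_bounded D X -> (total_homology_dim shifted_cx <= D)%N.
Proof.
move=> [S [P [dS Pi]]]; apply: leq_trans dS.
pose cb := (ob X + `|N|)%N; pose n := cb.*2.+1.
pose j (t : 'I_n) : int := N - (t%:Z - cb%:Z).
have jI t s : j t = j s -> t = s by rewrite /j => e; apply: val_inj => /=; lia.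
pose Z i := (piece i :&: lker (linfun (od X)))%VS.
pose C (t : 'I_n) := (Z (j t) :\: (linfun (od X) @: piece (j t - 1)))%VS.
have Cp t v : v \in C t -> og X (j t) v = v /\ od X v = 0.
  move=> /(subvP (diffvSl _ _)) /memv_capP[/pieceP -> ]; rewrite memv_ker lfunE /= => /eqP.
  by [].
have Cog t s v : v \in C t -> og X (j s) v = if t == s then v else 0.
  move=> /Cp[<- _]; rewrite (ok_gg okX); case: (t =P s) => [->|ts]; first by rewrite eqxx.
  by case: eqP => // e; case: ts; apply: jI.
have dC : directv (\sum_t C t).
  apply/directv_sum_independent => us Us s0 s _.
  have := congr1 (og X (j s)) s0; rewrite linear0 linear_sum (bigD1 s) //=.
  rewrite (Cog s) ?Us // eqxx big1 ?addr0 // => t ts.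
  by rewrite (Cog t) ?Us // (negbTE ts).
have -> : (total_homology_dim shifted_cx <= \dim {: S})%N = 
  (\sum_(t < n) homology_dim shifted_cx (t%:Z - cb%:Z) <= \dim {: S})%N by [].
apply: (@leq_trans (\sum_t \dim (C t))%N).
  by apply: leq_sum => t _; apply: homology_dim_le.
move: (dC); rewrite directvE /= => /eqP <-.
rewrite -(limg_dim_eq (f := linfun P)) ?dimvS ?subvf //.
apply/eqP; rewrite -subv0; apply/subvP => v /memv_capP[/memv_sumP[w wC ->]].
rewrite memv_ker lfunE /= memv0 => /eqP Pw.
have zw : od X (\sum_t w t) = 0.
  by rewrite linear_sum big1 // => t _; case: (Cp _ _ (wC t isT)).
have [y ey] := Pi _ zw Pw; apply/eqP; apply: big1 => t _.
(* Only the component of [y] one degree lower contributes to degree [j t], so [w t] is a boundary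
   lying in the chosen complement of the boundaries, hence zero. *)
have wt : w t = od X (og X (j t - 1) y).
  rewrite -(ok_gd okX) subrK -ey linear_sum (bigD1 t) //= (Cog t) ?wC // eqxx.
  by rewrite big1 ?addr0 // => s st; rewrite (Cog s) ?wC // (negbTE st).
apply/eqP; rewrite -memv0 -(capv_diff (Z (j t)) (linfun (od X) @: piece (j t - 1))%VS).
rewrite memv_cap [w t \in _]wC //= wt.
rewrite -[od X _]lfunE memv_img //; apply/pieceP.
by rewrite (ok_gg okX) eqxx.
Qed.

End GradedPieces.

(** * Shifts that are not homotopy equivalent *)

Section NonEquivalence.
Import VectorInternalTheory.
Variables (k : fieldType) (gT : finGroupType) (G : {group gT}) (c : int) (X : opcx k gT).
Hypothesis okX : opcx_ok G c X.
Local Notation M := (oM X).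
Local Notation V := (fun j => subvs_of (piece X j)).

Lemma og_sum (z : M) : z = \sum_(t < (ob X).*2.+1) og X (t%:Z - (ob X)%:Z) z.
Proof.
apply/eqP; rewrite -subr_eq0; apply/eqP/(ok_gx okX) => i; rewrite linearB linear_sum /=.
have [bi|ib] := ltnP (ob X) `|i|.
  rewrite (ok_g0 okX) // big1 ?subr0 // => t _; rewrite (ok_gg okX); case: eqP => // ei.
  by have := ltn_ord t; move: bi; rewrite ei; lia.
have it : (absz (i + (ob X)%:Z)%R < (ob X).*2.+1)%N by lia.
rewrite (bigD1 (Ordinal it)) //= (ok_gg okX) ifT; last by apply/eqP; lia.
rewrite big1 ?addr0 ?subrr // => t /eqP nt; rewrite (ok_gg okX) ifN //.
by apply/eqP => ei; apply: nt; apply: val_inj => /=; rewrite ei; lia.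
Qed.

Lemma nonzero_degree : hom_nonzero X -> exists j z,
  [/\ og X j z = z, od X z = 0, forall y, z <> od X y & (`|j| <= ob X)%N].
Proof.
move=> [z [zz nz]]; apply: contrapT => nj.
have bz j : exists y, og X j z = od X y.
  apply: contrapT => ny; apply: nj; exists j, (og X j z).
  have z0 : og X j z <> 0 by move=> e; apply: ny; exists 0; rewrite linear0.
  split; first by rewrite (ok_gg okX) eqxx.
  - by rewrite -(ok_gd okX) zz linear0.
  - by move=> y e; apply: ny; exists y.
  - by rewrite leqNgt; apply/negP => bj; apply: z0; apply: (ok_g0 okX).
have [y yP] := choice bz; apply: (nz (\sum_(t < (ob X).*2.+1) y (t%:Z - (ob X)%:Z))).
by rewrite linear_sum {1}[z]og_sum; apply: eq_bigr => t _; apply: yP.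
Qed.

Lemma castmx_v2r N l l' (el : l = l') (e : dim (V (N - l)) = dim (V (N - l')))
    (u : V (N - l)) (u' : V (N - l')) :
  vsval u = vsval u' -> castmx (erefl 1%N, e) (v2r u) = v2r u'.
Proof.
case: _ / el e u' => e u' uu; rewrite castmx_id; congr v2r.
exact: val_inj.
Qed.

Lemma mulmx_castr m n n' q (e : n = n') (y : 'M[k]_(q, m)) (A : 'M_(m, n)) :
  y *m castmx (erefl m, e) A = castmx (erefl q, e) (y *m A).
Proof. by case: _ / e. Qed.

(** In the degree where [z] lives the other shift vanishes. A homotopy equivalence would make the
    identity of this shift null homotopic in that degree, and the cycle [z] would be a boundary. *)
Lemma shifted_not_equivalent N N' j z : og X j z = z -> od X z = 0 ->
  (forall y, z <> od X y) -> (ob X < absz (j + (N' - N))%R)%N ->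
  ~ homotopy_equivalent (shifted_cx okX N') (shifted_cx okX N).
Proof.
move=> gz dz nz far [f [g [_ [_ [_ [h [_ hE]]]]]]].
pose i := N - j; have ei : N - i = j by rewrite /i opprB addrC subrK.
have zi : z \in piece X (N - i) by apply/(pieceP okX); rewrite ei.
pose x : 'rV_(dim (V (N - i))) := v2r (vsproj (piece X (N - i)) z).
have c0 : cdim (shifted_cx okX N') i = 0%N.
  by apply: (piece_dim0 okX); move: far; rewrite /i; lia.
have gf : g i *m f i = 0.
  apply/matrixP => a b; rewrite !mxE big1 // => l _.
  by have := ltn_ord l; rewrite [X in (_ < X)%N -> _]c0.
have := congr1 (mulmx x) (hE i); rewrite gf sub0r mulmxN mulmx1 mulmxDr !mulmx_castr !mulmxA.
have -> : x *m cd (shifted_cx okX N) i = 0.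
  rewrite v2r_mxl -[RHS](linear0 v2r); congr v2r; apply: val_inj.
  by rewrite [LHS](vsval_sd okX) vsprojK // dz [RHS]linear0.
rewrite mul0mx; pose y : 'rV_(dim (V (N - (i + 1)))) := x *m h i; rewrite -/y.
pose w := piece_diff X (N - (i + 1)) (N - (i + 1 - 1)) (r2v y).
have -> : y *m cd (shifted_cx okX N) (i + 1) = v2r w by rewrite -[in LHS](r2vK y); apply: v2r_mxl.
have ew : vsval w = od X (vsval (r2v y)) by exact: (vsval_sd okX).
have eii : i + 1 - 1 = i by rewrite addrK.
have wi : vsval w \in piece X (N - i) by have := subvsP w; move: (vsval w) => v; rewrite eii.
rewrite (castmx_v2r eii _ (u' := vsproj (piece X (N - i)) (vsval w))); last by rewrite vsprojK.
have -> : castmx (erefl 1%N, dim_subK (shifted_cx okX N) i) 0 = 0.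
  by case: _ / (dim_subK _ _).
have inj (s t : V (N - i)) : v2r s = v2r t -> s = t by apply: v2r_inj.
rewrite add0r /x -[- v2r _](linearN v2r) => e0; have := congr1 vsval (inj _ _ e0).
rewrite (_ : vsval (- _) = - z); last by rewrite linearN /= vsprojK.
rewrite (vsprojK wi) ew => e.
by apply: (nz (- vsval (r2v y))); rewrite linearN -e opprK.
Qed.

End NonEquivalence.

Theorem mainTheorem1 (k : fieldType) (p : nat) (gT : finGroupType) (G : {group gT}) :
  prime p -> p \in [pchar k] -> (3 <= p)%N -> (8 <= 'r_p(G)%g)%N ->
  exists D : nat -> kG_complex k G,
    (forall n, cx_projective (D n) /\
               ((p.-group G)%g -> cx_free (D n)) /\
               (total_homology_dim (D n) < 2 ^ 'r_p(G)%g)%N) /\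
    (forall m n, m <> n -> ~ homotopy_equivalent (D m) (D n)).
Proof.
move=> _ pk p3 r8.
have k2 : (2%:R : k) != 0.
  by rewrite -(dvdn_pcharf pk); apply/negP => /(dvdn_leq (isT : 0 < 2)%N); rewrite leqNgt p3.
have [zeta [zP acyc]] := class_twisted_acyclic G pk k2.
set d := class_deg G in zP acyc.
have d2 : (1 < d)%N.
  by rewrite -[X in (X < _)%N]/(0.*2.+1) ltn_Sdouble muln_gt0 cardG_gt0 fact_gt0.
have od' : ~~ odd d by rewrite odd_double.
have [X [okX tX bX nX]] := small_complex d2 od' k2 (fun s => (zP s).1) (fun s => (zP s).2)
  ('r_p(G)%g - 8).
have aX := ok_act okX.
have [S SG] := Sylow_exists p G; have sS := pHall_sub SG; have pS := pHall_pgroup SG.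
have hX : higman G (oa X).
  apply: (higman_sylow pk SG aX); apply: (acyclic_higman pk pS (act_onS sS aX)).
  by apply: acyc => // s /andP[s0 sr]; apply: tX; rewrite s0 subnKC.
have [j [z [gz dz nz bj]]] := nonzero_degree okX nX.
(* All degrees of [X] lie between [- ob X] and [ob X], so distinct multiples of [(ob X).*2.+1] give
   shifts with disjoint supports. *)
exists (fun n => shifted_cx okX (n * (ob X).*2.+1)%N%:Z); split=> [n|m n mn].
  split; first exact: shifted_cx_projective.
  split; first by move=> pG; apply: (shifted_cx_free okX _ pk pG).
  apply: leq_ltn_trans (total_homology_dim_le okX _ bX) _.
  rewrite -[X in (_ < 2 ^ X)%N](subnKC r8) expnD ltn_mul2r expn_gt0 /=.
  by [].
apply: (shifted_not_equivalent gz dz nz); move: bj mn; move: (ob X) => b bj mn.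
nia.
Qed.
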